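(* Let $I\subset\mathbb R$ be an open interval, $x_0\in I$, and let $\tilde f:I\to\mathbb H^3_1$ and $\tilde\nu:I\to\mathbb S^2_1$ be smooth maps satisfying $\langle\tilde f^{-1}\tilde f',\tilde\nu\rangle=0$, with $\tilde f'$ nowhere null (i.e. $\langle\tilde f',\tilde f'\rangle\neq0$ everywhere). Let $H$ be a constant with $|H|>1$, let $\theta$ be defined by $\tanh(2\theta)=1/H$, and put $\mu=e^{4\theta}$ and $$N_1=-\frac2{\mu-1}\,P_+\big(\tilde f^{-1}\tilde f'\big)+P_-\big(\tilde\nu'\big)-\frac2{\mu^{-1}-1}\,P_-\big(\tilde f^{-1}\tilde f'\big).$$ Let $\hat F$ be the extended frame produced by the DPW construction (described in the context) from the Cauchy data $N_0=\tilde\nu$ and $N_1$, with frame $F$ along $I$. Then, on a neighbourhood $\Omega$ of the diagonal in $I\times I$, $$f=L\,\hat F|_{\lambda=e^{2\theta}}\,\exp(-\theta e_3)\,\hat F|_{\lambda=1}^{-1},\qquad L=\tilde f(x_0)F(x_0)\exp(\theta e_3)F(x_0)^{-1},$$ is a timelike immersion into $\mathbb H^3_1$ of constant mean curvature $H$, with Gauss map $\nu=\mathrm{Ad}_{\hat F|_{\lambda=1}}e_3$ and with $(x,y)$ as null coordinates for its first fundamental form, and $$f(x,x)=\tilde f(x),\qquad \nu(x,x)=\tilde\nu(x)\qquad(x\in I).$$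
   Context: Ambient space. On the space $\mathfrak{gl}(2,\mathbb R)$ of real $2\times2$ matrices let $\langle X,Y\rangle=-\tfrac12\operatorname{tr}(X\bar Y)$, where $\bar Y=(\operatorname{tr}Y)\mathrm{Id}-Y$; then $\langle X,X\rangle=-\det X$. Anti-de Sitter 3-space is $\mathbb H^3_1=\{X:\langle X,X\rangle=-1\}=SL(2,\mathbb R)$ with the induced Lorentzian metric. On $\mathfrak{sl}(2,\mathbb R)$, $\langle X,Y\rangle=\tfrac12\operatorname{tr}(XY)$; put $\mathbb S^2_1=\{X\in\mathfrak{sl}(2,\mathbb R):\langle X,X\rangle=1\}$, $e_3=\begin{pmatrix}-1&0\\0&1\end{pmatrix}$, $\mathrm{Ad}_FX=FXF^{-1}$, $\mathfrak k=\mathbb Re_3$. Projections. For $\tilde\nu\in\mathbb S^2_1$, the operator $\tfrac12\operatorname{ad}_{\tilde\nu}=\tfrac12[\tilde\nu,\cdot]$ on the plane $\tilde\nu^\perp\subset\mathfrak{sl}(2,\mathbb R)$ squares to the identity, and its $\pm1$ eigenspaces are the two null lines of $\tilde\nu^\perp$; $P_\pm$ denote the projections of $\tilde\nu^\perp$ onto the $\pm1$ eigenline along the other one. Surfaces. An immersion $f$ into $\mathbb H^3_1$ is timelike if the induced metric is Lorentzian; it has Gauss map $\nu$ if $N=f\nu$ is a unit normal ($\langle N,N\rangle=1$, $N$ orthogonal to $f,f_x,f_y$). $(x,y)$ are null coordinates if $\langle f_x,f_x\rangle=\langle f_y,f_y\rangle=0$. With the shape operator $S$ defined by $S(f_x,f_y)^T=(N_x,N_y)^T$,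 the mean curvature is $-\tfrac12\operatorname{tr}S$; in null coordinates it equals $\langle f_{xy},N\rangle/\langle f_x,f_y\rangle$. Loop groups. Let $G_\sigma$ be the group of smooth loops $\gamma(\lambda)$ in $SL(2,\mathbb C)$ with $\overline{\gamma(\bar\lambda)}=\gamma(\lambda)$ and $\gamma(-\lambda)=\mathrm{Ad}_{e_3}\gamma(\lambda)$; $G_\sigma^+$ the loops extending holomorphically to the unit disc $\mathbb D$; $G^-_{\sigma,*}$ the loops extending holomorphically to $\mathbb P^1\setminus\mathbb D$ and equal to $\mathrm{Id}$ at $\infty$. The big cell $G^-_{\sigma,*}\cdot G^+_\sigma$ is open and dense, and its elements factor uniquely. DPW construction from Cauchy data $N_0:I\to\mathbb S^2_1$, $N_1:I\to\mathfrak{sl}(2,\mathbb R)$ with $\langle N_1,N_0\rangle=0$. Choose any smooth $F:I\to SL(2,\mathbb R)$ with $\mathrm{Ad}_Fe_3=N_0$ and put $\beta_1=-\tfrac14[e_3,\mathrm{Ad}_F^{-1}N_1]$, $\gamma_{-1}=-\tfrac14[e_3,\mathrm{Ad}_F^{-1}(N_0'-N_1)]$, $\hat\alpha^\lambda=(F^{-1}F')_{\mathfrak k}+\lambda\beta_1+\lambda^{-1}\gamma_{-1}$, where $(\cdot)_{\mathfrak k}$ is the $e_3$-component. Solve $X^{-1}dX=\hat\alpha^\lambda(x)\,dx$, $Y^{-1}dY=\hat\alpha^\lambda(y)\,dy$ with $X(x_0)=Y(x_0)=F(x_0)$ for all $\lambda$. On an open neighbourhood of the diagonal of $I\times I$ on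 which $X(x)^{-1}Y(y)$ lies in the big cell, factor $X(x)^{-1}Y(y)=H_-(x,y)H_+(x,y)$ with $H_-\in G^-_{\sigma,*}$, $H_+\in G^+_\sigma$, and set $\hat F(x,y)=X(x)H_-(x,y)=Y(y)H_+(x,y)^{-1}$. Its Maurer–Cartan form is defined for all $\lambda\ne0$ (a Laurent polynomial in $\lambda$, with $\lambda$-degrees $\{0,1\}$ in $dx$ and $\{-1,0\}$ in $dy$), so $\hat F$ is evaluated at all real $\lambda\ne0$. *)

(* Defs.v *)
From Stdlib Require Import Reals Factorial.
From Coquelicot Require Import Coquelicot.
Open Scope R_scope.

(** * Two-by-two matrices *)

Notation MR := (@matrix_Ring R_Ring 2).
Notation MC := (@matrix_Ring C_Ring 2).

Declare Scope mat_scope.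
Delimit Scope mat_scope with M.
Bind Scope mat_scope with matrix.

Definition entry {K : Ring} (A : @matrix_Ring K 2) (i j : nat) : K :=
  coeff_mat zero A i j.

Definition mat2 {K : Ring} (a b c d : K) : @matrix_Ring K 2 :=
  [[a, b], [c, d]].

Definition mscal {K : Ring} (c : K) (A : @matrix_Ring K 2) : @matrix_Ring K 2 :=
  mk_matrix 2 2 (fun i j => mult c (entry A i j)).

Infix "+" := plus : mat_scope.
Infix "-" := minus : mat_scope.
Notation "- A" := (opp A) : mat_scope.
Infix "*" := mult : mat_scope.
Notation "c *: A" := (mscal c%R A%M) (at level 40, left associativity) : mat_scope.

Definition mtr {K : Ring} (A : @matrix_Ring K 2) : K :=
  plus (entry A 0 0) (entry A 1 1).

Definition mdet {K : Ring} (A : @matrix_Ring K 2) : K :=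
  minus (mult (entry A 0 0) (entry A 1 1)) (mult (entry A 0 1) (entry A 1 0)).

Definition bar {K : Ring} (A : @matrix_Ring K 2) : @matrix_Ring K 2 :=
  (mtr A *: one - A)%M.

(* [bar A] is the adjugate of [A]. *)
Definition invR (A : MR) : MR := (/ mdet A *: bar A)%M.
Definition invC (A : MC) : MC := mscal (Cinv (mdet A)) (bar A).

Definition bracket {K : Ring} (A B : @matrix_Ring K 2) : @matrix_Ring K 2 :=
  (A * B - B * A)%M.

Definition embed (A : MR) : MC :=
  mk_matrix 2 2 (fun i j => RtoC (entry A i j)).

Definition mconj (A : MC) : MC :=
  mk_matrix 2 2 (fun i j => Cconj (entry A i j)).

Definition AdR (F X : MR) : MR := (F * X * invR F)%M.
Definition AdC (F X : MC) : MC := (F * X * invC F)%M.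

Definition mexp (A : MR) : MR :=
  mk_matrix 2 2 (fun i j => Series (fun n => / INR (fact n) * entry (pow_n A n) i j)).

(** * Anti-de Sitter space *)

Definition adsform (X Y : MR) : R := - / 2 * mtr (X * bar Y)%M.

Definition H31 (X : MR) : Prop := adsform X X = -1.
Definition sl2 (X : MR) : Prop := mtr X = 0.
Definition S21 (X : MR) : Prop := sl2 X /\ adsform X X = 1.

Definition e3 : MR := mat2 (-1) 0 0 1.

(* [e3] is a unit vector, so this is its component along [R e3] in [sl2]. *)
Definition kpart (X : MR) : MR := (adsform X e3 *: e3)%M.

(* For [eps = 1] or [eps = -1]. *)
Definition eigenline (nu : MR) (eps : R) (Z : MR) : Prop :=
  sl2 Z /\ adsform Z nu = 0 /\ (/ 2 *: bracket nu Z)%M = (eps *: Z)%M.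

(* [P] is the projection of [Z] onto the [eps]-eigenline along the other one. *)
Definition is_proj (nu : MR) (eps : R) (Z P : MR) : Prop :=
  eigenline nu eps P /\ eigenline nu (- eps) (Z - P)%M.

(** * Smooth curves and smooth maps of two variables *)

Definition is_open_interval (I : R -> Prop) : Prop :=
  open I /\ (forall a b x, I a -> I b -> a <= x <= b -> I x).

Definition smooth_on (I : R -> Prop) (F : R -> MR) : Prop :=
  forall (i j n : nat) (x : R), I x -> ex_derive_n (fun t => entry (F t) i j) n x.

Definition mderive (F : R -> MR) (x : R) : MR :=
  mk_matrix 2 2 (fun i j => Derive (fun t => entry (F t) i j) x).

Definition partial_x (f : R -> R -> MR) (x y : R) : MR := mderive (fun t => f t y) x.
Definition partial_y (f : R -> R -> MR) (x y : R) : MR := mderive (fun t => f x t) y.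

Fixpoint Ck (k : nat) (Om : R * R -> Prop) (g : R -> R -> R) : Prop :=
  match k with
  | O => forall p, Om p -> continuous (fun q : R * R => g (fst q) (snd q)) p
  | S k' =>
      (forall x y, Om (x, y) ->
         ex_derive (fun t => g t y) x /\ ex_derive (fun t => g x t) y) /\
      Ck k' Om (fun x y => Derive (fun t => g t y) x) /\
      Ck k' Om (fun x y => Derive (fun t => g x t) y)
  end.

Definition smooth2_on (Om : R * R -> Prop) (f : R -> R -> MR) : Prop :=
  forall (i j k : nat), Ck k Om (fun x y => entry (f x y) i j).

(** * Surfaces in anti-de Sitter space *)

Definition immersion_H31 (Om : R * R -> Prop) (f : R -> R -> MR) : Prop :=
  smooth2_on Om f /\
  forall x y, Om (x, y) ->
    H31 (f x y) /\
    (forall a b, (a *: partial_x f x y + b *: partial_y f x y)%M = zero -> a = 0 /\ b = 0).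

(* The induced metric has signature (1,1): some basis of the tangent plane is
   orthonormal with one timelike and one spacelike vector. *)
Definition timelike (Om : R * R -> Prop) (f : R -> R -> MR) : Prop :=
  forall x y, Om (x, y) ->
    exists a b c d : R,
      a * d - b * c <> 0 /\
      let v := (a *: partial_x f x y + b *: partial_y f x y)%M in
      let w := (c *: partial_x f x y + d *: partial_y f x y)%M in
      adsform v v = -1 /\ adsform w w = 1 /\ adsform v w = 0.

Definition normal_of (f nu : R -> R -> MR) (x y : R) : MR := (f x y * nu x y)%M.

Definition gauss_map (Om : R * R -> Prop) (f nu : R -> R -> MR) : Prop :=
  smooth2_on Om nu /\
  forall x y, Om (x, y) ->
    let N := normal_of f nu x y in
    adsform N N = 1 /\ adsform N (f x y) = 0 /\
    adsform N (partial_x f x y) = 0 /\ adsform N (partial_y f x y) = 0.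

Definition mean_curvature (Om : R * R -> Prop) (f nu : R -> R -> MR) (H : R) : Prop :=
  let N := normal_of f nu in
  forall x y, Om (x, y) ->
    exists S : MR,
      partial_x N x y = (entry S 0 0 *: partial_x f x y + entry S 0 1 *: partial_y f x y)%M /\
      partial_y N x y = (entry S 1 0 *: partial_x f x y + entry S 1 1 *: partial_y f x y)%M /\
      H = - / 2 * mtr S.

Definition null_coordinates (Om : R * R -> Prop) (f : R -> R -> MR) : Prop :=
  forall x y, Om (x, y) ->
    adsform (partial_x f x y) (partial_x f x y) = 0 /\ adsform (partial_y f x y) (partial_y f x y) = 0.

(** * Loop groups *)

(* A loop is a function of [lambda] of which only the values on the circle
   [Cmod lambda = 1] matter. *)

Definition smooth_loop (g : C -> MC) : Prop :=
  forall (i j n : nat) (t : R),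
    ex_derive_n (fun s => Re (entry (g (cos s, sin s)) i j)) n t /\
    ex_derive_n (fun s => Im (entry (g (cos s, sin s)) i j)) n t.

Definition G_sigma (g : C -> MC) : Prop :=
  smooth_loop g /\
  forall l : C, Cmod l = 1 ->
    mdet (g l) = RtoC 1 /\
    mconj (g (Cconj l)) = g l /\
    g (Copp l) = AdC (embed e3) (g l).

Definition holomorphic_in_disc (h : C -> MC) : Prop :=
  forall i j : nat,
    (forall z : C, Cmod z < 1 ->
       @ex_derive C_AbsRing C_NormedModule (fun w : C => entry (h w) i j) z) /\
    (forall z : C, Cmod z <= 1 ->
       filterlim (fun w : C => entry (h w) i j)
         (within (fun w : C => Cmod w <= 1) (locally z))
         (locally (entry (h z) i j : C))).

(* Elements of the two subgroups are identified with their (unique) extensions: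
   [G_plus g] also constrains [g] on the closed unit disc, and [G_minus g] also
   constrains [g] on [Cmod l >= 1], the chart [w = 1/l] being used near infinity. *)
Definition G_plus (g : C -> MC) : Prop :=
  G_sigma g /\ holomorphic_in_disc g.

Definition G_minus (g : C -> MC) : Prop :=
  G_sigma g /\
  exists k : C -> MC,
    holomorphic_in_disc k /\ k (RtoC 0) = one /\
    forall l : C, 1 <= Cmod l -> g l = k (Cinv l).

Definition birkhoff (g gm gp : C -> MC) : Prop :=
  G_minus gm /\ G_plus gp /\
  forall l : C, Cmod l = 1 -> g l = (gm l * gp l)%M.

Definition big_cell (g : C -> MC) : Prop :=
  exists gm gp : C -> MC, birkhoff g gm gp.

(** * The DPW construction *)

Definition beta1 (N1 F : R -> MR) (x : R) : MR :=
  (- / 4 *: bracket e3 (AdR (invR (F x)) (N1 x)))%M.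

Definition gammam1 (N0 N1 F : R -> MR) (x : R) : MR :=
  (- / 4 *: bracket e3 (AdR (invR (F x)) (mderive N0 x - N1 x)))%M.

Definition alpha_hat (N0 N1 F : R -> MR) (l : C) (x : R) : MC :=
  (embed (kpart (invR (F x) * mderive F x))
   + l *: embed (beta1 N1 F x)
   + Cinv l *: embed (gammam1 N0 N1 F x))%M.

Definition adapted_frame (I : R -> Prop) (N0 F : R -> MR) : Prop :=
  smooth_on I F /\ forall x, I x -> mdet (F x) = 1 /\ AdR (F x) e3 = N0 x.

Definition dpw_ode (I : R -> Prop) (x0 : R) (N0 N1 F : R -> MR)
    (X : R -> C -> MC) : Prop :=
  forall l : C, l <> RtoC 0 ->
    X x0 l = embed (F x0) /\
    forall (x : R) (i j : nat), I x ->
      @is_derive R_AbsRing C_R_NormedModule (fun t => entry (X t l) i j) x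
        (entry (X x l * alpha_hat N0 N1 F l x)%M i j).

Definition transition (X Y : R -> C -> MC) (x y : R) (l : C) : MC :=
  (invC (X x l) * Y y l)%M.

(* [X Hm] and [Y Hp^-1] agree on the circle and extend holomorphically to its
   exterior and to its interior without the origin, respectively; together they
   give the value of the extended frame at every nonzero [l]. *)
Definition extended_frame (X Y : R -> C -> MC) (Hm Hp : R -> R -> C -> MC)
    (x y : R) (l : C) : MC :=
  if Rle_dec 1 (Cmod l)
  then (X x l * Hm x y l)%M
  else (Y y l * invC (Hp x y l))%M.

Definition neighbourhood_of_diagonal (I : R -> Prop) (Om : R * R -> Prop) : Prop :=
  open Om /\
  (forall x y, Om (x, y) -> I x /\ I y) /\
  (forall x, I x -> Om (x, x)).

(* Main.v *)
Require Import Defs.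
From Stdlib Require Import Reals Lra Lia.
From Coquelicot Require Import Coquelicot.
Open Scope R_scope.

(* Read in the frame [F], the potential is [[-k, l r + u0 / l], [l s + v0 / l, k]] dx, with
   [l] the spectral parameter. Solving [w_x = p], [p_y = s u0 exp (2 w) - r v0 exp (-2 w)] with
   [w = 0], [p = k] on the diagonal makes
     [[-p, l r], [l s, p]] dx + l^-1 [[0, u0 exp (2 w)], [v0 exp (-2 w), 0]] dy
   a flat connection for every [l], which restricts to the potential on the diagonal.
   Its iterated integrals from the diagonal in the [y] and in the [x] direction are power
   series in [1/l] and in [l], and these are the Birkhoff factors of [X(x)^-1 Y(y)]. Any other
   factorization coincides with this one: the quotients of the factors are holomorphic
   inside and outside the circle and agree on it, hence are constant. So the extended
   frame has the connection above, from which [f_x], [f_y] are moved multiples of the matrix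
   units [E21], [E12], and the curvature is read off. On the diagonal [f' = f (ft^-1 ft')],
   so [f = ft] by uniqueness for linear differential equations. *)

(** * Functions of class C^k in the plane *)

(** [I] may be non-compact and the data unbounded, so no strip of fixed width around the diagonal
    will do: distances are measured by a primitive [P] of a weight [c] dominating the data. The
    frame is also needed off the unit circle, at [exp (2 * theta)]; the width is therefore cut down
    by [rho = exp (2 * Rabs theta)], so that both series converge for [/ rho <= Cmod l <= rho]. Why
    this spectral value and this [N1]: let [T = exp (- theta e3)]. The map [M -> T^-1 M T] scales
    E21 by [exp (2 * theta)] and E12 by its inverse. For the connection [A_l] at
    [l = exp (2 * theta)], the difference [T^-1 A_l T - A_1] loses its diagonal and its [r] and [v]
    entries; what is left is [(mu - 1) s E21 dx + (/ mu - 1) u E12 dy], two null directions. [N1] is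
    chosen so that on the diagonal these entries are those of [F^-1 (ft^-1 ft') F]. Orthogonality of
    [ft^-1 ft'] to [nut] says that this matrix is off-diagonal; [ft'] being non-null says that both
    its entries are nonzero, which gives the immersion. *)

Definition smooth1 (I : R -> Prop) (g : R -> R) : Prop :=
  forall (n : nat) (x : R), I x -> ex_derive_n g n x.

Lemma open_section_x (Om : R * R -> Prop) (x y : R) :
  open Om -> Om (x, y) -> locally x (fun t => Om (t, y)).
Proof.
  intros hO h. destruct (hO _ h) as [d hd].
  exists d. intros t ht. apply hd. split; simpl.
  - exact ht.
  - apply ball_center.
Qed.

Lemma open_section_y (Om : R * R -> Prop) (x y : R) :
  open Om -> Om (x, y) -> locally y (fun t => Om (x, t)).
Proof.
  intros hO h. destruct (hO _ h) as [d hd].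
  exists d. intros t ht. apply hd. split; simpl.
  - apply ball_center.
  - exact ht.
Qed.

Section Ck.

Context (Om : R * R -> Prop) (hO : open Om).

(** A derivative at a point of [Om] sees only a neighbourhood of it, which lies in [Om] by
    openness. *)
Lemma Ck_ext (k : nat) (g h : R -> R -> R) :
  (forall x y, Om (x, y) -> g x y = h x y) -> Ck k Om g -> Ck k Om h.
Proof.
  revert g h. induction k as [|k IH]; intros g h E Hg.
  - intros p hp. apply continuous_ext_loc with (fun q : R * R => g (fst q) (snd q)).
    + apply filter_imp with Om; [|exact (hO _ hp)].
      intros [x y] hq. simpl. now apply E.
    + now apply Hg.
  - destruct Hg as [H1 [H2 H3]]. split; [|split].
    + intros x y h0. destruct (H1 x y h0) as [Ha Hb]. split.
      * apply ex_derive_ext_loc with (fun t => g t y); [|exact Ha].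
        apply filter_imp with (fun t => Om (t, y)); [intros t ht; now apply E|].
        now apply open_section_x.
      * apply ex_derive_ext_loc with (fun t => g x t); [|exact Hb].
        apply filter_imp with (fun t => Om (x, t)); [intros t ht; now apply E|].
        now apply open_section_y.
    + apply IH with (2 := H2). intros x y h0. apply Derive_ext_loc.
      apply filter_imp with (fun t => Om (t, y)); [intros t ht; now apply E|].
      now apply open_section_x.
    + apply IH with (2 := H3). intros x y h0. apply Derive_ext_loc.
      apply filter_imp with (fun t => Om (x, t)); [intros t ht; now apply E|].
      now apply open_section_y.
Qed.

(** Trades the [Derive] of the definition for named partial derivatives, so that solutions of
    first-order systems can be bootstrapped. *)
Lemma Ck_S_of (k : nat) (g gx gy : R -> R -> R) :
  (forall x y, Om (x, y) -> is_derive (fun t => g t y) x (gx x y)) ->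
  (forall x y, Om (x, y) -> is_derive (fun t => g x t) y (gy x y)) ->
  Ck k Om gx -> Ck k Om gy -> Ck (S k) Om g.
Proof.
  intros Hx Hy Cx Cy. split; [|split].
  - intros x y h. split; eexists; [apply Hx | apply Hy]; exact h.
  - apply Ck_ext with (2 := Cx). intros x y h. symmetry. now apply is_derive_unique, Hx.
  - apply Ck_ext with (2 := Cy). intros x y h. symmetry. now apply is_derive_unique, Hy.
Qed.

Lemma Ck_S_inv (k : nat) (g : R -> R -> R) : Ck (S k) Om g ->
  exists gx gy : R -> R -> R,
  (forall x y, Om (x, y) -> is_derive (fun t => g t y) x (gx x y)) /\
  (forall x y, Om (x, y) -> is_derive (fun t => g x t) y (gy x y)) /\
  Ck k Om gx /\ Ck k Om gy.
Proof.
  intros [H1 [H2 H3]].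
  exists (fun x y => Derive (fun t => g t y) x), (fun x y => Derive (fun t => g x t) y).
  split; [|split; [|exact (conj H2 H3)]]; intros x y h.
  - exact (Derive_correct _ _ (proj1 (H1 x y h))).
  - exact (Derive_correct _ _ (proj2 (H1 x y h))).
Qed.

Lemma Ck_continuity_2d (g : R -> R -> R) :
  Ck 0 Om g <-> (forall x y, Om (x, y) -> continuity_2d_pt g x y).
Proof.
  split.
  - intros H x y h. apply continuity_2d_pt_filterlim. exact (H (x, y) h).
  - intros H [x y] h. apply (continuity_2d_pt_filterlim g x y). now apply H.
Qed.

Lemma open_square (x y : R) : Om (x, y) ->
  exists d : posreal, forall s t, Rabs (s - x) < d -> Rabs (t - y) < d -> Om (s, t).
Proof.
  intros h. destruct (hO _ h) as [d hd]. exists d. intros s t hs ht.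
  apply hd. split; assumption.
Qed.

(** The horizontal step is controlled by the mean value theorem and a local bound of [gx]; the
    vertical step is made at the fixed abscissa [x], where derivability gives continuity. *)
Lemma continuity_2d_of_derivatives (g gx gy : R -> R -> R) :
  (forall x y, Om (x, y) -> is_derive (fun t => g t y) x (gx x y)) ->
  (forall x y, Om (x, y) -> is_derive (fun t => g x t) y (gy x y)) ->
  Ck 0 Om gx -> forall x y, Om (x, y) -> continuity_2d_pt g x y.
Proof.
  intros Hx Hy Cx x y h.
  assert (Cx' := proj1 (Ck_continuity_2d gx) Cx x y h).
  destruct (Cx' (mkposreal 1 Rlt_0_1)) as [d1 hd1]. simpl in hd1.
  destruct (open_square x y h) as [d2 hd2].
  assert (Cy : continuous (fun t => g x t) y).
  { apply (@ex_derive_continuous R_AbsRing R_NormedModule). eexists. now apply Hy. }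
  intros eps. set (M := Rabs (gx x y) + 1).
  assert (hM : 0 < M) by (unfold M; generalize (Rabs_pos (gx x y)); lra).
  assert (he : 0 < eps / 2) by (generalize (cond_pos eps); lra).
  destruct (proj1 (filterlim_locally _ _) Cy (mkposreal _ he)) as [d3 hd3].
  assert (he2 : 0 < eps / 2 / M) by (apply Rdiv_lt_0_compat; lra).
  set (d := Rmin (Rmin d1 d2) (Rmin d3 (eps / 2 / M))).
  assert (hd : 0 < d).
  { unfold d. repeat apply Rmin_glb_lt; try apply cond_pos; lra. }
  exists (mkposreal d hd). simpl. intros s t hs ht.
  assert (D1 : d <= d1) by (unfold d; eapply Rle_trans; [apply Rmin_l|apply Rmin_l]).
  assert (D2 : d <= d2) by (unfold d; eapply Rle_trans; [apply Rmin_l|apply Rmin_r]).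
  assert (D3 : d <= d3) by (unfold d; eapply Rle_trans; [apply Rmin_r|apply Rmin_l]).
  assert (D4 : d <= eps / 2 / M) by (unfold d; eapply Rle_trans; [apply Rmin_r|apply Rmin_r]).
  assert (K : forall c, Rmin x s <= c <= Rmax x s -> Rabs (c - x) < d).
  { intros c hc. eapply Rle_lt_trans; [|exact hs].
    revert hc. unfold Rmin, Rmax. destruct (Rle_dec x s); intros hc;
      unfold Rabs; destruct (Rcase_abs (c - x)), (Rcase_abs (s - x)); lra. }
  destruct (MVT_gen (fun a => g a t) x s (fun a => gx a t)) as [c [hc Ec]].
  - intros c hc. apply Hx. apply hd2; [|lra].
    assert (Rabs (c - x) < d) by (apply K; lra). lra.
  - intros c hc. apply continuity_pt_filterlim.
    apply (@ex_derive_continuous R_AbsRing R_NormedModule (fun a => g a t)).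
    exists (gx c t). apply Hx. apply hd2; [|lra].
    assert (Rabs (c - x) < d) by now apply K. lra.
  - replace (g s t - g x y) with ((g s t - g x t) + (g x t - g x y)) by ring.
    eapply Rle_lt_trans; [apply Rabs_triang|].
    rewrite Ec, Rabs_mult.
    assert (B : Rabs (gx c t) <= M).
    { assert (Hc : Rabs (c - x) < d) by now apply K.
      assert (Q : Rabs (gx c t - gx x y) < 1) by (apply hd1; lra).
      unfold M. generalize (Rabs_triang_inv (gx c t) (gx x y)). lra. }
    assert (Q3 : Rabs (g x t - g x y) < eps / 2).
    { apply hd3. change (Rabs (t - y) < d3). lra. }
    assert (Rabs (gx c t) * Rabs (s - x) <= M * (eps / 2 / M)).
    { apply Rmult_le_compat; try apply Rabs_pos; lra. }
    replace (M * (eps / 2 / M)) with (eps / 2) in H by (field; lra).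
    lra.
Qed.

(** [Ck (S k)] does not mention continuity of [g] itself, so it has to be recovered from the partial
    derivatives. *)
Lemma Ck_pred (k : nat) (g : R -> R -> R) : Ck (S k) Om g -> Ck k Om g.
Proof.
  revert g. induction k as [|k IH]; intros g H.
  - destruct (Ck_S_inv 0 g H) as (gx & gy & Hx & Hy & Cx & Cy).
    apply Ck_continuity_2d. now apply continuity_2d_of_derivatives with gx gy.
  - destruct (Ck_S_inv _ g H) as (gx & gy & Hx & Hy & Cx & Cy).
    apply Ck_S_of with gx gy; auto.
Qed.

Lemma Ck_0 (k : nat) (g : R -> R -> R) : Ck k Om g -> Ck 0 Om g.
Proof.
  induction k as [|k IH]; [auto|]. intros H. now apply IH, Ck_pred.
Qed.

Lemma Ck_const (k : nat) (c : R) : Ck k Om (fun _ _ => c).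
Proof.
  revert c. induction k as [|k IH]; intros c.
  - intros p _. apply continuous_const.
  - apply Ck_S_of with (fun _ _ => 0) (fun _ _ => 0); auto;
      intros; apply (is_derive_const c).
Qed.

Lemma Ck_plus (k : nat) (g h : R -> R -> R) :
  Ck k Om g -> Ck k Om h -> Ck k Om (fun x y => g x y + h x y).
Proof.
  revert g h. induction k as [|k IH]; intros g h Hg Hh.
  - intros p hp. apply (continuous_plus (fun q : R * R => g (fst q) (snd q))
      (fun q => h (fst q) (snd q))); auto.
  - destruct (Ck_S_inv _ g Hg) as (gx & gy & Gx & Gy & Cx & Cy).
    destruct (Ck_S_inv _ h Hh) as (hx & hy & Hx & Hy & Dx & Dy).
    apply Ck_S_of with (fun x y => gx x y + hx x y) (fun x y => gy x y + hy x y); auto.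
    + intros x y h0. apply (is_derive_plus (fun t => g t y) (fun t => h t y)); auto.
    + intros x y h0. apply (is_derive_plus (fun t => g x t) (fun t => h x t)); auto.
Qed.

Lemma Ck_mult (k : nat) (g h : R -> R -> R) :
  Ck k Om g -> Ck k Om h -> Ck k Om (fun x y => g x y * h x y).
Proof.
  revert g h. induction k as [|k IH]; intros g h Hg Hh.
  - intros p hp. apply (continuous_mult (fun q : R * R => g (fst q) (snd q))
      (fun q => h (fst q) (snd q))); auto.
  - assert (Hg' := Ck_pred _ _ Hg). assert (Hh' := Ck_pred _ _ Hh).
    destruct (Ck_S_inv _ g Hg) as (gx & gy & Gx & Gy & Cx & Cy).
    destruct (Ck_S_inv _ h Hh) as (hx & hy & Hx & Hy & Dx & Dy).
    apply Ck_S_of with (fun x y => gx x y * h x y + g x y * hx x y)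
      (fun x y => gy x y * h x y + g x y * hy x y).
    + intros x y h0. apply (is_derive_mult (fun t => g t y) (fun t => h t y)); auto.
      intros; apply Rmult_comm.
    + intros x y h0. apply (is_derive_mult (fun t => g x t) (fun t => h x t)); auto.
      intros; apply Rmult_comm.
    + apply Ck_plus; apply IH; auto.
    + apply Ck_plus; apply IH; auto.
Qed.

Lemma Ck_opp (k : nat) (g : R -> R -> R) :
  Ck k Om g -> Ck k Om (fun x y => - g x y).
Proof.
  intros H. apply Ck_ext with (fun x y => (-1) * g x y); [intros; ring|].
  apply Ck_mult; [apply Ck_const | exact H].
Qed.

Lemma Ck_minus (k : nat) (g h : R -> R -> R) :
  Ck k Om g -> Ck k Om h -> Ck k Om (fun x y => g x y - h x y).
Proof.
  intros Hg Hh. apply Ck_plus; [exact Hg | now apply Ck_opp].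
Qed.

Lemma Ck_exp (k : nat) (g : R -> R -> R) :
  Ck k Om g -> Ck k Om (fun x y => exp (g x y)).
Proof.
  revert g. induction k as [|k IH]; intros g Hg.
  - intros p hp. apply (continuous_comp (fun q : R * R => g (fst q) (snd q)) exp).
    + now apply Hg.
    + apply continuous_exp.
  - assert (Hg' := Ck_pred _ _ Hg).
    destruct (Ck_S_inv _ g Hg) as (gx & gy & Gx & Gy & Cx & Cy).
    apply Ck_S_of with (fun x y => gx x y * exp (g x y)) (fun x y => gy x y * exp (g x y)).
    + intros x y h0. apply (is_derive_comp exp (fun t => g t y)); auto. apply is_derive_exp.
    + intros x y h0. apply (is_derive_comp exp (fun t => g x t)); auto. apply is_derive_exp.
    + apply Ck_mult; auto.
    + apply Ck_mult; auto.
Qed.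

End Ck.

Lemma Ck_swap (k : nat) (Om : R * R -> Prop) (g : R -> R -> R) :
  Ck k Om g -> Ck k (fun q => Om (snd q, fst q)) (fun x y => g y x).
Proof.
  revert g. induction k as [|k IH]; intros g H.
  - apply Ck_continuity_2d. intros x y hp. simpl in hp. intros eps.
    destruct (proj1 (Ck_continuity_2d Om g) H y x hp eps) as [d hd].
    exists d. auto.
  - destruct H as [H1 [H2 H3]]. split; [|split].
    + intros x y h. simpl in h. destruct (H1 y x h) as [Ha Hb]. now split.
    + apply (IH (fun x y => Derive (fun t => g x t) y) H3).
    + apply (IH (fun x y => Derive (fun t => g t y) x) H2).
Qed.

Lemma smooth1_Derive (I : R -> Prop) (g : R -> R) : smooth1 I g -> smooth1 I (Derive g).
Proof.
  intros H n x hx. specialize (H (S n) x hx).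
  destruct n as [|n]; [exact Logic.I|].
  simpl in H |- *. apply ex_derive_ext with (2 := H).
  intros t. change (Derive (Derive_n g n) t) with (Derive_n (Derive_n g n) 1 t).
  rewrite Derive_n_comp, Nat.add_comm, <- Derive_n_comp. reflexivity.
Qed.

Lemma smooth1_is_derive (I : R -> Prop) (g : R -> R) (x : R) :
  smooth1 I g -> I x -> is_derive g x (Derive g x).
Proof.
  intros H hx. apply Derive_correct. exact (H 1%nat x hx).
Qed.

Lemma Ck_fst (I : R -> Prop) (Om : R * R -> Prop) (k : nat) (g : R -> R) :
  open Om -> (forall x y, Om (x, y) -> I x) -> smooth1 I g -> Ck k Om (fun x _ => g x).
Proof.
  intros hO hI. revert g. induction k as [|k IH]; intros g H.
  - intros [x y] h. apply (continuous_comp (fun q : R * R => fst q) g).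
    + apply (@continuous_fst R_UniformSpace R_UniformSpace).
    + apply (@ex_derive_continuous R_AbsRing R_NormedModule).
      exact (H 1%nat x (hI _ _ h)).
  - apply Ck_S_of with (fun x _ => Derive g x) (fun _ _ => 0); auto.
    + intros x y h. apply smooth1_is_derive with I; [exact H | exact (hI _ _ h)].
    + intros x y h. apply (is_derive_const (g x)).
    + apply IH. now apply smooth1_Derive.
    + now apply Ck_const.
Qed.

Lemma Ck_snd (I : R -> Prop) (Om : R * R -> Prop) (k : nat) (g : R -> R) :
  open Om -> (forall x y, Om (x, y) -> I y) -> smooth1 I g -> Ck k Om (fun _ y => g y).
Proof.
  intros hO hI. revert g. induction k as [|k IH]; intros g H.
  - intros [x y] h. apply (continuous_comp (fun q : R * R => snd q) g).
    + apply (@continuous_snd R_UniformSpace R_UniformSpace).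
    + apply (@ex_derive_continuous R_AbsRing R_NormedModule).
      exact (H 1%nat y (hI _ _ h)).
  - apply Ck_S_of with (fun _ _ => 0) (fun _ y => Derive g y); auto.
    + intros x y h. apply (is_derive_const (g y)).
    + intros x y h. apply smooth1_is_derive with I; [exact H | exact (hI _ _ h)].
    + now apply Ck_const.
    + apply IH. now apply smooth1_Derive.
Qed.

(** * Integration from the diagonal *)

(** The closed square with opposite corners [(x, x)] and [(y, y)] lies in [Om]; it contains the
    horizontal and the vertical segment from [(x, y)] to the diagonal. *)
Definition starlike (Om : R * R -> Prop) : Prop :=
  open Om /\
  forall x y s t, Om (x, y) -> Rmin x y <= s <= Rmax x y -> Rmin x y <= t <= Rmax x y ->
    Om (s, t).

Definition from_diag (g : R -> R -> R) (x y : R) : R := RInt (fun t => g x t) x y.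

Lemma Rmin_max_l (a b : R) : Rmin a b <= a <= Rmax a b.
Proof. split; [apply Rmin_l | apply Rmax_l]. Qed.

Lemma Rmin_max_r (a b : R) : Rmin a b <= b <= Rmax a b.
Proof. split; [apply Rmin_r | apply Rmax_r]. Qed.

Lemma Rmin_max_segment (a b m M t : R) :
  m <= a <= M -> m <= b <= M -> Rmin a b <= t <= Rmax a b -> m <= t <= M.
Proof.
  unfold Rmin, Rmax. destruct (Rle_dec a b); lra.
Qed.

Lemma RInt_abs_le (f : R -> R) (a b m : R) :
  ex_RInt f a b -> (forall t, Rmin a b <= t <= Rmax a b -> Rabs (f t) <= m) ->
  Rabs (RInt f a b) <= m * Rabs (b - a).
Proof.
  intros hi hb. destruct (Rle_dec a b) as [h|h].
  - rewrite (Rabs_pos_eq (b - a)) by lra. rewrite Rmult_comm.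
    apply abs_RInt_le_const; auto.
    intros t ht. apply hb. rewrite Rmin_left, Rmax_right; lra.
  - rewrite <- opp_RInt_swap by now apply ex_RInt_swap.
    change (opp (RInt f b a)) with (- RInt f b a). rewrite Rabs_Ropp.
    rewrite (Rabs_left (b - a)) by lra. replace (- (b - a)) with (a - b) by ring.
    rewrite Rmult_comm. apply abs_RInt_le_const; [lra | now apply ex_RInt_swap|].
    intros t ht. apply hb. rewrite Rmin_right, Rmax_left; lra.
Qed.

Section Integration.

Context (Om : R * R -> Prop) (hO : starlike Om).

(** By openness [Om] contains a point slightly farther from the diagonal, and that point spans a
    larger square. *)
Lemma starlike_tube (x y : R) : Om (x, y) ->
  exists d : posreal, forall s t,
    Rmin x y - d <= s <= Rmax x y + d -> Rmin x y - d <= t <= Rmax x y + d -> Om (s, t).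
Proof.
  intros h. destruct (open_square Om (proj1 hO) x y h) as [d hd].
  assert (hd2 : 0 < d / 2) by (generalize (cond_pos d); lra).
  exists (mkposreal _ hd2). simpl. intros s t hs ht.
  destruct (Rle_dec x y) as [hxy|hxy].
  - rewrite Rmin_left, Rmax_right in hs, ht by lra.
    apply (proj2 hO) with (x - d / 2) (y + d / 2).
    + apply hd; unfold Rabs; destruct (Rcase_abs _); lra.
    + rewrite Rmin_left, Rmax_right; lra.
    + rewrite Rmin_left, Rmax_right; lra.
  - rewrite Rmin_right, Rmax_left in hs, ht by lra.
    apply (proj2 hO) with (x + d / 2) (y - d / 2).
    + apply hd; unfold Rabs; destruct (Rcase_abs _); lra.
    + rewrite Rmin_right, Rmax_left; lra.
    + rewrite Rmin_right, Rmax_left; lra.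
Qed.

Lemma starlike_section (x y t : R) :
  Om (x, y) -> Rmin x y <= t <= Rmax x y -> Om (x, t).
Proof.
  intros h ht. apply (proj2 hO) with x y; auto. apply Rmin_max_l.
Qed.

Lemma starlike_diag_l (x y : R) : Om (x, y) -> Om (x, x).
Proof. intros h. apply starlike_section with y; auto. apply Rmin_max_l. Qed.

Lemma continuous_section_y (g : R -> R -> R) (x y : R) :
  Ck 0 Om g -> Om (x, y) -> continuous (fun t => g x t) y.
Proof.
  intros H h. apply (proj1 (Ck_continuity_2d Om g)) with (2 := h) in H.
  apply continuity_pt_filterlim. intros eps he.
  destruct (H (mkposreal eps he)) as [d hd]. exists d. split; [apply cond_pos|].
  intros t [_ ht]. apply (hd x t); [|exact ht].
  rewrite Rminus_diag, Rabs_R0. apply cond_pos.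
Qed.

Lemma ex_RInt_section (g : R -> R -> R) (x y a b : R) :
  Ck 0 Om g -> (forall t, Rmin a b <= t <= Rmax a b -> Om (x, t)) ->
  ex_RInt (fun t => g x t) a b.
Proof.
  intros H h. apply (@ex_RInt_continuous R_CompleteNormedModule). intros t ht.
  apply continuous_section_y; auto.
Qed.

Lemma ex_RInt_from_diag (g : R -> R -> R) (x y : R) :
  Ck 0 Om g -> Om (x, y) -> ex_RInt (fun t => g x t) x y.
Proof.
  intros H h. apply ex_RInt_section; auto. intros t ht. now apply starlike_section with y.
Qed.

Lemma from_diag_diag (g : R -> R -> R) (x : R) : from_diag g x x = 0.
Proof. apply (RInt_point (V := R_CompleteNormedModule)). Qed.

Lemma is_derive_from_diag_y (g : R -> R -> R) (x y : R) :
  Ck 0 Om g -> Om (x, y) -> is_derive (fun t => from_diag g x t) y (g x y).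
Proof.
  intros H h.
  apply (is_derive_RInt (fun t => g x t) (fun t => from_diag g x t) x y).
  - apply filter_imp with (fun t => Om (x, t)); [|now apply open_section_y; [apply hO|]].
    intros t ht. apply (RInt_correct (V := R_CompleteNormedModule)). now apply ex_RInt_from_diag.
  - now apply continuous_section_y.
Qed.

Lemma from_diag_continuous (g : R -> R -> R) : Ck 0 Om g -> Ck 0 Om (from_diag g).
Proof.
  intros H. apply Ck_continuity_2d. intros x y h eps.
  destruct (starlike_tube x y h) as [d hd].
  set (m := Rmin x y - d / 2). set (M := Rmax x y + d / 2).
  assert (d0 := cond_pos d).
  assert (hx := Rmin_max_l x y). assert (hy := Rmin_max_r x y).
  assert (hin : forall s t, m <= s <= M -> m <= t <= M -> Om (s, t)).
  { unfold m, M. intros s t hs ht. apply hd; lra. }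
  assert (hmM : m < M) by (unfold m, M; lra).
  assert (he : 0 < eps / 3 / (M - m)).
  { generalize (cond_pos eps). intros. repeat apply Rdiv_lt_0_compat; lra. }
  (* Replacing [x'] by [x] in the integrand is uniformly cheap on the compact square; the limits of
     integration are then moved with [x] fixed, where the primitive is continuous. *)
  destruct (uniform_continuity_2d_1d' g m M x) with (eps := mkposreal _ he) as [d1 hd1].
  { intros t ht. apply (proj1 (Ck_continuity_2d Om g) H). apply hin; [unfold m, M; lra | exact ht]. }
  assert (Cy : continuous (fun t => RInt (fun a => g x a) x t) y).
  { apply (@ex_derive_continuous R_AbsRing R_NormedModule).
    exists (g x y). now apply is_derive_from_diag_y. }
  assert (Cx : continuous (fun t => RInt (fun a => g x a) x t) x).
  { apply (@ex_derive_continuous R_AbsRing R_NormedModule).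
    exists (g x x). apply is_derive_from_diag_y; auto. now apply starlike_diag_l with y. }
  assert (he3 : 0 < eps / 3) by (generalize (cond_pos eps); lra).
  destruct (proj1 (filterlim_locally _ _) Cy (mkposreal _ he3)) as [d2 hd2].
  destruct (proj1 (filterlim_locally _ _) Cx (mkposreal _ he3)) as [d3 hd3].
  set (e := Rmin (Rmin d1 (d / 2)) (Rmin d2 d3)).
  assert (he0 : 0 < e).
  { unfold e. repeat apply Rmin_glb_lt; try apply cond_pos; lra. }
  exists (mkposreal e he0). simpl. intros x' y' hx' hy'.
  assert (E1 : e <= d1) by (unfold e; eapply Rle_trans; [apply Rmin_l|apply Rmin_l]).
  assert (E2 : e <= d / 2) by (unfold e; eapply Rle_trans; [apply Rmin_l|apply Rmin_r]).
  assert (E3 : e <= d2) by (unfold e; eapply Rle_trans; [apply Rmin_r|apply Rmin_l]).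
  assert (E4 : e <= d3) by (unfold e; eapply Rle_trans; [apply Rmin_r|apply Rmin_r]).
  apply Rabs_lt_between in hx'. apply Rabs_lt_between in hy'.
  assert (ix' : m <= x' <= M) by (unfold m, M; lra).
  assert (iy' : m <= y' <= M) by (unfold m, M; lra).
  assert (ix : m <= x <= M) by (unfold m, M; lra).
  assert (X1 : forall s a b, m <= s <= M -> m <= a <= M -> m <= b <= M ->
    ex_RInt (fun t => g s t) a b).
  { intros s a b hs ha hb. apply ex_RInt_section; auto. intros t ht. apply hin; auto.
    apply (Rmin_max_segment a b); auto. }
  assert (K1 : Rabs (RInt (fun t => g x' t - g x t) x' y') <= eps / 3 / (M - m) * (M - m)).
  { eapply Rle_trans; [apply RInt_abs_le with (m := eps / 3 / (M - m))|].
    - apply (@ex_RInt_minus R_NormedModule); apply X1; auto.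
    - intros t ht. left. apply (hd1 t x t x').
      + apply (Rmin_max_segment x' y'); auto.
      + generalize (cond_pos d1). lra.
      + apply (Rmin_max_segment x' y'); auto.
      + lra.
      + rewrite Rminus_diag, Rabs_R0. apply cond_pos.
    - apply Rmult_le_compat_l; [lra|]. apply Rabs_le. lra. }
  replace (eps / 3 / (M - m) * (M - m)) with (eps / 3) in K1 by (field; lra).
  assert (K2 : Rabs (RInt (fun a => g x a) x y' - RInt (fun a => g x a) x y) < eps / 3).
  { apply hd2. change (Rabs (y' - y) < d2). apply Rabs_lt_between. lra. }
  assert (K3 : Rabs (RInt (fun a => g x a) x x' - RInt (fun a => g x a) x x) < eps / 3).
  { apply hd3. change (Rabs (x' - x) < d3). apply Rabs_lt_between. lra. }
  assert (R0 : RInt (fun a => g x a) x x = 0) by apply (RInt_point (V := R_CompleteNormedModule)).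
  rewrite R0 in K3.
  assert (Q1 : RInt (fun t => g x' t - g x t) x' y' =
    RInt (fun t => g x' t) x' y' - RInt (fun t => g x t) x' y').
  { apply (RInt_minus (V := R_CompleteNormedModule)); apply X1; auto. }
  assert (Q2 : RInt (fun t => g x t) x x' + RInt (fun t => g x t) x' y' =
    RInt (fun t => g x t) x y').
  { apply (RInt_Chasles (V := R_CompleteNormedModule)); apply X1; auto. }
  unfold from_diag.
  apply Rabs_lt_between. apply Rabs_le_between in K1. apply Rabs_lt_between in K2.
  apply Rabs_lt_between in K3. lra.
Qed.

Lemma is_derive_from_diag_x (g gx : R -> R -> R) (x y : R) :
  Ck 0 Om g -> Ck 0 Om gx ->
  (forall x y, Om (x, y) -> is_derive (fun t => g t y) x (gx x y)) ->
  Om (x, y) ->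
  is_derive (fun t => from_diag g t y) x (- g x x + from_diag gx x y).
Proof.
  intros H Hx D h. destruct (starlike_tube x y h) as [d hd].
  assert (hx := Rmin_max_l x y). assert (hy := Rmin_max_r x y).
  assert (d0 := cond_pos d).
  assert (hd2 : 0 < d / 2) by lra.
  assert (CD : forall s t, Om (s, t) ->
    continuity_2d_pt (fun u v : R => Derive (fun z : R => g z v) u) s t).
  { assert (C0 : Ck 0 Om (fun u v : R => Derive (fun z : R => g z v) u)).
    { apply Ck_ext with gx; [apply hO| |exact Hx].
      intros s t hst. symmetry. apply is_derive_unique. auto. }
    exact (proj1 (Ck_continuity_2d Om _) C0). }
  assert (near : forall P : R -> Prop,
    (forall s, x - d / 2 <= s <= x + d / 2 -> P s) -> locally x P).
  { intros P HP. exists (mkposreal _ hd2). intros s hs.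
    change (Rabs (s - x) < d / 2) in hs. apply HP.
    apply Rabs_lt_between in hs. lra. }
  (* The shape of the Leibniz rule with lower limit [t] and constant upper limit [y]: boundary terms
     with factors 1 and 0. *)
  replace (- g x x + from_diag gx x y) with
    (RInt (fun t : R => Derive (fun u : R => g u t) x) x y + - g x x * 1 + g x y * 0).
  2:{ unfold from_diag. rewrite (RInt_ext (fun t => Derive (fun u => g u t) x) (fun t => gx x t)).
      - ring.
      - intros t ht. apply is_derive_unique, D. apply starlike_section with y; auto. lra. }
  apply is_derive_RInt_param_bound_comp with (a := fun t => t) (b := fun _ => y).
  - apply near. intros s hs. apply ex_RInt_section; auto. intros t ht. apply hd; lra.
  - exists (mkposreal _ hd2). apply near. intros s hs. simpl.
    apply ex_RInt_section; auto. intros t ht. rewrite Rmin_left, Rmax_right in ht by lra.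
    apply hd; lra.
  - exists (mkposreal _ hd2). apply near. intros s hs. simpl.
    apply ex_RInt_section; auto. intros t ht. rewrite Rmin_left, Rmax_right in ht by lra.
    apply hd; lra.
  - apply (is_derive_id x).
  - apply (is_derive_const y x).
  - exists (mkposreal _ hd2). apply near. simpl. intros s hs t ht.
    exists (gx s t). apply D. apply hd; [lra|].
    unfold Rmin, Rmax in *.
    destruct (Rle_dec x y), (Rle_dec (x - d / 2) (y - d / 2)), (Rle_dec (x + d / 2) (y + d / 2)); lra.
  - intros t ht. apply CD. now apply starlike_section with y.
  - exists (mkposreal _ hd2). simpl. intros u v hu hv. apply CD.
    apply Rabs_lt_between in hu. apply Rabs_lt_between in hv. apply hd; lra.
  - exists (mkposreal _ hd2). simpl. intros u v hu hv. apply CD.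
    apply Rabs_lt_between in hu. apply Rabs_lt_between in hv. apply hd; lra.
  - apply continuity_pt_filterlim. apply continuous_section_y; auto.
    now apply starlike_diag_l with y.
  - apply continuity_pt_filterlim. now apply continuous_section_y.
Qed.

Lemma from_diag_minus (g h : R -> R -> R) (x y : R) : Ck 0 Om g -> Ck 0 Om h -> Om (x, y) ->
  from_diag g x y - from_diag h x y = from_diag (fun s t => g s t - h s t) x y.
Proof.
  intros Hg Hh h0. symmetry. apply (RInt_minus (V := R_CompleteNormedModule));
    now apply ex_RInt_from_diag.
Qed.

(** Used to identify functions by their [y]-derivatives and their values on the diagonal. *)
Lemma from_diag_of_derive (g gy : R -> R -> R) (x y : R) :
  (forall x y, Om (x, y) -> is_derive (fun t => g x t) y (gy x y)) -> Ck 0 Om gy ->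
  Om (x, y) -> g x y = g x x + from_diag gy x y.
Proof.
  intros D C h. unfold from_diag.
  assert (E := is_RInt_derive (V := R_CompleteNormedModule) (fun t => g x t) (fun t => gy x t) x y).
  apply (is_RInt_unique (V := R_CompleteNormedModule)) in E.
  - rewrite E. unfold minus, plus, opp; simpl. ring.
  - intros t ht. apply D. now apply starlike_section with y.
  - intros t ht. apply continuous_section_y; auto. now apply starlike_section with y.
Qed.

End Integration.

Section Diagonal.

Context (Om : R * R -> Prop) (hO : starlike Om).

(** Provides the total derivative that the chain rule along the diagonal requires. The increment in
    [x] uses the mean value theorem and continuity of [gx], the increment in [y] the derivative at
    the point itself. *)
Lemma differentiable_of_C1 (g gx gy : R -> R -> R) (x y : R) :
  (forall x y, Om (x, y) -> is_derive (fun t => g t y) x (gx x y)) ->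
  (forall x y, Om (x, y) -> is_derive (fun t => g x t) y (gy x y)) ->
  Ck 0 Om gx -> Om (x, y) -> differentiable_pt_lim g x y (gx x y) (gy x y).
Proof.
  intros Hx Hy Cx h eps.
  assert (he : 0 < eps / 2) by (generalize (cond_pos eps); lra).
  destruct (proj1 (Ck_continuity_2d Om gx) Cx x y h (mkposreal _ he)) as [d1 hd1].
  destruct (open_square Om (proj1 hO) x y h) as [d2 hd2].
  destruct (proj1 (is_derive_Reals (fun t => g x t) y (gy x y)) (Hy x y h) _ he) as [d3 hd3].
  set (d := Rmin d1 (Rmin d2 d3)).
  assert (hd : 0 < d) by (unfold d; repeat apply Rmin_glb_lt; apply cond_pos).
  assert (D1 : d <= d1) by apply Rmin_l.
  assert (D2 : d <= d2) by (unfold d; eapply Rle_trans; [apply Rmin_r|apply Rmin_l]).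
  assert (D3 : d <= d3) by (unfold d; eapply Rle_trans; [apply Rmin_r|apply Rmin_r]).
  exists (mkposreal d hd). simpl. intros s t hs ht.
  assert (K : forall c, Rmin x s <= c <= Rmax x s -> Rabs (c - x) < d).
  { intros c hc. eapply Rle_lt_trans; [|exact hs].
    revert hc. unfold Rmin, Rmax. destruct (Rle_dec x s); intros hc;
      unfold Rabs; destruct (Rcase_abs (c - x)), (Rcase_abs (s - x)); lra. }
  destruct (MVT_gen (fun a => g a t) x s (fun a => gx a t)) as [c [hc Ec]].
  - intros c hc. apply Hx. apply hd2; [|lra].
    assert (Rabs (c - x) < d) by (apply K; lra). lra.
  - intros c hc. apply continuity_pt_filterlim.
    apply (@ex_derive_continuous R_AbsRing R_NormedModule (fun a => g a t)).
    exists (gx c t). apply Hx. apply hd2; [|lra].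
    assert (Rabs (c - x) < d) by now apply K. lra.
  - replace (g s t - g x y - (gx x y * (s - x) + gy x y * (t - y))) with
      ((gx c t - gx x y) * (s - x) + (g x t - g x y - gy x y * (t - y))).
    2:{ rewrite Rmult_minus_distr_r, <- Ec. ring. }
    eapply Rle_trans; [apply Rabs_triang|].
    replace (eps * Rmax (Rabs (s - x)) (Rabs (t - y))) with
      (eps / 2 * Rmax (Rabs (s - x)) (Rabs (t - y)) + eps / 2 * Rmax (Rabs (s - x)) (Rabs (t - y)))
      by field.
    apply Rplus_le_compat.
    + rewrite Rabs_mult. apply Rmult_le_compat; try apply Rabs_pos; [|apply Rmax_l].
      left. apply hd1; [|lra]. assert (Rabs (c - x) < d) by now apply K. lra.
    + apply Rle_trans with (eps / 2 * Rabs (t - y)).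
      2:{ apply Rmult_le_compat_l; [lra | apply Rmax_r]. }
      destruct (Req_dec t y) as [->|hty].
      * replace (g x y - g x y - gy x y * (y - y)) with 0 by ring.
        rewrite Rabs_R0. apply Rmult_le_pos; [lra | apply Rabs_pos].
      * assert (hn : t - y <> 0) by lra.
        assert (Q := hd3 (t - y) hn ltac:(lra)).
        replace (y + (t - y)) with t in Q by ring.
        replace (g x t - g x y - gy x y * (t - y)) with
          (((g x t - g x y) / (t - y) - gy x y) * (t - y)) by now field.
        rewrite Rabs_mult. apply Rmult_le_compat_r; [apply Rabs_pos | lra].
Qed.

(** Differentiating [from_diag g] in [x] produces the boundary value [g x x], so smoothness has to
    pass to diagonal values. *)
Lemma Ck_diag (k : nat) (g : R -> R -> R) : Ck k Om g -> Ck k Om (fun x _ => g x x).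
Proof.
  revert g. induction k as [|k IH]; intros g H.
  - apply Ck_continuity_2d. intros x y h eps.
    assert (h' := starlike_diag_l Om hO x y h).
    destruct (proj1 (Ck_continuity_2d Om g) H x x h' eps) as [d hd].
    exists d. intros s t hs _. now apply hd.
  - destruct (Ck_S_inv Om _ g H) as (gx & gy & Gx & Gy & Cx & Cy).
    apply Ck_S_of with (fun x _ => gx x x + gy x x) (fun _ _ => 0); try apply hO.
    + intros x y h. apply is_derive_Reals.
      replace (gx x x + gy x x) with (gx x x * 1 + gy x x * 1) by ring.
      apply (derivable_pt_lim_comp_2d g (fun t => t) (fun t => t) x).
      * apply differentiable_of_C1; auto.
        -- now apply Ck_0 with k; [apply hO|].
        -- now apply starlike_diag_l with y.
      * apply derivable_pt_lim_id.
      * apply derivable_pt_lim_id.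
    + intros x y h. apply (is_derive_const (g x x)).
    + apply (IH (fun x y => gx x y + gy x y)). now apply Ck_plus; [apply hO| |].
    + apply Ck_const, hO.
Qed.

Lemma Ck_from_diag (k : nat) (g : R -> R -> R) : Ck k Om g -> Ck k Om (from_diag g).
Proof.
  revert g. induction k as [|k IH]; intros g H.
  - now apply from_diag_continuous.
  - assert (H' := Ck_pred Om (proj1 hO) _ _ H).
    assert (H0 := Ck_0 Om (proj1 hO) _ _ H).
    destruct (Ck_S_inv Om _ g H) as (gx & gy & Gx & Gy & Cx & Cy).
    assert (C0 := Ck_0 Om (proj1 hO) _ _ Cx).
    apply Ck_S_of with (fun x y => - g x x + from_diag gx x y) g; try apply hO.
    + intros x y h. apply (is_derive_from_diag_x Om hO); assumption.
    + intros x y h. apply (is_derive_from_diag_y Om hO); assumption.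
    + apply Ck_plus; [apply hO| |].
      * apply Ck_opp; [apply hO|]. now apply Ck_diag.
      * now apply IH.
    + exact H'.
Qed.

End Diagonal.

(** * Geometrically convergent series *)

Lemma ex_series_geom_bound (a : nat -> R) (A q : R) : 0 <= q < 1 ->
  (forall n, Rabs (a n) <= A * q ^ n) -> ex_series a.
Proof.
  intros hq h. apply (ex_series_le (V := R_CompleteNormedModule)) with (fun n => A * q ^ n); auto.
  apply (ex_series_scal (V := R_NormedModule) A (fun n => q ^ n)).
  apply ex_series_geom. rewrite Rabs_pos_eq; lra.
Qed.

Lemma Series_geom_bound (a : nat -> R) (A q : R) : 0 <= q < 1 ->
  (forall n, Rabs (a n) <= A * q ^ n) -> Rabs (Series a) <= A / (1 - q).
Proof.
  intros hq h.
  assert (hx : ex_series (fun n => A * q ^ n)).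
  { apply (ex_series_scal (V := R_NormedModule) A (fun n => q ^ n)).
    apply ex_series_geom. rewrite Rabs_pos_eq; lra. }
  eapply Rle_trans; [apply Series_Rabs|].
  - apply (ex_series_le (V := R_CompleteNormedModule)) with (fun n => A * q ^ n); auto.
    intros n. change (norm (Rabs (a n))) with (Rabs (Rabs (a n))). now rewrite Rabs_Rabsolu.
  - eapply Rle_trans; [apply Series_le with (b := fun n => A * q ^ n)|]; auto.
    + intros n. split; [apply Rabs_pos | auto].
    + rewrite Series_scal_l, Series_geom; [right; reflexivity|].
      rewrite Rabs_pos_eq; lra.
Qed.

Lemma Series_tail_bound (a : nat -> R) (A q : R) (N : nat) : 0 <= q < 1 ->
  (forall n, Rabs (a n) <= A * q ^ n) ->
  Rabs (Series a - sum_n a N) <= A * q ^ S N / (1 - q).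
Proof.
  intros hq h.
  rewrite (Series_incr_n a (S N)); [|lia|now apply ex_series_geom_bound with A q].
  rewrite sum_n_Reals. simpl pred.
  replace (_ + _ - _) with (Series (fun k => a (S N + k)%nat)) by ring.
  apply Series_geom_bound; auto.
  intros n. eapply Rle_trans; [apply h|]. rewrite pow_add. right. ring.
Qed.

Lemma geom_pow_small (A q eps : R) : 0 <= q < 1 -> 0 < eps ->
  exists N, A * q ^ S N / (1 - q) < eps.
Proof.
  intros hq he.
  assert (hA : 0 < Rabs A + 1) by (generalize (Rabs_pos A); lra).
  destruct (pow_lt_1_zero q) with (y := eps * (1 - q) / (Rabs A + 1)) as [N hN].
  - rewrite Rabs_pos_eq; lra.
  - apply Rdiv_lt_0_compat; [apply Rmult_lt_0_compat; lra | lra].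
  - exists N. specialize (hN (S N) ltac:(lia)).
    rewrite Rabs_pos_eq in hN by (apply pow_le; lra).
    apply Rle_lt_trans with ((Rabs A + 1) * q ^ S N / (1 - q)).
    + unfold Rdiv. apply Rmult_le_compat_r; [left; apply Rinv_0_lt_compat; lra|].
      apply Rmult_le_compat_r; [apply pow_le; lra|]. generalize (Rle_abs A). lra.
    + apply Rmult_lt_reg_r with ((1 - q) / (Rabs A + 1)).
      { apply Rdiv_lt_0_compat; lra. }
      replace ((Rabs A + 1) * q ^ S N / (1 - q) * ((1 - q) / (Rabs A + 1))) with (q ^ S N)
        by (field; lra).
      eapply Rlt_le_trans; [exact hN|]. right. field. lra.
Qed.

Lemma Ck_0_Series (Om : R * R -> Prop) (f : nat -> R -> R -> R) (A q : R) :
  open Om -> 0 <= q < 1 -> (forall n, Ck 0 Om (f n)) ->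
  (forall n x y, Om (x, y) -> Rabs (f n x y) <= A * q ^ n) ->
  Ck 0 Om (fun x y => Series (fun n => f n x y)).
Proof.
  intros hO hq hc hb. apply Ck_continuity_2d. intros x y h eps.
  assert (he : 0 < eps / 3) by (generalize (cond_pos eps); lra).
  destruct (geom_pow_small A q _ hq he) as [N hN].
  assert (cS : Ck 0 Om (fun x y => sum_n (fun n => f n x y) N)).
  { clear hN. induction N as [|N IH].
    - apply Ck_ext with (f 0%nat); auto. intros. now rewrite sum_O.
    - apply Ck_ext with (fun x y => sum_n (fun n => f n x y) N + f (S N) x y); auto.
      + intros. rewrite sum_Sn. reflexivity.
      + apply Ck_plus; auto. }
  destruct (proj1 (Ck_continuity_2d Om _) cS x y h (mkposreal _ he)) as [d1 hd1].
  destruct (open_square Om hO x y h) as [d2 hd2].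
  assert (hd : 0 < Rmin d1 d2) by (apply Rmin_glb_lt; apply cond_pos).
  exists (mkposreal _ hd). simpl. intros s t hs ht.
  assert (D1 := Rmin_l d1 d2). assert (D2 := Rmin_r d1 d2).
  assert (Q : Rabs (sum_n (fun n => f n s t) N - sum_n (fun n => f n x y) N) < eps / 3)
    by (apply hd1; lra).
  assert (T1 := Series_tail_bound (fun n => f n s t) A q N hq
    (fun n => hb n s t (hd2 s t ltac:(lra) ltac:(lra)))).
  assert (T2 := Series_tail_bound (fun n => f n x y) A q N hq (fun n => hb n x y h)).
  apply Rabs_lt_between. apply Rabs_lt_between in Q.
  apply Rabs_le_between in T1. apply Rabs_le_between in T2. lra.
Qed.

(** By the mean value theorem the difference quotients obey the same geometric bound as the
    derivatives, so all tails beyond [N] are small uniformly in the increment. *)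
Lemma is_derive_Series (f g : nat -> R -> R) (x A q : R) : 0 <= q < 1 ->
  locally x (fun t => forall n, is_derive (f n) t (g n t) /\
    Rabs (f n t) <= A * q ^ n /\ Rabs (g n t) <= A * q ^ n) ->
  is_derive (fun t => Series (fun n => f n t)) x (Series (fun n => g n x)).
Proof.
  intros hq [d hd]. apply is_derive_Reals. intros eps he.
  assert (he4 : 0 < eps / 4) by lra.
  destruct (geom_pow_small A q _ hq he4) as [N hN].
  assert (DS : derivable_pt_lim (fun t => sum_n (fun n => f n t) N) x (sum_n (fun n => g n x) N)).
  { apply is_derive_Reals. apply (is_derive_sum_n (fun n t => f n t)). intros k _.
    apply hd. apply ball_center. }
  destruct (DS _ he4) as [d1 hd1].
  assert (hdd : 0 < Rmin d d1) by (apply Rmin_glb_lt; apply cond_pos).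
  exists (mkposreal _ hdd). simpl. intros h hn hh.
  assert (D1 := Rmin_l d d1). assert (D2 := Rmin_r d d1).
  assert (Q := hd1 h hn ltac:(lra)).
  assert (B : forall c, Rabs (c - x) < d -> forall n, is_derive (f n) c (g n c) /\
    Rabs (f n c) <= A * q ^ n /\ Rabs (g n c) <= A * q ^ n).
  { intros c hc. apply hd. exact hc. }
  assert (B0 : forall n, is_derive (f n) x (g n x) /\
    Rabs (f n x) <= A * q ^ n /\ Rabs (g n x) <= A * q ^ n).
  { apply B. rewrite Rminus_diag, Rabs_R0. apply cond_pos. }
  assert (Bh : forall n, is_derive (f n) (x + h) (g n (x + h)) /\
    Rabs (f n (x + h)) <= A * q ^ n /\ Rabs (g n (x + h)) <= A * q ^ n).
  { apply B. replace (x + h - x) with h by ring. lra. }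
  assert (L : forall n, Rabs ((f n (x + h) - f n x) / h) <= A * q ^ n).
  { intros n.
    assert (K : forall c, Rmin x (x + h) <= c <= Rmax x (x + h) -> Rabs (c - x) < d).
    { intros c hc. assert (Rabs (c - x) <= Rabs h); [|lra].
      revert hc. unfold Rmin, Rmax. destruct (Rle_dec x (x + h)); intros hc;
        unfold Rabs; destruct (Rcase_abs (c - x)), (Rcase_abs h); lra. }
    destruct (MVT_gen (f n) x (x + h) (g n)) as [c [hc Ec]].
    - intros c hc. apply B, K. lra.
    - intros c hc. apply continuity_pt_filterlim.
      apply (@ex_derive_continuous R_AbsRing R_NormedModule (f n)).
      exists (g n c). apply B, K. lra.
    - rewrite Ec. replace (g n c * (x + h - x) / h) with (g n c) by now field.
      apply B. now apply K. }
  assert (T1 := Series_tail_bound (fun n => (f n (x + h) - f n x) / h) A q N hq L).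
  assert (T2 := Series_tail_bound (fun n => g n x) A q N hq (fun n => proj2 (proj2 (B0 n)))).
  assert (E : Series (fun n => (f n (x + h) - f n x) / h) =
    (Series (fun n => f n (x + h)) - Series (fun n => f n x)) / h).
  { unfold Rdiv. rewrite Series_scal_r. f_equal. apply Series_minus.
    - apply ex_series_geom_bound with A q; auto. intros n. apply Bh.
    - apply ex_series_geom_bound with A q; auto. intros n. apply B0. }
  assert (E2 : sum_n (fun n => (f n (x + h) - f n x) / h) N =
    (sum_n (fun n => f n (x + h)) N - sum_n (fun n => f n x) N) / h).
  { clear - hn. induction N as [|N IH].
    - now rewrite !sum_O.
    - rewrite !sum_Sn, IH. unfold plus; simpl. field. exact hn. }
  rewrite E, E2 in T1.
  apply Rabs_lt_between. apply Rabs_lt_between in Q.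
  apply Rabs_le_between in T1. apply Rabs_le_between in T2. lra.
Qed.

(** * A neighbourhood of the diagonal with weighted estimates *)

Lemma Ck_subset (k : nat) (Om Om' : R * R -> Prop) (g : R -> R -> R) :
  (forall x y, Om (x, y) -> Om' (x, y)) -> Ck k Om' g -> Ck k Om g.
Proof.
  intros hs. revert g. induction k as [|k IH]; intros g H.
  - intros [x y] h. exact (H (x, y) (hs x y h)).
  - destruct H as [H1 [H2 H3]]. split; [|split].
    + intros x y h. exact (H1 x y (hs x y h)).
    + exact (IH _ H2).
    + exact (IH _ H3).
Qed.

(* The integral of [g (., y)] from the diagonal point [(y, y)] to [(x, y)]. *)
Definition from_diag_x (g : R -> R -> R) (x y : R) : R :=
  from_diag (fun a b => g b a) y x.

(* [P] will be a primitive of a weight that dominates the Cauchy data: measuring the distance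
   to the diagonal by [P] makes all estimates uniform although [I] need not be compact. *)
Definition near_diag (I : R -> Prop) (P : R -> R) (eps : R) (q : R * R) : Prop :=
  I (fst q) /\ I (snd q) /\ Rabs (P (snd q) - P (fst q)) < eps.

Section Near_diag.

Context (I : R -> Prop) (hI : is_open_interval I) (c P : R -> R)
  (hc : forall x, I x -> continuous c x) (hc1 : forall x, I x -> 1 <= c x)
  (hP : forall x, I x -> is_derive P x (c x)) (eps : R) (heps : 0 < eps <= / 10).

Let Om := near_diag I P eps.

Lemma interval_segment (a b t : R) : I a -> I b -> Rmin a b <= t <= Rmax a b -> I t.
Proof.
  intros ha hb ht. destruct (Rle_dec a b) as [h|h].
  - apply (proj2 hI) with a b; auto. rewrite Rmin_left, Rmax_right in ht; lra.
  - apply (proj2 hI) with b a; auto. rewrite Rmin_right, Rmax_left in ht; lra.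
Qed.

Lemma continuous_primitive (x : R) : I x -> continuous P x.
Proof.
  intros hx. apply (@ex_derive_continuous R_AbsRing R_NormedModule). eexists. now apply hP.
Qed.

Lemma primitive_integral (a b : R) : I a -> I b -> is_RInt c a b (P b - P a).
Proof.
  intros ha hb. apply (is_RInt_derive (V := R_CompleteNormedModule)).
  - intros t ht. apply hP. now apply interval_segment with a b.
  - intros t ht. apply hc. now apply interval_segment with a b.
Qed.

Lemma primitive_incr (a b : R) : I a -> I b -> a <= b -> P a <= P b.
Proof.
  intros ha hb hab. destruct (MVT_gen P a b c) as [t [ht Et]].
  - intros t ht. apply hP. apply interval_segment with a b; auto. lra.
  - intros t ht. apply continuity_pt_filterlim, continuous_primitive.
    now apply interval_segment with a b.
  - assert (1 <= c t) by (apply hc1; now apply interval_segment with a b). nra.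
Qed.

(** [P] is increasing, so points between [x] and [y] are at most as far apart in the scale of [P];
    this makes [near_diag] starlike. *)
Lemma near_diag_monotone (x y s t : R) : I x -> I y ->
  Rmin x y <= s <= Rmax x y -> Rmin x y <= t <= Rmax x y ->
  Rabs (P t - P s) <= Rabs (P y - P x).
Proof.
  intros hx hy hs ht.
  assert (is : I s) by now apply interval_segment with x y.
  assert (it : I t) by now apply interval_segment with x y.
  destruct (Rle_dec x y) as [h|h].
  - rewrite Rmin_left, Rmax_right in hs, ht by lra.
    assert (P x <= P s) by (apply primitive_incr; auto; lra).
    assert (P s <= P y) by (apply primitive_incr; auto; lra).
    assert (P x <= P t) by (apply primitive_incr; auto; lra).
    assert (P t <= P y) by (apply primitive_incr; auto; lra).
    unfold Rabs. destruct (Rcase_abs (P t - P s)), (Rcase_abs (P y - P x)); lra.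
  - rewrite Rmin_right, Rmax_left in hs, ht by lra.
    assert (P y <= P s) by (apply primitive_incr; auto; lra).
    assert (P s <= P x) by (apply primitive_incr; auto; lra).
    assert (P y <= P t) by (apply primitive_incr; auto; lra).
    assert (P t <= P x) by (apply primitive_incr; auto; lra).
    unfold Rabs. destruct (Rcase_abs (P t - P s)), (Rcase_abs (P y - P x)); lra.
Qed.

Lemma near_diag_open : open Om.
Proof.
  intros [x y] [hx [hy h]]. simpl in hx, hy, h.
  assert (he : 0 < (eps - Rabs (P y - P x)) / 2) by lra.
  destruct (proj1 hI x hx) as [d1 hd1]. destruct (proj1 hI y hy) as [d2 hd2].
  destruct (proj1 (filterlim_locally _ _) (continuous_primitive x hx) (mkposreal _ he)) as [d3 hd3].
  destruct (proj1 (filterlim_locally _ _) (continuous_primitive y hy) (mkposreal _ he)) as [d4 hd4].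
  assert (hd : 0 < Rmin (Rmin d1 d2) (Rmin d3 d4))
    by (repeat apply Rmin_glb_lt; apply cond_pos).
  exists (mkposreal _ hd). intros [s t] [hs ht]. simpl in hs, ht.
  assert (D1 := Rmin_l (Rmin d1 d2) (Rmin d3 d4)). assert (D2 := Rmin_r (Rmin d1 d2) (Rmin d3 d4)).
  assert (D3 := Rmin_l d1 d2). assert (D4 := Rmin_r d1 d2).
  assert (D5 := Rmin_l d3 d4). assert (D6 := Rmin_r d3 d4).
  change (Rabs (s - x) < Rmin (Rmin d1 d2) (Rmin d3 d4)) in hs.
  change (Rabs (t - y) < Rmin (Rmin d1 d2) (Rmin d3 d4)) in ht.
  split; [|split]; simpl.
  - apply hd1. change (Rabs (s - x) < d1). lra.
  - apply hd2. change (Rabs (t - y) < d2). lra.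
  - assert (A : Rabs (P s - P x) < (eps - Rabs (P y - P x)) / 2).
    { apply hd3. change (Rabs (s - x) < d3). lra. }
    assert (B : Rabs (P t - P y) < (eps - Rabs (P y - P x)) / 2).
    { apply hd4. change (Rabs (t - y) < d4). lra. }
    replace (P t - P s) with ((P t - P y) + (P y - P x) - (P s - P x)) by ring.
    unfold Rminus at 1. eapply Rle_lt_trans; [apply Rabs_triang|]. rewrite Rabs_Ropp.
    generalize (Rabs_triang (P t - P y) (P y - P x)). lra.
Qed.

Lemma near_diag_starlike : starlike Om.
Proof.
  split; [exact near_diag_open|].
  intros x y s t [hx [hy h]] hs ht. simpl in hx, hy, h. split; [|split]; simpl.
  - now apply interval_segment with x y.
  - now apply interval_segment with x y.
  - eapply Rle_lt_trans; [|exact h]. now apply near_diag_monotone.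
Qed.

Lemma near_diag_swap (x y : R) : Om (x, y) -> Om (y, x).
Proof.
  intros [hx [hy h]]. simpl in *. split; [|split]; auto. simpl. now rewrite Rabs_minus_sym.
Qed.

Lemma near_diag_diag (x : R) : I x -> Om (x, x).
Proof.
  intros hx. split; [|split]; auto. simpl. rewrite Rminus_diag, Rabs_R0. lra.
Qed.

Lemma Ck_swap_near (k : nat) (g : R -> R -> R) : Ck k Om g -> Ck k Om (fun x y => g y x).
Proof.
  intros H. apply Ck_subset with (fun q => Om (snd q, fst q)).
  - intros x y h. now apply near_diag_swap.
  - now apply Ck_swap.
Qed.

Lemma Ck_from_diag_x (k : nat) (g : R -> R -> R) : Ck k Om g -> Ck k Om (from_diag_x g).
Proof.
  intros H. apply (Ck_swap_near k (from_diag (fun a b => g b a))).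
  apply Ck_from_diag; [exact near_diag_starlike|]. now apply Ck_swap_near.
Qed.

(** The weight [c] integrates over the segment to [Rabs (P y - P x) < eps], whatever the length of
    the segment. *)
Lemma from_diag_weighted_bound (g : R -> R -> R) (m x y : R) : Om (x, y) -> Ck 0 Om g ->
  (forall t, Om (x, t) -> Rabs (g x t) <= m * c t) -> Rabs (from_diag g x y) <= m * eps.
Proof.
  intros h hg hb. assert (h' := h). destruct h' as [hx [hy hP']]. simpl in hx, hy, hP'.
  assert (m0 : 0 <= m).
  { assert (hxx : Om (x, x)) by now apply near_diag_diag.
    generalize (hb x hxx) (Rabs_pos (g x x)) (hc1 x hx). nra. }
  assert (ic := primitive_integral x y hx hy).
  assert (K : Rabs (from_diag g x y) <= m * Rabs (P y - P x)).
  { assert (ig := ex_RInt_from_diag Om near_diag_starlike g x y hg h).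
    assert (hsec : forall t, Rmin x y <= t <= Rmax x y -> Rabs (g x t) <= m * c t).
    { intros t ht. apply hb. now apply (starlike_section Om near_diag_starlike x y). }
    unfold from_diag. destruct (Rle_dec x y) as [hxy|hxy].
    - assert (Q := norm_RInt_le (V := R_NormedModule) (fun t => g x t) (fun t => m * c t) x y
        (RInt (fun t => g x t) x y) (m * (P y - P x)) hxy).
      eapply Rle_trans; [apply Q|].
      + intros t ht. apply hsec. rewrite Rmin_left, Rmax_right; lra.
      + now apply (RInt_correct (V := R_CompleteNormedModule)).
      + now apply (is_RInt_scal (V := R_NormedModule)).
      + apply Rmult_le_compat_l; auto. apply Rle_abs.
    - apply is_RInt_swap in ic. apply ex_RInt_swap in ig.
      rewrite <- (opp_RInt_swap (V := R_CompleteNormedModule)) by exact ig.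
      change (Rabs (- RInt (fun t => g x t) y x) <= m * Rabs (P y - P x)). rewrite Rabs_Ropp.
      assert (Q := norm_RInt_le (V := R_NormedModule) (fun t => g x t) (fun t => m * c t) y x
        (RInt (fun t => g x t) y x) (m * (opp (P y - P x))) ltac:(lra)).
      eapply Rle_trans; [apply Q|].
      + intros t ht. apply hsec. rewrite Rmin_right, Rmax_left; lra.
      + now apply (RInt_correct (V := R_CompleteNormedModule)).
      + now apply (is_RInt_scal (V := R_NormedModule)).
      + apply Rmult_le_compat_l; auto. rewrite <- Rabs_Ropp. apply Rle_abs. }
  eapply Rle_trans; [exact K|]. apply Rmult_le_compat_l; [exact m0 | lra].
Qed.

Lemma from_diag_x_weighted_bound (g : R -> R -> R) (m x y : R) : Om (x, y) -> Ck 0 Om g ->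
  (forall t, Om (t, y) -> Rabs (g t y) <= m * c t) -> Rabs (from_diag_x g x y) <= m * eps.
Proof.
  intros h hg hb. apply from_diag_weighted_bound.
  - now apply near_diag_swap.
  - now apply Ck_swap_near.
  - intros t ht. apply hb. now apply near_diag_swap.
Qed.

End Near_diag.

(** * A Cauchy problem for the generalized sinh-Gordon equation *)

Lemma exp_2_le_9 : exp 2 <= 9.
Proof.
  replace 2 with (1 + 1) by ring. rewrite exp_plus.
  generalize exp_le_3 (exp_pos 1). nra.
Qed.

Lemma exp_le_9 (a : R) : a <= 2 -> 0 < exp a <= 9.
Proof.
  intros h. split; [apply exp_pos|].
  apply Rle_trans with (exp 2); [|exact exp_2_le_9].
  destruct (Rle_lt_or_eq_dec _ _ h) as [h'| ->]; [left; now apply exp_increasing | lra].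
Qed.

Lemma exp_lipschitz (a b : R) : a <= 2 -> b <= 2 -> Rabs (exp a - exp b) <= 9 * Rabs (a - b).
Proof.
  intros ha hb. destruct (MVT_gen exp b a exp) as [t [ht Et]].
  - intros t _. apply is_derive_exp.
  - intros t _. apply derivable_continuous_pt, derivable_pt_exp.
  - rewrite Et, Rabs_mult. apply Rmult_le_compat_r; [apply Rabs_pos|].
    assert (t <= 2). { apply Rle_trans with (Rmax b a); [lra | now apply Rmax_lub]. }
    destruct (exp_le_9 t H). rewrite Rabs_pos_eq; lra.
Qed.

Section Cauchy_problem.

Context (I : R -> Prop) (hI : is_open_interval I) (c P : R -> R)
  (hc : forall x, I x -> continuous c x) (hc1 : forall x, I x -> 1 <= c x)
  (hP : forall x, I x -> is_derive P x (c x)) (eps : R) (heps : 0 < eps <= / 10)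
  (k r s u0 v0 : R -> R)
  (sk : smooth1 I k) (sr : smooth1 I r) (ss : smooth1 I s)
  (su : smooth1 I u0) (sv : smooth1 I v0)
  (bk : forall x, I x -> Rabs (k x) <= c x)
  (brs : forall x, I x -> Rabs (r x) + Rabs (s x) <= c x)
  (buv : forall x, I x -> Rabs (u0 x) + Rabs (v0 x) <= c x).

Let Om := near_diag I P eps.
Let hS : starlike Om := near_diag_starlike I hI c P hc1 hP eps.
Let hO : open Om := proj1 hS.

(** With [w_x = p], flatness becomes [w_xy = source w]. [picard] integrates this twice from the
    diagonal: in [y] with initial value [k], then in [x] with initial value 0. *)
Definition source (w : R -> R -> R) (x y : R) : R :=
  s x * u0 y * exp (2 * w x y) - r x * v0 y * exp (- 2 * w x y).

Definition slope (w : R -> R -> R) (x y : R) : R := k x + from_diag (source w) x y.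

Definition picard (w : R -> R -> R) : R -> R -> R := from_diag_x (slope w).

Lemma Ck_near_fst (n : nat) (g : R -> R) : smooth1 I g -> Ck n Om (fun x _ => g x).
Proof.
  intros hg. apply Ck_fst with I; [exact hO | | exact hg]. intros x y h. apply h.
Qed.

Lemma Ck_near_snd (n : nat) (g : R -> R) : smooth1 I g -> Ck n Om (fun _ y => g y).
Proof.
  intros hg. apply Ck_snd with I; [exact hO | | exact hg]. intros x y h. apply h.
Qed.

Lemma Ck_exp_scal (n : nat) (a : R) (w : R -> R -> R) :
  Ck n Om w -> Ck n Om (fun x y => exp (a * w x y)).
Proof.
  intros hw. apply Ck_exp; [exact hO|]. apply Ck_mult; [exact hO| |exact hw].
  apply Ck_const, hO.
Qed.

Lemma Ck_source (n : nat) (w : R -> R -> R) : Ck n Om w -> Ck n Om (source w).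
Proof.
  intros hw. apply Ck_minus; [exact hO| |]; repeat apply Ck_mult; try exact hO;
    try (apply Ck_near_fst; assumption); try (apply Ck_near_snd; assumption);
    apply Ck_exp_scal; exact hw.
Qed.

Lemma Ck_slope (n : nat) (w : R -> R -> R) : Ck n Om w -> Ck n Om (slope w).
Proof.
  intros hw. apply Ck_plus; [exact hO| |].
  - now apply Ck_near_fst.
  - apply Ck_from_diag; [exact hS|]. now apply Ck_source.
Qed.

Lemma Ck_picard (n : nat) (w : R -> R -> R) : Ck n Om w -> Ck n Om (picard w).
Proof.
  intros hw. apply (Ck_from_diag_x I hI c P hc1 hP eps). now apply Ck_slope.
Qed.

Definition bounded_by_1 (w : R -> R -> R) : Prop := forall x y, Om (x, y) -> Rabs (w x y) <= 1.

Lemma bounded_exponents (w : R -> R -> R) (x y : R) : bounded_by_1 w -> Om (x, y) ->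
  2 * w x y <= 2 /\ - 2 * w x y <= 2.
Proof.
  intros hw h. assert (Q := hw x y h). apply Rabs_le_between in Q. lra.
Qed.

(** Both products occur in the expansion of [(Rabs (r x) + Rabs (s x)) * (Rabs (u0 y) + Rabs (v0
    y))]. The bound 9 is that of the exponentials: [exp 2 <= 9]. *)
Lemma weight_product (x y a b : R) : Om (x, y) -> Rabs a <= 9 -> Rabs b <= 9 ->
  Rabs (s x * u0 y * a - r x * v0 y * b) <= 9 * c x * c y.
Proof.
  intros [hx [hy _]] ha hb. simpl in hx, hy.
  generalize (brs x hx) (buv y hy) (Rabs_pos (r x)) (Rabs_pos (s x)) (Rabs_pos (u0 y))
    (Rabs_pos (v0 y)). intros H1 H2 P1 P2 P3 P4.
  unfold Rminus at 1. eapply Rle_trans; [apply Rabs_triang|]. rewrite Rabs_Ropp, !Rabs_mult.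
  assert (Rabs (s x) * Rabs (u0 y) * Rabs a <= Rabs (s x) * Rabs (u0 y) * 9)
    by (apply Rmult_le_compat_l; auto; now apply Rmult_le_pos).
  assert (Rabs (r x) * Rabs (v0 y) * Rabs b <= Rabs (r x) * Rabs (v0 y) * 9)
    by (apply Rmult_le_compat_l; auto; now apply Rmult_le_pos).
  assert ((Rabs (r x) + Rabs (s x)) * (Rabs (u0 y) + Rabs (v0 y)) <= c x * c y)
    by (apply Rmult_le_compat; lra).
  assert (0 <= Rabs (s x) * Rabs (v0 y)) by now apply Rmult_le_pos.
  assert (0 <= Rabs (r x) * Rabs (u0 y)) by now apply Rmult_le_pos.
  lra.
Qed.

Lemma picard_bounded (w : R -> R -> R) : Ck 0 Om w -> bounded_by_1 w -> bounded_by_1 (picard w).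
Proof.
  intros hC hb x y h.
  (* The slope is at most [c t + 9 * c t * eps <= 2 * c t], and one more integration multiplies by
     [eps]. *)
  apply Rle_trans with (2 * eps); [|lra].
  apply (from_diag_x_weighted_bound I hI c P hc hc1 hP eps heps (slope w)); auto.
  { now apply Ck_slope. }
  intros t ht. unfold slope.
  assert (Q : Rabs (from_diag (source w) t y) <= 9 * c t * eps).
  { apply (from_diag_weighted_bound I hI c P hc hc1 hP eps heps); auto.
    - now apply Ck_source.
    - intros y' h'. apply weight_product; auto.
      + destruct (exp_le_9 (2 * w t y')); [now apply bounded_exponents|].
        rewrite Rabs_pos_eq; lra.
      + destruct (exp_le_9 (- 2 * w t y')); [now apply bounded_exponents|].
        rewrite Rabs_pos_eq; lra. }
  assert (ct := hc1 t (proj1 ht)). assert (kt := bk t (proj1 ht)).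
  eapply Rle_trans; [apply Rabs_triang|]. nra.
Qed.

Lemma picard_contraction (w w' : R -> R -> R) (d : R) :
  Ck 0 Om w -> bounded_by_1 w -> Ck 0 Om w' -> bounded_by_1 w' -> 0 <= d ->
  (forall x y, Om (x, y) -> Rabs (w x y - w' x y) <= d) ->
  forall x y, Om (x, y) -> Rabs (picard w x y - picard w' x y) <= / 2 * d.
Proof.
  intros hC hb hC' hb' hd hdiff x y h.
  assert (E : picard w x y - picard w' x y = from_diag_x (fun a b => slope w a b - slope w' a b) x y).
  { apply (from_diag_minus Om hS).
    - apply (Ck_swap_near I P eps). now apply Ck_slope.
    - apply (Ck_swap_near I P eps). now apply Ck_slope.
    - now apply near_diag_swap. }
  rewrite E. clear E.
  (* Each of the two integrations gains [eps]; the Lipschitz constant 9 of [exp] and the factor 2 in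
     the exponents give 18. *)
  apply Rle_trans with (18 * eps * d * eps).
  2:{ assert (eps * eps <= / 10 * / 10) by (apply Rmult_le_compat; lra). nra. }
  apply (from_diag_x_weighted_bound I hI c P hc hc1 hP eps heps); auto.
  { apply Ck_minus; [exact hO| |]; now apply Ck_slope. }
  intros t ht. unfold slope.
  replace (_ + _ - _) with (from_diag (source w) t y - from_diag (source w') t y) by ring.
  rewrite (from_diag_minus Om hS); [|now apply Ck_source|now apply Ck_source|exact ht].
  replace (18 * eps * d * c t) with (18 * c t * d * eps) by ring.
  apply (from_diag_weighted_bound I hI c P hc hc1 hP eps heps); auto.
  { apply Ck_minus; [exact hO| |]; now apply Ck_source. }
  intros y' h'. unfold source.
  replace (_ - _ - _) with (s t * u0 y' * (exp (2 * w t y') - exp (2 * w' t y'))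
    - r t * v0 y' * (exp (- 2 * w t y') - exp (- 2 * w' t y'))) by ring.
  destruct (bounded_exponents w t y' hb h') as [B1 B2].
  destruct (bounded_exponents w' t y' hb' h') as [B3 B4].
  assert (D := hdiff t y' h').
  assert (L1 := exp_lipschitz _ _ B1 B3). assert (L2 := exp_lipschitz _ _ B2 B4).
  replace (2 * w t y' - 2 * w' t y') with (2 * (w t y' - w' t y')) in L1 by ring.
  replace (- 2 * w t y' - - 2 * w' t y') with (- 2 * (w t y' - w' t y')) in L2 by ring.
  rewrite Rabs_mult in L1, L2. rewrite (Rabs_pos_eq 2) in L1 by lra.
  rewrite (Rabs_left (- 2)) in L2 by lra.
  (* Dividing the differences of exponentials by [2 * d] makes them at most 9, the form expected by
     [weight_product]; for [d = 0] the two functions agree. *)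
  destruct (Rle_lt_or_eq_dec _ _ hd) as [hd'|hd'].
  - set (e1 := exp (2 * w t y') - exp (2 * w' t y')) in *.
    set (e2 := exp (- 2 * w t y') - exp (- 2 * w' t y')) in *.
    assert (hd2 : 0 < 2 * d) by lra.
    replace (s t * u0 y' * e1 - r t * v0 y' * e2) with
      (2 * d * (s t * u0 y' * (e1 / (2 * d)) - r t * v0 y' * (e2 / (2 * d)))) by (field; lra).
    rewrite Rabs_mult, (Rabs_pos_eq (2 * d)) by lra.
    replace (18 * c t * d * c y') with (2 * d * (9 * c t * c y')) by ring.
    apply Rmult_le_compat_l; [lra|]. apply weight_product; auto.
    + unfold Rdiv. rewrite Rabs_mult, Rabs_inv, (Rabs_pos_eq (2 * d)) by lra.
      apply Rmult_le_reg_r with (2 * d); [lra|]. rewrite Rmult_assoc, Rinv_l by lra. lra.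
    + unfold Rdiv. rewrite Rabs_mult, Rabs_inv, (Rabs_pos_eq (2 * d)) by lra.
      apply Rmult_le_reg_r with (2 * d); [lra|]. rewrite Rmult_assoc, Rinv_l by lra. lra.
  - subst d. assert (Z : w t y' - w' t y' = 0).
    { apply Rabs_le_between in D. lra. }
    replace (w' t y') with (w t y') by lra.
    rewrite !Rminus_diag, !Rmult_0_r, Rminus_0_r, Rabs_R0. lra.
Qed.

Fixpoint iterate (n : nat) : R -> R -> R :=
  match n with
  | O => fun _ _ => 0
  | S n' => picard (iterate n')
  end.

Lemma iterate_Ck (n : nat) : Ck 0 Om (iterate n).
Proof.
  induction n as [|n IH]; [exact (Ck_const Om hO 0 0) | now apply Ck_picard].
Qed.

Lemma iterate_bounded (n : nat) : bounded_by_1 (iterate n).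
Proof.
  induction n as [|n IH].
  - intros x y _. simpl. rewrite Rabs_R0. lra.
  - apply picard_bounded; [apply iterate_Ck | exact IH].
Qed.

Lemma iterate_cauchy (n : nat) : forall x y, Om (x, y) ->
  Rabs (iterate (S n) x y - iterate n x y) <= 1 * (/ 2) ^ n.
Proof.
  induction n as [|n IH].
  - intros x y h. simpl pow. change (iterate 0 x y) with 0. rewrite Rminus_0_r, Rmult_1_r.
    now apply (iterate_bounded 1).
  - intros x y h. replace (1 * (/ 2) ^ S n) with (/ 2 * (1 * (/ 2) ^ n)) by (simpl; ring).
    apply (picard_contraction (iterate (S n)) (iterate n)); auto.
    + apply iterate_Ck.
    + apply iterate_bounded.
    + apply iterate_Ck.
    + apply iterate_bounded.
    + apply Rmult_le_pos; [lra|]. apply pow_le. lra.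
Qed.

(** The limit of the iterates as a telescoping series, so that [Ck_0_Series] yields its
    continuity. *)
Definition solution (x y : R) : R := Series (fun n => iterate (S n) x y - iterate n x y).

Lemma solution_Ck_0 : Ck 0 Om solution.
Proof.
  apply (Ck_0_Series Om (fun n x y => iterate (S n) x y - iterate n x y) 1 (/ 2)); auto.
  - lra.
  - intros n. apply Ck_minus; [exact hO| |]; apply iterate_Ck.
  - intros n x y h. now apply iterate_cauchy.
Qed.

Lemma solution_approx (n : nat) (x y : R) : Om (x, y) ->
  Rabs (solution x y - iterate (S n) x y) <= 2 * (/ 2) ^ S n.
Proof.
  intros h.
  assert (Q := Series_tail_bound (fun n => iterate (S n) x y - iterate n x y) 1 (/ 2) n ltac:(lra)
    (fun n => iterate_cauchy n x y h)).
  assert (E : sum_n (fun n => iterate (S n) x y - iterate n x y) n = iterate (S n) x y).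
  { clear Q. induction n as [|n IH].
    - rewrite sum_O. change (iterate 1 x y - 0 = iterate 1 x y). ring.
    - rewrite sum_Sn, IH.
      change (iterate (S n) x y + (iterate (S (S n)) x y - iterate (S n) x y)
        = iterate (S (S n)) x y). ring. }
  rewrite E in Q. unfold solution. eapply Rle_trans; [exact Q|]. right. field.
Qed.

Lemma half_pow_small (e : R) : 0 < e -> exists n, 2 * (/ 2) ^ S n < e.
Proof.
  intros he. destruct (geom_pow_small 1 (/ 2) e) as [n hn]; [lra|exact he|].
  exists n. replace (2 * (/ 2) ^ S n) with (1 * (/ 2) ^ S n / (1 - / 2)) by field. exact hn.
Qed.

Lemma solution_bounded : bounded_by_1 solution.
Proof.
  intros x y h. apply Rnot_lt_le. intros hl.
  destruct (half_pow_small (Rabs (solution x y) - 1)) as [n hn]; [lra|].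
  assert (A := solution_approx n x y h). assert (B := iterate_bounded (S n) x y h).
  assert (T := Rabs_triang (solution x y - iterate (S n) x y) (iterate (S n) x y)).
  replace (solution x y - iterate (S n) x y + iterate (S n) x y) with (solution x y) in T by ring.
  lra.
Qed.

(** Both sides are within a geometrically small distance of the same iterate, the right one by the
    contraction estimate. *)
Lemma solution_fixed (x y : R) : Om (x, y) -> solution x y = picard solution x y.
Proof.
  intros h. apply Rminus_diag_uniq. apply Rabs_eq_0. apply Rle_antisym; [|apply Rabs_pos].
  apply Rnot_lt_le. intros hl.
  destruct (half_pow_small (Rabs (solution x y - picard solution x y) / 2)) as [n hn]; [lra|].
  assert (A := solution_approx (S n) x y h).
  assert (B : Rabs (picard solution x y - picard (iterate (S n)) x y) <= / 2 * (2 * (/ 2) ^ S n)).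
  { apply picard_contraction; auto.
    - apply solution_Ck_0.
    - apply solution_bounded.
    - apply iterate_Ck.
    - apply iterate_bounded.
    - apply Rmult_le_pos; [lra|]. apply pow_le. lra.
    - intros. now apply solution_approx. }
  change (picard (iterate (S n)) x y) with (iterate (S (S n)) x y) in B.
  assert (E : 2 * (/ 2) ^ S (S n) = / 2 * (2 * (/ 2) ^ S n)) by (simpl; field).
  rewrite E in A. set (D := Rabs (solution x y - picard solution x y)) in *.
  assert (T : D <= Rabs (solution x y - iterate (S (S n)) x y) +
     Rabs (picard solution x y - iterate (S (S n)) x y)).
  { unfold D. rewrite (Rabs_minus_sym (picard solution x y)).
    replace (solution x y - picard solution x y) with
      ((solution x y - iterate (S (S n)) x y) + (iterate (S (S n)) x y - picard solution x y)) by ring.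
    apply Rabs_triang. }
  lra.
Qed.

Lemma solution_derive_x (x y : R) : Om (x, y) ->
  is_derive (fun t => solution t y) x (slope solution x y).
Proof.
  intros h. apply is_derive_ext_loc with (fun t => picard solution t y).
  - apply filter_imp with (fun t => Om (t, y)); [|now apply open_section_x].
    intros t ht. symmetry. now apply solution_fixed.
  - apply (is_derive_from_diag_y Om hS (fun a b => slope solution b a) y x).
    + apply (Ck_swap_near I P eps). apply Ck_slope. apply solution_Ck_0.
    + now apply near_diag_swap.
Qed.

Lemma slope_derive_y (x y : R) : Om (x, y) ->
  is_derive (fun t => slope solution x t) y (source solution x y).
Proof.
  intros h. unfold slope.
  replace (source solution x y) with (0 + source solution x y) by ring.
  apply (is_derive_plus (fun _ => k x)); [apply (is_derive_const (k x))|].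
  apply (is_derive_from_diag_y Om hS); auto. apply Ck_source. apply solution_Ck_0.
Qed.

Lemma solution_diag (x : R) : I x -> solution x x = 0.
Proof.
  intros hx. rewrite solution_fixed; [|now apply near_diag_diag].
  apply (from_diag_diag (fun a b => slope solution b a)).
Qed.

Lemma slope_diag (x : R) : slope solution x x = k x.
Proof.
  unfold slope. rewrite from_diag_diag. ring.
Qed.

Definition source_x (x y : R) : R :=
  (Derive s x + 2 * slope solution x y * s x) * u0 y * exp (2 * solution x y)
  - (Derive r x - 2 * slope solution x y * r x) * v0 y * exp (- 2 * solution x y).

Lemma source_derive_x (x y : R) : Om (x, y) ->
  is_derive (fun t => source solution t y) x (source_x x y).
Proof.
  intros h. unfold source, source_x.
  assert (Ds := smooth1_is_derive I s x ss (proj1 h)).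
  assert (Dr := smooth1_is_derive I r x sr (proj1 h)).
  assert (Dw := solution_derive_x x y h).
  set (w := fun t => solution t y) in *.
  change (is_derive (fun t => s t * u0 y * exp (2 * w t) - r t * v0 y * exp (- 2 * w t)) x
    ((Derive s x + 2 * slope solution x y * s x) * u0 y * exp (2 * w x)
  - (Derive r x - 2 * slope solution x y * r x) * v0 y * exp (- 2 * w x))).
  auto_derive.
  - repeat split; try (eexists; eassumption).
  - change (Derive (fun x0 : R => w x0) x) with (Derive w x).
    rewrite (is_derive_unique w x _ Dw).
    change (Derive (fun x0 : R => s x0) x) with (Derive s x).
    change (Derive (fun x0 : R => r x0) x) with (Derive r x). ring.
Qed.

Lemma Ck_source_x (n : nat) : Ck n Om solution -> Ck n Om (slope solution) -> Ck n Om source_x.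
Proof.
  intros hw hp.
  assert (h2 : Ck n Om (fun x y => 2 * slope solution x y)).
  { apply Ck_mult; [exact hO|apply Ck_const, hO|exact hp]. }
  apply Ck_minus; [exact hO| |]; apply Ck_mult; try exact hO;
    try (apply Ck_exp_scal; exact hw); apply Ck_mult; try exact hO;
    try (apply Ck_near_snd; assumption).
  - apply Ck_plus; [exact hO| |].
    + apply Ck_near_fst. now apply smooth1_Derive.
    + apply Ck_mult; [exact hO|exact h2|]. now apply Ck_near_fst.
  - apply Ck_minus; [exact hO| |].
    + apply Ck_near_fst. now apply smooth1_Derive.
    + apply Ck_mult; [exact hO|exact h2|]. now apply Ck_near_fst.
Qed.

(** The partial derivatives of [solution] and [slope] are built by integration and algebra from
    these two functions and the data, without any derivative of them; so the pair gains one order at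
    a time. *)
Lemma solution_slope_Ck (n : nat) : Ck n Om solution /\ Ck n Om (slope solution).
Proof.
  induction n as [|n [IHw IHp]].
  - split; [apply solution_Ck_0 | apply Ck_slope, solution_Ck_0].
  - assert (C0 := solution_Ck_0).
    assert (Cs0 : Ck 0 Om source_x).
    { apply Ck_source_x; [exact C0 | now apply Ck_slope]. }
    split.
    + apply Ck_S_of with (slope solution)
        (fun x y => - slope solution y y + from_diag_x (source solution) x y); try exact hO.
      * exact solution_derive_x.
      * intros x y h. apply is_derive_ext_loc with (fun t => picard solution x t).
        { apply filter_imp with (fun t => Om (x, t)); [|now apply open_section_y].
          intros t ht. symmetry. now apply solution_fixed. }
        apply (is_derive_from_diag_x Om hS (fun a b => slope solution b a)
          (fun a b => source solution b a) y x).
        -- apply (Ck_swap_near I P eps). now apply Ck_slope.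
        -- apply (Ck_swap_near I P eps). now apply Ck_source.
        -- intros a b hab. apply slope_derive_y. now apply near_diag_swap.
        -- now apply near_diag_swap.
      * exact IHp.
      * apply Ck_plus; [exact hO| |].
        -- apply Ck_opp; [exact hO|].
           apply (Ck_swap_near I P eps n (fun x _ => slope solution x x)).
           now apply (Ck_diag Om hS).
        -- apply (Ck_from_diag_x I hI c P hc1 hP eps). now apply Ck_source.
    + apply Ck_S_of with
        (fun x y => Derive k x + (- source solution x x + from_diag source_x x y))
        (source solution); try exact hO.
      * intros x y h. unfold slope. apply (is_derive_plus k).
        -- apply smooth1_is_derive with I; auto. apply h.
        -- apply (is_derive_from_diag_x Om hS); auto.
           ++ now apply Ck_source.
           ++ exact source_derive_x.
      * exact slope_derive_y.
      * apply Ck_plus; [exact hO| |].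
        -- apply Ck_near_fst. now apply smooth1_Derive.
        -- apply Ck_plus; [exact hO| |].
           ++ apply Ck_opp; [exact hO|]. apply (Ck_diag Om hS). now apply Ck_source.
           ++ apply (Ck_from_diag Om hS). now apply Ck_source_x.
      * now apply Ck_source.
Qed.

Lemma Cauchy_problem_solution : exists w p : R -> R -> R,
  (forall n, Ck n Om w) /\ (forall n, Ck n Om p) /\
  (forall x y, Om (x, y) -> Rabs (w x y) <= 1) /\
  (forall x y, Om (x, y) -> is_derive (fun t => w t y) x (p x y)) /\
  (forall x y, Om (x, y) -> is_derive (fun t => p x t) y
     (s x * u0 y * exp (2 * w x y) - r x * v0 y * exp (- 2 * w x y))) /\
  (forall x, I x -> w x x = 0) /\ (forall x, I x -> p x x = k x).
Proof.
  exists solution, (slope solution).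
  split; [intros n; apply solution_slope_Ck|]. split; [intros n; apply solution_slope_Ck|].
  split; [exact solution_bounded|]. split; [exact solution_derive_x|].
  split; [exact slope_derive_y|]. split; [exact solution_diag|].
  intros x _. apply slope_diag.
Qed.

End Cauchy_problem.

(** * Iterated integrals *)

(* The [(i, j)] entry of the [n]-th iterated integral, from the diagonal, of the matrix
   [[0, u], [v, 0]]; rows and columns are numbered by [false], [true]. *)
Fixpoint iterint (u v : R -> R -> R) (i : bool) (n : nat) (j : bool) : R -> R -> R :=
  match n with
  | O => fun _ _ => if Bool.eqb i j then 1 else 0
  | S n' => from_diag (fun x t => iterint u v i n' (negb j) x t * (if j then u else v) x t)
  end.

(** The coefficient of index [n - 1], and 0 for [n = 0]: on the generating series this is
    multiplication by the variable. *)
Definition iterint_pred (u v : R -> R -> R) (i : bool) (n : nat) (j : bool) : R -> R -> R :=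
  match n with
  | O => fun _ _ => 0
  | S n' => iterint u v i n' j
  end.

(** A product of [n] off-diagonal matrices is diagonal for even [n] and off-diagonal for odd [n].
    This becomes the twisting condition on the loops. *)
Lemma iterint_parity (u v : R -> R -> R) (i : bool) (n : nat) (j : bool) (x y : R) :
  Nat.even n <> Bool.eqb i j -> iterint u v i n j x y = 0.
Proof.
  revert j y. induction n as [|n IH]; intros j y h.
  - simpl in *. destruct (Bool.eqb i j); congruence.
  - simpl. unfold from_diag. rewrite (RInt_ext _ (fun _ => 0)).
    + rewrite RInt_const. apply Rmult_0_r.
    + intros t _. rewrite IH; [apply Rmult_0_l|].
      rewrite Nat.even_succ, <- Nat.negb_even in h.
      destruct i, j, (Nat.even n); simpl in *; congruence.
Qed.

Section Iterated_integrals.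

Context (I : R -> Prop) (hI : is_open_interval I) (c P : R -> R)
  (hc : forall x, I x -> continuous c x) (hc1 : forall x, I x -> 1 <= c x)
  (hP : forall x, I x -> is_derive P x (c x)) (eps : R) (heps : 0 < eps <= / 10).

Let Om := near_diag I P eps.
Let hS : starlike Om := near_diag_starlike I hI c P hc1 hP eps.
Let hO : open Om := proj1 hS.

Context (u v : R -> R -> R) (hu : Ck 0 Om u) (hv : Ck 0 Om v)
  (bu : forall x y, Om (x, y) -> Rabs (u x y) <= 9 * c y)
  (bv : forall x y, Om (x, y) -> Rabs (v x y) <= 9 * c y).

Lemma iterint_Ck (i : bool) (n : nat) (j : bool) : Ck 0 Om (iterint u v i n j).
Proof.
  revert j. induction n as [|n IH]; intros j.
  - exact (Ck_const Om hO 0 (if Bool.eqb i j then 1 else 0)).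
  - apply (Ck_from_diag Om hS). apply Ck_mult; [exact hO|apply IH|].
    destruct j; assumption.
Qed.

Lemma iterint_pred_Ck (i : bool) (n : nat) (j : bool) : Ck 0 Om (iterint_pred u v i n j).
Proof.
  destruct n as [|n]; [exact (Ck_const Om hO 0 0) | apply iterint_Ck].
Qed.

(** Every integration multiplies by [9 * eps], as [u] and [v] are at most 9 times the weight. *)
Lemma iterint_bound (i : bool) (n : nat) (j : bool) (x y : R) : Om (x, y) ->
  Rabs (iterint u v i n j x y) <= (9 * eps) ^ n.
Proof.
  revert j y. induction n as [|n IH]; intros j y h.
  - simpl. destruct (Bool.eqb i j); [rewrite Rabs_R1 | rewrite Rabs_R0]; lra.
  - simpl. replace (9 * eps * (9 * eps) ^ n) with ((9 * (9 * eps) ^ n) * eps) by ring.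
    apply (from_diag_weighted_bound I hI c P hc hc1 hP eps heps); auto.
    + apply Ck_mult; [exact hO|apply iterint_Ck|]. destruct j; assumption.
    + intros t ht. rewrite Rabs_mult.
      replace (9 * (9 * eps) ^ n * c t) with ((9 * eps) ^ n * (9 * c t)) by ring.
      apply Rmult_le_compat; try apply Rabs_pos; [now apply IH|].
      destruct j; [now apply bu | now apply bv].
Qed.

Lemma iterint_diag (i : bool) (n : nat) (j : bool) (x : R) :
  iterint u v i n j x x = if andb (Nat.eqb n 0) (Bool.eqb i j) then 1 else 0.
Proof.
  destruct n as [|n]; [reflexivity|]. apply from_diag_diag.
Qed.

Lemma iterint_derive_y (i : bool) (n : nat) (j : bool) (x y : R) : Om (x, y) ->
  is_derive (fun t => iterint u v i n j x t) y
    (iterint_pred u v i n (negb j) x y * (if j then u else v) x y).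
Proof.
  intros h. destruct n as [|n].
  - simpl. rewrite Rmult_0_l. apply is_derive_Reals, derivable_pt_lim_const.
  - apply (is_derive_from_diag_y Om hS (fun x t => iterint u v i n (negb j) x t * (if j then u else v) x t)); auto.
    apply Ck_mult; [exact hO|apply iterint_Ck|]. destruct j; assumption.
Qed.

(* Zero-curvature equations for [p e3 + l beta] and [l^-1 b], where [beta = [[0, r], [s, 0]]]
   and [b = [[0, u], [v, 0]]]. *)
Context (p : R -> R -> R) (k r s u0 v0 : R -> R)
  (sk : smooth1 I k) (sr : smooth1 I r) (ss : smooth1 I s)
  (su : smooth1 I u0) (sv : smooth1 I v0) (hp : Ck 0 Om p)
  (ux : forall x y, Om (x, y) -> is_derive (fun t => u t y) x (2 * p x y * u x y))
  (vx : forall x y, Om (x, y) -> is_derive (fun t => v t y) x (- 2 * p x y * v x y))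
  (py : forall x y, Om (x, y) -> is_derive (fun t => p x t) y (s x * u x y - r x * v x y))
  (pd : forall x, I x -> p x x = k x)
  (ud : forall x, I x -> u x x = u0 x) (vd : forall x, I x -> v x x = v0 x).

Definition sgn (i : bool) : R := if i then 1 else - 1.

(** The coefficient of [l^-n] in [M A - D M], where [M] is the series of iterated integrals, [A] the
    [dx] part of the connection and [D] the potential on the diagonal. *)
Definition iterint_x (i : bool) (n : nat) (j : bool) (x y : R) : R :=
  (p x y * sgn j - k x * sgn i) * iterint u v i n j x y
  + (if j then r else s) x * iterint u v i (S n) (negb j) x y
  - (if i then s else r) x * iterint u v (negb i) (S n) j x y
  - (if i then v0 else u0) x * iterint_pred u v (negb i) n j x y.

Lemma iterint_x_Ck (i : bool) (n : nat) (j : bool) : Ck 0 Om (iterint_x i n j).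
Proof.
  assert (H : forall g, smooth1 I g -> Ck 0 Om (fun x _ => g x)).
  { intros g hg. apply Ck_fst with I; [exact hO | | exact hg]. intros x y h. apply h. }
  unfold iterint_x.
  assert (A1 : Ck 0 Om (fun x y => (p x y * sgn j - k x * sgn i) * iterint u v i n j x y)).
  { apply Ck_mult; [exact hO| |apply iterint_Ck].
    apply Ck_minus; [exact hO| |]; (apply Ck_mult; [exact hO| |apply Ck_const, hO]);
      [exact hp | now apply H]. }
  assert (A2 : Ck 0 Om (fun x y => (if j then r else s) x * iterint u v i (S n) (negb j) x y)).
  { apply Ck_mult; [exact hO| |apply iterint_Ck]. destruct j; now apply H. }
  assert (A3 : Ck 0 Om (fun x y => (if i then s else r) x * iterint u v (negb i) (S n) j x y)).
  { apply Ck_mult; [exact hO| |apply iterint_Ck]. destruct i; now apply H. }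
  assert (A4 : Ck 0 Om (fun x y => (if i then v0 else u0) x * iterint_pred u v (negb i) n j x y)).
  { apply Ck_mult; [exact hO| |apply iterint_pred_Ck]. destruct i; now apply H. }
  exact (Ck_minus Om hO _ _ _ (Ck_minus Om hO _ _ _ (Ck_plus Om hO _ _ _ A1 A2) A3) A4).
Qed.

(** With [M_y = M B], flatness [A_y + B A - A B = B_x] gives
    [(M A - D M)_y = (M A - D M) B + M B_x]; the term with [2 * p] is the part [M B_x]. *)
Lemma iterint_x_derive_y (i : bool) (n : nat) (j : bool) (x y : R) : Om (x, y) ->
  is_derive (fun t => iterint_x i n j x t) y
   (match n with
    | O => 0
    | S n' => (iterint_x i n' (negb j) x y + 2 * p x y * sgn j * iterint u v i n' (negb j) x y)
              * (if j then u else v) x y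
    end).
Proof.
  intros h.
  assert (D1 := iterint_derive_y i n j x y h).
  assert (D2 := iterint_derive_y i (S n) (negb j) x y h).
  assert (D3 := iterint_derive_y (negb i) (S n) j x y h).
  assert (D4 : is_derive (fun t => iterint_pred u v (negb i) n j x t) y
    (match n with O => 0 | S n' => iterint_pred u v (negb i) n' (negb j) x y end
     * (if j then u else v) x y)).
  { destruct n as [|n].
    - simpl. rewrite Rmult_0_l. apply is_derive_Reals, derivable_pt_lim_const.
    - exact (iterint_derive_y (negb i) n j x y h). }
  assert (Dp := py x y h).
  unfold iterint_x at 1.
  set (f1 := fun t => iterint u v i n j x t) in D1.
  set (f2 := fun t => iterint u v i (S n) (negb j) x t) in D2.
  set (f3 := fun t => iterint u v (negb i) (S n) j x t) in D3.
  set (f4 := fun t => iterint_pred u v (negb i) n j x t) in D4.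
  set (f0 := fun t => p x t) in Dp.
  change (is_derive (fun t => (f0 t * sgn j - k x * sgn i) * f1 t
    + (if j then r else s) x * f2 t - (if i then s else r) x * f3 t
    - (if i then v0 else u0) x * f4 t) y
   (match n with
    | O => 0
    | S n' => (iterint_x i n' (negb j) x y + 2 * p x y * sgn j * iterint u v i n' (negb j) x y)
              * (if j then u else v) x y
    end)).
  auto_derive.
  { repeat split; eexists; eassumption. }
  change (Derive (fun x0 : R => f0 x0) y) with (Derive f0 y).
  change (Derive (fun x0 : R => f1 x0) y) with (Derive f1 y).
  change (Derive (fun x0 : R => f2 x0) y) with (Derive f2 y).
  change (Derive (fun x0 : R => f3 x0) y) with (Derive f3 y).
  change (Derive (fun x0 : R => f4 x0) y) with (Derive f4 y).
  rewrite (is_derive_unique f1 y _ D1), (is_derive_unique f2 y _ D2), (is_derive_unique f3 y _ D3),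
    (is_derive_unique f4 y _ D4), (is_derive_unique f0 y _ Dp).
  unfold f0, f1. clear.
  destruct n as [|n].
  - unfold iterint_pred, sgn. destruct i, j; simpl; ring.
  - unfold iterint_x.
    destruct j; cbn [negb iterint_pred sgn]; destruct i; cbn [negb sgn]; ring.
Qed.

(** By induction on [n]: the claimed derivative and the one given by the Leibniz rule have equal
    [y]-derivatives and equal diagonal values. The boundary term [- g x x] survives only at index 1,
    where it matches the [u0], [v0] part of the potential. *)
Lemma iterint_derive_x (i : bool) (n : nat) (j : bool) (x y : R) : Om (x, y) ->
  is_derive (fun t => iterint u v i n j t y) x (iterint_x i n j x y).
Proof.
  assert (hid : forall a b, Om (a, b) -> I a) by (intros a b hab; apply hab).
  revert j x y. induction n as [|n IH]; intros j x y h.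
  - assert (E : iterint_x i 0 j x y = 0).
    { rewrite (from_diag_of_derive Om hS (iterint_x i 0 j) (fun _ _ => 0)); auto.
      - unfold from_diag. rewrite RInt_const.
        change (scal (y - x) 0) with ((y - x) * 0). rewrite Rmult_0_r, Rplus_0_r.
        unfold iterint_x. rewrite !iterint_diag, pd by exact (hid _ _ h).
        destruct i, j; simpl; ring.
      - intros a b hab. exact (iterint_x_derive_y i 0 j a b hab).
      - exact (Ck_const Om hO 0 0). }
    rewrite E. apply is_derive_Reals, derivable_pt_lim_const.
  - set (col := if j then u else v).
    set (g := fun x t => iterint u v i n (negb j) x t * col x t).
    set (gx := fun x t => (iterint_x i n (negb j) x t
      + 2 * p x t * sgn j * iterint u v i n (negb j) x t) * col x t).
    assert (hcol : Ck 0 Om col) by (unfold col; destruct j; assumption).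
    assert (hgx : Ck 0 Om gx).
    { apply Ck_mult; [exact hO| |exact hcol]. apply Ck_plus; [exact hO| |].
      - apply iterint_x_Ck.
      - apply Ck_mult; [exact hO| |apply iterint_Ck].
        apply Ck_mult; [exact hO| |apply Ck_const, hO].
        apply Ck_mult; [exact hO|apply Ck_const, hO|exact hp]. }
    assert (E : iterint_x i (S n) j x y = - g x x + from_diag gx x y).
    { rewrite (from_diag_of_derive Om hS (iterint_x i (S n) j) gx); auto.
      - f_equal. unfold iterint_x, g, col. cbn [iterint_pred]. rewrite !iterint_diag.
        assert (hx := hid _ _ h).
        destruct j, n, i; simpl; rewrite ?ud, ?vd by exact hx; ring.
      - intros a b hab. exact (iterint_x_derive_y i (S n) j a b hab). }
    rewrite E. apply (is_derive_from_diag_x Om hS g gx); auto.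
    + apply Ck_mult; [exact hO|apply iterint_Ck|exact hcol].
    + intros a b hab. unfold g, gx, col.
      assert (D1 := IH (negb j) a b hab).
      assert (D2 : is_derive (fun t => (if j then u else v) t b) a
        (2 * p a b * sgn j * (if j then u else v) a b)).
      { destruct j; unfold sgn.
        - replace (2 * p a b * 1 * u a b) with (2 * p a b * u a b) by ring. now apply ux.
        - replace (2 * p a b * -1 * v a b) with (- 2 * p a b * v a b) by ring. now apply vx. }
      assert (D := is_derive_mult (fun t => iterint u v i n (negb j) t b) (fun t => (if j then u else v) t b)
        a _ _ D1 D2 (fun x y => Rmult_comm x y)).
      match type of D with is_derive _ _ ?l => match goal with |- is_derive _ _ ?m =>
        replace m with l; [exact D|] end end.
      unfold plus, mult; simpl. ring.
Qed.

Lemma iterint_x_bound (x y : R) : Om (x, y) -> exists d : posreal, exists A : R,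
  forall t, Rabs (t - x) < d -> Om (t, y) /\
    forall i n j, Rabs (iterint_x i n j t y) <= A * (9 * eps) ^ n.
Proof.
  intros h.
  assert (hl : forall g, smooth1 I g -> exists d : posreal, forall t, Rabs (t - x) < d ->
    Rabs (g t) <= Rabs (g x) + 1).
  { intros g hg. assert (Cg : continuous g x).
    { apply (@ex_derive_continuous R_AbsRing R_NormedModule). exact (hg 1%nat x (proj1 h)). }
    destruct (proj1 (filterlim_locally _ _) Cg (mkposreal 1 Rlt_0_1)) as [d hd].
    exists d. intros t ht. assert (Q := hd t ht). change (Rabs (g t - g x) < 1) in Q.
    assert (T := Rabs_triang_inv (g t) (g x)). lra. }
  destruct (hl k sk) as [d1 h1]. destruct (hl r sr) as [d2 h2]. destruct (hl s ss) as [d3 h3].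
  destruct (hl u0 su) as [d4 h4]. destruct (hl v0 sv) as [d5 h5].
  destruct (proj1 (Ck_continuity_2d Om p) hp x y h (mkposreal 1 Rlt_0_1)) as [d6 h6].
  destruct (open_square Om hO x y h) as [d7 h7].
  set (d := Rmin (Rmin (Rmin d1 d2) (Rmin d3 d4)) (Rmin d5 (Rmin d6 d7))).
  assert (hd : 0 < d) by (unfold d; repeat apply Rmin_glb_lt; apply cond_pos).
  exists (mkposreal d hd).
  set (B := 1 + (Rabs (k x) + Rabs (r x) + Rabs (s x) + Rabs (u0 x) + Rabs (v0 x) + Rabs (p x y))).
  assert (hB : Rabs (k x) + 1 <= B /\ Rabs (r x) + 1 <= B /\ Rabs (s x) + 1 <= B /\
    Rabs (u0 x) + 1 <= B /\ Rabs (v0 x) + 1 <= B /\ Rabs (p x y) + 1 <= B /\ 1 <= B).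
  { unfold B. generalize (Rabs_pos (k x)) (Rabs_pos (r x)) (Rabs_pos (s x)) (Rabs_pos (u0 x))
      (Rabs_pos (v0 x)) (Rabs_pos (p x y)). lra. }
  (* The first term of [iterint_x] costs [2 * B], the next two [B] each; the last one has index
     [n - 1], which costs an extra factor [/ (9 * eps)]. *)
  exists (4 * B + B / (9 * eps)). simpl. intros t ht.
  assert (T : Rabs (t - x) < d1 /\ Rabs (t - x) < d2 /\ Rabs (t - x) < d3 /\ Rabs (t - x) < d4 /\
    Rabs (t - x) < d5 /\ Rabs (t - x) < d6 /\ Rabs (t - x) < d7).
  { unfold d in ht. repeat split; eapply Rlt_le_trans; try exact ht;
    repeat first [apply Rle_refl | eapply Rle_trans; [apply Rmin_l|apply Rle_refl]
     | eapply Rle_trans; [apply Rmin_r|apply Rle_refl]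
     | eapply Rle_trans; [apply Rmin_l|eapply Rle_trans; [apply Rmin_l|apply Rmin_l]]
     | eapply Rle_trans; [apply Rmin_l|eapply Rle_trans; [apply Rmin_l|apply Rmin_r]]
     | eapply Rle_trans; [apply Rmin_l|eapply Rle_trans; [apply Rmin_r|apply Rmin_l]]
     | eapply Rle_trans; [apply Rmin_l|eapply Rle_trans; [apply Rmin_r|apply Rmin_r]]
     | eapply Rle_trans; [apply Rmin_r|apply Rmin_l]
     | eapply Rle_trans; [apply Rmin_r|eapply Rle_trans; [apply Rmin_r|apply Rmin_l]]
     | eapply Rle_trans; [apply Rmin_r|eapply Rle_trans; [apply Rmin_r|apply Rmin_r]] ]. }
  destruct T as (t1 & t2 & t3 & t4 & t5 & t6 & t7).
  assert (hyy : Rabs (y - y) < d6 /\ Rabs (y - y) < d7)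
    by (rewrite Rminus_diag, Rabs_R0; split; apply cond_pos).
  assert (ht' : Om (t, y)) by (apply h7; [exact t7 | apply hyy]).
  split; [exact ht'|].
  assert (bp : Rabs (p t y) <= B).
  { assert (Q := h6 t y t6 (proj1 hyy)). simpl in Q.
    assert (T := Rabs_triang_inv (p t y) (p x y)). lra. }
  assert (b1 := h1 t t1). assert (b2 := h2 t t2). assert (b3 := h3 t t3).
  assert (b4 := h4 t t4). assert (b5 := h5 t t5).
  intros i n j. unfold iterint_x.
  set (q := 9 * eps). assert (hq : 0 < q < 1) by (unfold q; lra).
  assert (i1 := iterint_bound i n j t y ht').
  assert (i2 := iterint_bound i (S n) (negb j) t y ht').
  assert (i3 := iterint_bound (negb i) (S n) j t y ht').
  assert (i4 : Rabs (iterint_pred u v (negb i) n j t y) <= q ^ n / q).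
  { destruct n as [|n].
    - simpl. rewrite Rabs_R0. apply Rdiv_le_0_compat; lra.
    - simpl iterint_pred. replace (q ^ S n / q) with (q ^ n) by (simpl; field; lra).
      now apply iterint_bound. }
  fold q in i1, i2, i3.
  assert (qn : 0 < q ^ n) by (apply pow_lt; lra).
  assert (e1 : Rabs ((p t y * sgn j - k t * sgn i) * iterint u v i n j t y) <= 2 * B * q ^ n).
  { rewrite Rabs_mult. apply Rmult_le_compat; try apply Rabs_pos; [|exact i1].
    unfold Rminus. eapply Rle_trans; [apply Rabs_triang|]. rewrite Rabs_Ropp, !Rabs_mult.
    assert (sg : forall i, Rabs (sgn i) = 1).
    { intros []; unfold sgn; [apply Rabs_R1 | rewrite Rabs_left; lra]. }
    rewrite !sg. lra. }
  assert (e2 : Rabs ((if j then r else s) t * iterint u v i (S n) (negb j) t y) <= B * q ^ n).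
  { rewrite Rabs_mult. apply Rmult_le_compat; try apply Rabs_pos; [destruct j; lra|].
    eapply Rle_trans; [exact i2|]. simpl. nra. }
  assert (e3 : Rabs ((if i then s else r) t * iterint u v (negb i) (S n) j t y) <= B * q ^ n).
  { rewrite Rabs_mult. apply Rmult_le_compat; try apply Rabs_pos; [destruct i; lra|].
    eapply Rle_trans; [exact i3|]. simpl. nra. }
  assert (e4 : Rabs ((if i then v0 else u0) t * iterint_pred u v (negb i) n j t y) <= B * (q ^ n / q)).
  { rewrite Rabs_mult. apply Rmult_le_compat; try apply Rabs_pos; [destruct i; lra|exact i4]. }
  replace ((4 * B + B / q) * q ^ n) with (2 * B * q ^ n + B * q ^ n + B * q ^ n + B * (q ^ n / q))
    by (field; lra).
  apply Rabs_le_between in e1. apply Rabs_le_between in e2. apply Rabs_le_between in e3.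
  apply Rabs_le_between in e4. apply Rabs_le. lra.
Qed.

End Iterated_integrals.

(** * Complex differentiability and power series *)

Lemma RtoC_m1 : RtoC (-1) = (- (1))%C.
Proof. unfold RtoC, Copp; simpl. f_equal; ring. Qed.

(** An explicit form that is neutral between the two normed module structures on [C];
    [cdiff_is_derive] and [cdiff_is_derive_C] link it to each. *)
Definition cdiff (f : C -> C) (z l : C) : Prop :=
  forall eps, 0 < eps -> exists d, 0 < d /\ forall w, Cmod (w - z)%C < d ->
    Cmod (f w - f z - (w - z) * l)%C <= eps * Cmod (w - z)%C.

Lemma cdiff_is_derive (f : C -> C) (z l : C) :
  cdiff f z l <-> @is_derive C_AbsRing (AbsRing_NormedModule C_AbsRing) f z l.
Proof.
  split.
  - intros H. split; [apply is_linear_scal_l|].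
    intros x hx. assert (x = z) as ->.
    { symmetry. apply (is_filter_lim_locally_unique (V := AbsRing_NormedModule C_AbsRing)). exact hx. }
    intros eps. destruct (H eps (cond_pos eps)) as (d & hd & hw). exists (mkposreal d hd). exact hw.
  - intros [_ H] eps he. destruct (H z (fun P h => h) (mkposreal eps he)) as [d hd].
    exists d. split; [apply cond_pos|]. intros w hw. apply hd. exact hw.
Qed.

Lemma cdiff_is_derive_C (f : C -> C) (z l : C) :
  cdiff f z l <-> @is_derive C_AbsRing C_NormedModule f z l.
Proof.
  rewrite cdiff_is_derive. unfold is_derive, filterdiff.
  split; intros [[h1 h2 h3] h]; split; try exact h; split; auto.
Qed.

Lemma cdiff_const (c z : C) : cdiff (fun _ => c) z 0.
Proof. apply cdiff_is_derive. apply (@is_derive_const C_AbsRing (AbsRing_NormedModule C_AbsRing)). Qed.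

Lemma cdiff_id (z : C) : cdiff (fun w => w) z 1.
Proof. apply cdiff_is_derive. apply (is_derive_id (K := C_AbsRing)). Qed.

Lemma cdiff_plus (f g : C -> C) (z a b : C) :
  cdiff f z a -> cdiff g z b -> cdiff (fun w => f w + g w)%C z (a + b).
Proof.
  rewrite !cdiff_is_derive. apply (@is_derive_plus C_AbsRing (AbsRing_NormedModule C_AbsRing)).
Qed.

Lemma cdiff_mult (f g : C -> C) (z a b : C) :
  cdiff f z a -> cdiff g z b -> cdiff (fun w => f w * g w)%C z (a * g z + f z * b).
Proof.
  rewrite !cdiff_is_derive. intros Hf Hg.
  apply (@is_derive_mult C_AbsRing f g z a b Hf Hg). intros; apply Cmult_comm.
Qed.

Lemma cdiff_comp (f g : C -> C) (z a b : C) :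
  cdiff f (g z) a -> cdiff g z b -> cdiff (fun w => f (g w)) z (b * a).
Proof.
  rewrite !cdiff_is_derive.
  apply (@is_derive_comp C_AbsRing (AbsRing_NormedModule C_AbsRing)).
Qed.

Lemma cdiff_inv (z : C) : z <> 0 -> cdiff Cinv z (- (/ z * / z)).
Proof.
  intros hz eps he. assert (m0 : 0 < Cmod z) by now apply Cmod_gt_0.
  set (m := Cmod z) in *.
  exists (Rmin (m / 2) (eps * (m * m * m) / 2)). split.
  { apply Rmin_glb_lt; [lra|]. apply Rdiv_lt_0_compat; [|lra].
    repeat apply Rmult_lt_0_compat; assumption. }
  intros w hw. assert (h1 := Rmin_l (m / 2) (eps * (m * m * m) / 2)).
  assert (h2 := Rmin_r (m / 2) (eps * (m * m * m) / 2)).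
  assert (hwm : m / 2 <= Cmod w).
  { assert (T := Cmod_triangle w (z - w)). replace (w + (z - w))%C with z in T by ring.
    fold m in T. replace (z - w)%C with (- (w - z))%C in T by ring. rewrite Cmod_opp in T. lra. }
  assert (hw0 : w <> 0) by (apply Cmod_gt_0; lra).
  replace (/ w - / z - (w - z) * - (/ z * / z))%C with
    ((w - z) * ((w - z) * (/ w * / z * / z)))%C by (field; split; assumption).
  rewrite Cmod_mult, (Rmult_comm (Cmod (w - z))).
  apply Rmult_le_compat_r; [apply Cmod_ge_0|].
  rewrite !Cmod_mult, !Cmod_inv by assumption. fold m.
  apply Rle_trans with ((eps * (m * m * m) / 2) * (/ (m / 2) * / m * / m)).
  - apply Rmult_le_compat; try lra; [apply Cmod_ge_0| |].
    + repeat apply Rmult_le_pos; left; apply Rinv_0_lt_compat; lra.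
    + apply Rmult_le_compat_r; [left; apply Rinv_0_lt_compat; lra|].
      apply Rmult_le_compat_r; [left; apply Rinv_0_lt_compat; lra|].
      apply Rinv_le_contravar; lra.
  - right. field. lra.
Qed.

Lemma cdiff_conj (f : C -> C) (z l : C) :
  cdiff f (Cconj z) l -> cdiff (fun w => Cconj (f (Cconj w))) z (Cconj l).
Proof.
  intros H eps he. destruct (H eps he) as (d & hd & hw). exists d. split; [exact hd|].
  intros w h. specialize (hw (Cconj w)).
  assert (E : Cmod (Cconj w - Cconj z) = Cmod (w - z)) by now rewrite <- Cminus_conj, Cmod_conj.
  rewrite E in hw. specialize (hw h).
  rewrite <- Cmod_conj. rewrite !Cminus_conj, Cmult_conj, !Cconj_conj, !Cminus_conj. exact hw.
Qed.

Lemma cdiff_continuous (f : C -> C) (z l : C) : cdiff f z l ->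
  forall eps, 0 < eps -> exists d, 0 < d /\ forall w, Cmod (w - z)%C < d ->
    Cmod (f w - f z)%C < eps.
Proof.
  intros H eps he. destruct (H 1 Rlt_0_1) as (d & hd & hw).
  assert (h0 : 0 < 1 + Cmod l) by (generalize (Cmod_ge_0 l); lra).
  assert (h1 : 0 < eps / (1 + Cmod l)) by (apply Rdiv_lt_0_compat; lra).
  exists (Rmin d (eps / (1 + Cmod l))). split; [now apply Rmin_glb_lt|].
  intros w h. assert (A := Rmin_l d (eps / (1 + Cmod l))). assert (B := Rmin_r d (eps / (1 + Cmod l))).
  specialize (hw w ltac:(lra)).
  replace (f w - f z)%C with ((f w - f z - (w - z) * l) + (w - z) * l)%C by ring.
  eapply Rle_lt_trans; [apply Cmod_triangle|]. rewrite Cmod_mult.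
  apply Rle_lt_trans with (Cmod (w - z) * (1 + Cmod l)); [lra|].
  apply Rlt_le_trans with (eps / (1 + Cmod l) * (1 + Cmod l)).
  - apply Rmult_lt_compat_r; lra.
  - right. field. lra.
Qed.

Definition disc_continuous (f : C -> C) (z : C) : Prop :=
  forall eps, 0 < eps -> exists d, 0 < d /\ forall w, Cmod w <= 1 -> Cmod (w - z)%C < d ->
    Cmod (f w - f z)%C < eps.

Lemma disc_continuous_filterlim (f : C -> C) (z : C) :
  disc_continuous f z <->
  filterlim f (within (fun w => Cmod w <= 1) (@locally (AbsRing_UniformSpace C_AbsRing) z))
    (@locally (AbsRing_UniformSpace C_AbsRing) (f z)).
Proof.
  split.
  - intros H P [e he]. destruct (H e (cond_pos e)) as (d & hd & hw).
    exists (mkposreal d hd). intros w hb h. apply he. exact (hw w h hb).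
  - intros H eps he. destruct (H (fun y => Cmod (y - f z)%C < eps)) as [d hd].
    + exists (mkposreal eps he). auto.
    + exists d. split; [apply cond_pos|]. intros w h hb. exact (hd w hb h).
Qed.

Lemma disc_continuous_filterlim_C (f : C -> C) (z : C) :
  disc_continuous f z <->
  filterlim f (within (fun w => Cmod w <= 1) (@locally C_UniformSpace z))
    (@locally C_UniformSpace (f z)).
Proof.
  rewrite disc_continuous_filterlim. split; intros H P HP.
  - apply locally_C in HP. apply locally_C. exact (H P HP).
  - apply locally_C in HP. apply locally_C. exact (H P HP).
Qed.

Lemma disc_continuous_plus (f g : C -> C) (z : C) :
  disc_continuous f z -> disc_continuous g z -> disc_continuous (fun w => f w + g w)%C z.
Proof.
  rewrite !disc_continuous_filterlim. intros Hf Hg.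
  exact (filterlim_comp_2 _ _ _ Hf Hg
    (filterlim_plus (V := AbsRing_NormedModule C_AbsRing) (f z) (g z))).
Qed.

Lemma disc_continuous_mult (f g : C -> C) (z : C) :
  disc_continuous f z -> disc_continuous g z -> disc_continuous (fun w => f w * g w)%C z.
Proof.
  rewrite !disc_continuous_filterlim. intros Hf Hg.
  exact (filterlim_comp_2 _ _ _ Hf Hg (filterlim_mult (K := C_AbsRing) (f z) (g z))).
Qed.

Lemma disc_continuous_comp (f g : C -> C) (z : C) :
  (forall w, Cmod w <= 1 -> Cmod (g w) <= 1) ->
  disc_continuous f (g z) -> disc_continuous g z -> disc_continuous (fun w => f (g w)) z.
Proof.
  intros hb Hf Hg eps he. destruct (Hf eps he) as (d & hd & hw).
  destruct (Hg d hd) as (d' & hd' & hw'). exists d'. split; [exact hd'|].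
  intros w h h'. apply hw; auto.
Qed.

Definition disc_holomorphic (f : C -> C) : Prop :=
  (forall z, Cmod z < 1 -> exists l, cdiff f z l) /\
  (forall z, Cmod z <= 1 -> disc_continuous f z).

Lemma holomorphic_in_disc_entry (h : C -> MC) (i j : nat) :
  holomorphic_in_disc h -> disc_holomorphic (fun w => entry (h w) i j).
Proof.
  intros H. destruct (H i j) as [H1 H2]. split.
  - intros z hz. destruct (H1 z hz) as [l hl]. exists l. now apply cdiff_is_derive_C.
  - intros z hz. apply disc_continuous_filterlim_C. now apply H2.
Qed.

Lemma holomorphic_in_disc_of_entries (h : C -> MC) :
  (forall i j, disc_holomorphic (fun w => entry (h w) i j)) -> holomorphic_in_disc h.
Proof.
  intros H i j. destruct (H i j) as [H1 H2]. split.
  - intros z hz. destruct (H1 z hz) as [l hl]. exists l. now apply cdiff_is_derive_C.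
  - intros z hz. apply disc_continuous_filterlim_C. now apply H2.
Qed.

Lemma disc_holomorphic_ext (f g : C -> C) :
  (forall z, f z = g z) -> disc_holomorphic f -> disc_holomorphic g.
Proof.
  intros E [H1 H2]. split.
  - intros z hz. destruct (H1 z hz) as [l hl]. exists l.
    intros eps he. destruct (hl eps he) as (d & hd & hw). exists d. split; auto.
    intros w hw'. rewrite <- !E. auto.
  - intros z hz eps he. destruct (H2 z hz eps he) as (d & hd & hw). exists d. split; auto.
    intros w h1 h2. rewrite <- !E. auto.
Qed.

Lemma disc_holomorphic_of_cdiff (f : C -> C) :
  (forall z, Cmod z <= 1 -> exists l, cdiff f z l) -> disc_holomorphic f.
Proof.
  intros H. split.
  - intros z hz. apply H. lra.
  - intros z hz eps he. destruct (H z hz) as [l hl].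
    destruct (cdiff_continuous f z l hl eps he) as (d & hd & hw).
    exists d. split; auto.
Qed.

Lemma disc_holomorphic_const (c : C) : disc_holomorphic (fun _ => c).
Proof.
  apply disc_holomorphic_of_cdiff. intros z _. eexists. apply cdiff_const.
Qed.

Lemma disc_holomorphic_plus (f g : C -> C) :
  disc_holomorphic f -> disc_holomorphic g -> disc_holomorphic (fun w => f w + g w)%C.
Proof.
  intros [F1 F2] [G1 G2]. split.
  - intros z hz. destruct (F1 z hz) as [a ha]. destruct (G1 z hz) as [b hb].
    eexists. now apply cdiff_plus; eassumption.
  - intros z hz. apply disc_continuous_plus; auto.
Qed.

Lemma disc_holomorphic_mult (f g : C -> C) :
  disc_holomorphic f -> disc_holomorphic g -> disc_holomorphic (fun w => f w * g w)%C.
Proof.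
  intros [F1 F2] [G1 G2]. split.
  - intros z hz. destruct (F1 z hz) as [a ha]. destruct (G1 z hz) as [b hb].
    eexists. now apply cdiff_mult; eassumption.
  - intros z hz. apply disc_continuous_mult; auto.
Qed.

Lemma disc_holomorphic_opp (f : C -> C) :
  disc_holomorphic f -> disc_holomorphic (fun w => - f w)%C.
Proof.
  intros H. apply disc_holomorphic_ext with (fun w => (RtoC (-1)) * f w)%C.
  - intros z. destruct (f z). unfold Cmult, Copp; simpl. f_equal; ring.
  - apply disc_holomorphic_mult; [apply disc_holomorphic_const | exact H].
Qed.

(** Schwarz reflection: conjugating both the argument and the value preserves complex
    differentiability. *)
Lemma disc_holomorphic_conj (f : C -> C) :
  disc_holomorphic f -> disc_holomorphic (fun w => Cconj (f (Cconj w))).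
Proof.
  intros [F1 F2]. split.
  - intros z hz. destruct (F1 (Cconj z)) as [a ha]; [now rewrite Cmod_conj|].
    eexists. now apply cdiff_conj; eassumption.
  - intros z hz eps he. destruct (F2 (Cconj z)) with (eps := eps) as (d & hd & hw); auto.
    { now rewrite Cmod_conj. }
    exists d. split; auto. intros w h1 h2.
    rewrite <- Cminus_conj, Cmod_conj. apply hw; [now rewrite Cmod_conj|].
    now rewrite <- Cminus_conj, Cmod_conj.
Qed.

Lemma disc_holomorphic_comp (f g : C -> C) :
  (forall w, Cmod w <= 1 -> Cmod (g w) <= 1) -> (forall w, Cmod w < 1 -> Cmod (g w) < 1) ->
  disc_holomorphic f -> disc_holomorphic g -> disc_holomorphic (fun w => f (g w)).
Proof.
  intros h1 h2 [F1 F2] [G1 G2]. split.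
  - intros z hz. destruct (F1 (g z)) as [a ha]; auto. destruct (G1 z hz) as [b hb].
    eexists. now apply cdiff_comp; eassumption.
  - intros z hz. apply disc_continuous_comp; auto.
Qed.

(** * Complex series with geometric bounds, and power series with real coefficients *)

Definition Csum (e : nat -> C) : C :=
  (Series (fun n => fst (e n)), Series (fun n => snd (e n))).

Definition geom_bounded (e : nat -> C) (A q : R) : Prop :=
  0 <= q < 1 /\ forall n, Cmod (e n) <= A * q ^ n.

Lemma geom_bounded_fst (e : nat -> C) (A q : R) : geom_bounded e A q ->
  forall n, Rabs (fst (e n)) <= A * q ^ n.
Proof.
  intros [_ h] n. eapply Rle_trans; [|apply h].
  eapply Rle_trans; [|apply Rmax_Cmod]. apply Rmax_l.
Qed.

Lemma geom_bounded_snd (e : nat -> C) (A q : R) : geom_bounded e A q ->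
  forall n, Rabs (snd (e n)) <= A * q ^ n.
Proof.
  intros [_ h] n. eapply Rle_trans; [|apply h].
  eapply Rle_trans; [|apply Rmax_Cmod]. apply Rmax_r.
Qed.

Lemma Csum_ext (e f : nat -> C) : (forall n, e n = f n) -> Csum e = Csum f.
Proof.
  intros E. unfold Csum. f_equal; apply Series_ext; intros n; now rewrite E.
Qed.

Lemma Csum_plus (e f : nat -> C) (A B q : R) :
  geom_bounded e A q -> geom_bounded f B q -> Csum (fun n => e n + f n)%C = (Csum e + Csum f)%C.
Proof.
  intros He Hf. unfold Csum, Cplus. simpl. f_equal; apply Series_plus;
    (eapply ex_series_geom_bound; [apply He|]);
    try (eapply geom_bounded_fst; eassumption); try (eapply geom_bounded_snd; eassumption).
Qed.

Lemma Csum_scal (c : C) (e : nat -> C) (A q : R) :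
  geom_bounded e A q -> Csum (fun n => c * e n)%C = (c * Csum e)%C.
Proof.
  intros He. unfold Csum, Cmult. simpl.
  assert (h1 : ex_series (fun n => fst (e n))).
  { eapply ex_series_geom_bound; [apply He|]. eapply geom_bounded_fst; eassumption. }
  assert (h2 : ex_series (fun n => snd (e n))).
  { eapply ex_series_geom_bound; [apply He|]. eapply geom_bounded_snd; eassumption. }
  assert (L : forall a u, ex_series u -> ex_series (fun n => a * u n)).
  { intros a u hu. now apply (ex_series_scal (V := R_NormedModule) a u). }
  f_equal.
  - rewrite Series_minus by now apply L. now rewrite !Series_scal_l.
  - rewrite Series_plus by now apply L. now rewrite !Series_scal_l.
Qed.

Lemma Csum_incr (e : nat -> C) (A q : R) :
  geom_bounded e A q -> Csum e = (e 0%nat + Csum (fun n => e (S n)))%C.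
Proof.
  intros He. unfold Csum, Cplus. simpl. f_equal; apply Series_incr_1;
    (eapply ex_series_geom_bound; [apply He|]);
    try (eapply geom_bounded_fst; eassumption); try (eapply geom_bounded_snd; eassumption).
Qed.

Lemma Csum_bound (e : nat -> C) (A q : R) :
  geom_bounded e A q -> Cmod (Csum e) <= 2 * (A / (1 - q)).
Proof.
  intros He. eapply Rle_trans; [apply Cmod_2Rmax|].
  assert (h1 := Series_geom_bound _ A q (proj1 He) (geom_bounded_fst e A q He)).
  assert (h2 := Series_geom_bound _ A q (proj1 He) (geom_bounded_snd e A q He)).
  apply Rmult_le_compat.
  - apply sqrt_pos.
  - eapply Rle_trans; [apply Rabs_pos|apply Rmax_l].
  - replace 2 with (sqrt (2 * 2)) at 2 by (rewrite sqrt_square; lra).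
    apply sqrt_le_1_alt. lra.
  - apply Rmax_lub; assumption.
Qed.

Lemma Csum_conj (e : nat -> C) : Csum (fun n => Cconj (e n)) = Cconj (Csum e).
Proof.
  unfold Csum, Cconj. simpl. f_equal. apply Series_opp.
Qed.

Definition dpow (w : C) (n : nat) : C :=
  match n with O => 0 | S n' => (RtoC (INR n) * w ^ n')%C end.

(** Radius 2 leaves room around the closed unit disc. The remainder satisfies
    [R_(n+1) = w R_n + dpow z n (w - z)^2], and [2 * 8 ^ n + 4 ^ n <= 8 ^ (n + 1)]. *)
Lemma pow_taylor_bound (z w : C) (n : nat) : Cmod z <= 2 -> Cmod w <= 2 ->
  Cmod (w ^ n - z ^ n - (w - z) * dpow z n)%C <= 8 ^ n * (Cmod (w - z) * Cmod (w - z)).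
Proof.
  intros hz hw. set (d := (w - z)%C).
  assert (d0 : 0 <= Cmod d * Cmod d) by (apply Rmult_le_pos; apply Cmod_ge_0).
  assert (hn : forall n, INR n * 2 ^ n <= 4 ^ n).
  { clear. intros n. replace 4 with (2 * 2) by ring. rewrite Rpow_mult_distr.
    apply Rmult_le_compat_r; [apply pow_le; lra|].
    induction n as [|n IH]; [simpl; lra|]. rewrite S_INR.
    assert (1 <= 2 ^ n) by (apply pow_R1_Rle; lra). simpl. lra. }
  induction n as [|n IH].
  - replace (w ^ 0 - z ^ 0 - d * dpow z 0)%C with (RtoC 0) by (simpl; ring).
    rewrite Cmod_0. simpl. lra.
  - assert (E : (w ^ S n - z ^ S n - d * dpow z (S n))%C =
      (w * (w ^ n - z ^ n - d * dpow z n) + dpow z n * (d * d))%C).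
    { unfold dpow. destruct n as [|n].
      - unfold d. simpl. ring.
      - rewrite (S_INR (S n)), RtoC_plus, !Cpow_S. unfold d. ring. }
    rewrite E. eapply Rle_trans; [apply Cmod_triangle|]. rewrite !Cmod_mult.
    assert (hd : Cmod (dpow z n) <= 4 ^ n).
    { destruct n as [|n]; [unfold dpow; rewrite Cmod_0; simpl; lra|].
      unfold dpow. rewrite Cmod_mult, Cmod_R, Cmod_pow, Rabs_pos_eq by apply pos_INR.
      eapply Rle_trans; [|apply hn]. apply Rmult_le_compat_l; [apply pos_INR|].
      apply Rle_trans with (2 ^ n); [apply pow_incr; split; [apply Cmod_ge_0|exact hz]|].
      assert (0 < 2 ^ n) by (apply pow_lt; lra). simpl. lra. }
    assert (h48 : 4 ^ n <= 8 ^ n) by (apply pow_incr; lra).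
    assert (p8 : 0 < 8 ^ n) by (apply pow_lt; lra).
    assert (h1 : Cmod w * Cmod (w ^ n - z ^ n - d * dpow z n) <= 2 * (8 ^ n * (Cmod d * Cmod d))).
    { apply Rmult_le_compat; try apply Cmod_ge_0; assumption. }
    assert (h2 : Cmod (dpow z n) * (Cmod d * Cmod d) <= 8 ^ n * (Cmod d * Cmod d)).
    { apply Rmult_le_compat_r; lra. }
    simpl pow. nra.
Qed.

Lemma dpow_bound (z : C) (n : nat) : Cmod z <= 2 -> Cmod (dpow z n) <= 8 ^ n.
Proof.
  intros hz. destruct n as [|n]; [unfold dpow; rewrite Cmod_0; simpl; lra|].
  unfold dpow. rewrite Cmod_mult, Cmod_R, Cmod_pow, Rabs_pos_eq by apply pos_INR.
  assert (h1 : Cmod z ^ n <= 2 ^ n) by (apply pow_incr; split; [apply Cmod_ge_0|exact hz]).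
  assert (h2 : INR (S n) <= 8 * 4 ^ n).
  { induction n as [|n IH]; [simpl; lra|]. rewrite S_INR. simpl pow.
    assert (1 <= 4 ^ n) by (apply pow_R1_Rle; lra). specialize (IH).
    assert (Cmod z ^ n <= 2 ^ n) by (apply pow_incr; split; [apply Cmod_ge_0|exact hz]).
    specialize (IH H0). lra. }
  replace (8 ^ S n) with ((8 * 4 ^ n) * 2 ^ n).
  2:{ replace (8 ^ S n) with (8 * (4 * 2) ^ n) by (simpl; f_equal; f_equal; lra).
      rewrite Rpow_mult_distr. ring. }
  apply Rmult_le_compat; auto; [apply pos_INR | apply pow_le, Cmod_ge_0].
Qed.

Definition power_series (a : nat -> R) (z : C) : C := Csum (fun n => RtoC (a n) * z ^ n)%C.

Lemma power_series_bounded (a : nat -> R) (A q rho : R) (z : C) : 0 <= q ->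
  (forall n, Rabs (a n) <= A * q ^ n) -> Cmod z <= rho -> q * rho < 1 ->
  geom_bounded (fun n => RtoC (a n) * z ^ n)%C A (q * rho).
Proof.
  intros hq ha hz hr. assert (hz0 := Cmod_ge_0 z). split.
  - split; [apply Rmult_le_pos; lra | exact hr].
  - intros n. rewrite Cmod_mult, Cmod_R, Cmod_pow, Rpow_mult_distr, <- Rmult_assoc.
    apply Rmult_le_compat; auto; [apply Rabs_pos | apply pow_le; lra|].
    apply pow_incr. lra.
Qed.

(** The ratio 1/16 against the Taylor bound [8 ^ n] leaves a series of ratio 1/2. Boundary points
    are included, so continuity on the closed disc comes along. *)
Lemma power_series_cdiff (a : nat -> R) (A : R) (z : C) :
  (forall n, Rabs (a n) <= A * (/ 16) ^ n) -> Cmod z <= 1 ->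
  cdiff (power_series a) z (Csum (fun n => RtoC (a n) * dpow z n)%C).
Proof.
  intros ha hz.
  assert (hA : 0 <= A). { generalize (ha 0%nat) (Rabs_pos (a 0%nat)). simpl. lra. }
  assert (p16 : forall n, (/ 16) ^ n * 8 ^ n = (/ 2) ^ n).
  { intros n. rewrite <- Rpow_mult_distr. f_equal. lra. }
  assert (b1 : forall w, Cmod w <= 2 -> geom_bounded (fun n => RtoC (a n) * w ^ n)%C A (/ 2)).
  { intros w hw. destruct (power_series_bounded a A (/ 16) 2 w) as [_ B]; auto; try lra.
    split; [lra|]. intros n. eapply Rle_trans; [apply B|]. apply Rmult_le_compat_l; auto.
    apply pow_incr. lra. }
  assert (b2 : geom_bounded (fun n => RtoC (a n) * dpow z n)%C A (/ 2)).
  { split; [lra|]. intros n. rewrite Cmod_mult, Cmod_R, <- p16, <- Rmult_assoc.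
    apply Rmult_le_compat; auto; [apply Rabs_pos | apply Cmod_ge_0 | apply dpow_bound; lra]. }
  intros eps he.
  assert (hA1 : 0 < 4 * A + 1) by lra.
  assert (hd : 0 < eps / (4 * A + 1)) by (apply Rdiv_lt_0_compat; lra).
  exists (Rmin 1 (eps / (4 * A + 1))). split; [apply Rmin_glb_lt; lra|].
  intros w hw.
  assert (m1 := Rmin_l 1 (eps / (4 * A + 1))). assert (m2 := Rmin_r 1 (eps / (4 * A + 1))).
  assert (hw2 : Cmod w <= 2).
  { replace w with (z + (w - z))%C by ring. eapply Rle_trans; [apply Cmod_triangle|]. lra. }
  assert (b3 : geom_bounded (fun n => RtoC (a n) * (w ^ n - z ^ n - (w - z) * dpow z n))%C
    (A * (Cmod (w - z) * Cmod (w - z))) (/ 2)).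
  { split; [lra|]. intros n. rewrite Cmod_mult, Cmod_R.
    replace (A * (Cmod (w - z) * Cmod (w - z)) * (/ 2) ^ n) with
      (A * (/ 16) ^ n * (8 ^ n * (Cmod (w - z) * Cmod (w - z)))) by (rewrite <- p16; ring).
    apply Rmult_le_compat; auto; [apply Rabs_pos | apply Cmod_ge_0 |].
    apply pow_taylor_bound; lra. }
  assert (E : (power_series a w - power_series a z
      - (w - z) * Csum (fun n => RtoC (a n) * dpow z n))%C =
    Csum (fun n => RtoC (a n) * (w ^ n - z ^ n - (w - z) * dpow z n))%C).
  { unfold power_series.
    assert (c1 : geom_bounded (fun n => (RtoC (-1)) * (RtoC (a n) * z ^ n))%C A (/ 2)).
    { split; [lra|]. intros n. rewrite Cmod_mult, Cmod_R, (Rabs_left (-1)) by lra.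
      replace (- -1) with 1 by ring. rewrite Rmult_1_l. apply b1. lra. }
    assert (c2 : geom_bounded (fun n => (- (w - z)) * (RtoC (a n) * dpow z n))%C A (/ 2)).
    { split; [lra|]. intros n. rewrite Cmod_mult, Cmod_opp.
      apply Rle_trans with (1 * (A * (/ 2) ^ n)); [|lra].
      apply Rmult_le_compat; try apply Cmod_ge_0; [lra | apply b2]. }
    rewrite (Csum_ext (fun n => RtoC (a n) * (w ^ n - z ^ n - (w - z) * dpow z n))%C
      (fun n => (RtoC (a n) * w ^ n + (RtoC (-1)) * (RtoC (a n) * z ^ n))
      + (- (w - z)) * (RtoC (a n) * dpow z n))%C).
    2:{ intros n. rewrite RtoC_m1. ring. }
    rewrite (Csum_plus _ _ (A + A) A (/ 2)); [|split; [lra|]|exact c2].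
    2:{ intros n. eapply Rle_trans; [apply Cmod_triangle|]. rewrite Rmult_plus_distr_r.
        apply Rplus_le_compat; [apply (b1 w hw2) | apply c1]. }
    rewrite (Csum_plus _ _ A A (/ 2)); [|exact (b1 w hw2)|exact c1].
    rewrite (Csum_scal _ _ A (/ 2)) by (apply b1; lra).
    rewrite (Csum_scal _ _ A (/ 2)) by exact b2. rewrite RtoC_m1. ring. }
  rewrite E. eapply Rle_trans; [apply (Csum_bound _ _ _ b3)|].
  replace (2 * (A * (Cmod (w - z) * Cmod (w - z)) / (1 - / 2))) with
    (4 * A * Cmod (w - z) * Cmod (w - z)) by field.
  apply Rmult_le_compat_r; [apply Cmod_ge_0|].
  apply Rle_trans with ((4 * A + 1) * (eps / (4 * A + 1))).
  - apply Rmult_le_compat; try lra. apply Cmod_ge_0.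
  - right. field. lra.
Qed.

Lemma power_series_holomorphic (a : nat -> R) (A : R) :
  (forall n, Rabs (a n) <= A * (/ 16) ^ n) -> disc_holomorphic (power_series a).
Proof.
  intros ha. apply disc_holomorphic_of_cdiff. intros z hz. eexists.
  now apply power_series_cdiff with A.
Qed.

Lemma Series_single (e : nat -> R) : (forall n, e (S n) = 0) -> Series e = e 0%nat.
Proof.
  intros h. rewrite Series_incr_1.
  - rewrite (Series_ext (fun k => e (S k)) (fun k => 0 * 0)) by (intros n; rewrite h; ring).
    rewrite Series_scal_l. ring.
  - apply (ex_series_geom_bound e (Rabs (e 0%nat)) 0); [lra|].
    intros [|n]; [simpl; lra|]. rewrite h, Rabs_R0. simpl. lra.
Qed.

Lemma power_series_0 (a : nat -> R) : power_series a 0 = RtoC (a 0%nat).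
Proof.
  assert (E : forall n, (RtoC (a (S n)) * RtoC 0 ^ S n)%C = RtoC 0)
    by (intros n; rewrite Cpow_S; ring).
  unfold power_series, Csum. rewrite !Series_single by (intros n; now rewrite E).
  simpl. unfold RtoC. f_equal; ring.
Qed.

Lemma power_series_conj (a : nat -> R) (z : C) :
  power_series a (Cconj z) = Cconj (power_series a z).
Proof.
  unfold power_series. rewrite <- Csum_conj. apply Csum_ext. intros n.
  rewrite Cmult_conj, Cpow_conj. f_equal. unfold Cconj, RtoC; simpl. now rewrite Ropp_0.
Qed.

(** [b] is the value of [Nat.even] at the indices whose coefficients vanish: the series is odd for
    [true] and even for [false]. *)
Lemma power_series_parity (a : nat -> R) (b : bool) (A q rho : R) (z : C) : 0 <= q ->
  (forall n, Rabs (a n) <= A * q ^ n) -> Cmod z <= rho -> q * rho < 1 ->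
  (forall n, Nat.even n = b -> a n = 0) ->
  power_series a (- z)%C = (RtoC (if b then -1 else 1) * power_series a z)%C.
Proof.
  intros hq ha hz hr hb. unfold power_series.
  rewrite <- (Csum_scal _ _ A (q * rho)) by now apply power_series_bounded.
  apply Csum_ext. intros n.
  assert (E : ((- z) ^ n)%C = (RtoC (if Nat.even n then 1 else -1) * z ^ n)%C).
  { induction n as [|n IH]; [simpl; ring|].
    rewrite !Cpow_S, IH, Nat.even_succ, <- Nat.negb_even.
    destruct (Nat.even n); simpl; rewrite ?RtoC_m1; ring. }
  rewrite E. specialize (hb n).
  destruct b, (Nat.even n); try (rewrite hb by reflexivity); rewrite ?RtoC_m1; ring.
Qed.

(** * Smoothness of power series on the unit circle *)

Lemma Cexp_pow (t : R) (n : nat) : ((cos t, sin t) ^ n)%C = (cos (INR n * t), sin (INR n * t)).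
Proof.
  induction n as [|n IH].
  - simpl. rewrite Rmult_0_l, cos_0, sin_0. reflexivity.
  - rewrite Cpow_S, IH, S_INR. replace ((INR n + 1) * t) with (t + INR n * t) by ring.
    rewrite cos_plus, sin_plus. unfold Cmult; simpl. f_equal; ring.
Qed.

(** The quotient [(q'^n - q^n) / (q' - q)] is a sum of [n] terms, each at least [q^(n-1)]. *)
Lemma INR_geom_bound (q q' : R) (n : nat) : 0 <= q < q' -> INR n * q ^ n <= q' / (q' - q) * q' ^ n.
Proof.
  intros h. assert (hq' : 0 < q') by lra.
  assert (K : forall m, INR m * q ^ m * (q' - q) <= q' * (q' ^ m - q ^ m) /\ q ^ m <= q' ^ m).
  { induction m as [|m [IH1 IH2]]; [simpl; lra|].
    assert (p1 : 0 <= q ^ m) by (apply pow_le; lra).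
    assert (p2 : 0 <= q' ^ m) by (apply pow_le; lra).
    rewrite S_INR. simpl pow. split; [|apply Rmult_le_compat; lra].
    assert (q * (INR m * q ^ m * (q' - q)) <= q * (q' * (q' ^ m - q ^ m)))
      by (apply Rmult_le_compat_l; lra).
    assert (0 <= (q' - q) * (q' * q' ^ m - q * q ^ m)).
    { apply Rmult_le_pos; [lra|]. assert (q * q ^ m <= q' * q' ^ m) by (apply Rmult_le_compat; lra).
      lra. }
    nra. }
  destruct (K n) as [S1 _]. assert (p1 : 0 <= q ^ n) by (apply pow_le; lra).
  apply Rmult_le_reg_r with (q' - q); [lra|].
  replace (q' / (q' - q) * q' ^ n * (q' - q)) with (q' * q' ^ n) by (field; lra).
  nra.
Qed.

(** Differentiation multiplies the coefficients by [k] and shifts the phase by [PI / 2], so it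
    preserves the family of such series; the factor [k] is absorbed by passing to the ratio
    [(1 + p) / 2]. *)
Lemma cos_series_smooth (a : nat -> R) (A q ph : R) : 0 <= q < 1 ->
  (forall n, Rabs (a n) <= A * q ^ n) ->
  forall n t, ex_derive_n (fun t => Series (fun k => a k * cos (INR k * t + ph))) n t.
Proof.
  intros hq ha.
  assert (hA : 0 <= A). { generalize (ha 0%nat) (Rabs_pos (a 0%nat)). simpl. lra. }
  assert (K : forall n, exists b B p ph', 0 <= p < 1 /\ (forall k, Rabs (b k) <= B * p ^ k) /\ 0 <= B /\
    forall t, Derive_n (fun t => Series (fun k => a k * cos (INR k * t + ph))) n t =
      Series (fun k => b k * cos (INR k * t + ph'))).
  { assert (D : forall b B p ph' t, 0 <= p < 1 -> (forall k, Rabs (b k) <= B * p ^ k) -> 0 <= B ->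
      is_derive (fun t => Series (fun k => b k * cos (INR k * t + ph'))) t
        (Series (fun k => (INR k * b k) * cos (INR k * t + (ph' + PI / 2))))).
    { intros b B p ph' t hp hb hB. set (p' := (1 + p) / 2).
      set (B' := B + B * (p' / (p' - p))).
      assert (hp' : p < p' < 1) by (unfold p'; lra).
      assert (hB' : 0 <= B * (p' / (p' - p))).
      { apply Rmult_le_pos; auto. apply Rdiv_le_0_compat; lra. }
      apply (is_derive_Series (fun k t => b k * cos (INR k * t + ph'))
        (fun k t => (INR k * b k) * cos (INR k * t + (ph' + PI / 2))) t B' p'); [lra|].
      apply filter_forall. intros x n.
      assert (c1 : forall y, Rabs (cos y) <= 1).
      { intros y. apply Rabs_le. apply COS_bound. }
      assert (pp : 0 <= p ^ n <= p' ^ n) by (split; [apply pow_le; lra | apply pow_incr; lra]).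
      split; [|split].
      - replace (INR n * b n * cos (INR n * x + (ph' + PI / 2))) with
          (b n * (- sin (INR n * x + ph') * INR n)).
        + auto_derive; [trivial|]. ring.
        + replace (INR n * x + (ph' + PI / 2)) with (PI / 2 + (INR n * x + ph')) by ring.
          rewrite cos_plus, cos_PI2, sin_PI2. ring.
      - rewrite Rabs_mult. apply Rle_trans with (B * p ^ n * 1).
        + apply Rmult_le_compat; auto; apply Rabs_pos.
        + unfold B'. nra.
      - rewrite !Rabs_mult, (Rabs_pos_eq (INR n)) by apply pos_INR.
        apply Rle_trans with (INR n * (B * p ^ n) * 1).
        + apply Rmult_le_compat; auto; [|apply Rabs_pos|].
          * apply Rmult_le_pos; [apply pos_INR | apply Rabs_pos].
          * apply Rmult_le_compat_l; [apply pos_INR | apply hb].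
        + assert (Q := INR_geom_bound p p' n ltac:(lra)).
          assert (B * (INR n * p ^ n) <= B * (p' / (p' - p) * p' ^ n))
            by (apply Rmult_le_compat_l; auto).
          assert (0 <= B * p' ^ n) by (apply Rmult_le_pos; lra).
          unfold B'. lra. }
    intros n. induction n as [|n (b & B & p & ph' & hp & hb & hB & E)].
    - exists a, A, q, ph. repeat split; auto; lra.
    - set (p' := (1 + p) / 2). assert (hp' : p < p' < 1) by (unfold p'; lra).
      exists (fun k => INR k * b k), (B * (p' / (p' - p))), p', (ph' + PI / 2).
      assert (hB' : 0 <= B * (p' / (p' - p))).
      { apply Rmult_le_pos; auto. apply Rdiv_le_0_compat; lra. }
      split; [lra|]. split; [|split; [exact hB'|]].
      + intros k. rewrite Rabs_mult, (Rabs_pos_eq (INR k)) by apply pos_INR.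
        apply Rle_trans with (INR k * (B * p ^ k)).
        * apply Rmult_le_compat_l; [apply pos_INR | apply hb].
        * assert (Q := INR_geom_bound p p' k ltac:(lra)).
          assert (B * (INR k * p ^ k) <= B * (p' / (p' - p) * p' ^ k))
            by (apply Rmult_le_compat_l; auto). lra.
      + intros t. simpl. rewrite (Derive_ext _ _ t E). apply is_derive_unique.
        now apply (D b B p ph'). }
  intros n t. destruct n as [|n]; [exact Logic.I|].
  destruct (K n) as (b & B & p & ph' & hp & hb & hB & E). simpl.
  apply (ex_derive_ext (fun t => Series (fun k => b k * cos (INR k * t + ph')))).
  { intros x. now rewrite E. }
  set (p' := (1 + p) / 2). assert (hp' : p < p' < 1) by (unfold p'; lra).
  set (B' := B + B * (p' / (p' - p))).
  assert (hB' : 0 <= B * (p' / (p' - p))).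
  { apply Rmult_le_pos; auto. apply Rdiv_le_0_compat; lra. }
  eexists.
  apply (is_derive_Series (fun k t => b k * cos (INR k * t + ph'))
        (fun k t => b k * (- sin (INR k * t + ph') * INR k)) t B' p'); [lra|].
  apply filter_forall. intros x k.
  assert (pp : 0 <= p ^ k <= p' ^ k) by (split; [apply pow_le; lra | apply pow_incr; lra]).
  split; [|split].
  - auto_derive; [trivial|]. ring.
  - rewrite Rabs_mult. apply Rle_trans with (B * p ^ k * 1).
    + apply Rmult_le_compat; auto; try apply Rabs_pos. apply Rabs_le, COS_bound.
    + unfold B'. nra.
  - rewrite !Rabs_mult, Rabs_Ropp, (Rabs_pos_eq (INR k)) by apply pos_INR.
    apply Rle_trans with (B * p ^ k * (1 * INR k)).
    + apply Rmult_le_compat; auto; try apply Rabs_pos.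
      * apply Rmult_le_pos; [apply Rabs_pos | apply pos_INR].
      * apply Rmult_le_compat_r; [apply pos_INR|]. apply Rabs_le, SIN_bound.
    + assert (Q := INR_geom_bound p p' k ltac:(lra)).
      assert (B * (INR k * p ^ k) <= B * (p' / (p' - p) * p' ^ k))
        by (apply Rmult_le_compat_l; auto).
      assert (0 <= B * p' ^ k) by (apply Rmult_le_pos; lra).
      unfold B'. lra.
Qed.

(** * Goursat's theorem and the mean value property *)

Section Goursat.

Context (P Q : R -> R -> R).

(** The form [P ds + Q dt] is closed at the point: both functions are differentiable there and
    [P_t = Q_s], the common value being [m]. *)
Definition closed_at (s t : R) : Prop :=
  exists p1 m q2, differentiable_pt_lim P s t p1 m /\ differentiable_pt_lim Q s t m q2.

Definition in_rect (a b c d s t : R) : Prop := a <= s <= b /\ c <= t <= d.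

Definition circulation (a b c d : R) : R :=
  RInt (fun s => P s c - P s d) a b + RInt (fun t => Q b t - Q a t) c d.

Lemma differentiable_pt_lim_continuity (g : R -> R -> R) (s t l m : R) :
  differentiable_pt_lim g s t l m -> continuity_2d_pt g s t.
Proof.
  intros h. apply differentiable_continuity_pt. now exists l, m.
Qed.

Lemma continuity_2d_section_x (g : R -> R -> R) (x y : R) :
  continuity_2d_pt g x y -> continuous (fun t => g t y) x.
Proof.
  intros H. apply continuity_pt_filterlim. intros eps he.
  destruct (H (mkposreal eps he)) as [d hd]. exists d. split; [apply cond_pos|].
  intros t [_ ht]. apply (hd t y); [exact ht|].
  rewrite Rminus_diag, Rabs_R0. apply cond_pos.
Qed.

Lemma continuity_2d_section_y (g : R -> R -> R) (x y : R) :
  continuity_2d_pt g x y -> continuous (fun t => g x t) y.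
Proof.
  intros H. apply continuity_pt_filterlim. intros eps he.
  destruct (H (mkposreal eps he)) as [d hd]. exists d. split; [apply cond_pos|].
  intros t [_ ht]. apply (hd x t); [|exact ht].
  rewrite Rminus_diag, Rabs_R0. apply cond_pos.
Qed.

Section Rect.

Context (a0 b0 c0 d0 : R) (hclosed : forall s t, in_rect a0 b0 c0 d0 s t -> closed_at s t).

Lemma ex_RInt_horizontal (t a b : R) : c0 <= t <= d0 -> a0 <= a <= b0 -> a0 <= b <= b0 ->
  ex_RInt (fun s => P s t) a b.
Proof.
  intros ht ha hb. apply (@ex_RInt_continuous R_CompleteNormedModule). intros s hs.
  destruct (hclosed s t) as (p1 & m & q2 & h1 & h2).
  - split; [|exact ht]. now apply (Rmin_max_segment a b).
  - apply continuity_2d_section_x. eapply differentiable_pt_lim_continuity; eassumption.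
Qed.

Lemma ex_RInt_vertical (s c d : R) : a0 <= s <= b0 -> c0 <= c <= d0 -> c0 <= d <= d0 ->
  ex_RInt (fun t => Q s t) c d.
Proof.
  intros hs hc hd. apply (@ex_RInt_continuous R_CompleteNormedModule). intros t ht.
  destruct (hclosed s t) as (p1 & m & q2 & h1 & h2).
  - split; [exact hs|]. now apply (Rmin_max_segment c d).
  - apply continuity_2d_section_y. eapply differentiable_pt_lim_continuity; eassumption.
Qed.

Lemma circulation_split (a b c d : R) : a0 <= a <= b0 -> a0 <= b <= b0 -> c0 <= c <= d0 ->
  c0 <= d <= d0 -> circulation a b c d =
  RInt (fun s => P s c) a b - RInt (fun s => P s d) a b
  + (RInt (fun t => Q b t) c d - RInt (fun t => Q a t) c d).
Proof.
  intros ha hb hc hd. unfold circulation. f_equal.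
  - exact (RInt_minus (V := R_CompleteNormedModule) (fun s => P s c) (fun s => P s d) a b
      (ex_RInt_horizontal c a b hc ha hb) (ex_RInt_horizontal d a b hd ha hb)).
  - exact (RInt_minus (V := R_CompleteNormedModule) (fun t => Q b t) (fun t => Q a t) c d
      (ex_RInt_vertical b c d hb hc hd) (ex_RInt_vertical a c d ha hc hd)).
Qed.

Lemma circulation_add (a m b c n d : R) : a0 <= a <= b0 -> a0 <= m <= b0 -> a0 <= b <= b0 ->
  c0 <= c <= d0 -> c0 <= n <= d0 -> c0 <= d <= d0 ->
  circulation a b c d = circulation a m c n + circulation m b c n
    + circulation a m n d + circulation m b n d.
Proof.
  intros ha hm hb hc hn hd. rewrite !circulation_split by assumption.
  assert (X : forall t, c0 <= t <= d0 ->
    RInt (fun s => P s t) a m + RInt (fun s => P s t) m b = RInt (fun s => P s t) a b).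
  { intros t ht. apply (RInt_Chasles (V := R_CompleteNormedModule));
      apply ex_RInt_horizontal; assumption. }
  assert (Y : forall s, a0 <= s <= b0 ->
    RInt (fun t => Q s t) c n + RInt (fun t => Q s t) n d = RInt (fun t => Q s t) c d).
  { intros s hs. apply (RInt_Chasles (V := R_CompleteNormedModule));
      apply ex_RInt_vertical; assumption. }
  generalize (X c hc) (X d hd) (X n hn) (Y a ha) (Y b hb) (Y m hm). lra.
Qed.

(** The linear approximation is a closed form and has no circulation. The error is at most [eps * M]
    on each of four sides of length at most [M]. *)
Lemma circulation_small (s t eps : R) : in_rect a0 b0 c0 d0 s t -> 0 < eps ->
  exists delta, 0 < delta /\ forall a b c d M,
    a0 <= a -> b <= b0 -> c0 <= c -> d <= d0 -> in_rect a b c d s t ->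
    b - a <= M -> d - c <= M -> M < delta -> Rabs (circulation a b c d) <= 4 * eps * (M * M).
Proof.
  intros hst he. destruct (hclosed s t hst) as (p1 & m & q2 & hP & hQ).
  destruct (hP (mkposreal eps he)) as [d1 h1]. destruct (hQ (mkposreal eps he)) as [d2 h2].
  simpl in h1, h2. exists (Rmin d1 d2). split; [apply Rmin_glb_lt; apply cond_pos|].
  intros a b c d M la lb lc ld [hs ht] hba hdc hM.
  assert (r1 := Rmin_l d1 d2). assert (r2 := Rmin_r d1 d2).
  assert (near : forall u v, in_rect a b c d u v -> Rabs (u - s) <= M /\ Rabs (v - t) <= M).
  { intros u v [hu hv]. split; apply Rabs_le; lra. }
  assert (eP : forall u v, in_rect a b c d u v ->
    Rabs (P u v - P s t - (p1 * (u - s) + m * (v - t))) <= eps * M).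
  { intros u v huv. destruct (near u v huv) as [n1 n2].
    eapply Rle_trans; [apply h1; lra|]. apply Rmult_le_compat_l; [lra|]. now apply Rmax_lub. }
  assert (eQ : forall u v, in_rect a b c d u v ->
    Rabs (Q u v - Q s t - (m * (u - s) + q2 * (v - t))) <= eps * M).
  { intros u v huv. destruct (near u v huv) as [n1 n2].
    eapply Rle_trans; [apply h2; lra|]. apply Rmult_le_compat_l; [lra|]. now apply Rmax_lub. }
  assert (XP : ex_RInt (fun u => P u c - P u d) a b).
  { apply (@ex_RInt_minus R_NormedModule); apply ex_RInt_horizontal; lra. }
  assert (XQ : ex_RInt (fun v => Q b v - Q a v) c d).
  { apply (@ex_RInt_minus R_NormedModule); apply ex_RInt_vertical; lra. }
  assert (K1 : Rabs (RInt (fun u => P u c - P u d) a b - m * (c - d) * (b - a)) <= 2 * eps * M * M).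
  { assert (E : RInt (fun u => P u c - P u d) a b - m * (c - d) * (b - a) =
      RInt (fun u => P u c - P u d - m * (c - d)) a b).
    { rewrite (RInt_minus (V := R_CompleteNormedModule) (fun u => P u c - P u d) (fun _ => m * (c - d)));
        [|exact XP|apply ex_RInt_const].
      rewrite RInt_const. unfold minus, plus, opp, scal; simpl. unfold mult; simpl. ring. }
    rewrite E. eapply Rle_trans; [apply RInt_abs_le with (m := 2 * eps * M)|].
    - apply (@ex_RInt_minus R_NormedModule); [exact XP | apply ex_RInt_const].
    - intros u hu. rewrite Rmin_left, Rmax_right in hu by lra.
      assert (A := eP u c ltac:(split; lra)). assert (B := eP u d ltac:(split; lra)).
      apply Rabs_le_between in A. apply Rabs_le_between in B. apply Rabs_le. lra.
    - rewrite Rabs_pos_eq by lra. apply Rmult_le_compat_l; [|lra].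
      repeat apply Rmult_le_pos; lra. }
  assert (K2 : Rabs (RInt (fun v => Q b v - Q a v) c d - m * (b - a) * (d - c)) <= 2 * eps * M * M).
  { assert (E : RInt (fun v => Q b v - Q a v) c d - m * (b - a) * (d - c) =
      RInt (fun v => Q b v - Q a v - m * (b - a)) c d).
    { rewrite (RInt_minus (V := R_CompleteNormedModule) (fun v => Q b v - Q a v) (fun _ => m * (b - a)));
        [|exact XQ|apply ex_RInt_const].
      rewrite RInt_const. unfold minus, plus, opp, scal; simpl. unfold mult; simpl. ring. }
    rewrite E. eapply Rle_trans; [apply RInt_abs_le with (m := 2 * eps * M)|].
    - apply (@ex_RInt_minus R_NormedModule); [exact XQ | apply ex_RInt_const].
    - intros v hv. rewrite Rmin_left, Rmax_right in hv by lra.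
      assert (A := eQ a v ltac:(split; lra)). assert (B := eQ b v ltac:(split; lra)).
      apply Rabs_le_between in A. apply Rabs_le_between in B. apply Rabs_le. lra.
    - rewrite Rabs_pos_eq by lra. apply Rmult_le_compat_l; [|lra].
      repeat apply Rmult_le_pos; lra. }
  unfold circulation.
  replace (m * (c - d) * (b - a)) with (- (m * (b - a) * (d - c))) in K1 by ring.
  apply Rabs_le_between in K1. apply Rabs_le_between in K2. apply Rabs_le. lra.
Qed.

(** Selects a quarter that carries at least a fourth of the circulation; if the first three fail,
    additivity forces the last. *)
Definition quarter (r : R * R * R * R) : R * R * R * R :=
  let '(a, b, c, d) := r in
  let m := (a + b) / 2 in
  let n := (c + d) / 2 in
  let big := Rabs (circulation a b c d) / 4 in
  if Rle_dec big (Rabs (circulation a m c n)) then (a, m, c, n)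
  else if Rle_dec big (Rabs (circulation m b c n)) then (m, b, c, n)
  else if Rle_dec big (Rabs (circulation a m n d)) then (a, m, n, d)
  else (m, b, n, d).

Lemma quarter_spec (a b c d : R) : a0 <= a -> a <= b -> b <= b0 -> c0 <= c -> c <= d -> d <= d0 ->
  exists a' b' c' d', quarter (a, b, c, d) = (a', b', c', d') /\
    a <= a' /\ b' <= b /\ c <= c' /\ d' <= d /\ b' - a' = (b - a) / 2 /\ d' - c' = (d - c) / 2 /\
    Rabs (circulation a b c d) / 4 <= Rabs (circulation a' b' c' d').
Proof.
  intros ha hab hb hc hcd hd. unfold quarter.
  set (m := (a + b) / 2). set (n := (c + d) / 2).
  assert (hm : a <= m <= b) by (unfold m; lra). assert (hn : c <= n <= d) by (unfold n; lra).
  assert (E := circulation_add a m b c n d ltac:(lra) ltac:(lra) ltac:(lra) ltac:(lra) ltac:(lra) ltac:(lra)).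
  destruct (Rle_dec _ _) as [h1|h1].
  { exists a, m, c, n. repeat split; try lra; unfold m, n; lra. }
  destruct (Rle_dec _ _) as [h2|h2].
  { exists m, b, c, n. repeat split; try lra; unfold m, n; lra. }
  destruct (Rle_dec _ _) as [h3|h3].
  { exists a, m, n, d. repeat split; try lra; unfold m, n; lra. }
  exists m, b, n, d. repeat split; try (unfold m, n in *; lra).
  assert (T : Rabs (circulation a b c d) <= Rabs (circulation a m c n) + Rabs (circulation m b c n)
    + Rabs (circulation a m n d) + Rabs (circulation m b n d)).
  { rewrite E. eapply Rle_trans; [apply Rabs_triang|]. apply Rplus_le_compat_r.
    eapply Rle_trans; [apply Rabs_triang|]. apply Rplus_le_compat_r. apply Rabs_triang. }
  lra.
Qed.

Theorem Goursat : a0 <= b0 -> c0 <= d0 -> circulation a0 b0 c0 d0 = 0.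
Proof.
  intros hab hcd.
  set (r := fun n => Nat.iter n quarter (a0, b0, c0, d0)).
  set (A := fun n => fst (fst (fst (r n)))). set (B := fun n => snd (fst (fst (r n)))).
  set (G := fun n => snd (fst (r n))). set (D := fun n => snd (r n)).
  set (j := Rabs (circulation a0 b0 c0 d0)).
  assert (er : forall n, r n = (A n, B n, G n, D n)).
  { intros n. unfold A, B, G, D. now destruct (r n) as [[[? ?] ?] ?]. }
  assert (H : forall n, a0 <= A n /\ A n <= B n /\ B n <= b0 /\ c0 <= G n /\ G n <= D n /\ D n <= d0 /\
    B n - A n = (b0 - a0) * (/ 2) ^ n /\ D n - G n = (d0 - c0) * (/ 2) ^ n /\
    j * (/ 4) ^ n <= Rabs (circulation (A n) (B n) (G n) (D n)) /\
    A n <= A (S n) /\ B (S n) <= B n /\ G n <= G (S n) /\ D (S n) <= D n).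
  { assert (ST : forall n, a0 <= A n -> A n <= B n -> B n <= b0 -> c0 <= G n -> G n <= D n -> D n <= d0 ->
      A n <= A (S n) /\ B (S n) <= B n /\ G n <= G (S n) /\ D (S n) <= D n /\
      B (S n) - A (S n) = (B n - A n) / 2 /\ D (S n) - G (S n) = (D n - G n) / 2 /\
      Rabs (circulation (A n) (B n) (G n) (D n)) / 4
        <= Rabs (circulation (A (S n)) (B (S n)) (G (S n)) (D (S n)))).
    { intros n k1 k2 k3 k4 k5 k6.
      destruct (quarter_spec (A n) (B n) (G n) (D n) k1 k2 k3 k4 k5 k6)
        as (a' & b' & c' & d' & e & Hq).
      assert (e' : r (S n) = (a', b', c', d')).
      { change (r (S n)) with (quarter (r n)). rewrite er. exact e. }
      assert (EA : A (S n) = a') by (unfold A; now rewrite e').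
      assert (EB : B (S n) = b') by (unfold B; now rewrite e').
      assert (EG : G (S n) = c') by (unfold G; now rewrite e').
      assert (ED : D (S n) = d') by (unfold D; now rewrite e').
      rewrite EA, EB, EG, ED. exact Hq. }
    assert (main : forall n, a0 <= A n /\ A n <= B n /\ B n <= b0 /\ c0 <= G n /\ G n <= D n /\ D n <= d0 /\
      B n - A n = (b0 - a0) * (/ 2) ^ n /\ D n - G n = (d0 - c0) * (/ 2) ^ n /\
      j * (/ 4) ^ n <= Rabs (circulation (A n) (B n) (G n) (D n))).
    { induction n as [|n (k1 & k2 & k3 & k4 & k5 & k6 & k7 & k8 & k9)].
      - change (A 0%nat) with a0. change (B 0%nat) with b0. change (G 0%nat) with c0.
        change (D 0%nat) with d0. fold j. simpl. lra.
      - destruct (ST n k1 k2 k3 k4 k5 k6) as (s1 & s2 & s3 & s4 & s5 & s6 & s7).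
        simpl pow. repeat split; try lra. }
    intros n. destruct (main n) as (k1 & k2 & k3 & k4 & k5 & k6 & k7 & k8 & k9).
    destruct (ST n k1 k2 k3 k4 k5 k6) as (s1 & s2 & s3 & s4 & s5 & s6 & s7).
    repeat split; assumption. }
  assert (nest : forall X Y : nat -> R, (forall n, X n <= Y n) -> (forall n, X n <= X (S n)) ->
    (forall n, Y (S n) <= Y n) -> exists l, forall n, X n <= l <= Y n).
  { intros X Y h1 h2 h3.
    assert (mX : forall n k, X n <= X (k + n)%nat).
    { intros n k. induction k as [|k IH]; [simpl; lra|]. simpl. specialize (h2 (k + n)%nat). lra. }
    assert (mY : forall n k, Y (k + n)%nat <= Y n).
    { intros n k. induction k as [|k IH]; [simpl; lra|]. simpl. specialize (h3 (k + n)%nat). lra. }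
    assert (XY : forall n m, X n <= Y m).
    { intros n m. assert (u1 := mX n m). assert (u2 := mY m n). assert (u3 := h1 (m + n)%nat).
      rewrite (Nat.add_comm n m) in u2. lra. }
    destruct (completeness (fun x => exists n, x = X n)) as [l [l1 l2]].
    - exists (Y 0%nat). intros x [n ->]. apply XY.
    - exists (X 0%nat). now exists 0%nat.
    - exists l. intros n. split; [apply l1; now exists n|].
      apply l2. intros x [m ->]. apply XY. }
  destruct (nest A B) as [s hs]; try (intros n; apply (H n)).
  destruct (nest G D) as [t ht]; try (intros n; apply (H n)).
  assert (hj : 0 <= j) by apply Rabs_pos.
  destruct (Rle_lt_or_eq_dec 0 j hj) as [hj'|hj'].
  2:{ apply Rabs_eq_0. symmetry. exact hj'. }
  exfalso.
  set (Lam := 1 + (b0 - a0) + (d0 - c0)). assert (hL : 0 < Lam) by (unfold Lam; lra).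
  assert (hLL : 0 < Lam * Lam) by now apply Rmult_lt_0_compat.
  (* With this tolerance the upper bound at stage [n] is [j / 2 * (/ 4) ^ n], half of the lower
     bound. *)
  assert (he : 0 < j / (8 * (Lam * Lam))) by (apply Rdiv_lt_0_compat; lra).
  destruct (circulation_small s t _ ltac:(split; [apply (hs 0%nat)|apply (ht 0%nat)]) he)
    as (delta & hdel & HS).
  destruct (geom_pow_small (Lam * 2) (/ 2) delta ltac:(lra) hdel) as [N hN].
  set (n := S N) in *.
  replace (Lam * 2 * (/ 2) ^ n / (1 - / 2)) with (4 * (Lam * (/ 2) ^ n)) in hN by field.
  assert (p2 : 0 < (/ 2) ^ n) by (apply pow_lt; lra).
  assert (pL : 0 < Lam * (/ 2) ^ n) by now apply Rmult_lt_0_compat.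
  destruct (H n) as (k1 & k2 & k3 & k4 & k5 & k6 & k7 & k8 & k9 & _).
  assert (Bd := HS (A n) (B n) (G n) (D n) (Lam * (/ 2) ^ n) k1 k3 k4 k6
    (conj (hs n) (ht n))).
  assert (q1 : B n - A n <= Lam * (/ 2) ^ n).
  { rewrite k7. apply Rmult_le_compat_r; unfold Lam; lra. }
  assert (q2 : D n - G n <= Lam * (/ 2) ^ n).
  { rewrite k8. apply Rmult_le_compat_r; unfold Lam; lra. }
  specialize (Bd q1 q2 ltac:(lra)).
  replace (4 * (j / (8 * (Lam * Lam))) * (Lam * (/ 2) ^ n * (Lam * (/ 2) ^ n))) with
    (j / 2 * ((/ 2) ^ n * (/ 2) ^ n)) in Bd by (field; lra).
  rewrite <- Rpow_mult_distr in Bd. replace (/ 2 * / 2) with (/ 4) in Bd by field.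
  assert (p4 : 0 < (/ 4) ^ n) by (apply pow_lt; lra).
  nra.
Qed.

End Rect.

End Goursat.

(** * Cauchy-Riemann equations and circle means in logarithmic polar coordinates *)

Lemma cdiff_differentiable (f : C -> C) (x y : R) (l : C) : cdiff f (x, y) l ->
  differentiable_pt_lim (fun a b => fst (f (a, b))) x y (fst l) (- snd l) /\
  differentiable_pt_lim (fun a b => snd (f (a, b))) x y (snd l) (fst l).
Proof.
  intros H.
  assert (K : forall eps : posreal, exists d : posreal, forall a b, Rabs (a - x) < d -> Rabs (b - y) < d ->
    Cmod (f (a, b) - f (x, y) - ((a, b) - (x, y)) * l)%C <= eps * Rmax (Rabs (a - x)) (Rabs (b - y))).
  { intros eps. assert (he : 0 < eps / 2) by (generalize (cond_pos eps); lra).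
    destruct (H _ he) as (d & hd & hw). assert (hd2 : 0 < d / 2) by lra.
    exists (mkposreal _ hd2). simpl. intros a b ha hb.
    assert (S2 : sqrt 2 <= 2).
    { replace 2 with (sqrt (2 * 2)) at 2 by (rewrite sqrt_square; lra). apply sqrt_le_1_alt. lra. }
    assert (M : Cmod ((a, b) - (x, y))%C <= 2 * Rmax (Rabs (a - x)) (Rabs (b - y))).
    { eapply Rle_trans; [apply Cmod_2Rmax|]. apply Rmult_le_compat_r; [|exact S2].
      eapply Rle_trans; [apply Rabs_pos|apply Rmax_l]. }
    assert (M2 : Rmax (Rabs (a - x)) (Rabs (b - y)) < d / 2) by now apply Rmax_lub_lt.
    eapply Rle_trans; [apply hw; lra|].
    replace (eps * Rmax (Rabs (a - x)) (Rabs (b - y))) with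
      (eps / 2 * (2 * Rmax (Rabs (a - x)) (Rabs (b - y)))) by field.
    apply Rmult_le_compat_l; lra. }
  split; intros eps; destruct (K eps) as [d hd]; exists d; intros a b ha hb;
    (eapply Rle_trans; [|apply (hd a b ha hb)]); (eapply Rle_trans; [|apply Rmax_Cmod]).
  - eapply Rle_trans; [|apply Rmax_l]. right. f_equal. simpl. ring.
  - eapply Rle_trans; [|apply Rmax_r]. right. f_equal. simpl. ring.
Qed.

Lemma starlike_full : starlike (fun _ => True).
Proof.
  split; [|trivial]. intros x _. exists (mkposreal 1 Rlt_0_1). trivial.
Qed.

Definition polar (s t : R) : C := (exp s * cos t, exp s * sin t).

Lemma polar_differentiable (s t : R) :
  differentiable_pt_lim (fun s t => exp s * cos t) s t (exp s * cos t) (- (exp s * sin t)) /\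
  differentiable_pt_lim (fun s t => exp s * sin t) s t (exp s * sin t) (exp s * cos t).
Proof.
  assert (Cf : forall g : R -> R, (forall x, continuous g x) ->
    Ck 0 (fun _ => True) (fun s t => exp s * g t)).
  { intros g hg. apply Ck_mult; [apply starlike_full| |].
    - intros [x y] _. apply (continuous_comp (fun q : R * R => fst q) exp).
      + apply (@continuous_fst R_UniformSpace R_UniformSpace).
      + apply continuous_exp.
    - intros [x y] _. apply (continuous_comp (fun q : R * R => snd q) g).
      + apply (@continuous_snd R_UniformSpace R_UniformSpace).
      + apply hg. }
  split.
  - apply (differentiable_of_C1 (fun _ => True) starlike_full (fun s t => exp s * cos t)
      (fun s t => exp s * cos t) (fun s t => - (exp s * sin t))); trivial.
    + intros x y _. auto_derive; [trivial|ring].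
    + intros x y _. auto_derive; [trivial|ring].
    + apply (Cf cos), continuous_cos.
  - apply (differentiable_of_C1 (fun _ => True) starlike_full (fun s t => exp s * sin t)
      (fun s t => exp s * sin t) (fun s t => exp s * cos t)); trivial.
    + intros x y _. auto_derive; [trivial|ring].
    + intros x y _. auto_derive; [trivial|ring].
    + apply (Cf sin), continuous_sin.
Qed.

Lemma Cmod_polar (s t : R) : Cmod (polar s t) = exp s.
Proof.
  unfold Cmod, polar. simpl fst. simpl snd.
  replace ((exp s * cos t) ^ 2 + (exp s * sin t) ^ 2) with (exp s * exp s).
  - apply sqrt_square. left. apply exp_pos.
  - assert (h := sin2_cos2 t). unfold Rsqr in h. simpl.
    replace (exp s * exp s) with (exp s * exp s * (sin t * sin t + cos t * cos t)) by (rewrite h; ring).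
    ring.
Qed.

(* In the coordinate [log z = s + i t] the form [f(z) dz / (i z)] becomes [- i f (ds + i dt)]. *)
Lemma polar_closed (f : C -> C) (s t : R) (l : C) : cdiff f (polar s t) l ->
  closed_at (fun s t => snd (f (polar s t))) (fun s t => fst (f (polar s t))) s t.
Proof.
  intros H. destruct (cdiff_differentiable f _ _ l H) as [H1 H2].
  destruct (polar_differentiable s t) as [D1 D2].
  assert (E1 := differentiable_pt_lim_comp (fun a b => fst (f (a, b))) _ _ s t _ _ _ _ _ _ H1 D1 D2).
  assert (E2 := differentiable_pt_lim_comp (fun a b => snd (f (a, b))) _ _ s t _ _ _ _ _ _ H2 D1 D2).
  eexists _, _, _. split; [exact E2|].
  replace (snd l * - (exp s * sin t) + fst l * (exp s * cos t)) with
    (fst l * (exp s * cos t) + - snd l * (exp s * sin t)) by ring.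
  exact E1.
Qed.

Definition circle (t : R) : C := (cos t, sin t).

Lemma polar_0 (t : R) : polar 0 t = circle t.
Proof. unfold polar, circle. now rewrite exp_0, !Rmult_1_l. Qed.

Lemma Cmod_circle (t : R) : Cmod (circle t) = 1.
Proof. rewrite <- polar_0, Cmod_polar. apply exp_0. Qed.

Lemma polar_period (s t : R) : polar s (t + 2 * PI) = polar s t.
Proof. unfold polar. now rewrite cos_plus, sin_plus, cos_2PI, sin_2PI, !Rmult_1_r, !Rmult_0_r, Rminus_0_r, Rplus_0_r. Qed.

Lemma unit_circle (z : C) : Cmod z = 1 -> exists t, z = circle t.
Proof.
  intros h. assert (h2 := Cmod2_alt z). rewrite h in h2. destruct z as [x y].
  unfold Re, Im in h2. simpl fst in h2. simpl snd in h2.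
  assert (hx : -1 <= x <= 1) by nra.
  destruct (Rle_dec 0 y) as [hy|hy].
  - exists (acos x). unfold circle. rewrite cos_acos, sin_acos by exact hx. f_equal.
    symmetry. apply sqrt_lem_1; unfold Rsqr; nra.
  - exists (- acos x). unfold circle. rewrite cos_neg, sin_neg, cos_acos, sin_acos by exact hx.
    f_equal. assert (E : sqrt (1 - Rsqr x) = - y) by (apply sqrt_lem_1; unfold Rsqr; nra). lra.
Qed.

(** Frozen at the boundary value for [s > 0], hence continuous in the whole plane; this allows
    uniform continuity around [s = 0], although [f] is controlled only on the closed disc. *)
Definition clamp_polar (f : C -> C) (s t : R) : C := f (polar (Rmin s 0) t).

Lemma clamp_polar_continuous (f : C -> C) (s t : R) : disc_holomorphic f ->
  continuity_2d_pt (fun s t => fst (clamp_polar f s t)) s t.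
Proof.
  intros [_ Hc] eps.
  assert (hb : forall s t, Cmod (polar (Rmin s 0) t) <= 1).
  { intros a b. rewrite Cmod_polar. rewrite <- exp_0.
    destruct (Rle_lt_or_eq_dec _ _ (Rmin_r a 0)) as [h| ->]; [left; now apply exp_increasing | lra]. }
  destruct (Hc (polar (Rmin s 0) t) (hb s t) eps (cond_pos eps)) as (d & hd & hw).
  assert (hd2 : 0 < d / 2) by lra.
  destruct (polar_differentiable (Rmin s 0) t) as [D1 D2].
  destruct (differentiable_pt_lim_continuity _ _ _ _ _ D1 (mkposreal _ hd2)) as [d1 h1].
  destruct (differentiable_pt_lim_continuity _ _ _ _ _ D2 (mkposreal _ hd2)) as [d2 h2].
  simpl in h1, h2.
  assert (hm : 0 < Rmin d1 d2) by (apply Rmin_glb_lt; apply cond_pos).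
  exists (mkposreal _ hm). simpl. intros a b ha hb'.
  assert (r1 := Rmin_l d1 d2). assert (r2 := Rmin_r d1 d2).
  assert (ha' : Rabs (Rmin a 0 - Rmin s 0) < Rmin d1 d2).
  { eapply Rle_lt_trans; [|exact ha]. unfold Rmin, Rabs.
    destruct (Rle_dec a 0), (Rle_dec s 0); repeat destruct (Rcase_abs _); lra. }
  specialize (h1 (Rmin a 0) b ltac:(lra) ltac:(lra)).
  specialize (h2 (Rmin a 0) b ltac:(lra) ltac:(lra)).
  assert (Q : Cmod (polar (Rmin a 0) b - polar (Rmin s 0) t)%C < d).
  { assert (S2 : sqrt 2 <= 2).
    { replace 2 with (sqrt (2 * 2)) at 2 by (rewrite sqrt_square; lra). apply sqrt_le_1_alt. lra. }
    eapply Rle_lt_trans; [apply Cmod_2Rmax|].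
    assert (M : Rmax (Rabs (fst (polar (Rmin a 0) b - polar (Rmin s 0) t)%C))
      (Rabs (snd (polar (Rmin a 0) b - polar (Rmin s 0) t)%C)) < d / 2)
      by (apply Rmax_lub_lt; [exact h1 | exact h2]).
    assert (M0 := Rle_trans _ _ _ (Rabs_pos (fst (polar (Rmin a 0) b - polar (Rmin s 0) t)%C))
      (Rmax_l _ (Rabs (snd (polar (Rmin a 0) b - polar (Rmin s 0) t)%C)))).
    nra. }
  specialize (hw _ (hb a b) Q). unfold clamp_polar.
  eapply Rle_lt_trans; [|exact hw]. eapply Rle_trans; [|apply Rmax_Cmod]. apply Rmax_l.
Qed.

Lemma ex_RInt_clamp (f : C -> C) (s a b : R) : disc_holomorphic f ->
  ex_RInt (fun t => fst (clamp_polar f s t)) a b.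
Proof.
  intros H. apply (@ex_RInt_continuous R_CompleteNormedModule). intros t _.
  apply (continuity_2d_section_y (fun s t => fst (clamp_polar f s t))).
  now apply clamp_polar_continuous.
Qed.

Lemma RInt_close (u v : R -> R) (a b e : R) : a <= b -> ex_RInt u a b -> ex_RInt v a b ->
  (forall t, a <= t <= b -> Rabs (u t - v t) <= e) ->
  Rabs (RInt u a b - RInt v a b) <= e * (b - a).
Proof.
  intros h hu hv hb.
  assert (E : RInt u a b - RInt v a b = RInt (fun t => u t - v t) a b).
  { symmetry. exact (RInt_minus (V := R_CompleteNormedModule) u v a b hu hv). }
  rewrite E. rewrite <- (Rabs_pos_eq (b - a)) by lra. apply RInt_abs_le.
  - now apply (@ex_RInt_minus R_NormedModule).
  - intros t ht. rewrite Rmin_left, Rmax_right in ht by lra. now apply hb.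
Qed.

Lemma mean_value_fst (f : C -> C) (c : R) : disc_holomorphic f ->
  is_RInt (fun t => fst (f (circle t))) c (c + 2 * PI) (2 * PI * fst (f 0)).
Proof.
  intros H. assert (pi0 := PI_RGT_0). set (c' := c + 2 * PI). assert (hcc : c <= c') by (unfold c'; lra).
  set (J := fun s => RInt (fun t => fst (clamp_polar f s t)) c c').
  (* Goursat on a rectangle of height [2 * PI]: the horizontal sides cancel by periodicity and the
     vertical ones are the two circle integrals. *)
  assert (const : forall s1 s2, s1 <= s2 -> s2 < 0 -> J s1 = J s2).
  { intros s1 s2 h12 h2.
    assert (G := Goursat (fun s t => snd (f (polar s t))) (fun s t => fst (f (polar s t))) s1 s2 c c').
    unfold circulation in G.
    assert (Z : RInt (fun s => snd (f (polar s c)) - snd (f (polar s c'))) s1 s2 = 0).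
    { rewrite (RInt_ext _ (fun _ => 0)).
      - rewrite RInt_const. apply Rmult_0_r.
      - intros s _. unfold c'. rewrite polar_period. apply Rminus_diag. }
    rewrite Z, Rplus_0_l in G.
    assert (cl : forall s, s < 0 -> forall t, clamp_polar f s t = f (polar s t)).
    { intros s hs t. unfold clamp_polar. rewrite Rmin_left; [reflexivity|lra]. }
    rewrite (RInt_ext _ (fun t => minus (fst (clamp_polar f s2 t)) (fst (clamp_polar f s1 t)))) in G.
    2:{ intros t _. rewrite !cl by lra. reflexivity. }
    rewrite (RInt_minus (V := R_CompleteNormedModule)) in G by now apply ex_RInt_clamp.
    assert (G' : J s2 - J s1 = 0).
    { apply G; [|exact h12|exact hcc]. intros s t [hs _].
      destruct (proj1 H (polar s t)) as [l hl].
      - rewrite Cmod_polar, <- exp_0. apply exp_increasing. lra.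
      - now apply polar_closed with l. }
    lra. }
  (* The circle may be shrunk until [f] is close to [f 0] on it; a nonzero gap would then be at most
     half of itself. *)
  assert (center : forall s, s < 0 -> J s = 2 * PI * fst (f 0)).
  { intros s hs. apply Rminus_diag_uniq, Rabs_eq_0. apply Rle_antisym; [|apply Rabs_pos].
    apply Rnot_lt_le. intros hpos. set (gap := Rabs (J s - 2 * PI * fst (f 0))) in *.
    assert (he : 0 < gap / (4 * PI)) by (apply Rdiv_lt_0_compat; lra).
    destruct (proj1 H 0) as [l hl]; [rewrite Cmod_0; lra|].
    destruct (cdiff_continuous f 0 l hl _ he) as (d & hd & hw).
    set (s1 := Rmin s (ln (d / 2))).
    assert (hs1 : s1 <= s) by apply Rmin_l.
    assert (e1 : exp s1 < d).
    { apply Rle_lt_trans with (exp (ln (d / 2))).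
      - destruct (Rle_lt_or_eq_dec _ _ (Rmin_r s (ln (d / 2)))) as [h|h].
        + left. now apply exp_increasing.
        + right. now f_equal.
      - rewrite exp_ln; lra. }
    assert (K := RInt_close (fun t => fst (clamp_polar f s1 t)) (fun _ => fst (f 0)) c c' (gap / (4 * PI)) hcc
      (ex_RInt_clamp f s1 c c' H) (ex_RInt_const c c' (fst (f 0)))).
    assert (K' : forall t, c <= t <= c' -> Rabs (fst (clamp_polar f s1 t) - fst (f 0)) <= gap / (4 * PI)).
    { intros t _. unfold clamp_polar. rewrite Rmin_left by lra. left.
      eapply Rle_lt_trans; [|apply (hw (polar s1 t))].
      - eapply Rle_trans; [|apply Rmax_Cmod]. apply Rmax_l.
      - replace (polar s1 t - 0)%C with (polar s1 t) by ring. now rewrite Cmod_polar. }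
    specialize (K K'). rewrite RInt_const in K.
    change (scal (c' - c) (fst (f 0))) with ((c' - c) * fst (f 0)) in K.
    replace (c' - c) with (2 * PI) in K by (unfold c'; ring).
    change (Rabs (J s1 - 2 * PI * fst (f 0)) <= gap / (4 * PI) * (2 * PI)) in K.
    rewrite (const s1 s hs1 hs) in K. fold gap in K.
    replace (gap / (4 * PI) * (2 * PI)) with (gap / 2) in K by (field; lra). lra. }
  (* Passage to the unit circle, where [f] is merely continuous, by comparing [s = 0] with
     [s = - d]. *)
  assert (bdry : J 0 = 2 * PI * fst (f 0)).
  { apply Rminus_diag_uniq, Rabs_eq_0. apply Rle_antisym; [|apply Rabs_pos].
    apply Rnot_lt_le. intros hpos. set (gap := Rabs (J 0 - 2 * PI * fst (f 0))) in *.
    assert (he : 0 < gap / (4 * PI)) by (apply Rdiv_lt_0_compat; lra).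
    destruct (uniform_continuity_2d_1d' (fun s t => fst (clamp_polar f s t)) c c' 0) with
      (eps := mkposreal _ he) as [d hd].
    { intros t _. now apply clamp_polar_continuous. }
    assert (d0 := cond_pos d).
    assert (K := RInt_close (fun t => fst (clamp_polar f 0 t)) (fun t => fst (clamp_polar f (- d) t)) c c'
      (gap / (4 * PI)) hcc (ex_RInt_clamp f 0 c c' H) (ex_RInt_clamp f (- d) c c' H)).
    assert (K' : forall t, c <= t <= c' ->
      Rabs (fst (clamp_polar f 0 t) - fst (clamp_polar f (- d) t)) <= gap / (4 * PI)).
    { intros t ht. left. apply (hd t (- d) t 0); try lra.
      rewrite Rminus_diag, Rabs_R0. exact d0. }
    specialize (K K'). fold (J 0) (J (- d)) in K. rewrite (center (- d)) in K by lra. fold gap in K.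
    replace (c' - c) with (2 * PI) in K by (unfold c'; ring).
    replace (gap / (4 * PI) * (2 * PI)) with (gap / 2) in K by (field; lra). lra. }
  rewrite <- bdry.
  apply (is_RInt_ext (fun t => fst (clamp_polar f 0 t))).
  - intros t _. unfold clamp_polar. rewrite Rmin_left by lra. now rewrite polar_0.
  - apply (RInt_correct (V := R_CompleteNormedModule)). now apply ex_RInt_clamp.
Qed.

Lemma mean_value_snd (f : C -> C) (c : R) : disc_holomorphic f ->
  is_RInt (fun t => snd (f (circle t))) c (c + 2 * PI) (2 * PI * snd (f 0)).
Proof.
  intros H.
  assert (H' : disc_holomorphic (fun w => (- Ci) * f w)%C)
    by (apply disc_holomorphic_mult; [apply disc_holomorphic_const | exact H]).
  assert (E : forall z, fst ((- Ci) * f z)%C = snd (f z)) by (intros z; simpl; ring).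
  assert (K := mean_value_fst _ c H'). cbv beta in K. rewrite E in K.
  apply is_RInt_ext with (2 := K). intros t _. apply E.
Qed.

(** The primitive from [a] lies between 0 and the total integral 0, so it vanishes, and so does its
    derivative [g]. *)
Lemma RInt_nonneg_zero (g : R -> R) (a b t : R) : (forall x, continuous g x) -> (forall x, 0 <= g x) ->
  is_RInt g a b 0 -> a < t < b -> g t = 0.
Proof.
  intros hc hp hI ht. apply Rle_antisym; [|apply hp]. apply Rnot_lt_le. intros hlt.
  assert (hX : forall x y, ex_RInt g x y).
  { intros x y. apply (@ex_RInt_continuous R_CompleteNormedModule). auto. }
  assert (hZ : forall x, a < x < b -> RInt g a x = 0).
  { intros x hx. assert (E := RInt_Chasles (V := R_CompleteNormedModule) g a x b (hX a x) (hX x b)).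
    rewrite (is_RInt_unique (V := R_CompleteNormedModule) _ _ _ _ hI) in E.
    change (RInt g a x + RInt g x b = 0) in E.
    assert (p1 : 0 <= RInt g a x) by (apply RInt_ge_0; auto; lra).
    assert (p2 : 0 <= RInt g x b) by (apply RInt_ge_0; auto; lra). lra. }
  assert (D : is_derive (fun x => RInt g a x) t (g t)).
  { apply (is_derive_RInt g (fun x => RInt g a x) a t); [|apply hc].
    apply filter_forall. intros x. now apply (RInt_correct (V := R_CompleteNormedModule)). }
  assert (D0 : is_derive (fun x => RInt g a x) t 0).
  { apply is_derive_ext_loc with (fun _ => 0); [|apply (is_derive_const 0)].
    assert (hm : 0 < Rmin (t - a) (b - t)) by (apply Rmin_glb_lt; lra).
    exists (mkposreal _ hm). intros x hx. change (Rabs (x - t) < Rmin (t - a) (b - t)) in hx.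
    symmetry. apply hZ. assert (r1 := Rmin_l (t - a) (b - t)). assert (r2 := Rmin_r (t - a) (b - t)).
    apply Rabs_lt_between in hx. lra. }
  apply is_derive_unique in D. apply is_derive_unique in D0. rewrite D in D0. lra.
Qed.

(** * Automorphisms of the disc and rigidity of boundary values *)

Definition moebius (a w : C) : C := ((w + a) / (1 + Cconj a * w))%C.

Lemma moebius_den (a w : C) : Cmod a < 1 -> Cmod w <= 1 -> (1 + Cconj a * w)%C <> 0.
Proof.
  intros ha hw E. assert (h : (Cconj a * w)%C = (- (1))%C).
  { replace (Cconj a * w)%C with ((1 + Cconj a * w) - 1)%C by ring. rewrite E. ring. }
  assert (h1 : Cmod (Cconj a * w) = 1) by (rewrite h; apply Cmod_m1).
  rewrite Cmod_mult, Cmod_conj in h1. generalize (Cmod_ge_0 a) (Cmod_ge_0 w). nra.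
Qed.

(** The identity behind the three facts that follow: its sign shows on which side of the circle
    [moebius a w] lies. *)
Lemma moebius_Cmod (a w : C) :
  Cmod (1 + Cconj a * w)%C ^ 2 - Cmod (w + a)%C ^ 2 = (1 - Cmod w ^ 2) * (1 - Cmod a ^ 2).
Proof.
  rewrite !Cmod2_alt. destruct a, w. unfold Re, Im; simpl. ring.
Qed.

Lemma moebius_le (a w : C) : Cmod a < 1 -> Cmod w <= 1 -> Cmod (moebius a w) <= 1.
Proof.
  intros ha hw. assert (hn := moebius_den a w ha hw). unfold moebius. rewrite Cmod_div by exact hn.
  apply Cmod_gt_0 in hn. apply Rmult_le_reg_r with (1 := hn). unfold Rdiv.
  rewrite Rmult_assoc, Rinv_l, Rmult_1_l, Rmult_1_r by lra.
  assert (E := moebius_Cmod a w).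
  assert (0 <= (1 - Cmod w ^ 2) * (1 - Cmod a ^ 2)).
  { apply Rmult_le_pos; generalize (Cmod_ge_0 a) (Cmod_ge_0 w); simpl; nra. }
  apply Rnot_lt_le. intros hlt. simpl in E, H. nra.
Qed.

Lemma moebius_lt (a w : C) : Cmod a < 1 -> Cmod w < 1 -> Cmod (moebius a w) < 1.
Proof.
  intros ha hw. assert (hn := moebius_den a w ha (Rlt_le _ _ hw)). unfold moebius.
  rewrite Cmod_div by exact hn.
  apply Cmod_gt_0 in hn. apply Rmult_lt_reg_r with (1 := hn). unfold Rdiv.
  rewrite Rmult_assoc, Rinv_l, Rmult_1_l, Rmult_1_r by lra.
  assert (E := moebius_Cmod a w).
  assert (0 < (1 - Cmod w ^ 2) * (1 - Cmod a ^ 2)).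
  { apply Rmult_lt_0_compat; generalize (Cmod_ge_0 a) (Cmod_ge_0 w); simpl; nra. }
  assert (N0 := Cmod_ge_0 (w + a)). apply Rnot_le_lt. intros hlt. simpl in E, H. nra.
Qed.

Lemma moebius_circle (a w : C) : Cmod a < 1 -> Cmod w = 1 -> Cmod (moebius a w) = 1.
Proof.
  intros ha hw. assert (hn := moebius_den a w ha (Req_le _ _ hw)). unfold moebius.
  rewrite Cmod_div by exact hn. apply Cmod_gt_0 in hn.
  assert (E := moebius_Cmod a w). rewrite hw in E.
  assert (E' : Cmod (w + a) = Cmod (1 + Cconj a * w)).
  { assert (N0 := Cmod_ge_0 (w + a)). simpl in E. nra. }
  rewrite E'. field. lra.
Qed.

Lemma moebius_holomorphic (a : C) : Cmod a < 1 -> disc_holomorphic (moebius a).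
Proof.
  intros ha. apply disc_holomorphic_of_cdiff. intros z hz. eexists. unfold moebius.
  apply (cdiff_mult (fun w => w + a)%C (fun w => / (1 + Cconj a * w))%C).
  - apply cdiff_plus; [apply cdiff_id | apply cdiff_const].
  - apply (cdiff_comp Cinv (fun w => 1 + Cconj a * w)%C).
    + apply cdiff_inv. now apply moebius_den.
    + apply cdiff_plus; [apply cdiff_const|].
      apply cdiff_mult; [apply cdiff_const | apply cdiff_id].
Qed.

Lemma holomorphic_continuous_circle (f : C -> C) : disc_holomorphic f ->
  forall t, continuous (fun t => fst (f (circle t))) t.
Proof.
  intros H t. apply continuous_ext with (fun t => fst (clamp_polar f 0 t)).
  - intros x. unfold clamp_polar. rewrite Rmin_left by lra. now rewrite polar_0.
  - apply (continuity_2d_section_y (fun s t => fst (clamp_polar f s t))).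
    now apply clamp_polar_continuous.
Qed.

(* On the circle [conj (h - c)] is the boundary value of the holomorphic function
   [conj (k (conj z) - c)], so the mean of [|h - c|^2] is [0] for [c = h 0 = k 0]. *)
Lemma boundary_conjugate_constant (h k : C -> C) :
  disc_holomorphic h -> disc_holomorphic k -> (forall l, Cmod l = 1 -> h l = k (Cconj l)) ->
  forall z, Cmod z <= 1 -> h z = k 0.
Proof.
  intros Hh Hk E. assert (pi0 := PI_RGT_0).
  set (ks := fun w => Cconj (k (Cconj w))).
  assert (Hs : disc_holomorphic ks) by now apply disc_holomorphic_conj.
  assert (Es : forall t, ks (circle t) = Cconj (h (circle t))).
  { intros t. unfold ks. rewrite E by apply Cmod_circle. reflexivity. }
  assert (c0 : Cconj 0 = RtoC 0) by (unfold Cconj, RtoC; simpl; now rewrite Ropp_0).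
  (* Both are the circle mean of [h]; for [k] this goes through [ks], whose boundary values are
     conjugate to those of [h]. *)
  assert (E0 : h 0 = k 0).
  { assert (F1 := mean_value_fst h 0 Hh). assert (F2 := mean_value_fst ks 0 Hs).
    assert (S1 := mean_value_snd h 0 Hh). assert (S2 := mean_value_snd ks 0 Hs).
    apply (is_RInt_ext _ (fun t => fst (h (circle t)))) in F2.
    2:{ intros t _. now rewrite Es. }
    apply (is_RInt_ext _ (fun t => opp (snd (h (circle t))))) in S2.
    2:{ intros t _. now rewrite Es. }
    apply (is_RInt_opp (V := R_NormedModule)) in S2.
    apply (is_RInt_ext _ (fun t => snd (h (circle t)))) in S2.
    2:{ intros t _. apply opp_opp. }
    assert (A := eq_trans (eq_sym (is_RInt_unique (V := R_CompleteNormedModule) _ _ _ _ F1))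
      (is_RInt_unique (V := R_CompleteNormedModule) _ _ _ _ F2)).
    assert (B := eq_trans (eq_sym (is_RInt_unique (V := R_CompleteNormedModule) _ _ _ _ S1))
      (is_RInt_unique (V := R_CompleteNormedModule) _ _ _ _ S2)).
    unfold ks in A, B. rewrite c0 in A, B.
    change (2 * PI * snd (h 0) = - (2 * PI * - snd (k 0))) in B.
    change (2 * PI * fst (h 0) = 2 * PI * fst (k 0)) in A.
    destruct (h 0) as [h1 h2], (k 0) as [k1 k2]. simpl in A, B. f_equal; nra. }
  set (c := k 0) in *.
  (* The period is centred at [t], so that [t] is interior to the interval on which the nonnegative
     integrand has integral 0. *)
  assert (circ : forall t, h (circle t) = c).
  { intros t.
    set (g := fun w => ((h w + - c) * (ks w + - Cconj c))%C).
    assert (Hg : disc_holomorphic g).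
    { apply disc_holomorphic_mult; (apply disc_holomorphic_plus; [assumption|apply disc_holomorphic_const]). }
    assert (Eg : forall x, fst (g (circle x)) = Cmod (h (circle x) - c)%C ^ 2).
    { intros x. unfold g. rewrite Es, Cmod2_alt. destruct (h (circle x)), c. unfold Re, Im; simpl. ring. }
    assert (M := mean_value_fst g (t - PI) Hg).
    replace (fst (g 0)) with 0 in M by (unfold g; rewrite E0; simpl; ring).
    rewrite Rmult_0_r in M.
    assert (Z := RInt_nonneg_zero _ _ _ t (holomorphic_continuous_circle g Hg)
      (fun x => eq_ind_r (Rle 0) (pow2_ge_0 _) (Eg x)) M ltac:(lra)).
    cbv beta in Z. rewrite Eg in Z.
    assert (Z' : Cmod (h (circle t) - c) = 0) by (simpl in Z; nra).
    apply Cmod_eq_0 in Z'. replace (h (circle t)) with ((h (circle t) - c) + c)%C by ring.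
    rewrite Z'. ring. }
  intros z hz. destruct (Rle_lt_or_eq_dec _ _ hz) as [hz'|hz'].
  2:{ destruct (unit_circle z hz') as [t ->]. apply circ. }
  (* The automorphism takes 0 to [z], which turns the mean value property at 0 into one at [z], with
     the circle still mapped to itself. *)
  assert (Hm : disc_holomorphic (fun w => h (moebius z w))).
  { apply disc_holomorphic_comp; auto.
    - intros w hw. now apply moebius_le.
    - intros w hw. now apply moebius_lt.
    - now apply moebius_holomorphic. }
  assert (m0 : moebius z 0 = z) by (unfold moebius; field; intros F; apply RtoC_inj in F; lra).
  assert (cm : forall t, h (moebius z (circle t)) = c).
  { intros t. destruct (unit_circle (moebius z (circle t))) as [t' ->].
    - apply moebius_circle; [exact hz' | apply Cmod_circle].
    - apply circ. }
  assert (F := mean_value_fst _ 0 Hm). assert (S := mean_value_snd _ 0 Hm).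
  cbv beta in F, S. rewrite m0 in F, S.
  apply (is_RInt_ext _ (fun _ => fst c)) in F; [|intros t _; now rewrite cm].
  apply (is_RInt_ext _ (fun _ => snd c)) in S; [|intros t _; now rewrite cm].
  apply (is_RInt_unique (V := R_CompleteNormedModule)) in F.
  apply (is_RInt_unique (V := R_CompleteNormedModule)) in S.
  rewrite RInt_const in F, S.
  change ((0 + 2 * PI - 0) * fst c = 2 * PI * fst (h z)) in F.
  change ((0 + 2 * PI - 0) * snd c = 2 * PI * snd (h z)) in S.
  destruct (h z) as [h1 h2], c as [c1 c2]. simpl in F, S. f_equal; nra.
Qed.

(** * Calculus of two-by-two matrices *)

Lemma mat_ext {K : Ring} (A B : @matrix_Ring K 2) :
  entry A 0 0 = entry B 0 0 -> entry A 0 1 = entry B 0 1 ->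
  entry A 1 0 = entry B 1 0 -> entry A 1 1 = entry B 1 1 -> A = B.
Proof.
  destruct A as [[a [b []]] [[c [d []]] []]], B as [[a' [b' []]] [[c' [d' []]] []]].
  unfold entry, coeff_mat. simpl. intros -> -> -> ->. reflexivity.
Qed.

Lemma entry_mult {K : Ring} (A B : @matrix_Ring K 2) (i j : nat) : (i < 2)%nat -> (j < 2)%nat ->
  entry (mult A B) i j =
  plus (mult (entry A i 0) (entry B 0 j)) (mult (entry A i 1) (entry B 1 j)).
Proof.
  intros hi hj. unfold entry at 1. change (mult A B) with (Mmult A B). unfold Mmult.
  rewrite coeff_mat_bij by assumption. simpl pred. rewrite sum_Sn, sum_O. reflexivity.
Qed.

Lemma entry_plus {K : Ring} (A B : @matrix_Ring K 2) (i j : nat) : (i < 2)%nat -> (j < 2)%nat ->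
  entry (plus A B) i j = plus (entry A i j) (entry B i j).
Proof.
  intros hi hj. unfold entry at 1. change (plus A B) with (Mplus A B). unfold Mplus.
  now rewrite coeff_mat_bij by assumption.
Qed.

Lemma entry_opp {K : Ring} (A : @matrix_Ring K 2) (i j : nat) : (i < 2)%nat -> (j < 2)%nat ->
  entry (opp A) i j = opp (entry A i j).
Proof.
  intros hi hj. unfold entry at 1. change (opp A) with (Mopp A). unfold Mopp.
  now rewrite coeff_mat_bij by assumption.
Qed.

Lemma entry_mscal {K : Ring} (c : K) (A : @matrix_Ring K 2) (i j : nat) : (i < 2)%nat -> (j < 2)%nat ->
  entry (mscal c A) i j = mult c (entry A i j).
Proof.
  intros hi hj. unfold entry at 1, mscal. now rewrite coeff_mat_bij by assumption.
Qed.

Lemma entry_minus {K : Ring} (A B : @matrix_Ring K 2) (i j : nat) : (i < 2)%nat -> (j < 2)%nat ->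
  entry (minus A B) i j = minus (entry A i j) (entry B i j).
Proof.
  intros hi hj.
  exact (eq_trans (entry_plus A (opp B) i j hi hj)
    (f_equal (plus (entry A i j)) (entry_opp B i j hi hj))).
Qed.

Lemma entry_bar {K : Ring} (A : @matrix_Ring K 2) (i j : nat) : (i < 2)%nat -> (j < 2)%nat ->
  entry (bar A) i j = minus (if Nat.eqb i j then mtr A else zero) (entry A i j).
Proof.
  intros hi hj. unfold bar. rewrite entry_minus by assumption. f_equal.
  rewrite entry_mscal by assumption.
  destruct i as [|[|i]], j as [|[|j]]; try lia;
    (apply mult_one_r || apply mult_zero_r).
Qed.

(** Indices out of range read the default [zero]. They matter because [smooth_loop],
    [holomorphic_in_disc] and [smooth2_on] quantify over all indices. *)
Lemma entry_ge {T : Ring} (A : @matrix_Ring T 2) (i j : nat) : (2 <= i)%nat \/ (2 <= j)%nat ->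
  entry A i j = zero.
Proof.
  destruct A as [[a [b []]] [[c [d []]] []]].
  assert (Z : forall j, coeff_Tn zero (@mk_Tn T 2 (fun _ => zero)) j = zero).
  { intros k. destruct k as [|[|k]]; reflexivity. }
  intros h. unfold entry, coeff_mat.
  destruct i as [|[|i]]; [destruct j as [|[|j]]; [lia|lia|] | destruct j as [|[|j]]; [lia|lia|] | ];
    simpl; try reflexivity.
  apply Z.
Qed.

Section Real_entries.

Context (A B : MR) (c : R) (i j : nat) (hi : (i < 2)%nat) (hj : (j < 2)%nat).

Lemma entryR_mult : entry (mult A B) i j = entry A i 0 * entry B 0 j + entry A i 1 * entry B 1 j.
Proof. exact (entry_mult A B i j hi hj). Qed.

Lemma entryR_plus : entry (plus A B) i j = entry A i j + entry B i j.
Proof. exact (entry_plus A B i j hi hj). Qed.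

Lemma entryR_opp : entry (opp A) i j = - entry A i j.
Proof. exact (entry_opp A i j hi hj). Qed.

Lemma entryR_minus : entry (minus A B) i j = entry A i j - entry B i j.
Proof. exact (entry_minus A B i j hi hj). Qed.

Lemma entryR_mscal : entry (mscal c A) i j = c * entry A i j.
Proof. exact (entry_mscal (K := R_Ring) c A i j hi hj). Qed.

Lemma entryR_bar : entry (bar A) i j =
  (if Nat.eqb i j then entry A 0 0 + entry A 1 1 else 0) - entry A i j.
Proof. exact (entry_bar A i j hi hj). Qed.

End Real_entries.

Section Complex_entries.

Context (A B : MC) (c : C) (i j : nat) (hi : (i < 2)%nat) (hj : (j < 2)%nat).

Lemma entryC_mult : entry (mult A B) i j = (entry A i 0 * entry B 0 j + entry A i 1 * entry B 1 j)%C.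
Proof. exact (entry_mult A B i j hi hj). Qed.

Lemma entryC_plus : entry (plus A B) i j = (entry A i j + entry B i j)%C.
Proof. exact (entry_plus A B i j hi hj). Qed.

Lemma entryC_opp : entry (opp A) i j = (- entry A i j)%C.
Proof. exact (entry_opp A i j hi hj). Qed.

Lemma entryC_minus : entry (minus A B) i j = (entry A i j - entry B i j)%C.
Proof. exact (entry_minus A B i j hi hj). Qed.

Lemma entryC_mscal : entry (mscal c A) i j = (c * entry A i j)%C.
Proof. exact (entry_mscal (K := C_Ring) c A i j hi hj). Qed.

Lemma entryC_bar : entry (bar A) i j =
  ((if Nat.eqb i j then entry A 0 0 + entry A 1 1 else 0) - entry A i j)%C.
Proof. exact (entry_bar A i j hi hj). Qed.

End Complex_entries.

Lemma entry_embed (A : MR) (i j : nat) : (i < 2)%nat -> (j < 2)%nat ->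
  entry (embed A) i j = RtoC (entry A i j).
Proof.
  intros hi hj. unfold entry at 1, embed. now rewrite coeff_mat_bij by assumption.
Qed.

Lemma entry_mconj (A : MC) (i j : nat) : (i < 2)%nat -> (j < 2)%nat ->
  entry (mconj A) i j = Cconj (entry A i j).
Proof.
  intros hi hj. unfold entry at 1, mconj. now rewrite coeff_mat_bij by assumption.
Qed.

Lemma entry_mat2_00 {K : Ring} (a b c d : K) : entry (mat2 a b c d) 0 0 = a.
Proof. reflexivity. Qed.
Lemma entry_mat2_01 {K : Ring} (a b c d : K) : entry (mat2 a b c d) 0 1 = b.
Proof. reflexivity. Qed.
Lemma entry_mat2_10 {K : Ring} (a b c d : K) : entry (mat2 a b c d) 1 0 = c.
Proof. reflexivity. Qed.
Lemma entry_mat2_11 {K : Ring} (a b c d : K) : entry (mat2 a b c d) 1 1 = d.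
Proof. reflexivity. Qed.

Lemma mtr_R (A : MR) : mtr A = entry A 0 0 + entry A 1 1.
Proof. reflexivity. Qed.
Lemma mdet_R (A : MR) : mdet A = entry A 0 0 * entry A 1 1 - entry A 0 1 * entry A 1 0.
Proof. reflexivity. Qed.
Lemma mtr_C (A : MC) : mtr A = (entry A 0 0 + entry A 1 1)%C.
Proof. reflexivity. Qed.
Lemma mdet_C (A : MC) : mdet A = (entry A 0 0 * entry A 1 1 - entry A 0 1 * entry A 1 0)%C.
Proof. reflexivity. Qed.

Lemma entry_one_R (i j : nat) : (i < 2)%nat -> (j < 2)%nat ->
  entry (one : MR) i j = if Nat.eqb i j then 1 else 0.
Proof. intros hi hj. destruct i as [|[|i]], j as [|[|j]]; try lia; reflexivity. Qed.

Lemma entry_zero_R (i j : nat) : (i < 2)%nat -> (j < 2)%nat -> entry (zero : MR) i j = 0.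
Proof. intros hi hj. destruct i as [|[|i]], j as [|[|j]]; try lia; reflexivity. Qed.

Lemma entry_one_C (i j : nat) : (i < 2)%nat -> (j < 2)%nat ->
  entry (one : MC) i j = if Nat.eqb i j then RtoC 1 else RtoC 0.
Proof. intros hi hj. destruct i as [|[|i]], j as [|[|j]]; try lia; reflexivity. Qed.

Ltac lt2 := (apply Nat.lt_0_succ || apply Nat.lt_1_2 || lia).

Ltac expR := repeat first
  [ rewrite entryR_mult by lt2 | rewrite entryR_minus by lt2 | rewrite entryR_plus by lt2
  | rewrite entryR_opp by lt2 | rewrite entryR_mscal by lt2 | rewrite entryR_bar by lt2
  | rewrite entry_mat2_00 | rewrite entry_mat2_01 | rewrite entry_mat2_10 | rewrite entry_mat2_11
  | rewrite entry_one_R by lt2 | rewrite entry_zero_R by lt2 | rewrite mtr_R | rewrite mdet_R ];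
  cbn [Nat.eqb].

Ltac expC := repeat first
  [ rewrite entryC_mult by lt2 | rewrite entryC_minus by lt2 | rewrite entryC_plus by lt2
  | rewrite entryC_opp by lt2 | rewrite entryC_mscal by lt2 | rewrite entryC_bar by lt2
  | rewrite entry_mat2_00 | rewrite entry_mat2_01 | rewrite entry_mat2_10 | rewrite entry_mat2_11
  | rewrite entry_one_C by lt2 | rewrite entry_embed by lt2 | rewrite entry_mconj by lt2
  | rewrite mtr_C | rewrite mdet_C ];
  cbn [Nat.eqb].

(** Restates an equation in the carrier of [R_Ring] as one in [R], where [ring] and [field]
    apply. *)
Ltac eqR := match goal with |- @eq _ ?a ?b => change (@eq R a b) end.
Ltac eqC := match goal with |- @eq _ ?a ?b => change (@eq C a b) end.
Ltac matR := apply mat_ext; expR; eqR; try reflexivity; try ring.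
Ltac matC := apply mat_ext; expC; eqC; try reflexivity; try ring.

Lemma mult_bar_C (A : MC) : mult A (bar A) = mscal (mdet A) one.
Proof. matC. Qed.

Lemma bar_mult_C (A : MC) : mult (bar A) A = mscal (mdet A) one.
Proof. matC. Qed.

Lemma bar_mult_R (A : MR) : mult (bar A) A = mscal (mdet A) one.
Proof. matR. Qed.

Lemma mult_bar_R (A : MR) : mult A (bar A) = mscal (mdet A) one.
Proof. matR. Qed.

Lemma mscal_1_C (A : MC) : mscal (RtoC 1) A = A.
Proof. matC. Qed.

Lemma mscal_1_R (A : MR) : mscal 1 A = A.
Proof. matR. Qed.

Lemma mdet_mult_C (A B : MC) : mdet (mult A B) = (mdet A * mdet B)%C.
Proof. expC. eqC. ring. Qed.

Lemma mdet_mult_R (A B : MR) : mdet (mult A B) = mdet A * mdet B.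
Proof. expR. eqR. ring. Qed.

Lemma mdet_bar_C (A : MC) : mdet (bar A) = mdet A.
Proof. expC. eqC. ring. Qed.

Lemma mdet_bar_R (A : MR) : mdet (bar A) = mdet A.
Proof. expR. eqR. ring. Qed.

Lemma bar_bar_C (A : MC) : bar (bar A) = A.
Proof. matC. Qed.

Lemma bar_bar_R (A : MR) : bar (bar A) = A.
Proof. matR. Qed.

Lemma bar_mult_rev_R (A B : MR) : bar (mult A B) = mult (bar B) (bar A).
Proof. matR. Qed.

Lemma invC_det_1 (A : MC) : mdet A = RtoC 1 -> invC A = bar A.
Proof.
  intros h. unfold invC. rewrite h. replace (/ 1)%C with (RtoC 1) by (field; intros F; apply RtoC_inj in F; lra).
  apply mscal_1_C.
Qed.

Lemma invR_det_1 (A : MR) : mdet A = 1 -> invR A = bar A.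
Proof.
  intros h. unfold invR. rewrite h, Rinv_1. apply mscal_1_R.
Qed.

Lemma bar_cancel_l_C (A B : MC) : mdet A = RtoC 1 -> mult (bar A) (mult A B) = B.
Proof.
  intros h. rewrite mult_assoc, bar_mult_C, h, mscal_1_C. apply mult_one_l.
Qed.

Lemma bar_cancel_r_C (A B : MC) : mdet A = RtoC 1 -> mult A (mult (bar A) B) = B.
Proof.
  intros h. rewrite mult_assoc, mult_bar_C, h, mscal_1_C. apply mult_one_l.
Qed.

Lemma bar_cancel_l_R (A B : MR) : mdet A = 1 -> mult (bar A) (mult A B) = B.
Proof.
  intros h. rewrite mult_assoc, bar_mult_R, h, mscal_1_R. apply mult_one_l.
Qed.

Lemma bar_cancel_r_R (A B : MR) : mdet A = 1 -> mult A (mult (bar A) B) = B.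
Proof.
  intros h. rewrite mult_assoc, mult_bar_R, h, mscal_1_R. apply mult_one_l.
Qed.

Lemma embed_mult (A B : MR) : embed (mult A B) = mult (embed A) (embed B).
Proof.
  apply mat_ext; expC; expR; now rewrite RtoC_plus, !RtoC_mult.
Qed.

Lemma embed_bar (A : MR) : embed (bar A) = bar (embed A).
Proof.
  apply mat_ext; expC; expR; now rewrite RtoC_minus, ?RtoC_plus.
Qed.

Lemma mdet_embed (A : MR) : mdet (embed A) = RtoC (mdet A).
Proof.
  expC; expR. now rewrite RtoC_minus, !RtoC_mult.
Qed.

(** * Linear differential equations with trace-free coefficients *)

(** Real and imaginary parts separately, so that the results on real series and real derivatives
    apply. *)
Definition cderiv (f : R -> C) (x : R) (l : C) : Prop :=
  is_derive (fun t => fst (f t)) x (fst l) /\ is_derive (fun t => snd (f t)) x (snd l).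

Lemma cderiv_of_is_derive (f : R -> C) (x : R) (l : C) :
  @is_derive R_AbsRing C_R_NormedModule f x l -> cderiv f x l.
Proof.
  intros H. split.
  - assert (D := filterdiff_comp' (V := C_R_NormedModule) f (fun z : C => fst z) x _ _ H
      (filterdiff_linear (U := C_R_NormedModule) (V := R_NormedModule) _
        (is_linear_fst (U := R_NormedModule) (V := R_NormedModule)))).
    exact D.
  - assert (D := filterdiff_comp' (V := C_R_NormedModule) f (fun z : C => snd z) x _ _ H
      (filterdiff_linear (U := C_R_NormedModule) (V := R_NormedModule) _
        (is_linear_snd (U := R_NormedModule) (V := R_NormedModule)))).
    exact D.
Qed.

Lemma cderiv_const (c : C) (x : R) : cderiv (fun _ => c) x 0.
Proof. split; apply (is_derive_const (K := R_AbsRing) (V := R_NormedModule)). Qed.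

Lemma cderiv_plus (f g : R -> C) (x : R) (a b : C) :
  cderiv f x a -> cderiv g x b -> cderiv (fun t => f t + g t)%C x (a + b)%C.
Proof.
  intros [F1 F2] [G1 G2]. split.
  - exact (is_derive_plus (fun t => fst (f t)) (fun t => fst (g t)) x _ _ F1 G1).
  - exact (is_derive_plus (fun t => snd (f t)) (fun t => snd (g t)) x _ _ F2 G2).
Qed.

Lemma is_derive_mult_R (f g : R -> R) (x a b : R) :
  is_derive f x a -> is_derive g x b -> is_derive (fun t => f t * g t) x (a * g x + f x * b).
Proof.
  intros F G. exact (is_derive_mult f g x a b F G (fun x y => Rmult_comm x y)).
Qed.

Lemma cderiv_mult (f g : R -> C) (x : R) (a b : C) :
  cderiv f x a -> cderiv g x b -> cderiv (fun t => f t * g t)%C x (a * g x + f x * b)%C.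
Proof.
  intros [F1 F2] [G1 G2]. split.
  - assert (D := is_derive_minus _ _ x _ _ (is_derive_mult_R _ _ x _ _ F1 G1) (is_derive_mult_R _ _ x _ _ F2 G2)).
    match type of D with is_derive _ _ ?l => match goal with |- is_derive _ _ ?m =>
      replace m with l; [exact D|] end end.
    unfold minus, plus, opp; simpl. ring.
  - assert (D := is_derive_plus _ _ x _ _ (is_derive_mult_R _ _ x _ _ F1 G2) (is_derive_mult_R _ _ x _ _ F2 G1)).
    match type of D with is_derive _ _ ?l => match goal with |- is_derive _ _ ?m =>
      replace m with l; [exact D|] end end.
    unfold plus; simpl. ring.
Qed.

Lemma cderiv_opp (f : R -> C) (x : R) (a : C) : cderiv f x a -> cderiv (fun t => - f t)%C x (- a)%C.
Proof.
  intros [F1 F2]. split; [exact (is_derive_opp _ x _ F1) | exact (is_derive_opp _ x _ F2)].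
Qed.

Lemma cderiv_eq (f : R -> C) (x : R) (a b : C) : cderiv f x a -> a = b -> cderiv f x b.
Proof. now intros H <-. Qed.

Lemma cderiv_ext (f g : R -> C) (x : R) (a : C) :
  (forall t, f t = g t) -> cderiv f x a -> cderiv g x a.
Proof.
  intros E [F1 F2]. split.
  - apply is_derive_ext with (2 := F1). intros t. now rewrite E.
  - apply is_derive_ext with (2 := F2). intros t. now rewrite E.
Qed.

Definition mderivC (A : R -> MC) (x : R) (A' : MC) : Prop :=
  forall i j, (i < 2)%nat -> (j < 2)%nat -> cderiv (fun t => entry (A t) i j) x (entry A' i j).

Lemma mderivC_mult (A B : R -> MC) (x : R) (A' B' : MC) : mderivC A x A' -> mderivC B x B' ->
  mderivC (fun t => mult (A t) (B t)) x (plus (mult A' (B x)) (mult (A x) B')).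
Proof.
  intros HA HB i j hi hj.
  apply cderiv_ext with (fun t => entry (A t) i 0 * entry (B t) 0 j + entry (A t) i 1 * entry (B t) 1 j)%C.
  { intros t. symmetry. now apply entryC_mult. }
  eapply cderiv_eq.
  - exact (cderiv_plus _ _ _ _ _
      (cderiv_mult _ _ _ _ _ (HA i 0%nat hi Nat.lt_0_2) (HB 0%nat j Nat.lt_0_2 hj))
      (cderiv_mult _ _ _ _ _ (HA i 1%nat hi Nat.lt_1_2) (HB 1%nat j Nat.lt_1_2 hj))).
  - rewrite entryC_plus, !entryC_mult by lt2. eqC. ring.
Qed.

Lemma mderivC_bar (A : R -> MC) (x : R) (A' : MC) : mderivC A x A' ->
  mderivC (fun t => bar (A t)) x (bar A').
Proof.
  intros HA i j hi hj.
  apply cderiv_ext with (fun t => (if Nat.eqb i j then entry (A t) 0 0 + entry (A t) 1 1 else 0)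
    + - entry (A t) i j)%C.
  { intros t. symmetry. now rewrite entryC_bar. }
  rewrite entryC_bar by assumption.
  refine (cderiv_plus _ _ _ _ _ _ (cderiv_opp _ _ _ (HA i j hi hj))).
  destruct (Nat.eqb i j); [|apply cderiv_const].
  exact (cderiv_plus _ _ _ _ _ (HA 0%nat 0%nat Nat.lt_0_2 Nat.lt_0_2) (HA 1%nat 1%nat Nat.lt_1_2 Nat.lt_1_2)).
Qed.

Lemma mderivC_const (A : MC) (x : R) : mderivC (fun _ => A) x zero.
Proof.
  intros i j hi hj. replace (entry zero i j) with (RtoC 0); [apply cderiv_const|].
  destruct i as [|[|i]], j as [|[|j]]; try lia; reflexivity.
Qed.

Lemma derive_zero_constant (J : R -> Prop) (f : R -> R) (a b : R) :
  (forall x y z, J x -> J y -> x <= z <= y -> J z) ->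
  (forall x, J x -> is_derive f x 0) -> J a -> J b -> f a = f b.
Proof.
  intros hJ H.
  assert (K : forall a b, a < b -> J a -> J b -> f a = f b).
  { intros x y h hx hy. apply (eq_is_derive (V := R_NormedModule) f x y); [|exact h].
    intros t ht. apply H. now apply hJ with x y. }
  intros ha hb. destruct (Rtotal_order a b) as [h|[->|h]]; auto. symmetry. auto.
Qed.

Lemma mderivC_zero_constant (J : R -> Prop) (A : R -> MC) (a b : R) :
  (forall x y z, J x -> J y -> x <= z <= y -> J z) ->
  (forall x, J x -> mderivC A x zero) -> J a -> J b -> A a = A b.
Proof.
  intros hJ H ha hb.
  assert (K : forall i j, (i < 2)%nat -> (j < 2)%nat -> entry (A a) i j = entry (A b) i j).
  { intros i j hi hj.
    assert (Z : entry (zero : MC) i j = (0, 0)) by (destruct i as [|[|i]], j as [|[|j]]; try lia; reflexivity).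
    assert (E1 := derive_zero_constant J (fun t => fst (entry (A t) i j)) a b hJ
     (fun x hx => eq_rect _ (is_derive _ x) (proj1 (H x hx i j hi hj)) _ (f_equal fst Z)) ha hb).
    assert (E2 := derive_zero_constant J (fun t => snd (entry (A t) i j)) a b hJ
     (fun x hx => eq_rect _ (is_derive _ x) (proj2 (H x hx i j hi hj)) _ (f_equal snd Z)) ha hb).
    cbv beta in E1, E2. destruct (entry (A a) i j), (entry (A b) i j). simpl in *. congruence. }
  apply mat_ext; apply K; lt2.
Qed.

(* Two solutions [X, Y] of [X' = X al] with [tr al = 0] have [(X adj(Y))' = 0]. *)
Lemma trace_free_ode_quotient (J : R -> Prop) (X Y al : R -> MC) (a b : R) :
  (forall x y z, J x -> J y -> x <= z <= y -> J z) ->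
  (forall x, J x -> mtr (al x) = RtoC 0) ->
  (forall x, J x -> mderivC X x (mult (X x) (al x))) ->
  (forall x, J x -> mderivC Y x (mult (Y x) (al x))) -> J a -> J b ->
  mult (X a) (bar (Y a)) = mult (X b) (bar (Y b)).
Proof.
  intros hJ ht HX HY. apply (mderivC_zero_constant J (fun t => mult (X t) (bar (Y t))) a b hJ).
  intros x hx.
  assert (D := mderivC_mult _ _ x _ _ (HX x hx) (mderivC_bar _ x _ (HY x hx))).
  replace (zero : MC) with (plus (mult (mult (X x) (al x)) (bar (Y x)))
    (mult (X x) (bar (mult (Y x) (al x))))); [exact D|].
  assert (T : entry (al x) 1 1 = (- entry (al x) 0 0)%C).
  { assert (T := ht x hx). rewrite mtr_C in T.
    replace (entry (al x) 1 1) with ((entry (al x) 0 0 + entry (al x) 1 1) - entry (al x) 0 0)%C by ring.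
    rewrite T. eqC. ring. }
  apply mat_ext; expC; rewrite T; eqC; [change (entry (zero : MC) 0 0) with (RtoC 0)
   | change (entry (zero : MC) 0 1) with (RtoC 0) | change (entry (zero : MC) 1 0) with (RtoC 0)
   | change (entry (zero : MC) 1 1) with (RtoC 0)]; ring.
Qed.

(** The quotient [X adj(X)] of a solution by itself is [det X] times the identity, and it is
    constant. *)
Lemma trace_free_ode_det (J : R -> Prop) (X al : R -> MC) (a b : R) :
  (forall x y z, J x -> J y -> x <= z <= y -> J z) ->
  (forall x, J x -> mtr (al x) = RtoC 0) ->
  (forall x, J x -> mderivC X x (mult (X x) (al x))) -> J a -> J b ->
  mdet (X a) = mdet (X b).
Proof.
  intros hJ ht HX ha hb.
  assert (E := trace_free_ode_quotient J X X al a b hJ ht HX HX ha hb).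
  rewrite !mult_bar_C in E. apply (f_equal (fun M => entry M 0 0)) in E.
  rewrite !entryC_mscal, !entry_one_C in E by lt2. cbn [Nat.eqb] in E.
  now rewrite !Cmult_1_r in E.
Qed.

(** The constant quotient [X adj(Y)] is the identity at [a], hence at [b], where [det Y] is still
    1. *)
Lemma trace_free_ode_unique (J : R -> Prop) (X Y al : R -> MC) (a b : R) :
  (forall x y z, J x -> J y -> x <= z <= y -> J z) ->
  (forall x, J x -> mtr (al x) = RtoC 0) ->
  (forall x, J x -> mderivC X x (mult (X x) (al x))) ->
  (forall x, J x -> mderivC Y x (mult (Y x) (al x))) -> J a -> J b ->
  mdet (Y a) = RtoC 1 -> X a = Y a -> X b = Y b.
Proof.
  intros hJ ht HX HY ha hb hd E.
  assert (Q := trace_free_ode_quotient J X Y al a b hJ ht HX HY ha hb).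
  assert (hd' : mdet (Y b) = RtoC 1).
  { rewrite <- hd. symmetry. now apply (trace_free_ode_det J Y al). }
  rewrite E, mult_bar_C, hd, mscal_1_C in Q.
  apply (f_equal (fun M => mult M (Y b))) in Q.
  rewrite mult_one_l, <- mult_assoc, bar_mult_C, hd', mscal_1_C, mult_one_r in Q.
  symmetry. exact Q.
Qed.

Definition mderivR (A : R -> MR) (x : R) (A' : MR) : Prop :=
  forall i j, (i < 2)%nat -> (j < 2)%nat -> is_derive (fun t => entry (A t) i j) x (entry A' i j).

Lemma mderivR_mult (A B : R -> MR) (x : R) (A' B' : MR) : mderivR A x A' -> mderivR B x B' ->
  mderivR (fun t => mult (A t) (B t)) x (plus (mult A' (B x)) (mult (A x) B')).
Proof.
  intros HA HB i j hi hj.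
  apply is_derive_ext with (fun t => entry (A t) i 0 * entry (B t) 0 j + entry (A t) i 1 * entry (B t) 1 j).
  { intros t. symmetry. now apply entryR_mult. }
  assert (D := is_derive_plus _ _ _ _ _
      (is_derive_mult_R _ _ _ _ _ (HA i 0%nat hi Nat.lt_0_2) (HB 0%nat j Nat.lt_0_2 hj))
      (is_derive_mult_R _ _ _ _ _ (HA i 1%nat hi Nat.lt_1_2) (HB 1%nat j Nat.lt_1_2 hj))).
  match type of D with is_derive _ _ ?l => match goal with |- is_derive _ _ ?m =>
    replace m with l; [exact D|] end end.
  rewrite entryR_plus, !entryR_mult by lt2. unfold plus; simpl. eqR. ring.
Qed.

Lemma mderivR_bar (A : R -> MR) (x : R) (A' : MR) : mderivR A x A' ->
  mderivR (fun t => bar (A t)) x (bar A').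
Proof.
  intros HA i j hi hj.
  assert (E : forall B : MR, bar B = mat2 (entry B 1 1) (- entry B 0 1) (- entry B 1 0) (entry B 0 0))
    by (intros B; matR).
  rewrite E. destruct i as [|[|i]], j as [|[|j]]; try lia.
  - apply is_derive_ext with (2 := HA 1%nat 1%nat Nat.lt_1_2 Nat.lt_1_2). intros t. now rewrite E.
  - apply is_derive_ext with (2 := is_derive_opp _ _ _ (HA 0%nat 1%nat Nat.lt_0_2 Nat.lt_1_2)).
    intros t. now rewrite E.
  - apply is_derive_ext with (2 := is_derive_opp _ _ _ (HA 1%nat 0%nat Nat.lt_1_2 Nat.lt_0_2)).
    intros t. now rewrite E.
  - apply is_derive_ext with (2 := HA 0%nat 0%nat Nat.lt_0_2 Nat.lt_0_2). intros t. now rewrite E.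
Qed.

Lemma mderivR_const (A : MR) (x : R) : mderivR (fun _ => A) x zero.
Proof.
  intros i j hi hj. rewrite entry_zero_R by assumption. apply (is_derive_const (entry A i j)).
Qed.

Lemma mderivR_embed (A : R -> MR) (x : R) (A' : MR) : mderivR A x A' ->
  mderivC (fun t => embed (A t)) x (embed A').
Proof.
  intros HA i j hi hj. rewrite entry_embed by assumption.
  apply cderiv_ext with (fun t => RtoC (entry (A t) i j)).
  - intros t. symmetry. now apply entry_embed.
  - split; [exact (HA i j hi hj) | apply (is_derive_const 0)].
Qed.

Lemma entry_mderive (A : R -> MR) (x : R) (i j : nat) : (i < 2)%nat -> (j < 2)%nat ->
  entry (mderive A x) i j = Derive (fun t => entry (A t) i j) x.
Proof. intros hi hj. unfold entry at 1, mderive. now rewrite coeff_mat_bij by assumption. Qed.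

Lemma mderive_unique (A : R -> MR) (x : R) (A' : MR) : mderivR A x A' -> mderive A x = A'.
Proof.
  intros H.
  assert (K : forall i j, (i < 2)%nat -> (j < 2)%nat -> entry (mderive A x) i j = entry A' i j).
  { intros i j hi hj. rewrite entry_mderive by assumption. apply is_derive_unique. now apply H. }
  apply mat_ext; apply K; lt2.
Qed.

Lemma Ck_mmult (Om : R * R -> Prop) (hO : open Om) (n : nat) (A B : R -> R -> MR) :
  (forall i j, (i < 2)%nat -> (j < 2)%nat -> Ck n Om (fun x y => entry (A x y) i j)) ->
  (forall i j, (i < 2)%nat -> (j < 2)%nat -> Ck n Om (fun x y => entry (B x y) i j)) ->
  forall i j, (i < 2)%nat -> (j < 2)%nat -> Ck n Om (fun x y => entry (mult (A x y) (B x y)) i j).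
Proof.
  intros HA HB i j hi hj.
  apply Ck_ext with (fun x y => entry (A x y) i 0 * entry (B x y) 0 j + entry (A x y) i 1 * entry (B x y) 1 j).
  - exact hO.
  - intros x y _. symmetry. now apply entryR_mult.
  - apply Ck_plus; [exact hO| |].
    + exact (Ck_mult Om hO n _ _ (HA i 0%nat hi Nat.lt_0_2) (HB 0%nat j Nat.lt_0_2 hj)).
    + exact (Ck_mult Om hO n _ _ (HA i 1%nat hi Nat.lt_1_2) (HB 1%nat j Nat.lt_1_2 hj)).
Qed.

Lemma Ck_mbar (Om : R * R -> Prop) (hO : open Om) (n : nat) (A : R -> R -> MR) :
  (forall i j, (i < 2)%nat -> (j < 2)%nat -> Ck n Om (fun x y => entry (A x y) i j)) ->
  forall i j, (i < 2)%nat -> (j < 2)%nat -> Ck n Om (fun x y => entry (bar (A x y)) i j).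
Proof.
  intros HA i j hi hj.
  assert (E : forall B : MR, bar B = mat2 (entry B 1 1) (- entry B 0 1) (- entry B 1 0) (entry B 0 0))
    by (intros B; matR).
  destruct i as [|[|i]], j as [|[|j]]; try lia.
  - apply Ck_ext with (3 := HA 1%nat 1%nat Nat.lt_1_2 Nat.lt_1_2); [exact hO|]. intros x y _. now rewrite E.
  - apply Ck_ext with (3 := Ck_opp Om hO n _ (HA 0%nat 1%nat Nat.lt_0_2 Nat.lt_1_2)); [exact hO|].
    intros x y _. now rewrite E.
  - apply Ck_ext with (3 := Ck_opp Om hO n _ (HA 1%nat 0%nat Nat.lt_1_2 Nat.lt_0_2)); [exact hO|].
    intros x y _. now rewrite E.
  - apply Ck_ext with (3 := HA 0%nat 0%nat Nat.lt_0_2 Nat.lt_0_2); [exact hO|]. intros x y _. now rewrite E.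
Qed.

(** * Loops given by power series *)

Definition geom (q : R) (a : nat -> R) : Prop := exists A, forall n, Rabs (a n) <= A * q ^ n.

Lemma geom_plus (q : R) (a b : nat -> R) : geom q a -> geom q b -> geom q (fun n => a n + b n).
Proof.
  intros [A ha] [B hb]. exists (A + B). intros n. eapply Rle_trans; [apply Rabs_triang|].
  rewrite Rmult_plus_distr_r. now apply Rplus_le_compat.
Qed.

Lemma geom_scal (q c : R) (a : nat -> R) : geom q a -> geom q (fun n => c * a n).
Proof.
  intros [A ha]. exists (Rabs c * A). intros n. rewrite Rabs_mult, Rmult_assoc.
  apply Rmult_le_compat_l; [apply Rabs_pos | apply ha].
Qed.

Lemma geom_succ (q : R) (a : nat -> R) : geom q a -> geom q (fun n => a (S n)).
Proof.
  intros [A ha]. exists (A * q). intros n. eapply Rle_trans; [apply ha|]. right. simpl. ring.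
Qed.

Section Power_series_algebra.

Context (q : R) (hq : 0 <= q) (z : C) (hz : q * Cmod z < 1).

Lemma geom_terms (a : nat -> R) : geom q a ->
  exists A, geom_bounded (fun n => RtoC (a n) * z ^ n)%C A (q * Cmod z).
Proof.
  intros [A ha]. exists A. apply power_series_bounded; auto. lra.
Qed.

Lemma power_series_plus (a b : nat -> R) : geom q a -> geom q b ->
  power_series (fun n => a n + b n) z = (power_series a z + power_series b z)%C.
Proof.
  intros ha hb. destruct (geom_terms a ha) as [A hA]. destruct (geom_terms b hb) as [B hB].
  unfold power_series. rewrite <- (Csum_plus _ _ A B _ hA hB). apply Csum_ext.
  intros n. rewrite RtoC_plus. ring.
Qed.

Lemma power_series_scal (c : R) (a : nat -> R) : geom q a ->
  power_series (fun n => c * a n) z = (RtoC c * power_series a z)%C.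
Proof.
  intros ha. destruct (geom_terms a ha) as [A hA].
  unfold power_series. rewrite <- (Csum_scal _ _ A _ hA). apply Csum_ext.
  intros n. rewrite RtoC_mult. ring.
Qed.

Lemma power_series_succ (a : nat -> R) : geom q a ->
  power_series a z = (RtoC (a 0%nat) + z * power_series (fun n => a (S n)) z)%C.
Proof.
  intros ha. destruct (geom_terms a ha) as [A hA].
  destruct (geom_terms _ (geom_succ q a ha)) as [B hB].
  unfold power_series. rewrite (Csum_incr _ A _ hA), <- (Csum_scal _ _ B _ hB).
  f_equal; [simpl; ring|]. apply Csum_ext. intros n. rewrite Cpow_S. ring.
Qed.

(** The powers of [z] are constants here; their real and imaginary parts turn the claim into two
    real series of ratio [q * Cmod z]. *)
Lemma power_series_cderiv (a b : R -> nat -> R) (x A : R) :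
  locally x (fun t => forall n, is_derive (fun t => a t n) t (b t n) /\
    Rabs (a t n) <= A * q ^ n /\ Rabs (b t n) <= A * q ^ n) ->
  cderiv (fun t => power_series (a t) z) x (power_series (b x) z).
Proof.
  intros H. assert (z0 := Cmod_ge_0 z).
  assert (pz : forall n, Rabs (fst (z ^ n)%C) <= Cmod z ^ n /\ Rabs (snd (z ^ n)%C) <= Cmod z ^ n).
  { intros n. rewrite <- Cmod_pow. assert (M := Rmax_Cmod (z ^ n)%C).
    split; (eapply Rle_trans; [|exact M]); [apply Rmax_l | apply Rmax_r]. }
  assert (K : forall g : nat -> R, (forall n, Rabs (g n) <= Cmod z ^ n) ->
    is_derive (fun t => Series (fun n => a t n * g n)) x (Series (fun n => b x n * g n))).
  { intros g hg. apply (is_derive_Series (fun n t => a t n * g n) (fun n t => b t n * g n) x A (q * Cmod z)).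
    - split; [now apply Rmult_le_pos | exact hz].
    - apply filter_imp with (2 := H). intros t ht n. destruct (ht n) as (h1 & h2 & h3).
      split; [|split].
      + assert (D := is_derive_mult_R (fun t => a t n) (fun _ => g n) t _ _ h1 (is_derive_const (g n) t)).
        replace (b t n * g n) with (b t n * g n + a t n * 0) by ring. exact D.
      + rewrite Rabs_mult, Rpow_mult_distr, <- Rmult_assoc.
        apply Rmult_le_compat; auto; apply Rabs_pos.
      + rewrite Rabs_mult, Rpow_mult_distr, <- Rmult_assoc.
        apply Rmult_le_compat; auto; apply Rabs_pos. }
  assert (E1 : forall c n, fst (RtoC c * z ^ n)%C = c * fst (z ^ n)%C) by (intros; simpl; ring).
  assert (E2 : forall c n, snd (RtoC c * z ^ n)%C = c * snd (z ^ n)%C) by (intros; simpl; ring).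
  split; unfold power_series, Csum.
  - change (is_derive (fun t => Series (fun n => fst (RtoC (a t n) * z ^ n)%C)) x
      (Series (fun n => fst (RtoC (b x n) * z ^ n)%C))).
    apply is_derive_ext with (fun t => Series (fun n => a t n * fst (z ^ n)%C)).
    { intros t. apply Series_ext. intros n. symmetry. apply E1. }
    rewrite (Series_ext _ (fun n => b x n * fst (z ^ n)%C) (fun n => E1 (b x n) n)).
    apply K. intros n. apply pz.
  - change (is_derive (fun t => Series (fun n => snd (RtoC (a t n) * z ^ n)%C)) x
      (Series (fun n => snd (RtoC (b x n) * z ^ n)%C))).
    apply is_derive_ext with (fun t => Series (fun n => a t n * snd (z ^ n)%C)).
    { intros t. apply Series_ext. intros n. symmetry. apply E2. }
    rewrite (Series_ext _ (fun n => b x n * snd (z ^ n)%C) (fun n => E2 (b x n) n)).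
    apply K. intros n. apply pz.
Qed.

End Power_series_algebra.

Lemma power_series_ext (a b : nat -> R) (z : C) :
  (forall n, a n = b n) -> power_series a z = power_series b z.
Proof. intros E. apply Csum_ext. intros n. now rewrite E. Qed.

Lemma power_series_single (a : nat -> R) (z : C) : (forall n, a (S n) = 0) ->
  power_series a z = RtoC (a 0%nat).
Proof.
  intros h. unfold power_series, Csum. rewrite !Series_single.
  - simpl. unfold RtoC. f_equal; ring.
  - intros n. rewrite h. simpl. ring.
  - intros n. rewrite h. simpl. ring.
Qed.

Lemma power_series_real (a : nat -> R) (z : R) :
  power_series a (RtoC z) = RtoC (Series (fun n => a n * z ^ n)).
Proof.
  unfold power_series, Csum, RtoC. f_equal.
  - apply Series_ext. intros n. change (z, 0) with (RtoC z). change (a n, 0) with (RtoC (a n)).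
    rewrite <- RtoC_pow. simpl. ring.
  - rewrite (Series_ext _ (fun n => 0 * 0)).
    + rewrite Series_scal_l. ring.
    + intros n. change (z, 0) with (RtoC z). change (a n, 0) with (RtoC (a n)).
      rewrite <- RtoC_pow. simpl. ring.
Qed.

Definition series_loop (a : bool -> bool -> nat -> R) (z : C) : MC :=
  mat2 (power_series (a false false) z) (power_series (a false true) z)
    (power_series (a true false) z) (power_series (a true true) z).

Definition idx (i : nat) : bool := match i with O => false | _ => true end.

Lemma entry_series_loop (a : bool -> bool -> nat -> R) (z : C) (i j : nat) :
  (i < 2)%nat -> (j < 2)%nat -> entry (series_loop a z) i j = power_series (a (idx i) (idx j)) z.
Proof.
  intros hi hj. destruct i as [|[|i]], j as [|[|j]]; try lia; reflexivity.
Qed.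

Lemma power_series_smooth_circle (a : nat -> R) : geom (/ 16) a ->
  forall n t, ex_derive_n (fun s => Re (power_series a (cos s, sin s))) n t /\
    ex_derive_n (fun s => Im (power_series a (cos s, sin s))) n t.
Proof.
  intros [A ha] n t.
  assert (hq : 0 <= / 16 < 1) by lra. split.
  - apply ex_derive_n_ext with (fun s => Series (fun k => a k * cos (INR k * s + 0))).
    + intros s. unfold power_series, Csum, Re. simpl fst. apply Series_ext. intros k.
      rewrite Cexp_pow, Rplus_0_r. simpl. ring.
    + now apply (cos_series_smooth a A (/ 16) 0 hq ha).
  - apply ex_derive_n_ext with (fun s => Series (fun k => a k * cos (INR k * s + - (PI / 2)))).
    + intros s. unfold power_series, Csum, Im. simpl snd. apply Series_ext. intros k.
      rewrite Cexp_pow. simpl.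
      replace (INR k * s + - (PI / 2)) with (- (PI / 2 - INR k * s)) by ring.
      rewrite cos_neg, cos_shift. ring.
    + now apply (cos_series_smooth a A (/ 16) _ hq ha).
Qed.

Lemma Cinv_unit (l : C) : Cmod l = 1 -> (/ l)%C = Cconj l.
Proof.
  intros h. assert (hl : l <> 0) by (apply Cmod_gt_0; lra).
  assert (E := Cmod2_conj l). rewrite h in E.
  replace (Cconj l) with (/ l * (l * Cconj l))%C by (field; exact hl).
  rewrite <- E. replace (1 ^ 2) with 1 by ring. ring.
Qed.

Lemma smooth_loop_entries (g : C -> MC) :
  (forall i j, (i < 2)%nat -> (j < 2)%nat -> forall n t,
    ex_derive_n (fun s => Re (entry (g (cos s, sin s)) i j)) n t /\
    ex_derive_n (fun s => Im (entry (g (cos s, sin s)) i j)) n t) -> smooth_loop g.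
Proof.
  intros H i j n t.
  destruct (Nat.lt_ge_cases i 2) as [hi|hi]; [destruct (Nat.lt_ge_cases j 2) as [hj|hj]|].
  - now apply H.
  - split; apply ex_derive_n_ext with (fun _ => 0); try apply ex_derive_n_const;
      intros s; rewrite entry_ge by auto; reflexivity.
  - split; apply ex_derive_n_ext with (fun _ => 0); try apply ex_derive_n_const;
      intros s; rewrite entry_ge by auto; reflexivity.
Qed.

Lemma holomorphic_of_small_entries (h : C -> MC) :
  (forall i j, (i < 2)%nat -> (j < 2)%nat -> disc_holomorphic (fun w => entry (h w) i j)) ->
  holomorphic_in_disc h.
Proof.
  intros H. apply holomorphic_in_disc_of_entries. intros i j.
  destruct (Nat.lt_ge_cases i 2) as [hi|hi]; [destruct (Nat.lt_ge_cases j 2) as [hj|hj]|].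
  - now apply H.
  - apply disc_holomorphic_ext with (fun _ => zero); [|apply disc_holomorphic_const].
    intros z. rewrite entry_ge by auto. reflexivity.
  - apply disc_holomorphic_ext with (fun _ => zero); [|apply disc_holomorphic_const].
    intros z. rewrite entry_ge by auto. reflexivity.
Qed.

Lemma AdC_e3 (A : MC) : AdC (embed e3) A =
  mat2 (entry A 0 0) (- entry A 0 1)%C (- entry A 1 0)%C (entry A 1 1).
Proof.
  unfold AdC, invC. rewrite mdet_embed.
  replace (mdet e3) with (-1) by (unfold e3; expR; eqR; ring).
  replace (/ RtoC (-1))%C with (RtoC (-1)) by (unfold RtoC, Cinv; simpl; f_equal; field).
  unfold e3. matC; rewrite ?RtoC_m1; ring.
Qed.

Section Series_loop.

Context (a : bool -> bool -> nat -> R) (ha : forall i j, geom (/ 16) (a i j))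
  (hpar : forall i j n, Nat.even n <> Bool.eqb i j -> a i j n = 0).

Lemma series_loop_holomorphic : holomorphic_in_disc (series_loop a).
Proof.
  apply holomorphic_of_small_entries. intros i j hi hj.
  apply disc_holomorphic_ext with (power_series (a (idx i) (idx j))).
  - intros z. now rewrite entry_series_loop.
  - destruct (ha (idx i) (idx j)) as [A hA]. now apply power_series_holomorphic with A.
Qed.

Lemma series_loop_conj (z : C) : mconj (series_loop a (Cconj z)) = series_loop a z.
Proof.
  apply mat_ext; rewrite entry_mconj, !entry_series_loop by lt2;
    rewrite power_series_conj; apply Cconj_conj.
Qed.

(** Conjugation by [e3] changes the sign of the off-diagonal entries, which by [hpar] are the odd
    ones. *)
Lemma series_loop_opp (z : C) : Cmod z <= 1 ->
  series_loop a (- z)%C = AdC (embed e3) (series_loop a z).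
Proof.
  intros hz. rewrite AdC_e3.
  assert (K : forall i j, power_series (a i j) (- z)%C =
    (RtoC (if Bool.eqb i j then 1 else -1) * power_series (a i j) z)%C).
  { intros i j. destruct (ha i j) as [A hA].
    rewrite (power_series_parity (a i j) (negb (Bool.eqb i j)) A (/ 16) 1 z); auto; try lra.
    - f_equal. f_equal. destruct i, j; reflexivity.
    - intros n hn. apply hpar. rewrite hn. destruct i, j; discriminate. }
  unfold series_loop. rewrite !K. simpl Bool.eqb. cbv iota. rewrite RtoC_m1.
  matC.
Qed.

Lemma series_loop_smooth : smooth_loop (series_loop a).
Proof.
  apply smooth_loop_entries. intros i j hi hj n t.
  destruct (power_series_smooth_circle _ (ha (idx i) (idx j)) n t) as [h1 h2].
  split.
  - apply ex_derive_n_ext with (2 := h1). intros s. now rewrite entry_series_loop.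
  - apply ex_derive_n_ext with (2 := h2). intros s. now rewrite entry_series_loop.
Qed.

Lemma series_loop_0 : (forall i j, a i j 0%nat = if Bool.eqb i j then 1 else 0) ->
  series_loop a 0 = one.
Proof.
  intros h0. apply mat_ext; rewrite entry_series_loop, power_series_0, h0 by lt2; reflexivity.
Qed.

Lemma series_loop_G_plus : (forall z, Cmod z = 1 -> mdet (series_loop a z) = RtoC 1) ->
  G_plus (series_loop a).
Proof.
  intros hd. split; [|exact series_loop_holomorphic]. split; [exact series_loop_smooth|].
  intros l hl. split; [now apply hd|]. split; [apply series_loop_conj|].
  apply series_loop_opp. lra.
Qed.

(** On the circle [/ l] is the conjugate of [l], so smoothness follows from the coefficients being
    real; in the chart [/ l] the extension to infinity is the series itself. *)
Lemma series_loop_G_minus : (forall z, Cmod z = 1 -> mdet (series_loop a z) = RtoC 1) ->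
  (forall i j, a i j 0%nat = if Bool.eqb i j then 1 else 0) ->
  G_minus (fun l => series_loop a (/ l)%C).
Proof.
  intros hd h0. split; [split|].
  - apply smooth_loop_entries. intros i j hi hj n t.
    destruct (power_series_smooth_circle _ (ha (idx i) (idx j)) n t) as [h1 h2].
    assert (E : forall s, entry (series_loop a (/ (cos s, sin s))%C) i j =
      Cconj (power_series (a (idx i) (idx j)) (cos s, sin s))).
    { intros s. rewrite entry_series_loop by assumption.
      rewrite Cinv_unit; [apply power_series_conj|]. apply (Cmod_circle s). }
    split.
    + apply ex_derive_n_ext with (2 := h1). intros s. rewrite E. reflexivity.
    + apply ex_derive_n_ext with (fun s => - Im (power_series (a (idx i) (idx j)) (cos s, sin s))).
      * intros s. rewrite E. reflexivity.
      * now apply ex_derive_n_opp.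
  - intros l hl.
    assert (hl0 : l <> 0) by (apply Cmod_gt_0; lra).
    assert (hi : Cmod (/ l) = 1) by (rewrite Cmod_inv, hl by exact hl0; apply Rinv_1).
    split; [now apply hd|]. split.
    + rewrite <- Cinv_conj by exact hl0. apply series_loop_conj.
    + replace (/ - l)%C with (- / l)%C by (field; exact hl0). apply series_loop_opp. lra.
  - exists (series_loop a). split; [exact series_loop_holomorphic|].
    split; [now apply series_loop_0 | reflexivity].
Qed.

End Series_loop.

Lemma bar_entries (A : MC) :
  bar A = mat2 (entry A 1 1) (- entry A 0 1)%C (- entry A 1 0)%C (entry A 0 0).
Proof. matC. Qed.

Lemma disc_holomorphic_bar (h : C -> MC) (i j : nat) : (i < 2)%nat -> (j < 2)%nat ->
  (forall i j, disc_holomorphic (fun w => entry (h w) i j)) ->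
  disc_holomorphic (fun w => entry (bar (h w)) i j).
Proof.
  intros hi hj H.
  destruct i as [|[|i]], j as [|[|j]]; try lia.
  - apply disc_holomorphic_ext with (fun w => entry (h w) 1 1); [|apply H].
    intros z. now rewrite bar_entries.
  - apply disc_holomorphic_ext with (fun w => (- entry (h w) 0 1)%C).
    + intros z. now rewrite bar_entries.
    + apply disc_holomorphic_opp, H.
  - apply disc_holomorphic_ext with (fun w => (- entry (h w) 1 0)%C).
    + intros z. now rewrite bar_entries.
    + apply disc_holomorphic_opp, H.
  - apply disc_holomorphic_ext with (fun w => entry (h w) 0 0); [|apply H].
    intros z. now rewrite bar_entries.
Qed.

Lemma G_plus_bar (g : C -> MC) : G_plus g -> G_plus (fun l => bar (g l)).
Proof.
  intros [[hs hl] hh]. split; [split|].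
  - apply smooth_loop_entries. intros i j hi hj n t.
    destruct i as [|[|i]], j as [|[|j]]; try lia.
    + split; [apply ex_derive_n_ext with (2 := proj1 (hs 1 1 n t)%nat)
      | apply ex_derive_n_ext with (2 := proj2 (hs 1 1 n t)%nat)]; intros s; now rewrite bar_entries.
    + split.
      * apply ex_derive_n_ext with (2 := ex_derive_n_opp _ n t (proj1 (hs 0 1 n t)%nat)).
        intros s. now rewrite bar_entries.
      * apply ex_derive_n_ext with (2 := ex_derive_n_opp _ n t (proj2 (hs 0 1 n t)%nat)).
        intros s. now rewrite bar_entries.
    + split.
      * apply ex_derive_n_ext with (2 := ex_derive_n_opp _ n t (proj1 (hs 1 0 n t)%nat)).
        intros s. now rewrite bar_entries.
      * apply ex_derive_n_ext with (2 := ex_derive_n_opp _ n t (proj2 (hs 1 0 n t)%nat)).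
        intros s. now rewrite bar_entries.
    + split; [apply ex_derive_n_ext with (2 := proj1 (hs 0 0 n t)%nat)
      | apply ex_derive_n_ext with (2 := proj2 (hs 0 0 n t)%nat)]; intros s; now rewrite bar_entries.
  - intros l h. destruct (hl l h) as (h1 & h2 & h3). split; [now rewrite mdet_bar_C|]. split.
    + rewrite <- h2. apply mat_ext; rewrite ?entry_mconj by lt2; rewrite !bar_entries;
        expC; rewrite ?Copp_conj; reflexivity.
    + rewrite h3, !AdC_e3, !bar_entries. matC.
  - apply holomorphic_of_small_entries. intros i j hi hj.
    apply disc_holomorphic_bar; auto. intros i' j'. now apply holomorphic_in_disc_entry.
Qed.

Lemma disc_holomorphic_mmult (g h : C -> MC) (i j : nat) : (i < 2)%nat -> (j < 2)%nat ->
  (forall i j, (i < 2)%nat -> (j < 2)%nat -> disc_holomorphic (fun w => entry (g w) i j)) ->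
  (forall i j, (i < 2)%nat -> (j < 2)%nat -> disc_holomorphic (fun w => entry (h w) i j)) ->
  disc_holomorphic (fun w => entry (mult (g w) (h w)) i j).
Proof.
  intros hi hj Hg Hh.
  apply disc_holomorphic_ext with
    (fun w => entry (g w) i 0 * entry (h w) 0 j + entry (g w) i 1 * entry (h w) 1 j)%C.
  - intros z. now rewrite entryC_mult.
  - exact (disc_holomorphic_plus _ _
      (disc_holomorphic_mult _ _ (Hg i 0%nat hi Nat.lt_0_2) (Hh 0%nat j Nat.lt_0_2 hj))
      (disc_holomorphic_mult _ _ (Hg i 1%nat hi Nat.lt_1_2) (Hh 1%nat j Nat.lt_1_2 hj))).
Qed.

(* [gp0 adj(gp)] and [adj(gm0) gm] agree on the circle, and extend holomorphically to its
   interior and to its exterior. *)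
Lemma birkhoff_unique (g gm gp gp0 k0 : C -> MC) :
  birkhoff g gm gp -> birkhoff g (fun l => k0 (/ l)%C) gp0 ->
  holomorphic_in_disc k0 -> k0 0 = one ->
  (forall z, Cmod z <= 1 -> mdet (k0 z) = RtoC 1) ->
  (forall z, Cmod z <= 1 -> mdet (gp0 z) = RtoC 1) ->
  (forall l, 1 <= Cmod l -> gm l = k0 (/ l)%C) /\ (forall l, Cmod l <= 1 -> gp l = gp0 l).
Proof.
  intros [[[_ sm] [k [hk [k1 hgk]]]] [[[_ sp] hp] E]] [_ [[_ hp0] E0]] hk0 k01 dk dp.
  assert (ez : forall l, Cmod l = 1 -> (/ Cconj l)%C = l).
  { intros l hl. rewrite <- (Cinv_unit l hl). field. apply Cmod_gt_0. lra. }
  assert (hhol : forall i j, (i < 2)%nat -> (j < 2)%nat ->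
    disc_holomorphic (fun z => entry (mult (gp0 z) (bar (gp z))) i j)).
  { intros i j hi hj. apply disc_holomorphic_mmult; auto.
    - intros i' j' _ _. now apply holomorphic_in_disc_entry.
    - intros i' j' hi' hj'. apply disc_holomorphic_bar; auto.
      intros; now apply holomorphic_in_disc_entry. }
  assert (khol : forall i j, (i < 2)%nat -> (j < 2)%nat ->
    disc_holomorphic (fun z => entry (mult (bar (k0 z)) (k z)) i j)).
  { intros i j hi hj. apply disc_holomorphic_mmult; auto.
    - intros i' j' hi' hj'. apply disc_holomorphic_bar; auto.
      intros; now apply holomorphic_in_disc_entry.
    - intros i' j' _ _. now apply holomorphic_in_disc_entry. }
  (* The two factorizations agree on the circle, and there the argument [/ l] of [k0] and [k] is the
     conjugate of [l], as [boundary_conjugate_constant] expects. *)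
  assert (hcirc : forall l, Cmod l = 1 ->
    mult (gp0 l) (bar (gp l)) = mult (bar (k0 (Cconj l))) (k (Cconj l))).
  { intros l hl. rewrite <- (Cinv_unit l hl), <- hgk by lra.
    assert (Q : mult (gm l) (gp l) = mult (k0 (/ l)%C) (gp0 l)) by (rewrite <- E, <- E0 by exact hl; reflexivity).
    apply (f_equal (fun M => mult (bar (k0 (/ l)%C)) (mult M (bar (gp l))))) in Q.
    assert (dgp : mdet (gp l) = RtoC 1) by now apply sp.
    assert (dk0 : mdet (k0 (/ l)%C) = RtoC 1).
    { apply dk. rewrite (Cinv_unit l hl), Cmod_conj. lra. }
    rewrite <- !mult_assoc, mult_bar_C, dgp, mscal_1_C, mult_one_r, bar_cancel_l_C in Q by exact dk0.
    symmetry. exact Q. }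
  assert (k00 : mult (bar (k0 0)) (k 0) = one).
  { rewrite k01, k1. matC. }
  (* Rigidity, entry by entry; the constant is read off at infinity, where both minus factors are
     the identity. *)
  assert (hone : forall z, Cmod z <= 1 -> mult (gp0 z) (bar (gp z)) = one).
  { intros z hz. rewrite <- k00.
    assert (B : forall i j, (i < 2)%nat -> (j < 2)%nat ->
      entry (mult (gp0 z) (bar (gp z))) i j = entry (mult (bar (k0 0)) (k 0)) i j).
    { intros i j hi hj.
      apply (boundary_conjugate_constant (fun z => entry (mult (gp0 z) (bar (gp z))) i j)
        (fun z => entry (mult (bar (k0 z)) (k z)) i j)); auto.
      intros l hl. now rewrite hcirc. }
    apply mat_ext; apply B; lt2. }
  assert (kone : forall z, Cmod z <= 1 -> mult (bar (k0 z)) (k z) = one).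
  { intros z hz. rewrite <- (hone 0) by (rewrite Cmod_0; lra).
    assert (B : forall i j, (i < 2)%nat -> (j < 2)%nat ->
      entry (mult (bar (k0 z)) (k z)) i j = entry (mult (gp0 0) (bar (gp 0))) i j).
    { intros i j hi hj.
      apply (boundary_conjugate_constant (fun z => entry (mult (bar (k0 z)) (k z)) i j)
        (fun z => entry (mult (gp0 z) (bar (gp z))) i j)); auto.
      intros l hl. rewrite hcirc by now rewrite Cmod_conj. now rewrite Cconj_conj. }
    apply mat_ext; apply B; lt2. }
  split.
  - intros l hl. rewrite hgk by exact hl.
    assert (hl0 : l <> 0) by (apply Cmod_gt_0; lra).
    assert (hi : Cmod (/ l) <= 1).
    { rewrite Cmod_inv by exact hl0. rewrite <- Rinv_1. apply Rinv_le_contravar; lra. }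
    change (Cinv l) with (/ l)%C.
    rewrite <- (bar_cancel_r_C (k0 (/ l)%C) (k (/ l)%C)) by now apply dk.
    rewrite kone by exact hi. apply mult_one_r.
  - intros l hl. rewrite <- (bar_bar_C (gp l)).
    assert (Q : bar (gp l) = bar (gp0 l)).
    { rewrite <- (bar_cancel_l_C (gp0 l) (bar (gp l))) by now apply dp.
      rewrite hone by exact hl. apply mult_one_r. }
    rewrite Q. apply bar_bar_C.
Qed.

(** * The extended frame *)

Lemma cderiv_real (f : R -> R) (x l : R) : is_derive f x l ->
  cderiv (fun t => RtoC (f t)) x (RtoC l).
Proof. intros H. split; [exact H | apply (is_derive_const 0)]. Qed.

Lemma is_derive_unif (f : R -> R) (x a b : R) : is_derive f x a -> a = b -> is_derive f x b.
Proof. now intros H <-. Qed.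

Lemma locally_le_of_continuous (f : R -> R) (x : R) : continuous f x ->
  locally x (fun t => Rabs (f t) <= Rabs (f x) + 1).
Proof.
  intros H. destruct (proj1 (filterlim_locally _ _) H (mkposreal 1 Rlt_0_1)) as [d hd].
  exists d. intros t ht. assert (Q := hd t ht). change (Rabs (f t - f x) < 1) in Q.
  assert (T := Rabs_triang_inv (f t) (f x)). lra.
Qed.

Section Frame.

Context (I : R -> Prop) (hI : is_open_interval I) (c P : R -> R)
  (hc : forall x, I x -> continuous c x) (hc1 : forall x, I x -> 1 <= c x)
  (hP : forall x, I x -> is_derive P x (c x)) (eps : R) (heps : 0 < eps <= / 10)
  (rho : R) (hrho : 1 <= rho) (hsmall : 9 * eps * rho <= / 16).

Let Om := near_diag I P eps.
Let hS : starlike Om := near_diag_starlike I hI c P hc1 hP eps.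
Let hO : open Om := proj1 hS.

Lemma eps_rho_lt (z : C) : Cmod z <= rho -> 9 * eps * Cmod z < 1.
Proof. intros h. assert (z0 := Cmod_ge_0 z). nra. Qed.

(** The lemmas on linear equations run along intervals; monotonicity of [P] makes the sections of
    [Om] intervals. *)
Lemma near_diag_section_x_convex (y a b t : R) : Om (a, y) -> Om (b, y) -> a <= t <= b -> Om (t, y).
Proof.
  intros [ha [hy h1]] [hb [_ h2]] ht. simpl in *.
  assert (it : I t) by now apply (proj2 hI) with a b.
  assert (P a <= P t) by (apply (primitive_incr I hI c P hc1 hP); auto; lra).
  assert (P t <= P b) by (apply (primitive_incr I hI c P hc1 hP); auto; lra).
  apply Rabs_lt_between in h1. apply Rabs_lt_between in h2.
  split; [|split]; auto. simpl. apply Rabs_lt_between. lra.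
Qed.

Lemma near_diag_section_y_convex (x a b t : R) : Om (x, a) -> Om (x, b) -> a <= t <= b -> Om (x, t).
Proof.
  intros ha hb ht. apply near_diag_swap. apply near_diag_section_x_convex with a b; auto;
    now apply near_diag_swap.
Qed.

Section Iterated_series.

Context (u v : R -> R -> R) (hu : Ck 0 Om u) (hv : Ck 0 Om v)
  (bu : forall x y, Om (x, y) -> Rabs (u x y) <= 9 * c y)
  (bv : forall x y, Om (x, y) -> Rabs (v x y) <= 9 * c y).

Lemma iterint_geom (i j : bool) (x y : R) : Om (x, y) ->
  geom (9 * eps) (fun n => iterint u v i n j x y).
Proof.
  intros h. exists 1. intros n. rewrite Rmult_1_l.
  now apply (iterint_bound I hI c P hc hc1 hP eps heps u v hu hv bu bv).
Qed.

Lemma iterint_geom_16 (i j : bool) (x y : R) : Om (x, y) ->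
  geom (/ 16) (fun n => iterint u v i n j x y).
Proof.
  intros h. exists 1. intros n. rewrite Rmult_1_l.
  eapply Rle_trans; [now apply (iterint_bound I hI c P hc hc1 hP eps heps u v hu hv bu bv)|].
  apply pow_incr. nra.
Qed.

Lemma iterint_pred_geom (i j : bool) (x y : R) : Om (x, y) ->
  geom (9 * eps) (fun n => iterint_pred u v i n j x y).
Proof.
  intros h. exists (/ (9 * eps)). intros [|n].
  - simpl. rewrite Rabs_R0, Rmult_1_r. left. apply Rinv_0_lt_compat. lra.
  - replace (/ (9 * eps) * (9 * eps) ^ S n) with ((9 * eps) ^ n) by (simpl; field; lra).
    now apply (iterint_bound I hI c P hc hc1 hP eps heps u v hu hv bu bv).
Qed.

Lemma power_series_pred (i j : bool) (x y : R) (z : C) : Om (x, y) -> Cmod z <= rho ->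
  power_series (fun n => iterint_pred u v i n j x y) z =
  (z * power_series (fun n => iterint u v i n j x y) z)%C.
Proof.
  intros h hz. rewrite (power_series_succ (9 * eps) ltac:(lra) z (eps_rho_lt z hz));
    [|now apply iterint_pred_geom].
  simpl. apply Cplus_0_l.
Qed.

Lemma iterint_series_derive_y (i j : bool) (x y : R) (z : C) : Om (x, y) -> Cmod z <= rho ->
  cderiv (fun t => power_series (fun n => iterint u v i n j x t) z) y
    (z * power_series (fun n => iterint u v i n (negb j) x y) z * RtoC ((if j then u else v) x y))%C.
Proof.
  intros h hz. set (q := 9 * eps) in *. assert (hq : 0 < q < 1) by (unfold q; lra).
  eapply cderiv_eq.
  - apply (power_series_cderiv q ltac:(lra) z (eps_rho_lt z hz) (fun t n => iterint u v i n j x t)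
      (fun t n => iterint_pred u v i n (negb j) x t * (if j then u else v) x t) y
      (1 + 9 * (Rabs (c y) + 1) / q)).
    assert (hB : 0 <= 9 * (Rabs (c y) + 1) / q).
    { apply Rdiv_le_0_compat; [|lra]. generalize (Rabs_pos (c y)). lra. }
    assert (L1 := open_section_y Om x y hO h).
    assert (L2 := locally_le_of_continuous c y (hc y (proj1 (proj2 h)))).
    apply filter_imp with (2 := filter_and _ _ L1 L2). intros t [ht hct] n.
    assert (pn : 0 <= q ^ n) by (apply pow_le; lra).
    split; [|split].
    + apply (iterint_derive_y I hI c P hc1 hP eps u v hu hv i n j x t ht).
    + assert (B := iterint_bound I hI c P hc hc1 hP eps heps u v hu hv bu bv i n j x t ht).
      fold q in B. nra.
    + rewrite Rabs_mult.
      assert (B1 : Rabs (iterint_pred u v i n (negb j) x t) <= q ^ n / q).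
      { destruct n as [|n].
        - simpl. rewrite Rabs_R0. apply Rdiv_le_0_compat; lra.
        - replace (q ^ S n / q) with (q ^ n) by (simpl; field; lra).
          now apply (iterint_bound I hI c P hc hc1 hP eps heps u v hu hv bu bv). }
      assert (B2 : Rabs ((if j then u else v) x t) <= 9 * (Rabs (c y) + 1)).
      { assert (Q : Rabs ((if j then u else v) x t) <= 9 * c t) by (destruct j; auto).
        generalize (Rle_abs (c t)). lra. }
      apply Rle_trans with (q ^ n / q * (9 * (Rabs (c y) + 1))).
      * apply Rmult_le_compat; auto; apply Rabs_pos.
      * replace (q ^ n / q * (9 * (Rabs (c y) + 1))) with (9 * (Rabs (c y) + 1) / q * q ^ n) by (field; lra).
        lra.
  - rewrite (power_series_ext _ (fun n => (if j then u else v) x y * iterint_pred u v i n (negb j) x y))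
      by (intros; ring).
    rewrite (power_series_scal q ltac:(lra) z (eps_rho_lt z hz)) by now apply iterint_pred_geom.
    rewrite power_series_pred by assumption. ring.
Qed.

Lemma iterint_series_diag (i j : bool) (x : R) (z : C) :
  power_series (fun n => iterint u v i n j x x) z = RtoC (if Bool.eqb i j then 1 else 0).
Proof.
  rewrite power_series_single; [reflexivity|]. intros n. apply from_diag_diag.
Qed.

Lemma iterint_series_Ck_0 (i j : bool) (z : R) : Rabs z <= rho ->
  Ck 0 Om (fun x y => Series (fun n => iterint u v i n j x y * z ^ n)).
Proof.
  intros hz. apply (Ck_0_Series Om (fun n x y => iterint u v i n j x y * z ^ n) 1 (9 * eps * rho)); auto.
  - split; [|lra]. apply Rmult_le_pos; lra.
  - intros n. apply Ck_mult; [exact hO| |apply Ck_const, hO].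
    apply (iterint_Ck I hI c P hc1 hP eps u v hu hv).
  - intros n x y h. rewrite Rabs_mult, Rmult_1_l, Rpow_mult_distr, <- RPow_abs.
    apply Rmult_le_compat; try apply Rabs_pos.
    + apply pow_le, Rabs_pos.
    + now apply (iterint_bound I hI c P hc hc1 hP eps heps u v hu hv bu bv).
    + apply pow_incr. split; [apply Rabs_pos | exact hz].
Qed.

End Iterated_series.

Context (k r s u0 v0 : R -> R)
  (sk : smooth1 I k) (sr : smooth1 I r) (ss : smooth1 I s)
  (su : smooth1 I u0) (sv : smooth1 I v0)
  (brs : forall x, I x -> Rabs (r x) + Rabs (s x) <= c x)
  (buv : forall x, I x -> Rabs (u0 x) + Rabs (v0 x) <= c x)
  (w p : R -> R -> R) (Cw : forall n, Ck n Om w) (Cp : forall n, Ck n Om p)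
  (bw : forall x y, Om (x, y) -> Rabs (w x y) <= 1)
  (wx : forall x y, Om (x, y) -> is_derive (fun t => w t y) x (p x y))
  (py : forall x y, Om (x, y) -> is_derive (fun t => p x t) y
     (s x * u0 y * exp (2 * w x y) - r x * v0 y * exp (- 2 * w x y)))
  (wd : forall x, I x -> w x x = 0) (pd : forall x, I x -> p x x = k x).

Definition uu (x y : R) : R := u0 y * exp (2 * w x y).
Definition vv (x y : R) : R := v0 y * exp (- 2 * w x y).
(** The arguments are swapped because [iterint] integrates over its second one. The exponentials
    come from the gauge [diag (exp (- w), exp w)], which removes the diagonal part of [form_x]. *)
Definition ut (a b : R) : R := r b * exp (- 2 * w b a).
Definition vt (a b : R) : R := s b * exp (2 * w b a).

Lemma exp_w_bound (x y : R) : Om (x, y) ->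
  Rabs (exp (2 * w x y)) <= 9 /\ Rabs (exp (- 2 * w x y)) <= 9.
Proof.
  intros h. assert (Q := bw x y h). apply Rabs_le_between in Q.
  destruct (exp_le_9 (2 * w x y)) as [h1 h2]; [lra|].
  destruct (exp_le_9 (- 2 * w x y)) as [h3 h4]; [lra|].
  rewrite !Rabs_pos_eq by lra. lra.
Qed.

Lemma Ck_exp_w (n : nat) (a : R) : Ck n Om (fun x y => exp (a * w x y)).
Proof.
  apply Ck_exp; [exact hO|]. apply Ck_mult; [exact hO|apply Ck_const, hO|apply Cw].
Qed.

Lemma Ck_Om_fst (n : nat) (g : R -> R) : smooth1 I g -> Ck n Om (fun x _ => g x).
Proof.
  intros hg. apply Ck_fst with I; [exact hO | | exact hg]. intros x y h. apply h.
Qed.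

Lemma Ck_Om_snd (n : nat) (g : R -> R) : smooth1 I g -> Ck n Om (fun _ y => g y).
Proof.
  intros hg. apply Ck_snd with I; [exact hO | | exact hg]. intros x y h. apply h.
Qed.

Lemma uu_Ck (n : nat) : Ck n Om uu.
Proof. apply Ck_mult; [exact hO|now apply Ck_Om_snd|apply Ck_exp_w]. Qed.

Lemma vv_Ck (n : nat) : Ck n Om vv.
Proof. apply Ck_mult; [exact hO|now apply Ck_Om_snd|apply Ck_exp_w]. Qed.

Lemma ut_Ck (n : nat) : Ck n Om ut.
Proof.
  apply Ck_mult; [exact hO|now apply Ck_Om_snd|].
  apply (Ck_swap_near I P eps n (fun x y => exp (- 2 * w x y))). apply Ck_exp_w.
Qed.

Lemma vt_Ck (n : nat) : Ck n Om vt.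
Proof.
  apply Ck_mult; [exact hO|now apply Ck_Om_snd|].
  apply (Ck_swap_near I P eps n (fun x y => exp (2 * w x y))). apply Ck_exp_w.
Qed.

Lemma bound_9 (a b cc : R) : Rabs a <= cc -> Rabs b <= 9 -> Rabs (a * b) <= 9 * cc.
Proof.
  intros ha hb. rewrite Rabs_mult, (Rmult_comm 9).
  apply Rmult_le_compat; auto; apply Rabs_pos.
Qed.

Lemma uu_bound (x y : R) : Om (x, y) -> Rabs (uu x y) <= 9 * c y.
Proof.
  intros h. apply bound_9; [|now apply exp_w_bound].
  generalize (buv y (proj1 (proj2 h))) (Rabs_pos (v0 y)). lra.
Qed.

Lemma vv_bound (x y : R) : Om (x, y) -> Rabs (vv x y) <= 9 * c y.
Proof.
  intros h. apply bound_9; [|now apply exp_w_bound].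
  generalize (buv y (proj1 (proj2 h))) (Rabs_pos (u0 y)). lra.
Qed.

Lemma ut_bound (x y : R) : Om (x, y) -> Rabs (ut x y) <= 9 * c y.
Proof.
  intros h. apply bound_9; [|apply exp_w_bound; now apply near_diag_swap].
  generalize (brs y (proj1 (proj2 h))) (Rabs_pos (s y)). lra.
Qed.

Lemma vt_bound (x y : R) : Om (x, y) -> Rabs (vt x y) <= 9 * c y.
Proof.
  intros h. apply bound_9; [|apply exp_w_bound; now apply near_diag_swap].
  generalize (brs y (proj1 (proj2 h))) (Rabs_pos (r y)). lra.
Qed.

Lemma uu_derive_x (x y : R) : Om (x, y) -> is_derive (fun t => uu t y) x (2 * p x y * uu x y).
Proof.
  intros h. assert (D := wx x y h). unfold uu. set (f := fun t => w t y) in D.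
  change (is_derive (fun t => u0 y * exp (2 * f t)) x (2 * p x y * (u0 y * exp (2 * f x)))).
  auto_derive; [repeat split; eexists; exact D|].
  change (Derive (fun x0 : R => f x0) x) with (Derive f x).
  rewrite (is_derive_unique f x _ D). ring.
Qed.

Lemma vv_derive_x (x y : R) : Om (x, y) -> is_derive (fun t => vv t y) x (- 2 * p x y * vv x y).
Proof.
  intros h. assert (D := wx x y h). unfold vv. set (f := fun t => w t y) in D.
  change (is_derive (fun t => v0 y * exp (- 2 * f t)) x (- 2 * p x y * (v0 y * exp (- 2 * f x)))).
  auto_derive; [repeat split; eexists; exact D|].
  change (Derive (fun x0 : R => f x0) x) with (Derive f x).
  rewrite (is_derive_unique f x _ D). ring.
Qed.

Lemma p_derive_y (x y : R) : Om (x, y) ->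
  is_derive (fun t => p x t) y (s x * uu x y - r x * vv x y).
Proof.
  intros h. apply is_derive_unif with (1 := py x y h). unfold uu, vv. ring.
Qed.

Lemma uu_diag (x : R) : I x -> uu x x = u0 x.
Proof. intros h. unfold uu. rewrite wd, Rmult_0_r, exp_0 by exact h. ring. Qed.

Lemma vv_diag (x : R) : I x -> vv x x = v0 x.
Proof. intros h. unfold vv. rewrite wd, Rmult_0_r, exp_0 by exact h. ring. Qed.

Definition minus_coeff (x y : R) (i j : bool) (n : nat) : R := iterint uu vv i n j x y.

(* [minus_factor x y (/ l)] and the inverse of [plus_factor x y l] are the Birkhoff factors. *)
Definition minus_factor (x y : R) (z : C) : MC := series_loop (minus_coeff x y) z.

Definition gauge (j : bool) (x y : R) : R := if j then exp (w x y) else exp (- w x y).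

Definition plus_coeff (x y : R) (i j : bool) (n : nat) : R := gauge j x y * iterint ut vt i n j y x.

Definition plus_factor (x y : R) (l : C) : MC := series_loop (plus_coeff x y) l.

Definition form_x (l : C) (x y : R) : MC :=
  mat2 (- RtoC (p x y))%C (l * RtoC (r x))%C (l * RtoC (s x))%C (RtoC (p x y)).

Definition form_y (l : C) (x y : R) : MC :=
  mat2 (RtoC 0) (/ l * RtoC (uu x y))%C (/ l * RtoC (vv x y))%C (RtoC 0).

Definition form_diag (l : C) (x : R) : MC :=
  mat2 (- RtoC (k x))%C (l * RtoC (r x) + / l * RtoC (u0 x))%C
    (l * RtoC (s x) + / l * RtoC (v0 x))%C (RtoC (k x)).

Lemma mderivC_of_entries (A : R -> MC) (x : R) (a b cc d : C) :
  cderiv (fun t => entry (A t) 0 0) x a -> cderiv (fun t => entry (A t) 0 1) x b ->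
  cderiv (fun t => entry (A t) 1 0) x cc -> cderiv (fun t => entry (A t) 1 1) x d ->
  mderivC A x (mat2 a b cc d).
Proof.
  intros h1 h2 h3 h4 i j hi hj. destruct i as [|[|i]], j as [|[|j]]; try lia; assumption.
Qed.

Lemma minus_factor_derive_y (l : C) (x y : R) : Om (x, y) -> Cmod (/ l) <= rho ->
  mderivC (fun t => minus_factor x t (/ l)%C) y (mult (minus_factor x y (/ l)%C) (form_y l x y)).
Proof.
  intros h hz.
  assert (D := fun i j => iterint_series_derive_y uu vv (uu_Ck 0) (vv_Ck 0) uu_bound vv_bound i j x y (/ l)%C h hz).
  replace (mult (minus_factor x y (/ l)%C) (form_y l x y)) with
    (mat2 (/ l * power_series (minus_coeff x y false true) (/ l) * RtoC (vv x y))%C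
      (/ l * power_series (minus_coeff x y false false) (/ l) * RtoC (uu x y))%C
      (/ l * power_series (minus_coeff x y true true) (/ l) * RtoC (vv x y))%C
      (/ l * power_series (minus_coeff x y true false) (/ l) * RtoC (uu x y))%C).
  - apply mderivC_of_entries; [exact (D false false)|exact (D false true)|exact (D true false)|exact (D true true)].
  - unfold form_y, minus_factor, series_loop. matC.
Qed.

(** Sums [iterint_x] against powers of [/ l]. Raising the index by one multiplies the series by [l]
    after removal of its constant term, whence the last summand; for [i <> j] its two coefficients
    coincide, so it vanishes. *)
Lemma minus_coeff_series_x (i j : bool) (l : C) (x y : R) : Om (x, y) -> l <> 0 -> Cmod (/ l) <= rho ->
  cderiv (fun t => power_series (minus_coeff t y i j) (/ l)) x
   (RtoC (p x y * sgn j - k x * sgn i) * power_series (minus_coeff x y i j) (/ l)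
    + RtoC ((if j then r else s) x) * (l * power_series (minus_coeff x y i (negb j)) (/ l))
    - RtoC ((if i then s else r) x) * (l * power_series (minus_coeff x y (negb i) j) (/ l))
    - RtoC ((if i then v0 else u0) x) * (/ l * power_series (minus_coeff x y (negb i) j) (/ l))
    - l * RtoC (if Bool.eqb i j then 0 else (if j then r else s) x - (if i then s else r) x))%C.
Proof.
  intros h hl hz. set (q := 9 * eps). assert (hq : 0 < q < 1) by (unfold q; lra).
  assert (hz1 := eps_rho_lt _ hz). fold q in hz1.
  destruct (iterint_x_bound I hI c P hc hc1 hP eps heps uu vv (uu_Ck 0) (vv_Ck 0) uu_bound vv_bound
    p k r s u0 v0 sk sr ss su sv (Cp 0%nat) x y h) as (d & A & HA).
  eapply cderiv_eq.
  - apply (power_series_cderiv q ltac:(lra) _ hz1 (fun t n => minus_coeff t y i j n)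
      (fun t n => iterint_x uu vv p k r s u0 v0 i n j t y) x (1 + Rabs A)).
    exists d. intros t ht n. destruct (HA t ht) as [ht' Hb].
    assert (pn : 0 <= q ^ n) by (apply pow_le; lra).
    split; [|split].
    + apply (iterint_derive_x I hI c P hc1 hP eps uu vv (uu_Ck 0) (vv_Ck 0)
        p k r s u0 v0 sk sr ss su sv (Cp 0%nat) uu_derive_x vv_derive_x p_derive_y pd uu_diag vv_diag); auto.
    + assert (B := iterint_bound I hI c P hc hc1 hP eps heps uu vv (uu_Ck 0) (vv_Ck 0) uu_bound vv_bound i n j t y ht').
      fold q in B. unfold minus_coeff. generalize (Rabs_pos A). nra.
    + eapply Rle_trans; [apply Hb|]. fold q. apply Rmult_le_compat_r; auto.
      generalize (Rle_abs A). lra.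
  - assert (g0 : forall i j, geom q (minus_coeff x y i j)).
    { intros i' j'. now apply (iterint_geom uu vv (uu_Ck 0) (vv_Ck 0) uu_bound vv_bound). }
    assert (g1 : forall i j, geom q (fun n => minus_coeff x y i j (S n))) by (intros; now apply geom_succ).
    assert (g2 : forall i j, geom q (fun n => iterint_pred uu vv i n j x y)).
    { intros i' j'. now apply (iterint_pred_geom uu vv (uu_Ck 0) (vv_Ck 0) uu_bound vv_bound). }
    rewrite (power_series_ext _ (fun n => (p x y * sgn j - k x * sgn i) * minus_coeff x y i j n
      + (if j then r else s) x * minus_coeff x y i (negb j) (S n)
      + - (if i then s else r) x * minus_coeff x y (negb i) j (S n)
      + - (if i then v0 else u0) x * iterint_pred uu vv (negb i) n j x y)).
    2:{ intros n. unfold iterint_x, minus_coeff. ring. }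
    assert (hq0 : 0 <= q) by lra.
    rewrite (power_series_plus q hq0 _ hz1 (fun n => _ + _) (fun n => _ * iterint_pred uu vv (negb i) n j x y));
      [|repeat apply geom_plus; now apply geom_scal|now apply geom_scal].
    rewrite (power_series_plus q hq0 _ hz1 (fun n => _ + _) (fun n => _ * minus_coeff x y (negb i) j (S n)));
      [|repeat apply geom_plus; now apply geom_scal|now apply geom_scal].
    rewrite (power_series_plus q hq0 _ hz1 (fun n => _ * minus_coeff x y i j n) (fun n => _ * minus_coeff x y i (negb j) (S n)));
      [|now apply geom_scal|now apply geom_scal].
    rewrite !(power_series_scal q hq0 _ hz1) by auto.
    assert (succ : forall i j, (power_series (fun n => minus_coeff x y i j (S n)) (/ l) =
      l * (power_series (minus_coeff x y i j) (/ l) - RtoC (if Bool.eqb i j then 1 else 0)))%C).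
    { intros i' j'. rewrite (power_series_succ q hq0 _ hz1 (minus_coeff x y i' j') (g0 i' j')).
      change (minus_coeff x y i' j' 0%nat) with (if Bool.eqb i' j' then 1 else 0).
      set (T := power_series (fun n => minus_coeff x y i' j' (S n)) (/ l)). field. exact hl. }
    rewrite !succ.
    rewrite (power_series_pred uu vv (uu_Ck 0) (vv_Ck 0) uu_bound vv_bound (negb i) j x y _ h hz).
    change (fun n => iterint uu vv (negb i) n j x y) with (minus_coeff x y (negb i) j).
    rewrite !RtoC_opp. destruct i, j; simpl negb; simpl Bool.eqb; cbv iota; rewrite ?RtoC_minus; ring.
Qed.

Lemma minus_factor_derive_x (l : C) (x y : R) : Om (x, y) -> l <> 0 -> Cmod (/ l) <= rho ->
  mderivC (fun t => minus_factor t y (/ l)%C) x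
    (minus (mult (minus_factor x y (/ l)%C) (form_x l x y))
      (mult (form_diag l x) (minus_factor x y (/ l)%C))).
Proof.
  intros h hl hz.
  assert (D := fun i j => minus_coeff_series_x i j l x y h hl hz).
  match goal with |- mderivC _ _ ?M => replace M with
    (mat2 (entry M 0 0) (entry M 0 1) (entry M 1 0) (entry M 1 1)) by (apply mat_ext; reflexivity) end.
  apply mderivC_of_entries.
  - eapply cderiv_eq; [exact (D false false)|]. unfold form_x, form_diag, minus_factor, series_loop, sgn.
    expC. simpl negb; simpl Bool.eqb; cbv iota. rewrite ?RtoC_minus, ?RtoC_mult, RtoC_m1. eqC. ring.
  - eapply cderiv_eq; [exact (D false true)|]. unfold form_x, form_diag, minus_factor, series_loop, sgn.
    expC. simpl negb; simpl Bool.eqb; cbv iota. rewrite ?RtoC_minus, ?RtoC_mult, RtoC_m1. eqC. ring.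
  - eapply cderiv_eq; [exact (D true false)|]. unfold form_x, form_diag, minus_factor, series_loop, sgn.
    expC. simpl negb; simpl Bool.eqb; cbv iota. rewrite ?RtoC_minus, ?RtoC_mult, RtoC_m1. eqC. ring.
  - eapply cderiv_eq; [exact (D true true)|]. unfold form_x, form_diag, minus_factor, series_loop, sgn.
    expC. simpl negb; simpl Bool.eqb; cbv iota. rewrite ?RtoC_minus, ?RtoC_mult. eqC. ring.
Qed.

Lemma gauge_derive_x (j : bool) (x y : R) : Om (x, y) ->
  is_derive (fun t => gauge j t y) x (sgn j * p x y * gauge j x y).
Proof.
  intros h. assert (D := wx x y h). unfold gauge, sgn. set (f := fun t => w t y) in D.
  destruct j.
  - change (is_derive (fun t => exp (f t)) x (1 * p x y * exp (f x))).
    auto_derive; [repeat split; eexists; exact D|].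
    change (Derive (fun x0 : R => f x0) x) with (Derive f x).
    rewrite (is_derive_unique f x _ D). ring.
  - change (is_derive (fun t => exp (- f t)) x (- 1 * p x y * exp (- f x))).
    auto_derive; [repeat split; eexists; exact D|].
    change (Derive (fun x0 : R => f x0) x) with (Derive f x).
    rewrite (is_derive_unique f x _ D). ring.
Qed.

Lemma plus_coeff_series (i j : bool) (l : C) (x y : R) : Om (x, y) -> Cmod l <= rho ->
  power_series (plus_coeff x y i j) l =
  (RtoC (gauge j x y) * power_series (fun n => iterint ut vt i n j y x) l)%C.
Proof.
  intros h hz. apply (power_series_scal (9 * eps) ltac:(lra) l (eps_rho_lt l hz)).
  apply (iterint_geom ut vt (ut_Ck 0) (vt_Ck 0) ut_bound vt_bound). now apply near_diag_swap.
Qed.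

(** The gauge contributes the diagonal part of [form_x], the iterated integrals the part linear in
    [l]. *)
Lemma plus_factor_derive_x (l : C) (x y : R) : Om (x, y) -> Cmod l <= rho ->
  mderivC (fun t => plus_factor t y l) x (mult (plus_factor x y l) (form_x l x y)).
Proof.
  intros h hz.
  assert (h' : Om (y, x)) by now apply near_diag_swap.
  assert (D : forall i j, cderiv (fun t => power_series (plus_coeff t y i j) l) x
    (RtoC (sgn j * p x y) * power_series (plus_coeff x y i j) l
     + l * RtoC ((if j then r else s) x) * power_series (plus_coeff x y i (negb j)) l)%C).
  { intros i j.
    assert (Dg := cderiv_real _ x _ (gauge_derive_x j x y h)).
    assert (Di := iterint_series_derive_y ut vt (ut_Ck 0) (vt_Ck 0) ut_bound vt_bound i j y x l h' hz).
    assert (Dm := cderiv_mult _ _ _ _ _ Dg Di).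
    rewrite !plus_coeff_series by assumption.
    assert (E : locally x (fun t => (RtoC (gauge j t y) * power_series (fun n => iterint ut vt i n j y t) l)%C
      = power_series (plus_coeff t y i j) l)).
    { apply filter_imp with (2 := open_section_x Om x y hO h). intros t ht.
      symmetry. now apply plus_coeff_series. }
    assert (Dm' : cderiv (fun t => power_series (plus_coeff t y i j) l) x
      (RtoC (sgn j * p x y * gauge j x y) * power_series (fun n => iterint ut vt i n j y x) l
      + RtoC (gauge j x y) * (l * power_series (fun n => iterint ut vt i n (negb j) y x) l *
         RtoC ((if j then ut else vt) y x)))%C).
    { split.
      - apply is_derive_ext_loc with (2 := proj1 Dm). apply filter_imp with (2 := E).
        intros t ht. now rewrite ht.
      - apply is_derive_ext_loc with (2 := proj2 Dm). apply filter_imp with (2 := E).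
        intros t ht. now rewrite ht. }
    apply cderiv_eq with (1 := Dm').
    (* Moving the diagonal gauge past an off-diagonal matrix; this identity dictates the exponents
       in [ut] and [vt]. *)
    assert (G : gauge j x y * (if j then ut else vt) y x = (if j then r else s) x * gauge (negb j) x y).
    { unfold gauge, ut, vt. destruct j; simpl negb; cbv iota.
      - replace (- w x y) with (w x y + - 2 * w x y) by ring. rewrite exp_plus. ring.
      - replace (w x y) with (- w x y + 2 * w x y) at 3 by ring. rewrite exp_plus. ring. }
    transitivity ((RtoC (sgn j * p x y * gauge j x y) * power_series (fun n => iterint ut vt i n j y x) l
      + RtoC (gauge j x y * (if j then ut else vt) y x) *
         (l * power_series (fun n => iterint ut vt i n (negb j) y x) l))%C).
    { rewrite RtoC_mult. rewrite !RtoC_mult. ring. }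
    rewrite G, !RtoC_mult. ring. }
  match goal with |- mderivC _ _ ?M => replace M with
    (mat2 (entry M 0 0) (entry M 0 1) (entry M 1 0) (entry M 1 1)) by (apply mat_ext; reflexivity) end.
  apply mderivC_of_entries.
  - eapply cderiv_eq; [exact (D false false)|]. unfold form_x, plus_factor, series_loop, sgn.
    expC. simpl negb; cbv iota. rewrite RtoC_mult, RtoC_m1. eqC. ring.
  - eapply cderiv_eq; [exact (D false true)|]. unfold form_x, plus_factor, series_loop, sgn.
    expC. simpl negb; cbv iota. rewrite RtoC_mult. eqC. ring.
  - eapply cderiv_eq; [exact (D true false)|]. unfold form_x, plus_factor, series_loop, sgn.
    expC. simpl negb; cbv iota. rewrite RtoC_mult, RtoC_m1. eqC. ring.
  - eapply cderiv_eq; [exact (D true true)|]. unfold form_x, plus_factor, series_loop, sgn.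
    expC. simpl negb; cbv iota. rewrite RtoC_mult. eqC. ring.
Qed.

Lemma minus_factor_diag (x : R) (z : C) : minus_factor x x z = one.
Proof.
  apply mat_ext; unfold minus_factor; rewrite entry_series_loop by lt2;
    unfold minus_coeff; rewrite iterint_series_diag; reflexivity.
Qed.

Lemma plus_factor_diag (x : R) (l : C) : I x -> Cmod l <= rho -> plus_factor x x l = one.
Proof.
  intros hx hl. assert (h : Om (x, x)) by now apply near_diag_diag.
  apply mat_ext; unfold plus_factor; rewrite entry_series_loop by lt2;
    rewrite plus_coeff_series by assumption; rewrite iterint_series_diag; unfold gauge; simpl;
    rewrite wd by exact hx; rewrite ?Ropp_0, exp_0; eqC; change (entry one 0 0) with (RtoC 1);
    try change (entry (one : MC) 0 0) with (RtoC 1); try change (entry (one : MC) 0 1) with (RtoC 0);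
    try change (entry (one : MC) 1 0) with (RtoC 0); try change (entry (one : MC) 1 1) with (RtoC 1); ring.
Qed.

(** [form_y] is trace-free, so the determinant keeps its diagonal value along the vertical
    segment. *)
Lemma minus_factor_det (l : C) (x y : R) : Om (x, y) -> Cmod (/ l) <= rho ->
  mdet (minus_factor x y (/ l)%C) = RtoC 1.
Proof.
  intros h hz.
  rewrite <- (trace_free_ode_det (fun t => Om (x, t)) (fun t => minus_factor x t (/ l)%C)
    (fun t => form_y l x t) x y).
  - rewrite minus_factor_diag. rewrite mdet_C, !entry_one_C by lt2. simpl. eqC. ring.
  - intros a b t ha hb ht. now apply near_diag_section_y_convex with a b.
  - intros t _. unfold form_y. expC. eqC. ring.
  - intros t ht. now apply minus_factor_derive_y.
  - apply near_diag_diag; [exact heps | apply h].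
  - exact h.
Qed.

Lemma form_x_trace (l : C) (x y : R) : mtr (form_x l x y) = RtoC 0.
Proof. unfold form_x. expC. eqC. ring. Qed.

Lemma form_diag_trace (l : C) (x : R) : mtr (form_diag l x) = RtoC 0.
Proof. unfold form_diag. expC. eqC. ring. Qed.

Lemma plus_factor_det (l : C) (x y : R) : Om (x, y) -> Cmod l <= rho ->
  mdet (plus_factor x y l) = RtoC 1.
Proof.
  intros h hz.
  rewrite <- (trace_free_ode_det (fun t => Om (t, y)) (fun t => plus_factor t y l)
    (fun t => form_x l t y) y x).
  - rewrite plus_factor_diag by (assumption || apply h). rewrite mdet_C, !entry_one_C by lt2. simpl. eqC. ring.
  - intros a b t ha hb ht. now apply near_diag_section_x_convex with a b.
  - intros t _. apply form_x_trace.
  - intros t ht. now apply plus_factor_derive_x.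
  - apply near_diag_diag; [exact heps | apply h].
  - exact h.
Qed.

(** * The frame and its Birkhoff factors *)

Context (X : R -> C -> MC)
  (hX : forall l : C, l <> 0 -> forall x, I x -> mderivC (fun t => X t l) x (mult (X x l) (form_diag l x)))
  (dX : forall l : C, l <> 0 -> forall x, I x -> mdet (X x l) = RtoC 1).

Definition frame (x y : R) (l : C) : MC := mult (X x l) (minus_factor x y (/ l)%C).

Lemma frame_derive_x (l : C) (x y : R) : Om (x, y) -> l <> 0 -> Cmod (/ l) <= rho ->
  mderivC (fun t => frame t y l) x (mult (frame x y l) (form_x l x y)).
Proof.
  intros h hl hz.
  assert (D := mderivC_mult _ _ x _ _ (hX l hl x (proj1 h)) (minus_factor_derive_x l x y h hl hz)).
  unfold frame.
  match type of D with mderivC _ _ ?A => match goal with |- mderivC _ _ ?B =>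
    replace B with A; [exact D|] end end.
  matC.
Qed.

Lemma frame_derive_y (l : C) (x y : R) : Om (x, y) -> l <> 0 -> Cmod (/ l) <= rho ->
  mderivC (fun t => frame x t l) y (mult (frame x y l) (form_y l x y)).
Proof.
  intros h hl hz.
  assert (D := mderivC_mult _ _ y _ _ (mderivC_const (X x l) y) (minus_factor_derive_y l x y h hz)).
  unfold frame.
  match type of D with mderivC _ _ ?A => match goal with |- mderivC _ _ ?B =>
    replace B with A; [exact D|] end end.
  rewrite mult_zero_l, plus_zero_l. apply mult_assoc.
Qed.

Lemma frame_det (l : C) (x y : R) : Om (x, y) -> l <> 0 -> Cmod (/ l) <= rho ->
  mdet (frame x y l) = RtoC 1.
Proof.
  intros h hl hz. unfold frame. rewrite mdet_mult_C, dX, minus_factor_det by (assumption || apply h).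
  eqC. ring.
Qed.

Lemma frame_diag (l : C) (x : R) : frame x x l = X x l.
Proof. unfold frame. rewrite minus_factor_diag. apply mult_one_r. Qed.

(** For fixed [y], both [X(y)^-1 frame] and [plus_factor] solve the linear equation in [x] with
    coefficient [form_x], and both are the identity at [x = y]. *)
Lemma frame_plus_factor (l : C) (x y : R) : Om (x, y) -> l <> 0 -> Cmod l <= rho -> Cmod (/ l) <= rho ->
  frame x y l = mult (X y l) (plus_factor x y l).
Proof.
  intros h hl h1 h2. assert (hy : I y) by apply h.
  set (N := X y l).
  assert (dN : mdet N = RtoC 1) by now apply dX.
  assert (E : mult (bar N) (frame x y l) = plus_factor x y l).
  { apply (trace_free_ode_unique (fun t => Om (t, y)) (fun t => mult (bar N) (frame t y l))
      (fun t => plus_factor t y l) (fun t => form_x l t y) y x).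
    - intros a b t ha hb ht. now apply near_diag_section_x_convex with a b.
    - intros t _. apply form_x_trace.
    - intros t ht.
      assert (D := mderivC_mult _ _ t _ _ (mderivC_const (bar N) t) (frame_derive_x l t y ht hl h2)).
      match type of D with mderivC _ _ ?A => match goal with |- mderivC _ _ ?B =>
        replace B with A; [exact D|] end end.
      rewrite mult_zero_l, plus_zero_l. apply mult_assoc.
    - intros t ht. now apply plus_factor_derive_x.
    - now apply near_diag_diag.
    - exact h.
    - apply plus_factor_det; [now apply near_diag_diag|exact h1].
    - rewrite plus_factor_diag, frame_diag by assumption. unfold N.
      now rewrite bar_mult_C, dX, mscal_1_C by assumption. }
  rewrite <- E. symmetry. now apply bar_cancel_r_C.
Qed.

Lemma unit_inv (l : C) : Cmod l = 1 -> l <> 0 /\ Cmod (/ l) = 1.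
Proof.
  intros h. assert (hl : l <> 0) by (apply Cmod_gt_0; lra).
  split; [exact hl|]. rewrite Cmod_inv, h by exact hl. apply Rinv_1.
Qed.

Lemma minus_coeff_geom (x y : R) (i j : bool) : Om (x, y) -> geom (/ 16) (minus_coeff x y i j).
Proof. apply (iterint_geom_16 uu vv (uu_Ck 0) (vv_Ck 0) uu_bound vv_bound). Qed.

Lemma plus_coeff_geom (x y : R) (i j : bool) : Om (x, y) -> geom (/ 16) (plus_coeff x y i j).
Proof.
  intros h. apply geom_scal.
  apply (iterint_geom_16 ut vt (ut_Ck 0) (vt_Ck 0) ut_bound vt_bound). now apply near_diag_swap.
Qed.

(** The two expressions [X(x) M] and [X(y) K] of the frame give [X(x)^-1 X(y) = M K^-1]; as
    [det K = 1], the inverse is [bar]. *)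
Lemma frame_birkhoff (Y : R -> C -> MC) (x y : R) :
  (forall (l : C) t, l <> 0 -> I t -> Y t l = X t l) -> Om (x, y) ->
  birkhoff (transition X Y x y) (fun l => minus_factor x y (/ l)%C) (fun l => bar (plus_factor x y l)).
Proof.
  intros hY h. split; [|split].
  - apply series_loop_G_minus.
    + intros i j. now apply minus_coeff_geom.
    + intros i j n hn. now apply iterint_parity.
    + intros z hz. destruct (unit_inv z hz) as [hz0 hzi].
      replace z with (/ / z)%C by (field; exact hz0). refine (minus_factor_det (/ z)%C x y h _).
      replace (/ / z)%C with z by (field; exact hz0). lra.
    + intros i j. reflexivity.
  - apply G_plus_bar. apply series_loop_G_plus.
    + intros i j. now apply plus_coeff_geom.
    + intros i j n hn. unfold plus_coeff. rewrite iterint_parity by exact hn. ring.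
    + intros z hz. refine (plus_factor_det z x y h _). lra.
  - intros l hl. destruct (unit_inv l hl) as [hl0 hli].
    assert (F := frame_plus_factor l x y h hl0 ltac:(lra) ltac:(lra)). unfold frame in F.
    unfold transition. rewrite invC_det_1 by (apply dX; [exact hl0 | apply h]).
    rewrite hY by (exact hl0 || apply h).
    assert (dK : mdet (plus_factor x y l) = RtoC 1) by (apply plus_factor_det; [exact h | lra]).
    assert (Q : X y l = mult (mult (X x l) (minus_factor x y (/ l)%C)) (bar (plus_factor x y l))).
    { rewrite F, <- mult_assoc, mult_bar_C, dK, mscal_1_C. symmetry. apply mult_one_r. }
    rewrite Q, <- mult_assoc. apply bar_cancel_l_C. apply dX; [exact hl0 | apply h].
Qed.

(** Uniqueness replaces the given factors by the explicit ones, outside the circle for one branch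
    and inside for the other; on the annulus where both series converge the branches then agree. *)
Lemma extended_frame_eq (Y : R -> C -> MC) (Hm Hp : R -> R -> C -> MC) (x y : R) (l : C) :
  (forall (l : C) t, l <> 0 -> I t -> Y t l = X t l) -> Om (x, y) ->
  birkhoff (transition X Y x y) (Hm x y) (Hp x y) -> l <> 0 -> Cmod l <= rho -> Cmod (/ l) <= rho ->
  extended_frame X Y Hm Hp x y l = frame x y l.
Proof.
  intros hY h hb hl h1 h2.
  assert (B0 := frame_birkhoff Y x y hY h).
  destruct (birkhoff_unique _ _ _ _ (minus_factor x y) hb B0) as [U1 U2].
  - apply series_loop_holomorphic. intros i j. now apply minus_coeff_geom.
  - apply series_loop_0. reflexivity.
  (* [minus_factor_det] speaks of [/ l], so [z = 0], the point at infinity, is treated apart. *)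
  - intros z hz. destruct (Ceq_dec z 0) as [->|hz0].
    + unfold minus_factor. rewrite series_loop_0 by reflexivity.
      rewrite mdet_C, !entry_one_C by lt2. simpl. eqC. ring.
    + replace z with (/ / z)%C by (field; exact hz0). refine (minus_factor_det (/ z)%C x y h _).
      replace (/ / z)%C with z by (field; exact hz0). lra.
  - intros z hz. rewrite mdet_bar_C. refine (plus_factor_det z x y h _). lra.
  - unfold extended_frame. destruct (Rle_dec 1 (Cmod l)) as [hl1|hl1].
    + now rewrite U1.
    + rewrite U2 by lra. rewrite hY by (exact hl || apply h).
      rewrite invC_det_1 by (rewrite mdet_bar_C; now apply plus_factor_det).
      rewrite bar_bar_C. symmetry. now apply frame_plus_factor.
Qed.

(** * The frame at positive real spectral parameters *)

Context (rX : forall lam : R, lam <> 0 -> forall x, I x -> mconj (X x (RtoC lam)) = X x (RtoC lam)).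

Definition real_part (A : MC) : MR := mk_matrix 2 2 (fun i j => fst (entry A i j)).

Definition frameR (lam : R) (x y : R) : MR := real_part (frame x y (RtoC lam)).

Definition formR_x (lam x y : R) : MR := mat2 (- p x y) (lam * r x) (lam * s x) (p x y).

Definition formR_y (lam x y : R) : MR := mat2 0 (/ lam * uu x y) (/ lam * vv x y) 0.

Lemma entry_real_part (A : MC) (i j : nat) : (i < 2)%nat -> (j < 2)%nat ->
  entry (real_part A) i j = fst (entry A i j).
Proof. intros hi hj. unfold entry at 1, real_part. now rewrite coeff_mat_bij by assumption. Qed.

Lemma embed_real_part (A : MC) : mconj A = A -> embed (real_part A) = A.
Proof.
  intros h.
  assert (K : forall i j, (i < 2)%nat -> (j < 2)%nat -> RtoC (fst (entry A i j)) = entry A i j).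
  { intros i j hi hj. assert (E := f_equal (fun M => entry M i j) h). cbv beta in E.
    rewrite entry_mconj in E by assumption. destruct (entry A i j) as [a b].
    unfold Cconj in E. simpl in E. injection E as E. unfold RtoC. simpl. f_equal. lra. }
  apply mat_ext; rewrite entry_embed, entry_real_part by lt2; apply K; lt2.
Qed.

Lemma Cmod_inv_real (lam : R) : 0 < lam -> / lam <= rho -> Cmod (/ RtoC lam) <= rho.
Proof.
  intros h hl. rewrite <- RtoC_inv by lra. rewrite Cmod_R, Rabs_pos_eq; [exact hl|].
  left. now apply Rinv_0_lt_compat.
Qed.

Lemma RtoC_neq_0 (lam : R) : 0 < lam -> RtoC lam <> 0.
Proof. intros h F. apply RtoC_inj in F. lra. Qed.

Section Real_frame.

Context (lam : R) (hlam : 0 < lam) (hinv : / lam <= rho).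

Let hl0 : RtoC lam <> 0 := RtoC_neq_0 lam hlam.
Let hli : Cmod (/ RtoC lam) <= rho := Cmod_inv_real lam hlam hinv.

Lemma frameR_embed (x y : R) : Om (x, y) -> embed (frameR lam x y) = frame x y (RtoC lam).
Proof.
  intros h. apply embed_real_part. unfold frame.
  assert (mm : forall A B, mconj (mult A B) = mult (mconj A) (mconj B)).
  { intros A B. apply mat_ext; expC; now rewrite Cplus_conj, !Cmult_conj. }
  rewrite mm, rX by (lra || apply h). f_equal. rewrite <- RtoC_inv by lra.
  rewrite <- (series_loop_conj (minus_coeff x y) (RtoC (/ lam))) at 2.
  unfold minus_factor. do 2 f_equal. unfold Cconj, RtoC. simpl. now rewrite Ropp_0.
Qed.

Lemma frameR_det (x y : R) : Om (x, y) -> mdet (frameR lam x y) = 1.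
Proof.
  intros h. apply RtoC_inj. rewrite <- mdet_embed, frameR_embed by exact h.
  now apply frame_det.
Qed.

Lemma frameR_mult_form (x y : R) (B : MR) (i j : nat) : (i < 2)%nat -> (j < 2)%nat -> Om (x, y) ->
  fst (entry (mult (frame x y (RtoC lam)) (embed B)) i j) = entry (mult (frameR lam x y) B) i j.
Proof.
  intros hi hj h. rewrite <- frameR_embed, <- embed_mult, entry_embed by assumption. reflexivity.
Qed.

Lemma form_x_embed (x y : R) : form_x (RtoC lam) x y = embed (formR_x lam x y).
Proof.
  unfold form_x, formR_x. apply mat_ext; rewrite entry_embed by lt2;
    rewrite ?entry_mat2_00, ?entry_mat2_01, ?entry_mat2_10, ?entry_mat2_11;
    rewrite ?RtoC_opp, ?RtoC_mult; reflexivity.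
Qed.

Lemma form_y_embed (x y : R) : form_y (RtoC lam) x y = embed (formR_y lam x y).
Proof.
  unfold form_y, formR_y. apply mat_ext; rewrite entry_embed by lt2;
    rewrite ?entry_mat2_00, ?entry_mat2_01, ?entry_mat2_10, ?entry_mat2_11;
    rewrite ?RtoC_mult, ?RtoC_inv by lra; reflexivity.
Qed.

Lemma frameR_derive_x (x y : R) : Om (x, y) ->
  mderivR (fun t => frameR lam t y) x (mult (frameR lam x y) (formR_x lam x y)).
Proof.
  intros h i j hi hj. assert (D := proj1 (frame_derive_x (RtoC lam) x y h hl0 hli i j hi hj)).
  rewrite form_x_embed, frameR_mult_form in D by assumption.
  apply is_derive_ext with (2 := D). intros t. unfold frameR. now rewrite entry_real_part.
Qed.

Lemma frameR_derive_y (x y : R) : Om (x, y) ->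
  mderivR (fun t => frameR lam x t) y (mult (frameR lam x y) (formR_y lam x y)).
Proof.
  intros h i j hi hj. assert (D := proj1 (frame_derive_y (RtoC lam) x y h hl0 hli i j hi hj)).
  rewrite form_y_embed, frameR_mult_form in D by assumption.
  apply is_derive_ext with (2 := D). intros t. unfold frameR. now rewrite entry_real_part.
Qed.

Lemma frameR_Ck_0 (i j : nat) : (i < 2)%nat -> (j < 2)%nat ->
  Ck 0 Om (fun x y => entry (frameR lam x y) i j).
Proof.
  intros hi hj.
  assert (CX : forall a, (a < 2)%nat -> Ck 0 Om (fun x _ => fst (entry (X x (RtoC lam)) i a))).
  { intros a ha [x y] h.
    apply (continuous_comp (fun q : R * R => fst q) (fun t => fst (entry (X t (RtoC lam)) i a))).
    - apply (@continuous_fst R_UniformSpace R_UniformSpace).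
    - apply (@ex_derive_continuous R_AbsRing R_NormedModule). eexists.
      exact (proj1 (hX (RtoC lam) hl0 x (proj1 h) i a hi ha)). }
  assert (CM : forall a b, Ck 0 Om (fun x y => Series (fun n => iterint uu vv a n b x y * (/ lam) ^ n))).
  { intros a b. apply (iterint_series_Ck_0 uu vv (uu_Ck 0) (vv_Ck 0) uu_bound vv_bound).
    rewrite Rabs_pos_eq; [exact hinv|]. left. now apply Rinv_0_lt_compat. }
  apply Ck_ext with (fun x y =>
    fst (entry (X x (RtoC lam)) i 0) * Series (fun n => iterint uu vv (idx 0) n (idx j) x y * (/ lam) ^ n)
    + fst (entry (X x (RtoC lam)) i 1) * Series (fun n => iterint uu vv (idx 1) n (idx j) x y * (/ lam) ^ n)).
  - exact hO.
  - intros x y h. unfold frameR. rewrite entry_real_part by assumption. unfold frame.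
    rewrite entryC_mult by assumption. unfold minus_factor. rewrite !entry_series_loop by lt2.
    rewrite <- RtoC_inv by lra. rewrite !power_series_real. simpl. unfold minus_coeff.
    destruct j as [|[|j]]; try lia; simpl idx; ring.
  - apply Ck_plus; [exact hO| |]; (apply Ck_mult; [exact hO| |apply CM]); apply CX; lt2.
Qed.

Lemma formR_x_Ck (n : nat) (i j : nat) : (i < 2)%nat -> (j < 2)%nat ->
  Ck n Om (fun x y => entry (formR_x lam x y) i j).
Proof.
  intros hi hj. destruct i as [|[|i]], j as [|[|j]]; try lia.
  - exact (Ck_opp Om hO n p (Cp n)).
  - exact (Ck_mult Om hO n _ _ (Ck_const Om hO n lam) (Ck_Om_fst n r sr)).
  - exact (Ck_mult Om hO n _ _ (Ck_const Om hO n lam) (Ck_Om_fst n s ss)).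
  - exact (Cp n).
Qed.

Lemma formR_y_Ck (n : nat) (i j : nat) : (i < 2)%nat -> (j < 2)%nat ->
  Ck n Om (fun x y => entry (formR_y lam x y) i j).
Proof.
  intros hi hj. destruct i as [|[|i]], j as [|[|j]]; try lia.
  - exact (Ck_const Om hO n 0).
  - exact (Ck_mult Om hO n _ _ (Ck_const Om hO n (/ lam)) (uu_Ck n)).
  - exact (Ck_mult Om hO n _ _ (Ck_const Om hO n (/ lam)) (vv_Ck n)).
  - exact (Ck_const Om hO n 0).
Qed.

(** Both partial derivatives are the frame times a smooth matrix, so continuity, which comes from
    uniform convergence, bootstraps to every order. *)
Lemma frameR_Ck (n : nat) (i j : nat) : (i < 2)%nat -> (j < 2)%nat ->
  Ck n Om (fun x y => entry (frameR lam x y) i j).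
Proof.
  revert i j. induction n as [|n IH]; intros i j hi hj.
  - now apply frameR_Ck_0.
  - apply Ck_S_of with (fun x y => entry (mult (frameR lam x y) (formR_x lam x y)) i j)
      (fun x y => entry (mult (frameR lam x y) (formR_y lam x y)) i j).
    + exact hO.
    + intros x y h. exact (frameR_derive_x x y h i j hi hj).
    + intros x y h. exact (frameR_derive_y x y h i j hi hj).
    + apply (Ck_mmult Om hO); auto. intros; now apply formR_x_Ck.
    + apply (Ck_mmult Om hO); auto. intros; now apply formR_y_Ck.
Qed.

End Real_frame.

End Frame.

(** * The Cauchy data *)

(** Lets smooth functions of one variable inherit sums and products from [Ck], by regarding them as
    independent of the second variable. *)
Lemma smooth1_of_Ck (I : R -> Prop) (g : R -> R) :
  (forall n, Ck n (fun q => I (fst q) /\ I (snd q)) (fun x _ => g x)) -> smooth1 I g.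
Proof.
  intros H n. revert g H. induction n as [|n IH]; intros g H x hx; [exact Logic.I|].
  assert (D : forall y, I y -> ex_derive g y).
  { intros y hy. exact (proj1 (proj1 (H 1%nat) y y (conj hy hy))). }
  destruct n as [|n]; [exact (D x hx)|].
  assert (H' : forall m, Ck m (fun q => I (fst q) /\ I (snd q)) (fun x _ => Derive g x))
    by (intros m; exact (proj1 (proj2 (H (S m))))).
  assert (Q := IH (Derive g) H' x hx).
  apply ex_derive_ext with (2 := Q). intros t.
  change (Derive_n (Derive_n g 1) n t = Derive_n (Derive_n g n) 1 t).
  rewrite !Derive_n_comp. now rewrite Nat.add_comm.
Qed.

Section Smooth.

Context (I : R -> Prop) (hI : is_open_interval I).

Let Q (q : R * R) : Prop := I (fst q) /\ I (snd q).

Lemma square_open : open Q.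
Proof.
  intros [x y] [hx hy]. simpl in hx, hy.
  destruct (proj1 hI x hx) as [d1 h1]. destruct (proj1 hI y hy) as [d2 h2].
  assert (hm : 0 < Rmin d1 d2) by (apply Rmin_glb_lt; apply cond_pos).
  exists (mkposreal _ hm). intros [a b] [ha hb]. split; simpl in *.
  - apply h1. apply ball_le with (2 := ha). apply Rmin_l.
  - apply h2. apply ball_le with (2 := hb). apply Rmin_r.
Qed.

Lemma smooth1_Ck (g : R -> R) (n : nat) : smooth1 I g -> Ck n Q (fun x _ => g x).
Proof.
  intros hg. apply Ck_fst with I; [exact square_open | | exact hg]. intros x y h. apply h.
Qed.

Lemma smooth1_plus (f g : R -> R) : smooth1 I f -> smooth1 I g -> smooth1 I (fun x => f x + g x).
Proof.
  intros hf hg. apply smooth1_of_Ck. intros n.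
  exact (Ck_plus Q square_open n _ _ (smooth1_Ck f n hf) (smooth1_Ck g n hg)).
Qed.

Lemma smooth1_mult (f g : R -> R) : smooth1 I f -> smooth1 I g -> smooth1 I (fun x => f x * g x).
Proof.
  intros hf hg. apply smooth1_of_Ck. intros n.
  exact (Ck_mult Q square_open n _ _ (smooth1_Ck f n hf) (smooth1_Ck g n hg)).
Qed.

Lemma smooth1_const (a : R) : smooth1 I (fun _ => a).
Proof. apply smooth1_of_Ck. intros n. exact (Ck_const Q square_open n a). Qed.

Lemma smooth1_minus (f g : R -> R) : smooth1 I f -> smooth1 I g -> smooth1 I (fun x => f x - g x).
Proof.
  intros hf hg. apply smooth1_of_Ck. intros n.
  exact (Ck_minus Q square_open n _ _ (smooth1_Ck f n hf) (smooth1_Ck g n hg)).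
Qed.

Lemma smooth1_ext (f g : R -> R) : (forall x, f x = g x) -> smooth1 I f -> smooth1 I g.
Proof. intros E hf n x hx. apply ex_derive_n_ext with (2 := hf n x hx). exact E. Qed.

Lemma smooth1_continuous (f : R -> R) (x : R) : smooth1 I f -> I x -> continuous f x.
Proof.
  intros hf hx. apply (@ex_derive_continuous R_AbsRing R_NormedModule). exact (hf 1%nat x hx).
Qed.

Definition smoothM (A : R -> MR) : Prop :=
  forall i j, (i < 2)%nat -> (j < 2)%nat -> smooth1 I (fun x => entry (A x) i j).

Lemma smoothM_of_smooth_on (A : R -> MR) : smooth_on I A -> smoothM A.
Proof. intros H i j _ _ n x hx. exact (H i j n x hx). Qed.

Lemma smoothM_mult (A B : R -> MR) : smoothM A -> smoothM B -> smoothM (fun x => mult (A x) (B x)).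
Proof.
  intros hA hB i j hi hj.
  apply smooth1_ext with (fun x => entry (A x) i 0 * entry (B x) 0 j + entry (A x) i 1 * entry (B x) 1 j).
  - intros x. symmetry. now apply entryR_mult.
  - exact (smooth1_plus _ _ (smooth1_mult _ _ (hA i 0%nat hi Nat.lt_0_2) (hB 0%nat j Nat.lt_0_2 hj))
      (smooth1_mult _ _ (hA i 1%nat hi Nat.lt_1_2) (hB 1%nat j Nat.lt_1_2 hj))).
Qed.

Lemma smoothM_bar (A : R -> MR) : smoothM A -> smoothM (fun x => bar (A x)).
Proof.
  intros hA i j hi hj.
  assert (opp : forall i j, (i < 2)%nat -> (j < 2)%nat -> smooth1 I (fun x => -1 * entry (A x) i j)).
  { intros a b ha hb. exact (smooth1_mult _ _ (smooth1_const (-1)) (hA a b ha hb)). }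
  destruct i as [|[|i]], j as [|[|j]]; try lia.
  - apply smooth1_ext with (2 := hA 1%nat 1%nat Nat.lt_1_2 Nat.lt_1_2). intros x. symmetry. expR. eqR. ring.
  - apply smooth1_ext with (2 := opp 0%nat 1%nat Nat.lt_0_2 Nat.lt_1_2). intros x. symmetry. expR. eqR. ring.
  - apply smooth1_ext with (2 := opp 1%nat 0%nat Nat.lt_1_2 Nat.lt_0_2). intros x. symmetry. expR. eqR. ring.
  - apply smooth1_ext with (2 := hA 0%nat 0%nat Nat.lt_0_2 Nat.lt_0_2). intros x. symmetry. expR. eqR. ring.
Qed.

Lemma smoothM_mderive (A : R -> MR) : smoothM A -> smoothM (mderive A).
Proof.
  intros hA i j hi hj. apply smooth1_ext with (2 := smooth1_Derive _ _ (hA i j hi hj)).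
  intros x. now rewrite entry_mderive.
Qed.

Lemma smoothM_mderivR (A : R -> MR) (x : R) : smoothM A -> I x -> mderivR A x (mderive A x).
Proof.
  intros hA hx i j hi hj. rewrite entry_mderive by assumption.
  apply Derive_correct. exact (hA i j hi hj 1%nat x hx).
Qed.

Lemma mderivR_ext_loc (A B : R -> MR) (x : R) (A' : MR) : I x -> (forall t, I t -> A t = B t) ->
  mderivR A x A' -> mderivR B x A'.
Proof.
  intros hx E H i j hi hj. apply is_derive_ext_loc with (2 := H i j hi hj).
  apply filter_imp with (2 := proj1 hI x hx). intros t ht. now rewrite E.
Qed.

(** The derivative [A' adj(A) + A adj(A')] of the constant [A adj(A)] is this trace times the
    identity. *)
Lemma mderivR_det_1 (A : R -> MR) (x : R) (A' : MR) : I x -> (forall t, I t -> mdet (A t) = 1) ->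
  mderivR A x A' -> mtr (mult (bar (A x)) A') = 0.
Proof.
  intros hx hd HA.
  assert (D := mderivR_mult _ _ x _ _ HA (mderivR_bar _ x _ HA)).
  assert (D1 : mderivR (fun _ => one) x (plus (mult A' (bar (A x))) (mult (A x) (bar A')))).
  { apply mderivR_ext_loc with (3 := D); [exact hx|]. intros t ht.
    rewrite mult_bar_R, hd by exact ht. apply mscal_1_R. }
  assert (E := eq_trans (eq_sym (mderive_unique _ _ _ D1)) (mderive_unique _ _ _ (mderivR_const one x))).
  apply (f_equal (fun M => entry M 0 0)) in E. revert E. expR. intros E. eqR. lra.
Qed.

End Smooth.

Lemma adsform_det (A : MR) : adsform A A = - mdet A.
Proof. unfold adsform. expR. field. Qed.

(** Adding the eigenvalue equations of [P] and [Z - P] gives [/ 2 [nu, Z] = 2 P - Z]. *)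
Lemma proj_plus_explicit (nu Z P : MR) : is_proj nu 1 Z P ->
  P = mscal (/ 2) (plus Z (mscal (/ 2) (bracket nu Z))).
Proof.
  intros [[_ [_ h1]] [_ [_ h2]]]. unfold bracket in *.
  assert (K : forall i j, (i < 2)%nat -> (j < 2)%nat -> entry P i j =
    entry (mscal (/ 2) (plus Z (mscal (/ 2) (minus (mult nu Z) (mult Z nu))))) i j).
  { intros i j hi hj.
    assert (E1 := f_equal (fun M => entry M i j) h1). assert (E2 := f_equal (fun M => entry M i j) h2).
    revert E1 E2. cbv beta. rewrite !entryR_mscal, !entryR_plus, !entryR_mscal, !entryR_minus, !entryR_mult by lt2.
    rewrite !entryR_minus by lt2. intros E1 E2. eqR. lra. }
  apply mat_ext; apply K; lt2.
Qed.

Lemma proj_minus_explicit (nu Z P : MR) : is_proj nu (-1) Z P ->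
  P = mscal (/ 2) (minus Z (mscal (/ 2) (bracket nu Z))).
Proof.
  intros [[_ [_ h1]] [_ [_ h2]]]. unfold bracket in *.
  assert (K : forall i j, (i < 2)%nat -> (j < 2)%nat -> entry P i j =
    entry (mscal (/ 2) (minus Z (mscal (/ 2) (minus (mult nu Z) (mult Z nu))))) i j).
  { intros i j hi hj.
    assert (E1 := f_equal (fun M => entry M i j) h1). assert (E2 := f_equal (fun M => entry M i j) h2).
    revert E1 E2. cbv beta. rewrite !entryR_mscal, !entryR_minus, !entryR_mscal, !entryR_minus, !entryR_mult by lt2.
    rewrite !entryR_minus by lt2. intros E1 E2. eqR. lra. }
  apply mat_ext; apply K; lt2.
Qed.

(** * Geometry of the surface *)

Lemma adsform_mult_l (G U V : MR) : adsform (mult G U) (mult G V) = mdet G * adsform U V.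
Proof. unfold adsform. expR. eqR. ring. Qed.

Lemma adsform_mult_r (B U V : MR) : adsform (mult U B) (mult V B) = mdet B * adsform U V.
Proof. unfold adsform. expR. eqR. ring. Qed.

Lemma mderivR_const_l (A : MR) (B : R -> MR) (x : R) (B' : MR) : mderivR B x B' ->
  mderivR (fun t => mult A (B t)) x (mult A B').
Proof.
  intros HB. assert (D := mderivR_mult _ _ x _ _ (mderivR_const A x) HB).
  rewrite mult_zero_l, plus_zero_l in D. exact D.
Qed.

Lemma mderivR_const_r (A : R -> MR) (B : MR) (x : R) (A' : MR) : mderivR A x A' ->
  mderivR (fun t => mult (A t) B) x (mult A' B).
Proof.
  intros HA. assert (D := mderivR_mult _ _ x _ _ HA (mderivR_const B x)).
  rewrite mult_zero_r, plus_zero_r in D. exact D.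
Qed.

Lemma mderivR_sandwich (G W : R -> MR) (K A A1 : MR) (x : R) :
  mderivR G x (mult (G x) A) -> mderivR W x (mult (W x) A1) ->
  mderivR (fun t => mult (mult (G t) K) (bar (W t))) x
    (mult (mult (G x) (plus (mult A K) (mult K (bar A1)))) (bar (W x))).
Proof.
  intros HG HW.
  assert (D := mderivR_mult _ _ x _ _ (mderivR_const_r _ K x _ HG) (mderivR_bar _ x _ HW)).
  match type of D with mderivR _ _ ?A => match goal with |- mderivR _ _ ?B =>
    replace B with A; [exact D|] end end.
  rewrite bar_mult_rev_R, mult_distr_l, mult_distr_r, !mult_assoc. reflexivity.
Qed.

Section Surface.

Context (Om : R * R -> Prop) (hO : open Om) (L : MR) (dL : mdet L = 1) (W1 Wl : R -> R -> MR)
  (d1 : forall x y, Om (x, y) -> mdet (W1 x y) = 1)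
  (dl : forall x y, Om (x, y) -> mdet (Wl x y) = 1)
  (C1 : forall n i j, (i < 2)%nat -> (j < 2)%nat -> Ck n Om (fun x y => entry (W1 x y) i j))
  (Cl : forall n i j, (i < 2)%nat -> (j < 2)%nat -> Ck n Om (fun x y => entry (Wl x y) i j))
  (e : R) (he : 0 < e) (p u v : R -> R -> R) (r s : R -> R)
  (D1x : forall x y, Om (x, y) -> mderivR (fun t => W1 t y) x
     (mult (W1 x y) (mat2 (- p x y) (1 * r x) (1 * s x) (p x y))))
  (D1y : forall x y, Om (x, y) -> mderivR (fun t => W1 x t) y
     (mult (W1 x y) (mat2 0 (/ 1 * u x y) (/ 1 * v x y) 0)))
  (Dlx : forall x y, Om (x, y) -> mderivR (fun t => Wl t y) x
     (mult (Wl x y) (mat2 (- p x y) (e * e * r x) (e * e * s x) (p x y))))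
  (Dly : forall x y, Om (x, y) -> mderivR (fun t => Wl x t) y
     (mult (Wl x y) (mat2 0 (/ (e * e) * u x y) (/ (e * e) * v x y) 0)))
  (mu : R) (hmu : mu = e * e * (e * e)) (hmu1 : mu <> 1)
  (s0 : forall x y, Om (x, y) -> s x <> 0) (n0 : forall x y, Om (x, y) -> u x y <> 0).

(** This is [exp (- theta e3)] for [e = exp theta]. *)
Definition twist : MR := mat2 e 0 0 (/ e).

Definition surface (x y : R) : MR := mult (mult (mult L (Wl x y)) twist) (bar (W1 x y)).

Definition normal_map (x y : R) : MR := mult (mult (W1 x y) e3) (bar (W1 x y)).

(* Tangent vectors and the normal at [(x, y)] are all of this form. *)
Definition moved (U : MR) (x y : R) : MR :=
  mult (mult (mult (mult L (Wl x y)) twist) U) (bar (W1 x y)).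

(** This matrix and the next three are [T^-1 A_l T U - U A_1] with [T = twist], [l = e * e], [A] the
    [dx] or [dy] part of the connection, and [U] the identity for tangents, [e3] for the normal. *)
Definition tan_x (x : R) : MR := mat2 0 0 ((mu - 1) * s x) 0.
Definition tan_y (x y : R) : MR := mat2 0 ((/ mu - 1) * u x y) 0 0.
Definition nor_x (x : R) : MR := mat2 0 (2 * r x) (- (mu + 1) * s x) 0.
Definition nor_y (x y : R) : MR := mat2 0 ((/ mu + 1) * u x y) (- 2 * v x y) 0.

Lemma mu_pos : 0 < mu.
Proof. rewrite hmu. repeat apply Rmult_lt_0_compat; exact he. Qed.

Lemma inv_mu_neq_1 : / mu - 1 <> 0.
Proof.
  assert (m := mu_pos). intros F. apply hmu1.
  apply Rmult_eq_reg_r with (/ mu); [|apply Rinv_neq_0_compat; lra]. rewrite Rinv_r; lra.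
Qed.

(** The form is the polarization of [- det], so multiplication by matrices of determinant 1 on
    either side is an isometry. *)
Lemma adsform_moved (U V : MR) (x y : R) : Om (x, y) ->
  adsform (moved U x y) (moved V x y) = adsform U V.
Proof.
  intros h. unfold moved. rewrite adsform_mult_r, adsform_mult_l, mdet_bar_R, !mdet_mult_R.
  rewrite d1, dl, dL by exact h.
  assert (T : mdet twist = 1) by (unfold twist; expR; eqR; field; lra). rewrite T. ring.
Qed.

Lemma moved_plus (U V : MR) (x y : R) : moved (plus U V) x y = plus (moved U x y) (moved V x y).
Proof. unfold moved. now rewrite mult_distr_l, mult_distr_r. Qed.

Lemma mult_mscal_l (a : R) (A B : MR) : mult (mscal a A) B = mscal a (mult A B).
Proof. matR. Qed.

Lemma mult_mscal_r (a : R) (A B : MR) : mult A (mscal a B) = mscal a (mult A B).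
Proof. matR. Qed.

Lemma moved_mscal (a : R) (U : MR) (x y : R) : moved (mscal a U) x y = mscal a (moved U x y).
Proof. unfold moved. now rewrite mult_mscal_r, mult_mscal_l. Qed.

Lemma moved_zero (U : MR) (x y : R) : Om (x, y) -> moved U x y = zero -> U = zero.
Proof.
  intros h E. unfold moved in E.
  apply (f_equal (fun M => mult M (W1 x y))) in E.
  rewrite <- mult_assoc, bar_mult_R, d1, mscal_1_R, mult_one_r, mult_zero_l in E by exact h.
  apply (f_equal (fun M => mult (bar (mult (mult L (Wl x y)) twist)) M)) in E.
  rewrite mult_assoc, bar_mult_R, !mdet_mult_R, dl, dL, mult_zero_r in E by exact h.
  assert (T : mdet twist = 1) by (unfold twist; expR; eqR; field; lra).
  rewrite T, !Rmult_1_r, mscal_1_R, mult_one_l in E. exact E.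
Qed.

Lemma surface_moved (x y : R) : surface x y = moved one x y.
Proof. unfold surface, moved. now rewrite mult_one_r. Qed.

Lemma normal_moved (x y : R) : Om (x, y) -> normal_of surface normal_map x y = moved e3 x y.
Proof.
  intros h. unfold normal_of, surface, normal_map, moved.
  set (T := mult (mult L (Wl x y)) twist).
  rewrite <- (mult_assoc T (bar (W1 x y))), <- (mult_assoc (W1 x y) e3), bar_cancel_l_R by now apply d1.
  apply mult_assoc.
Qed.

Lemma moved_derive_x (U D : MR) (x y : R) : Om (x, y) ->
  plus (mult (mat2 (- p x y) (e * e * r x) (e * e * s x) (p x y)) (mult twist U))
    (mult (mult twist U) (bar (mat2 (- p x y) (1 * r x) (1 * s x) (p x y)))) = mult twist D ->
  mderivR (fun t => moved U t y) x (moved D x y).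
Proof.
  intros h E.
  assert (HG : mderivR (fun t => mult L (Wl t y)) x
    (mult (mult L (Wl x y)) (mat2 (- p x y) (e * e * r x) (e * e * s x) (p x y)))).
  { rewrite <- mult_assoc. apply mderivR_const_l. now apply Dlx. }
  assert (S := mderivR_sandwich _ _ (mult twist U) _ _ x HG (D1x x y h)).
  rewrite E in S. unfold moved. rewrite <- (mult_assoc _ twist D).
  intros i j hi hj. apply is_derive_ext with (2 := S i j hi hj). intros t.
  now rewrite mult_assoc.
Qed.

Lemma moved_derive_y (U D : MR) (x y : R) : Om (x, y) ->
  plus (mult (mat2 0 (/ (e * e) * u x y) (/ (e * e) * v x y) 0) (mult twist U))
    (mult (mult twist U) (bar (mat2 0 (/ 1 * u x y) (/ 1 * v x y) 0))) = mult twist D ->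
  mderivR (fun t => moved U x t) y (moved D x y).
Proof.
  intros h E.
  assert (HG : mderivR (fun t => mult L (Wl x t)) y
    (mult (mult L (Wl x y)) (mat2 0 (/ (e * e) * u x y) (/ (e * e) * v x y) 0))).
  { rewrite <- mult_assoc. apply mderivR_const_l. now apply Dly. }
  assert (S := mderivR_sandwich _ _ (mult twist U) _ _ y HG (D1y x y h)).
  rewrite E in S. unfold moved. rewrite <- (mult_assoc _ twist D).
  intros i j hi hj. apply is_derive_ext with (2 := S i j hi hj). intros t.
  now rewrite mult_assoc.
Qed.

Lemma mderivR_ext (A B : R -> MR) (x : R) (A' : MR) : locally x (fun t => A t = B t) ->
  mderivR A x A' -> mderivR B x A'.
Proof.
  intros E H i j hi hj. apply is_derive_ext_loc with (2 := H i j hi hj).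
  apply filter_imp with (2 := E). intros t ht. now rewrite ht.
Qed.

Lemma surface_x (x y : R) : Om (x, y) -> partial_x surface x y = moved (tan_x x) x y.
Proof.
  intros h. apply mderive_unique. apply mderivR_ext with (fun t => moved one t y).
  { apply filter_forall. intros t. symmetry. apply surface_moved. }
  apply moved_derive_x; [exact h|]. unfold tan_x, twist. rewrite hmu. matR; field; lra.
Qed.

Lemma surface_y (x y : R) : Om (x, y) -> partial_y surface x y = moved (tan_y x y) x y.
Proof.
  intros h. apply mderive_unique. apply mderivR_ext with (fun t => moved one x t).
  { apply filter_forall. intros t. symmetry. apply surface_moved. }
  apply moved_derive_y; [exact h|]. unfold tan_y, twist. rewrite hmu. matR; field; lra.
Qed.

Lemma normal_x (x y : R) : Om (x, y) ->
  partial_x (normal_of surface normal_map) x y = moved (nor_x x) x y.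
Proof.
  intros h. apply mderive_unique. apply mderivR_ext with (fun t => moved e3 t y).
  { apply filter_imp with (2 := open_section_x Om x y hO h). intros t ht.
    symmetry. now apply normal_moved. }
  apply moved_derive_x; [exact h|]. unfold nor_x, twist, e3. rewrite hmu. matR; field; lra.
Qed.

Lemma normal_y (x y : R) : Om (x, y) ->
  partial_y (normal_of surface normal_map) x y = moved (nor_y x y) x y.
Proof.
  intros h. apply mderive_unique. apply mderivR_ext with (fun t => moved e3 x t).
  { apply filter_imp with (2 := open_section_y Om x y hO h). intros t ht.
    symmetry. now apply normal_moved. }
  apply moved_derive_y; [exact h|]. unfold nor_y, twist, e3. rewrite hmu. matR; field; lra.
Qed.

Lemma adsform_offdiag (a b a' b' : R) : adsform (mat2 0 a b 0) (mat2 0 a' b' 0) = / 2 * (a * b' + b * a').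
Proof. unfold adsform. expR. eqR. ring. Qed.

Lemma smooth2_of_entries (g : R -> R -> MR) :
  (forall n i j, (i < 2)%nat -> (j < 2)%nat -> Ck n Om (fun x y => entry (g x y) i j)) ->
  smooth2_on Om g.
Proof.
  intros H i j n.
  destruct (Nat.lt_ge_cases i 2) as [hi|hi]; [destruct (Nat.lt_ge_cases j 2) as [hj|hj]|].
  - now apply H.
  - apply Ck_ext with (fun _ _ => 0); [exact hO| |apply Ck_const, hO].
    intros x y _. rewrite entry_ge by auto. reflexivity.
  - apply Ck_ext with (fun _ _ => 0); [exact hO| |apply Ck_const, hO].
    intros x y _. rewrite entry_ge by auto. reflexivity.
Qed.

Lemma surface_smooth : smooth2_on Om surface.
Proof.
  assert (Cc : forall (A : MR) n i j, (i < 2)%nat -> (j < 2)%nat -> Ck n Om (fun _ _ => entry A i j))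
    by (intros; apply Ck_const, hO).
  apply smooth2_of_entries. intros n. unfold surface.
  apply (Ck_mmult Om hO n (fun x y => mult (mult L (Wl x y)) twist) (fun x y => bar (W1 x y))).
  - apply (Ck_mmult Om hO n (fun x y => mult L (Wl x y)) (fun _ _ => twist)); [|apply Cc].
    apply (Ck_mmult Om hO n (fun _ _ => L) Wl); [apply Cc | apply Cl].
  - apply (Ck_mbar Om hO n W1). apply C1.
Qed.

Lemma normal_map_smooth : smooth2_on Om normal_map.
Proof.
  assert (Cc : forall (A : MR) n i j, (i < 2)%nat -> (j < 2)%nat -> Ck n Om (fun _ _ => entry A i j))
    by (intros; apply Ck_const, hO).
  apply smooth2_of_entries. intros n. unfold normal_map.
  apply (Ck_mmult Om hO n (fun x y => mult (W1 x y) e3) (fun x y => bar (W1 x y))).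
  - apply (Ck_mmult Om hO n W1 (fun _ _ => e3)); [apply C1 | apply Cc].
  - apply (Ck_mbar Om hO n W1). apply C1.
Qed.

Lemma tangent_moved (a b x y : R) : Om (x, y) ->
  plus (mscal a (partial_x surface x y)) (mscal b (partial_y surface x y)) =
  moved (mat2 0 (b * ((/ mu - 1) * u x y)) (a * ((mu - 1) * s x)) 0) x y.
Proof.
  intros h. rewrite surface_x, surface_y by exact h. rewrite <- !moved_mscal, <- moved_plus.
  f_equal. unfold tan_x, tan_y. matR.
Qed.

Lemma surface_immersion : immersion_H31 Om surface.
Proof.
  split; [exact surface_smooth|]. intros x y h. split.
  - unfold H31. rewrite surface_moved, adsform_moved by exact h. unfold adsform. expR. field.
  - intros a b E. rewrite tangent_moved in E by exact h. apply moved_zero in E; [|exact h].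
    assert (E1 : b * ((/ mu - 1) * u x y) = 0) by exact (f_equal (fun M : MR => entry M 0 1) E).
    assert (E2 : a * ((mu - 1) * s x) = 0) by exact (f_equal (fun M : MR => entry M 1 0) E).
    assert (i := inv_mu_neq_1). assert (hs := s0 x y h). assert (hu := n0 x y h).
    split.
    + apply Rmult_integral in E2. destruct E2 as [E2|E2]; [exact E2|].
      apply Rmult_integral in E2. destruct E2; [lra | contradiction].
    + apply Rmult_integral in E1. destruct E1 as [E1|E1]; [exact E1|].
      apply Rmult_integral in E1. destruct E1; contradiction.
Qed.

Lemma surface_timelike : timelike Om surface.
Proof.
  intros x y h.
  assert (i := inv_mu_neq_1). assert (hs := s0 x y h). assert (hu := n0 x y h).
  set (k1 := (mu - 1) * s x). set (k2 := (/ mu - 1) * u x y).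
  assert (h1 : k1 <> 0) by (unfold k1; apply Rmult_integral_contrapositive; split; [lra|exact hs]).
  assert (h2 : k2 <> 0) by (unfold k2; now apply Rmult_integral_contrapositive).
  (* The tangents are null and pair to [k1 * k2 / 2], so [f_x + t f_y] has square [t * k1 * k2]. *)
  exists 1, (- / (k1 * k2)), 1, (/ (k1 * k2)). split.
  - intros F. assert (hk : k1 * k2 <> 0) by now apply Rmult_integral_contrapositive.
    apply (Rinv_neq_0_compat _ hk). lra.
  - cbv zeta. rewrite !tangent_moved, !adsform_moved by exact h. fold k1 k2.
    rewrite !adsform_offdiag. repeat split; field; split; assumption.
Qed.

Lemma surface_null : null_coordinates Om surface.
Proof.
  intros x y h. rewrite surface_x, surface_y, !adsform_moved by exact h.
  unfold tan_x, tan_y. rewrite !adsform_offdiag. split; ring.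
Qed.

Lemma surface_gauss : gauss_map Om surface normal_map.
Proof.
  split; [exact normal_map_smooth|]. intros x y h. cbv zeta.
  rewrite normal_moved, surface_x, surface_y, surface_moved, !adsform_moved by exact h.
  assert (m := mu_pos). unfold tan_x, tan_y, e3, adsform. expR. repeat split; field; lra.
Qed.

Lemma surface_mean_curvature : mean_curvature Om surface normal_map ((mu + 1) / (mu - 1)).
Proof.
  intros x y h. cbv zeta.
  assert (i := inv_mu_neq_1). assert (hs := s0 x y h). assert (hu := n0 x y h). assert (m := mu_pos).
  assert (hm : mu - 1 <> 0) by lra.
  assert (hm' : 1 - mu <> 0) by lra.
  (* The tangents are multiples of E21 and E12, so the coefficients are quotients of entries; the
     diagonal ones agree since [(/ mu + 1) / (/ mu - 1) = - (mu + 1) / (mu - 1)]. *)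
  exists (mat2 (- ((mu + 1) / (mu - 1))) (2 * r x / ((/ mu - 1) * u x y))
    (- 2 * v x y / ((mu - 1) * s x)) (- ((mu + 1) / (mu - 1)))).
  rewrite !tangent_moved by exact h. rewrite normal_x, normal_y by exact h.
  rewrite !entry_mat2_00, !entry_mat2_01, !entry_mat2_10, !entry_mat2_11.
  split; [|split].
  - f_equal. unfold nor_x. f_equal; field; repeat split; lra || assumption.
  - f_equal. unfold nor_y. f_equal; field; repeat split; lra || assumption.
  - expR. field. assumption.
Qed.

End Surface.

(** * The Cauchy data read in the moving frame *)

Lemma mexp_e3 (t : R) : mexp (mscal t e3) = mat2 (exp (- t)) 0 0 (exp t).
Proof.
  assert (E : forall n, pow_n (mscal t e3 : MR) n = mat2 ((- t) ^ n) 0 0 (t ^ n)).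
  { induction n as [|n IH].
    - apply mat_ext; reflexivity.
    - change (pow_n (mscal t e3 : MR) (S n)) with (mult (mscal t e3) (pow_n (mscal t e3 : MR) n)).
      rewrite IH. unfold e3. matR; simpl; ring. }
  assert (S : forall z, Series (fun n => / INR (Factorial.fact n) * z ^ n) = exp z).
  { intros z. apply is_series_unique. apply is_pseries_R. apply is_exp_Reals. }
  assert (Z : Series (fun n => / INR (Factorial.fact n) * 0) = 0).
  { rewrite (Series_ext _ (fun _ => 0 * 0)) by (intros; ring). rewrite Series_scal_l. ring. }
  assert (en : forall i j, (i < 2)%nat -> (j < 2)%nat -> entry (mexp (mscal t e3)) i j =
    Series (fun n => / INR (Factorial.fact n) * entry (pow_n (mscal t e3 : MR) n) i j)).
  { intros i j hi hj. unfold entry at 1, mexp. now rewrite coeff_mat_bij by assumption. }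
  apply mat_ext; rewrite en by lt2.
  - rewrite (Series_ext _ (fun n => / INR (Factorial.fact n) * (- t) ^ n)) by (intros n; now rewrite E).
    apply S.
  - rewrite (Series_ext _ (fun n => / INR (Factorial.fact n) * 0)) by (intros n; now rewrite E).
    apply Z.
  - rewrite (Series_ext _ (fun n => / INR (Factorial.fact n) * 0)) by (intros n; now rewrite E).
    apply Z.
  - rewrite (Series_ext _ (fun n => / INR (Factorial.fact n) * t ^ n)) by (intros n; now rewrite E).
    apply S.
Qed.

(** For [mdet F = 1] this is Ad of [F^-1], written with the adjugate so that it is polynomial in the
    entries. *)
Definition conj_by (F M : MR) : MR := mult (mult (bar F) M) F.

Lemma conj_by_mult (F A B : MR) : mdet F = 1 ->
  conj_by F (mult A B) = mult (conj_by F A) (conj_by F B).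
Proof.
  intros h. unfold conj_by.
  rewrite <- (mult_assoc (mult (bar F) A) F), <- (mult_assoc (bar F) B F).
  rewrite (bar_cancel_r_R F) by exact h. now rewrite !mult_assoc.
Qed.

Lemma conj_by_plus (F A B : MR) : conj_by F (plus A B) = plus (conj_by F A) (conj_by F B).
Proof. unfold conj_by. now rewrite mult_distr_l, mult_distr_r. Qed.

Lemma conj_by_mscal (F A : MR) (c : R) : conj_by F (mscal c A) = mscal c (conj_by F A).
Proof. unfold conj_by. now rewrite mult_mscal_r, mult_mscal_l. Qed.

Lemma conj_by_minus (F A B : MR) : conj_by F (minus A B) = minus (conj_by F A) (conj_by F B).
Proof. unfold conj_by. matR. Qed.

Lemma conj_by_bracket (F A B : MR) : mdet F = 1 ->
  conj_by F (bracket A B) = bracket (conj_by F A) (conj_by F B).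
Proof. intros h. unfold bracket. now rewrite conj_by_minus, !conj_by_mult. Qed.

Lemma conj_by_AdR (F M : MR) : mdet F = 1 -> conj_by F (AdR F M) = M.
Proof.
  intros h. unfold conj_by, AdR. rewrite invR_det_1 by exact h.
  rewrite <- (mult_assoc F M), bar_cancel_l_R by exact h.
  rewrite <- mult_assoc, bar_mult_R, h, mscal_1_R. apply mult_one_r.
Qed.

Lemma AdR_inv (F M : MR) : mdet F = 1 -> AdR (invR F) M = conj_by F M.
Proof.
  intros h. unfold AdR, conj_by. rewrite (invR_det_1 F h).
  rewrite invR_det_1 by now rewrite mdet_bar_R. now rewrite bar_bar_R.
Qed.

Lemma adsform_conj_by (F A B : MR) : mdet F = 1 ->
  adsform (conj_by F A) (conj_by F B) = adsform A B.
Proof.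
  intros h. unfold conj_by. rewrite adsform_mult_r, adsform_mult_l, mdet_bar_R, h. ring.
Qed.

Section Data_at_a_point.

Context (nut N1 F : R -> MR) (x : R) (Z Pp Pm Pn : MR) (mu : R).

Let a : MR := mult (bar (F x)) (mderive F x).
Let zeta : MR := conj_by (F x) Z.

Context (dF : mdet (F x) = 1) (hnu : AdR (F x) e3 = nut x) (ta : mtr a = 0)
  (dnu : mderive nut x = plus (mult (mult (mderive F x) e3) (bar (F x)))
    (mult (mult (F x) e3) (bar (mderive F x))))
  (hPp : is_proj (nut x) 1 Z Pp) (hPm : is_proj (nut x) (-1) Z Pm)
  (hPn : is_proj (nut x) (-1) (mderive nut x) Pn)
  (hN1 : N1 x = (- (2 / (mu - 1)) *: Pp + Pn - (2 / (/ mu - 1)) *: Pm)%M).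

(** [nut = F e3 F^-1] has derivative [F [a, e3] F^-1], where [a = F^-1 F']. *)
Lemma conj_by_dnu : conj_by (F x) (mderive nut x) = bracket a e3.
Proof.
  rewrite dnu, conj_by_plus. unfold conj_by, bracket.
  assert (E1 : mult (mult (bar (F x)) (mult (mult (mderive F x) e3) (bar (F x)))) (F x) = mult a e3).
  { unfold a. rewrite <- !mult_assoc, bar_mult_R, dF, mscal_1_R, mult_one_r. reflexivity. }
  assert (E2 : mult (mult (bar (F x)) (mult (mult (F x) e3) (bar (mderive F x)))) (F x) = mult e3 (bar a)).
  { unfold a. rewrite bar_mult_rev_R, bar_bar_R.
    rewrite <- (mult_assoc (F x) e3), bar_cancel_l_R by exact dF. now rewrite mult_assoc. }
  rewrite E1, E2. unfold bar. rewrite ta. matR.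
Qed.

Lemma conj_by_N1 : conj_by (F x) (N1 x) =
  plus (mscal (- (2 / (mu - 1))) (mscal (/ 2) (plus zeta (mscal (/ 2) (bracket e3 zeta)))))
    (minus (mscal (/ 2) (minus (bracket a e3) (mscal (/ 2) (bracket e3 (bracket a e3)))))
     (mscal (2 / (/ mu - 1)) (mscal (/ 2) (minus zeta (mscal (/ 2) (bracket e3 zeta)))))).
Proof.
  rewrite hN1, (proj_plus_explicit _ _ _ hPp), (proj_minus_explicit _ _ _ hPm), (proj_minus_explicit _ _ _ hPn).
  rewrite <- hnu.
  rewrite conj_by_minus, conj_by_plus, !conj_by_mscal, conj_by_plus, !conj_by_minus, !conj_by_mscal,
    !conj_by_bracket, !conj_by_AdR, conj_by_dnu by exact dF.
  fold zeta. matR.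
Qed.

Let u0 : R := / (/ mu - 1) * entry zeta 0 1.
Let s : R := / (mu - 1) * entry zeta 1 0.

Lemma kpart_data : kpart (mult (invR (F x)) (mderive F x)) =
  mat2 (- (/ 2 * (entry a 1 1 - entry a 0 0))) 0 0 (/ 2 * (entry a 1 1 - entry a 0 0)).
Proof.
  rewrite (invR_det_1 _ dF). fold a. unfold kpart.
  assert (E : adsform a e3 = / 2 * (entry a 1 1 - entry a 0 0)).
  { unfold adsform, e3. expR. eqR. field. }
  rewrite E. unfold e3. matR.
Qed.

(** In the frame, half of ad e3 is 1 on E21 and -1 on E12, so the conjugate of [N1] is
    [2 (a01 - u0) E12 - 2 s E21], on which the bracket in [beta1] acts diagonally. *)
Lemma beta1_data : mu <> 1 -> / mu - 1 <> 0 ->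
  beta1 N1 F x = mat2 0 (entry a 0 1 - u0) s 0.
Proof.
  intros h1 h2. assert (h3 : mu - 1 <> 0) by lra.
  unfold beta1. rewrite AdR_inv, conj_by_N1 by exact dF. unfold bracket, u0, s, e3.
  set (c1 := 2 / (mu - 1)). set (c2 := 2 / (/ mu - 1)).
  replace (/ (/ mu - 1)) with (c2 / 2) by (unfold c2, Rdiv; lra).
  replace (/ (mu - 1)) with (c1 / 2) by (unfold c1, Rdiv; lra).
  apply mat_ext; expR; eqR; field.
Qed.

Lemma gammam1_data : mu <> 1 -> / mu - 1 <> 0 ->
  gammam1 nut N1 F x = mat2 0 u0 (entry a 1 0 - s) 0.
Proof.
  intros h1 h2. assert (h3 : mu - 1 <> 0) by lra.
  unfold gammam1. rewrite AdR_inv, conj_by_minus, conj_by_dnu, conj_by_N1 by exact dF.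
  unfold bracket, u0, s, e3.
  set (c1 := 2 / (mu - 1)). set (c2 := 2 / (/ mu - 1)).
  replace (/ (/ mu - 1)) with (c2 / 2) by (unfold c2, Rdiv; lra).
  replace (/ (mu - 1)) with (c1 / 2) by (unfold c1, Rdiv; lra).
  apply mat_ext; expR; eqR; field.
Qed.

(** This fixes the names [r = a01 - u0] and [v0 = a10 - s]. At [l = 1] the terms [u0] and [s] drop
    out and [a] remains. *)
Lemma alpha_hat_data (l : C) : mu <> 1 -> / mu - 1 <> 0 -> alpha_hat nut N1 F l x =
  mat2 (- RtoC (/ 2 * (entry a 1 1 - entry a 0 0)))%C
    (l * RtoC (entry a 0 1 - u0) + / l * RtoC u0)%C
    (l * RtoC s + / l * RtoC (entry a 1 0 - s))%C (RtoC (/ 2 * (entry a 1 1 - entry a 0 0))).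
Proof.
  intros h1 h2. unfold alpha_hat. rewrite kpart_data, beta1_data, gammam1_data by assumption.
  set (kk := / 2 * (entry a 1 1 - entry a 0 0)). set (rr := entry a 0 1 - u0). set (vv0 := entry a 1 0 - s).
  apply mat_ext; expC; rewrite ?RtoC_opp; eqC; ring.
Qed.

End Data_at_a_point.

(** * Reality of the frame, and the surface with the given Cauchy data *)

Lemma mderivC_mconj (A : R -> MC) (x : R) (A' : MC) : mderivC A x A' ->
  mderivC (fun t => mconj (A t)) x (mconj A').
Proof.
  intros H i j hi hj. rewrite entry_mconj by assumption.
  apply cderiv_ext with (fun t => Cconj (entry (A t) i j)).
  - intros t. symmetry. now apply entry_mconj.
  - destruct (H i j hi hj) as [h1 h2]. split; [exact h1|]. exact (is_derive_opp _ _ _ h2).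
Qed.

Lemma mconj_mult (A B : MC) : mconj (mult A B) = mult (mconj A) (mconj B).
Proof. apply mat_ext; expC; now rewrite Cplus_conj, !Cmult_conj. Qed.

Lemma mconj_embed (A : MR) : mconj (embed A) = embed A.
Proof. apply mat_ext; expC; unfold Cconj, RtoC; simpl; now rewrite Ropp_0. Qed.

Lemma embed_inj (A B : MR) : embed A = embed B -> A = B.
Proof.
  intros E.
  assert (K : forall i j, (i < 2)%nat -> (j < 2)%nat -> entry A i j = entry B i j).
  { intros i j hi hj. assert (Q := f_equal (fun M => entry M i j) E). cbv beta in Q.
    rewrite !entry_embed in Q by assumption. now apply RtoC_inj. }
  apply mat_ext; apply K; lt2.
Qed.

(** With [mu = exp (2 * theta) ^ 2] one has [tanh (2 * theta) = (mu - 1) / (mu + 1)]; this equals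
    [1 / H], which is nonzero, so [mu <> 1]. *)
Lemma tanh_double_mu (theta H mu : R) : 1 < Rabs H -> tanh (2 * theta) = 1 / H -> mu = exp (4 * theta) ->
  mu <> 1 /\ H = (mu + 1) / (mu - 1).
Proof.
  intros hH ht hmu.
  assert (hH0 : H <> 0) by (intros F; rewrite F, Rabs_R0 in hH; lra).
  set (b := exp (2 * theta)). assert (b0 : 0 < b) by apply exp_pos.
  assert (hb : mu = b * b) by (rewrite hmu; unfold b; rewrite <- exp_plus; f_equal; ring).
  assert (T : tanh (2 * theta) = (mu - 1) / (mu + 1)).
  { unfold tanh, sinh, cosh. rewrite exp_Ropp. fold b. rewrite hb. field. split; nra. }
  rewrite ht in T.
  assert (hm : mu <> 1).
  { intros F. rewrite F in T. replace ((1 - 1) / (1 + 1)) with 0 in T by field.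
    apply (Rinv_neq_0_compat H hH0). unfold Rdiv in T. lra. }
  split; [exact hm|].
  assert (m0 : 0 < mu) by (rewrite hb; nra).
  replace H with (/ (1 / H)) by (field; exact hH0). rewrite T. field. split; lra.
Qed.

Theorem corollary5p15
  (I : R -> Prop) (x0 : R) (hI : is_open_interval I) (hx0 : I x0)
  (ft nut : R -> MR)
  (hft : smooth_on I ft) (hnut : smooth_on I nut)
  (hftH : forall x, I x -> H31 (ft x))
  (hnutS : forall x, I x -> S21 (nut x))
  (horth : forall x, I x -> adsform (invR (ft x) * mderive ft x)%M (nut x) = 0)
  (hnonnull : forall x, I x -> adsform (mderive ft x) (mderive ft x) <> 0)
  (H theta mu : R) (hH : 1 < Rabs H)
  (htheta : tanh (2 * theta) = 1 / H)
  (hmu : mu = exp (4 * theta))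
  (Pp_df Pm_df Pm_dnu N1 : R -> MR)
  (hPp_df : forall x, I x ->
     is_proj (nut x) 1 (invR (ft x) * mderive ft x)%M (Pp_df x))
  (hPm_df : forall x, I x ->
     is_proj (nut x) (-1) (invR (ft x) * mderive ft x)%M (Pm_df x))
  (hPm_dnu : forall x, I x ->
     is_proj (nut x) (-1) (mderive nut x) (Pm_dnu x))
  (hN1 : forall x, I x ->
     N1 x = (- (2 / (mu - 1)) *: Pp_df x + Pm_dnu x
             - (2 / (/ mu - 1)) *: Pm_df x)%M)
  (F : R -> MR) (hF : adapted_frame I nut F)
  (X Y : R -> C -> MC)
  (hX : dpw_ode I x0 nut N1 F X) (hY : dpw_ode I x0 nut N1 F Y) :
  exists Om : R * R -> Prop,
    neighbourhood_of_diagonal I Om /\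
    (forall x y, Om (x, y) -> big_cell (transition X Y x y)) /\
    forall Hm Hp : R -> R -> C -> MC,
      (forall x y, Om (x, y) ->
         birkhoff (transition X Y x y) (Hm x y) (Hp x y)) ->
      let Fhat := extended_frame X Y Hm Hp in
      let L := (ft x0 * F x0 * mexp (theta *: e3) * invR (F x0))%M in
      exists f nu : R -> R -> MR,
        (forall x y, Om (x, y) ->
           embed (f x y) =
             (embed L * Fhat x y (RtoC (exp (2 * theta)))
              * embed (mexp (- theta *: e3)) * invC (Fhat x y (RtoC 1)))%M /\
           embed (nu x y) = AdC (Fhat x y (RtoC 1)) (embed e3)) /\
        immersion_H31 Om f /\
        timelike Om f /\
        mean_curvature Om f nu H /\
        gauss_map Om f nu /\
        null_coordinates Om f /\
        (forall x, I x -> f x x = ft x /\ nu x x = nut x).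
Proof.
  destruct (tanh_double_mu theta H mu hH htheta hmu) as [hmu1 EH].
  assert (m0 : 0 < mu) by (rewrite hmu; apply exp_pos).
  assert (hmui : / mu - 1 <> 0).
  { intros Q. apply hmu1. apply Rmult_eq_reg_r with (/ mu); [|apply Rinv_neq_0_compat; lra].
    rewrite Rinv_r; lra. }
  destruct hF as [sF hF].
  assert (dF : forall x, I x -> mdet (F x) = 1) by (intros x hx; apply (hF x hx)).
  assert (dft : forall x, I x -> mdet (ft x) = 1).
  { intros x hx. assert (Q := hftH x hx). unfold H31 in Q. rewrite adsform_det in Q. lra. }
  assert (SF := smoothM_of_smooth_on I F sF). assert (Sft := smoothM_of_smooth_on I ft hft).
  set (a := fun x => mult (bar (F x)) (mderive F x)).
  set (Z := fun x => mult (bar (ft x)) (mderive ft x)).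
  set (zeta := fun x => conj_by (F x) (Z x)).
  set (k := fun x => / 2 * (entry (a x) 1 1 - entry (a x) 0 0)).
  set (u0 := fun x => / (/ mu - 1) * entry (zeta x) 0 1).
  set (s := fun x => / (mu - 1) * entry (zeta x) 1 0).
  set (r := fun x => entry (a x) 0 1 - u0 x).
  set (v0 := fun x => entry (a x) 1 0 - s x).
  assert (Sa : smoothM I a).
  { exact (smoothM_mult I hI (fun x => bar (F x)) (mderive F) (smoothM_bar I hI F SF)
      (smoothM_mderive I F SF)). }
  assert (SZ : smoothM I Z).
  { exact (smoothM_mult I hI (fun x => bar (ft x)) (mderive ft) (smoothM_bar I hI ft Sft)
      (smoothM_mderive I ft Sft)). }
  assert (Sz : smoothM I zeta).
  { exact (smoothM_mult I hI (fun x => mult (bar (F x)) (Z x)) F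
      (smoothM_mult I hI (fun x => bar (F x)) Z (smoothM_bar I hI F SF) SZ) SF). }
  assert (lt0 := Nat.lt_0_2). assert (lt1 := Nat.lt_1_2).
  assert (sk : smooth1 I k).
  { exact (smooth1_mult I hI _ _ (smooth1_const I hI (/ 2))
      (smooth1_minus I hI _ _ (Sa 1%nat 1%nat lt1 lt1) (Sa 0%nat 0%nat lt0 lt0))). }
  assert (su : smooth1 I u0).
  { exact (smooth1_mult I hI _ _ (smooth1_const I hI _) (Sz 0%nat 1%nat lt0 lt1)). }
  assert (ss : smooth1 I s).
  { exact (smooth1_mult I hI _ _ (smooth1_const I hI _) (Sz 1%nat 0%nat lt1 lt0)). }
  assert (sr : smooth1 I r) by exact (smooth1_minus I hI _ _ (Sa 0%nat 1%nat lt0 lt1) su).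
  assert (sv : smooth1 I v0) by exact (smooth1_minus I hI _ _ (Sa 1%nat 0%nat lt1 lt0) ss).
  assert (DF : forall x, I x -> mderivR F x (mderive F x)).
  { intros x hx. now apply (smoothM_mderivR I). }
  assert (Dft : forall x, I x -> mderivR ft x (mderive ft x)).
  { intros x hx. now apply (smoothM_mderivR I). }
  assert (ta : forall x, I x -> mtr (a x) = 0).
  { intros x hx. now apply (mderivR_det_1 I hI F x _ hx dF (DF x hx)). }
  assert (tZ : forall x, I x -> mtr (Z x) = 0).
  { intros x hx. now apply (mderivR_det_1 I hI ft x _ hx dft (Dft x hx)). }
  assert (enu : forall x, I x -> nut x = mult (mult (F x) e3) (bar (F x))).
  { intros x hx. rewrite <- (proj2 (hF x hx)). unfold AdR. now rewrite invR_det_1 by now apply dF. }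
  assert (dnu : forall x, I x -> mderive nut x = plus (mult (mult (mderive F x) e3) (bar (F x)))
    (mult (mult (F x) e3) (bar (mderive F x)))).
  { intros x hx. apply mderive_unique.
    apply (mderivR_ext_loc I hI (fun x => mult (mult (F x) e3) (bar (F x)))); [exact hx| |].
    - intros t ht. symmetry. now apply enu.
    - apply (mderivR_mult (fun x => mult (F x) e3) (fun x => bar (F x))).
      + apply mderivR_const_r. now apply DF.
      + apply mderivR_bar. now apply DF. }
  assert (eal : forall l x, I x -> alpha_hat nut N1 F l x = form_diag k r s u0 v0 l x).
  { intros l x hx. assert (ei := invR_det_1 _ (dft x hx)).
    assert (q1 := hPp_df x hx). assert (q2 := hPm_df x hx). rewrite ei in q1, q2.
    exact (alpha_hat_data nut N1 F x (Z x) (Pp_df x) (Pm_df x) (Pm_dnu x) mu (dF x hx)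
      (proj2 (hF x hx)) (ta x hx) (dnu x hx) q1 q2 (hPm_dnu x hx) (hN1 x hx) l hmu1 hmui). }
  assert (conv : forall a b z, I a -> I b -> a <= z <= b -> I z) by apply hI.
  assert (ode : forall X, dpw_ode I x0 nut N1 F X -> forall l : C, l <> 0 -> forall x, I x ->
    mderivC (fun t => X t l) x (mult (X x l) (form_diag k r s u0 v0 l x))).
  { intros X' hX' l hl x hx i j hi hj. rewrite <- eal by exact hx.
    apply cderiv_of_is_derive. now apply (proj2 (hX' l hl)). }
  assert (trf : forall (l : C) x, I x -> mtr (form_diag k r s u0 v0 l x) = RtoC 0)
    by (intros; apply form_diag_trace).
  assert (dX : forall X, dpw_ode I x0 nut N1 F X -> forall l : C, l <> 0 -> forall x, I x ->
    mdet (X x l) = RtoC 1).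
  { intros X' hX' l hl x hx.
    rewrite (trace_free_ode_det I (fun t => X' t l) _ x x0 conv (trf l) (ode X' hX' l hl) hx hx0).
    rewrite (proj1 (hX' l hl)), mdet_embed, dF by exact hx0. reflexivity. }
  (* [X] and [Y] solve the same initial value problem, so one function serves for both variables. *)
  assert (hYX : forall (l : C) t, l <> 0 -> I t -> Y t l = X t l).
  { intros l t hl ht.
    apply (trace_free_ode_unique I (fun t => Y t l) (fun t => X t l) (form_diag k r s u0 v0 l) x0 t conv (trf l)
      (ode Y hY l hl) (ode X hX l hl) hx0 ht (dX X hX l hl x0 hx0)).
    now rewrite (proj1 (hX l hl)), (proj1 (hY l hl)). }
  (* For real [lam] the potential and the initial value are real, so the conjugate solves the same
     problem. *)
  assert (rX : forall lam : R, lam <> 0 -> forall x, I x -> mconj (X x (RtoC lam)) = X x (RtoC lam)).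
  { intros lam hlam x hx. set (l := RtoC lam).
    assert (hl : l <> 0) by (intros Q; now apply RtoC_inj in Q).
    apply (trace_free_ode_unique I (fun t => mconj (X t l)) (fun t => X t l) (form_diag k r s u0 v0 l) x0 x
      conv (trf l)); auto.
    - intros t ht. assert (D := mderivC_mconj _ _ _ (ode X hX l hl t ht)). rewrite mconj_mult in D.
      replace (mconj (form_diag k r s u0 v0 l t)) with (form_diag k r s u0 v0 l t) in D; [exact D|].
      unfold form_diag, l. rewrite <- RtoC_inv by exact hlam.
      apply mat_ext; expC; unfold Cconj, RtoC, Cplus, Cmult, Copp; simpl; f_equal; ring.
    - rewrite (proj1 (hX l hl)). apply mconj_embed. }
  (* At [l = 1] the potential is [F^-1 F'], so [F] itself is the solution. *)
  assert (XF : forall x, I x -> X x (RtoC 1) = embed (F x)).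
  { intros x hx. assert (h1 : RtoC 1 <> 0) by (intros Q; apply RtoC_inj in Q; lra).
    apply (trace_free_ode_unique I (fun t => X t (RtoC 1)) (fun t => embed (F t)) (form_diag k r s u0 v0 (RtoC 1)) x0 x
      conv (trf (RtoC 1))); auto.
    - intros t ht.
      replace (form_diag k r s u0 v0 (RtoC 1) t) with (embed (a t)).
      + rewrite <- embed_mult. unfold a. rewrite bar_cancel_r_R by now apply dF.
        apply mderivR_embed. now apply DF.
      + assert (T := ta t ht). rewrite mtr_R in T.
        unfold form_diag, r, v0, k. rewrite <- RtoC_inv by lra.
        apply mat_ext; expC; rewrite <- ?RtoC_opp, <- ?RtoC_mult, <- ?RtoC_plus; f_equal; eqR; lra.
    - rewrite mdet_embed, dF by exact hx0. reflexivity.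
    - apply (proj1 (hX (RtoC 1) h1)). }
  (* Squares instead of absolute values keep the weight smooth; as [Rabs b <= 1 + b * b], the
     summand 2 allows two absolute values to be bounded at once. *)
  set (c := fun x => 2 + (k x * k x + r x * r x + s x * s x + u0 x * u0 x + v0 x * v0 x)).
  assert (sc : smooth1 I c).
  { assert (q := fun f sf => smooth1_mult I hI f f sf sf).
    exact (smooth1_plus I hI _ _ (smooth1_const I hI 2) (smooth1_plus I hI _ _ (smooth1_plus I hI _ _
      (smooth1_plus I hI _ _ (smooth1_plus I hI _ _ (q k sk) (q r sr)) (q s ss)) (q u0 su)) (q v0 sv))). }
  assert (sq : forall b, Rabs b <= 1 + b * b).
  { intros b. unfold Rabs. destruct (Rcase_abs b); nra. }
  assert (hc : forall x, I x -> continuous c x) by (intros x hx; now apply (smooth1_continuous I)).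
  assert (hsq : forall b, 0 <= b * b) by (intros b; nra).
  assert (hc1 : forall x, I x -> 1 <= c x).
  { intros x _. unfold c. generalize (hsq (k x)) (hsq (r x)) (hsq (s x)) (hsq (u0 x)) (hsq (v0 x)). lra. }
  set (P := fun x => RInt c x0 x).
  assert (hP : forall x, I x -> is_derive P x (c x)).
  { intros x hx. apply (is_derive_RInt c P x0 x); [|now apply hc].
    apply filter_imp with (2 := proj1 hI x hx). intros t ht.
    apply (RInt_correct (V := R_CompleteNormedModule)).
    apply (@ex_RInt_continuous R_CompleteNormedModule). intros y hy. apply hc.
    now apply (interval_segment I hI x0 t). }
  (* Both [exp (2 * theta)] and its inverse are at most this, whatever the sign of [theta]. *)
  set (rho := exp (2 * Rabs theta)).
  assert (hrho : 1 <= rho).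
  { unfold rho. rewrite <- exp_0 at 1. assert (h0 := Rabs_pos theta).
    destruct h0 as [h0|h0]; [left; apply exp_increasing; lra | rewrite <- h0, Rmult_0_r; lra]. }
  (* Since [144 = 9 * 16], the ratio [9 * eps * rho] of the series is exactly 1/16. *)
  set (eps := / (144 * rho)).
  assert (heps : 0 < eps <= / 10).
  { unfold eps. split; [apply Rinv_0_lt_compat; lra | apply Rinv_le_contravar; lra]. }
  assert (hsmall : 9 * eps * rho <= / 16) by (right; unfold eps; field; lra).
  set (Om := near_diag I P eps).
  assert (hO : open Om) by exact (near_diag_open I hI c P hP eps).
  assert (bk : forall x, I x -> Rabs (k x) <= c x).
  { intros x _. unfold c. generalize (sq (k x)) (hsq (k x)) (hsq (r x)) (hsq (s x)) (hsq (u0 x)) (hsq (v0 x)). lra. }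
  assert (brs : forall x, I x -> Rabs (r x) + Rabs (s x) <= c x).
  { intros x _. unfold c. generalize (sq (r x)) (sq (s x)) (hsq (k x)) (hsq (u0 x)) (hsq (v0 x)). lra. }
  assert (buv : forall x, I x -> Rabs (u0 x) + Rabs (v0 x) <= c x).
  { intros x _. unfold c. generalize (sq (u0 x)) (sq (v0 x)) (hsq (k x)) (hsq (r x)) (hsq (s x)). lra. }
  destruct (Cauchy_problem_solution I hI c P hc hc1 hP eps heps k r s u0 v0 sk sr ss su sv bk brs buv)
    as (w & p & Cw & Cp & bw & wx & py & wd & pd).
  assert (hdiag : forall x, I x -> Om (x, x)) by (intros x hx; now apply near_diag_diag).
  exists Om. split; [|split].
  { split; [exact hO|]. split; [|exact hdiag]. intros x y h. split; apply h. }
  { intros x y h. eexists _, _.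
    exact (frame_birkhoff I hI c P hc hc1 hP eps heps rho hrho hsmall k r s u0 v0 sk sr ss su sv brs buv
      w p Cw Cp bw wx py wd pd X (ode X hX) (dX X hX) Y x y hYX h). }
  intros Hm Hp hb Fhat L.
  set (e := exp theta). assert (he : 0 < e) by apply exp_pos.
  assert (ee : exp (2 * theta) = e * e) by (unfold e; rewrite <- exp_plus; f_equal; ring).
  assert (emu : mu = e * e * (e * e)).
  { rewrite hmu. unfold e. rewrite <- !exp_plus. f_equal. ring. }
  assert (hlam : 0 < e * e) by now apply Rmult_lt_0_compat.
  assert (mono : forall b d, b <= d -> exp b <= exp d).
  { intros b d hbd. destruct hbd as [hbd| ->]; [left; now apply exp_increasing | lra]. }
  assert (hle : e * e <= rho).
  { rewrite <- ee. apply mono. generalize (Rle_abs theta). lra. }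
  assert (hinv : / (e * e) <= rho).
  { rewrite <- ee, <- exp_Ropp. apply mono. rewrite <- (Rabs_Ropp theta). generalize (Rle_abs (- theta)). lra. }
  assert (hinv1 : / 1 <= rho) by lra.
  set (fr := frameR u0 v0 w X).
  set (W1 := fr 1). set (Wl := fr (e * e)).
  assert (fe : forall lam x y, 0 < lam -> lam <= rho -> / lam <= rho -> Om (x, y) ->
    Fhat x y (RtoC lam) = embed (fr lam x y)).
  { intros lam x y h1 h2 h3 h.
    unfold fr. rewrite (frameR_embed I P eps u0 v0 w X rX lam h1 x y h).
    apply (extended_frame_eq I hI c P hc hc1 hP eps heps rho hrho hsmall k r s u0 v0 sk sr ss su sv brs buv
      w p Cw Cp bw wx py wd pd X (ode X hX) (dX X hX) Y Hm Hp x y (RtoC lam) hYX h (hb x y h)).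
    - now apply RtoC_neq_0.
    - rewrite Cmod_R, Rabs_pos_eq by lra. exact h2.
    - now apply Cmod_inv_real. }
  assert (hone : 0 < 1) by lra.
  assert (C_fr : forall lam, 0 < lam -> / lam <= rho -> forall n i j, (i < 2)%nat -> (j < 2)%nat ->
    Ck n Om (fun x y => entry (fr lam x y) i j)).
  { exact (frameR_Ck I hI c P hc hc1 hP eps heps rho hrho hsmall k r s u0 v0 sk sr ss su sv buv
      w p Cw Cp bw wx py wd pd X (ode X hX) rX). }
  assert (Dx_fr := frameR_derive_x I hI c P hc hc1 hP eps heps rho hsmall k r s u0 v0 sk sr ss su sv buv
      w p Cw Cp bw wx py wd pd X (ode X hX) rX).
  assert (Dy_fr := frameR_derive_y I hI c P hc hc1 hP eps heps rho hsmall u0 v0 su sv buv w Cw bw X rX).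
  assert (d_fr := frameR_det I hI c P hc hc1 hP eps heps rho hsmall u0 v0 su sv buv w Cw bw X (dX X hX) rX).
  assert (dL : mdet L = 1).
  { unfold L. rewrite !mdet_mult_R, dft, dF, mexp_e3, invR_det_1, mdet_bar_R, dF by auto.
    expR. rewrite exp_Ropp. eqR. field. apply Rgt_not_eq, exp_pos. }
  (* [Z] is trace-free and orthogonal to [nut], so [zeta] is trace-free and orthogonal to [e3], that
     is, off-diagonal. *)
  assert (diag0 : forall x, I x -> entry (zeta x) 0 0 = 0 /\ entry (zeta x) 1 1 = 0).
  { intros x hx. assert (q := horth x hx). rewrite invR_det_1 in q by now apply dft.
    fold (Z x) in q. rewrite <- (adsform_conj_by (F x)) in q by now apply dF.
    rewrite <- (proj2 (hF x hx)), conj_by_AdR in q by now apply dF. fold (zeta x) in q.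
    assert (t := tZ x hx).
    assert (t' : mtr (zeta x) = 0).
    { unfold zeta, conj_by. rewrite <- t. rewrite <- (Rmult_1_l (mtr (Z x))), <- (dF x hx).
      expR. eqR. ring. }
    revert q t'. unfold adsform, e3. expR. intros q t'. split; lra. }
  assert (mun : / mu - 1 <> 0).
  { intros Q. apply hmu1. rewrite <- (Rinv_inv mu). replace (/ mu) with 1 by lra. apply Rinv_1. }
  assert (ez01 : forall x, entry (zeta x) 0 1 = (/ mu - 1) * u0 x).
  { intros x. unfold u0. generalize (entry (zeta x) 0 1). intros z. eqR. symmetry. field.
    repeat split; lra. }
  assert (ez10 : forall x, entry (zeta x) 1 0 = (mu - 1) * s x).
  { intros x. unfold s. generalize (entry (zeta x) 1 0). intros z. eqR. symmetry. field. lra. }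
  (* The square of [ft'] is the product of the two off-diagonal entries of [zeta], multiples of [s]
     and [u0]. *)
  assert (nz : forall x, I x -> s x <> 0 /\ u0 x <> 0).
  { intros x hx. assert (q := hnonnull x hx).
    assert (E : mderive ft x = mult (ft x) (Z x)) by (unfold Z; symmetry; apply bar_cancel_r_R; auto).
    rewrite E, adsform_mult_l, dft, Rmult_1_l, <- (adsform_conj_by (F x)) in q by auto.
    fold (zeta x) in q. destruct (diag0 x hx) as [z0 z1].
    assert (E2 : adsform (zeta x) (zeta x) = entry (zeta x) 0 1 * entry (zeta x) 1 0).
    { unfold adsform. expR. rewrite z0, z1. eqR. field. }
    rewrite E2, ez01, ez10 in q. split; intros Q; apply q; rewrite Q; ring. }
  assert (s0 : forall x y, Om (x, y) -> s x <> 0) by (intros x y h; apply nz, h).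
  assert (n0 : forall x y, Om (x, y) -> uu u0 w x y <> 0).
  { intros x y h. unfold uu. apply Rmult_integral_contrapositive. split; [apply nz, h|].
    apply Rgt_not_eq, exp_pos. }
  exists (surface L W1 Wl e), (normal_map W1).
  assert (h1r : 1 <= rho) by exact hrho.
  assert (etw : mexp (mscal (- theta) e3) = twist e).
  { rewrite mexp_e3. unfold twist, e. now rewrite Ropp_involutive, exp_Ropp. }
  split; [|split; [|split; [|split; [|split; [|split]]]]].
  - intros x y h. rewrite ee, !fe by (lra || assumption). fold W1 Wl.
    assert (dW : mdet (embed (W1 x y)) = RtoC 1).
    { rewrite mdet_embed. f_equal. exact (d_fr 1 hone hinv1 x y h). }
    split.
    + rewrite invC_det_1 by exact dW. rewrite etw. unfold surface. now rewrite !embed_mult, embed_bar.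
    + unfold AdC. rewrite invC_det_1 by exact dW. unfold normal_map. now rewrite !embed_mult, embed_bar.
  - exact (surface_immersion Om hO L dL W1 Wl (d_fr 1 hone hinv1) (d_fr (e * e) hlam hinv)
      (C_fr 1 hone hinv1) (C_fr (e * e) hlam hinv) e he p (uu u0 w) (vv v0 w) r s
      (Dx_fr 1 hone hinv1) (Dy_fr 1 hone hinv1) (Dx_fr (e * e) hlam hinv) (Dy_fr (e * e) hlam hinv)
      mu emu hmu1 s0 n0).
  - exact (surface_timelike Om L dL W1 Wl (d_fr 1 hone hinv1) (d_fr (e * e) hlam hinv)
      e he p (uu u0 w) (vv v0 w) r s
      (Dx_fr 1 hone hinv1) (Dy_fr 1 hone hinv1) (Dx_fr (e * e) hlam hinv) (Dy_fr (e * e) hlam hinv)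
      mu emu hmu1 s0 n0).
  - rewrite EH. exact (surface_mean_curvature Om hO L W1 Wl (d_fr 1 hone hinv1)
      e he p (uu u0 w) (vv v0 w) r s
      (Dx_fr 1 hone hinv1) (Dy_fr 1 hone hinv1) (Dx_fr (e * e) hlam hinv) (Dy_fr (e * e) hlam hinv)
      mu emu hmu1 s0 n0).
  - exact (surface_gauss Om hO L dL W1 Wl (d_fr 1 hone hinv1) (d_fr (e * e) hlam hinv)
      (C_fr 1 hone hinv1) e he p (uu u0 w) (vv v0 w) r s
      (Dx_fr 1 hone hinv1) (Dy_fr 1 hone hinv1) (Dx_fr (e * e) hlam hinv) (Dy_fr (e * e) hlam hinv)
      mu emu hmu1).
  - exact (surface_null Om L dL W1 Wl (d_fr 1 hone hinv1) (d_fr (e * e) hlam hinv)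
      e he p (uu u0 w) (vv v0 w) r s
      (Dx_fr 1 hone hinv1) (Dy_fr 1 hone hinv1) (Dx_fr (e * e) hlam hinv) (Dy_fr (e * e) hlam hinv)
      mu emu).
  - set (fd := fun lam x => mat2 (- k x) (lam * r x + / lam * u0 x) (lam * s x + / lam * v0 x) (k x) : MR).
    assert (frX : forall lam x, 0 < lam -> I x -> embed (fr lam x x) = X x (RtoC lam)).
    { intros lam x hl hx. unfold fr.
      rewrite (frameR_embed I P eps u0 v0 w X rX lam hl x x (hdiag x hx)). apply frame_diag. }
    assert (W1F : forall x, I x -> W1 x x = F x).
    { intros x hx. apply embed_inj. unfold W1. rewrite frX by assumption. now apply XF. }
    assert (Dd : forall lam x, 0 < lam -> I x -> mderivR (fun t => fr lam t t) x (mult (fr lam x x) (fd lam x))).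
    { intros lam x hl hx i j hi hj.
      assert (D := proj1 (ode X hX (RtoC lam) (RtoC_neq_0 lam hl) x hx i j hi hj)).
      assert (Ef : form_diag k r s u0 v0 (RtoC lam) x = embed (fd lam x)).
      { unfold form_diag, fd. rewrite <- RtoC_inv by lra.
        apply mat_ext; expC; rewrite <- ?RtoC_opp, <- ?RtoC_mult, <- ?RtoC_plus; reflexivity. }
      rewrite Ef, <- (frX lam x hl hx), <- embed_mult, entry_embed in D by assumption.
      apply is_derive_ext with (2 := D). intros t. unfold fr, frameR.
      rewrite entry_real_part, frame_diag by assumption. reflexivity. }
    assert (Dg : forall x, I x -> mderivR (fun t => surface L W1 Wl e t t) x (mult (surface L W1 Wl e x x) (Z x))).
    { intros x hx.
      assert (HG : mderivR (fun t => mult L (Wl t t)) x (mult (mult L (Wl x x)) (fd (e * e) x))).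
      { rewrite <- mult_assoc. apply mderivR_const_l. now apply Dd. }
      assert (S := mderivR_sandwich _ _ (twist e) _ _ x HG (Dd 1 x hone hx)).
      (* The terms in [k], [r] and [v0] cancel, and what is left is [zeta]: this is why [s] and [u0]
         carry the factors [/ (mu - 1)] and [/ (/ mu - 1)]. *)
      assert (E : plus (mult (fd (e * e) x) (twist e)) (mult (twist e) (bar (fd 1 x))) = mult (twist e) (zeta x)).
      { destruct (diag0 x hx) as [z0 z1]. unfold fd, twist.
        apply mat_ext; expR; rewrite ?z0, ?z1, ?ez01, ?ez10, ?emu; eqR; field; lra. }
      rewrite E in S.
      replace (mult (surface L W1 Wl e x x) (Z x)) with
        (mult (mult (mult L (Wl x x)) (mult (twist e) (zeta x))) (bar (fr 1 x x))); [exact S|].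
      unfold surface. fold (W1 x x). rewrite W1F by exact hx.
      assert (Q : mult (zeta x) (bar (F x)) = mult (bar (F x)) (Z x)).
      { unfold zeta, conj_by. rewrite <- mult_assoc, mult_bar_R, dF, mscal_1_R by exact hx. apply mult_one_r. }
      rewrite <- !mult_assoc, Q. reflexivity. }
    intros x hx. split.
    + apply embed_inj.
      apply (trace_free_ode_unique I (fun t => embed (surface L W1 Wl e t t)) (fun t => embed (ft t))
        (fun t => embed (Z t)) x0 x conv); auto.
      * intros t ht. assert (T := tZ t ht). rewrite mtr_R in T. rewrite mtr_C, !entry_embed by lt2.
        rewrite <- RtoC_plus. now rewrite T.
      * intros t ht. rewrite <- embed_mult. now apply mderivR_embed, Dg.
      * intros t ht. rewrite <- embed_mult. unfold Z. rewrite bar_cancel_r_R by now apply dft.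
        now apply mderivR_embed, Dft.
      * rewrite mdet_embed, dft by exact hx0. reflexivity.
      (* At [x0] both frames equal [F x0], and the exponential in [L] cancels [twist]; this is the
         origin of [L]. *)
      * f_equal. unfold surface. rewrite W1F by exact hx0.
        assert (El : Wl x0 x0 = F x0).
        { apply embed_inj. unfold Wl. rewrite frX by assumption.
          now apply (hX (RtoC (e * e)) (RtoC_neq_0 _ hlam)). }
        rewrite El. unfold L. rewrite mexp_e3, invR_det_1 by now apply dF.
        fold e. rewrite exp_Ropp. fold e.
        rewrite <- (mult_assoc _ (bar (F x0)) (F x0)), bar_mult_R, dF, mscal_1_R, mult_one_r by exact hx0.
        rewrite <- (mult_assoc _ (mat2 (/ e) 0 0 e) (twist e)).
        assert (Et : mult (mat2 (/ e) 0 0 e) (twist e) = one).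
        { unfold twist. matR; field; lra. }
        rewrite Et, mult_one_r, <- mult_assoc, mult_bar_R, dF, mscal_1_R by exact hx0. apply mult_one_r.
    + unfold normal_map. rewrite W1F by exact hx. symmetry. now apply enu.
Qed.
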